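(* Let $G$ be a second countable residually compact group with a non-open cocompact closed subgroup $H$ (in particular, $G$ is not discrete). Let $A$ be a separable C*-algebra and let $\alpha\colon G\to\mathrm{Aut}(A)$ be a continuous group action. If $\dim_{\mathrm{Rok}}(\alpha,H)<\infty$, then $A\rtimes_\alpha G$ is stable.
   Context: Conventions: locally compact groups are Hausdorff; actions on C*-algebras are point-norm continuous; $A\rtimes_\alpha G$ is the full crossed product; c.p.c. means completely positive contractive. A C*-algebra $B$ is stable if $B\otimes\mathcal K\cong B$, with $\mathcal K$ the compact operators on a separable infinite-dimensional Hilbert space. A subgroup $H\le G$ is cocompact if $G=KH$ for some compact $K\subseteq G$. A locally compact group $G$ is residually compact if for every $g\in G\setminus\{1_G\}$ there is a closed cocompact subgroup $H$ with $g\notin H$. Central sequence algebras. Let $A_\infty=\ell^\infty(\mathbb N,A)/c_0(\mathbb N,A)$, with $A\subseteq A_\infty$ as constant sequences. Let $A_\infty^{(\alpha)}$ be the image in $A_\infty$ of those bounded sequences on which the componentwise action of $G$ by $\alpha$ is norm-continuous; the componentwise action induces $\alpha_\infty$. For an $\alpha$-invariant C*-subalgebra $D\subseteq A$ put $\mathrm{Ann}(D,A_\infty)=\{a\in A_\infty: ad=da=0\ \forall d\in D\}$, $F(D,A_\infty)=(A_\infty\cap D')/\mathrm{Ann}(D,A_\infty)$, and let $F^{(\alpha)}(D,A_\infty)$ be the image of $A_\infty^{(\alpha)}\cap D'$ in $F(D,A_\infty)$, with induced action $\tilde\alpha_\infty$. For $\sigma$-unital $D$ it is unital. Rokhlin dimension.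 A c.p.c. map $\varphi$ has order zero if $a\perp b$ implies $\varphi(a)\perp\varphi(b)$ for positive $a,b$. For a closed cocompact subgroup $H\le G$, $\dim_{\mathrm{Rok}}(\alpha,H)\le d$ means: for every separable $\alpha$-invariant C*-subalgebra $D\subseteq A$ there are equivariant c.p.c. order zero maps $\varphi_l\colon (C(G/H),\lambda)\to (F^{(\alpha)}(D,A_\infty),\tilde\alpha_\infty)$, $l=0,\dots,d$, with $\varphi_0(1)+\cdots+\varphi_d(1)=1$, where $\lambda_g(f)(sH)=f(g^{-1}sH)$ is the $G$-shift. $\dim_{\mathrm{Rok}}(\alpha,H)$ is the least such $d\in\mathbb N$, or $\infty$ if none exists. *)

(* Defs.v *)
From HB Require Import structures.
From mathcomp Require Import all_boot all_order all_algebra.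
From mathcomp Require Import all_classical all_reals all_analysis.
From mathcomp Require Import complex.

Set Implicit Arguments.
Unset Strict Implicit.
Unset Printing Implicit Defensive.

Import Order.TTheory GRing.Theory Num.Theory Num.Def.
Import numFieldNormedType.Exports.

Local Open Scope classical_set_scope.
Local Open Scope ring_scope.

(* The products are not assumed to have a unit, which is why MathComp's ring
   structures are not used. *)
HB.mixin Record Lmodule_isStarAlgebra (R : realType) V of GRing.Lmodule R[i] V := {
  smul : V -> V -> V;
  star : V -> V;
  smulA : associative smul;
  smulDl : left_distributive smul +%R;
  smulDr : right_distributive smul +%R;
  smulZl : forall (c : R[i]) (x y : V), smul (c *: x) y = c *: smul x y;
  smulZr : forall (c : R[i]) (x y : V), smul x (c *: y) = c *: smul x y;
  starK : involutive star;
  starD : {morph star : x y / x + y};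
  starZ : forall (c : R[i]) (x : V), star (c *: x) = conjC c *: star x;
  starM : forall x y : V, star (smul x y) = smul (star y) (star x)
}.

#[short(type="starAlgType")]
HB.structure Definition StarAlgebra (R : realType) :=
  {V of GRing.Lmodule R[i] V & Lmodule_isStarAlgebra R V}.

Notation "x ** y" := (smul x y) (at level 40, left associativity) : ring_scope.

HB.mixin Record isCStarAlgebra (R : realType) V
    of CompleteNormedModule R[i] V & StarAlgebra R V := {
  norm_smul_le : forall x y : V, `|x ** y| <= `|x| * `|y|;
  norm_star_smul : forall x : V, `|star x ** x| = `|x| ^+ 2
}.

#[short(type="cstarAlgType")]
HB.structure Definition CStarAlgebra (R : realType) :=
  {V of CompleteNormedModule R[i] V & StarAlgebra R V & isCStarAlgebra R V}.

Section star_algebra_theory.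
Context {R : realType} {E : starAlgType R}.
Implicit Types x y : E.

Lemma smul0x x : 0 ** x = 0.
Proof. by have := smulZl 0 (0 : E) x; rewrite !scale0r. Qed.

Lemma smulx0 x : x ** 0 = 0.
Proof. by have := smulZr 0 x (0 : E); rewrite !scale0r. Qed.

Lemma star0 : star (0 : E) = 0.
Proof. by have := starZ 0 (0 : E); rewrite rmorph0 !scale0r. Qed.

Lemma smulNl x y : (- x) ** y = - (x ** y).
Proof. by rewrite -scaleN1r smulZl scaleN1r. Qed.

Lemma smulNr x y : x ** (- y) = - (x ** y).
Proof. by rewrite -scaleN1r smulZr scaleN1r. Qed.

Lemma smulBl x y z : (x - y) ** z = x ** z - y ** z.
Proof. by rewrite smulDl smulNl. Qed.

Lemma smulBr x y z : x ** (y - z) = x ** y - x ** z.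
Proof. by rewrite smulDr smulNr. Qed.

Lemma starB x y : star (x - y) = star x - star y.
Proof. by rewrite starD -scaleN1r starZ rmorphN rmorph1 scaleN1r. Qed.

End star_algebra_theory.

(* |x| takes values in R[i]; rnorm x is the same number seen in R. *)
Definition rnorm {R : realType} {V : normedModType R[i]} (x : V) : R :=
  complex.Re `|x|.

Section complex_scalars.
Variable R : realType.
Local Notation C := (R[i]^o).

Fact complex_smulA : associative ( *%R : C -> C -> C).
Proof. exact: mulrA. Qed.
Fact complex_smulDl : left_distributive ( *%R : C -> C -> C) +%R.
Proof. exact: mulrDl. Qed.
Fact complex_smulDr : right_distributive ( *%R : C -> C -> C) +%R.
Proof. exact: mulrDr. Qed.
Fact complex_smulZl (c : R[i]) (x y : R[i]^o) : (c *: x) * y = c *: (x * y).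
Proof. by rewrite /GRing.scale/= mulrA. Qed.
Fact complex_smulZr (c : R[i]) (x y : R[i]^o) : x * (c *: y) = c *: (x * y).
Proof. by rewrite /GRing.scale/= mulrCA. Qed.
Fact complex_starK : involutive (conjC : R[i]^o -> R[i]^o).
Proof. exact: conjCK. Qed.
Fact complex_starD : {morph (conjC : R[i]^o -> R[i]^o) : x y / x + y}.
Proof. exact: rmorphD. Qed.
Fact complex_starZ (c : R[i]) (x : R[i]^o) :
  conjC (c *: x : R[i]) = conjC c *: (conjC (x : R[i]) : R[i]^o).
Proof. exact: rmorphM. Qed.
Fact complex_starM (x y : R[i]^o) :
  conjC (x * y : R[i]) = conjC (y : R[i]) * conjC (x : R[i]).
Proof. by rewrite rmorphM mulrC. Qed.

HB.instance Definition _ := @Lmodule_isStarAlgebra.Build R R[i]^o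
  _ _ complex_smulA complex_smulDl complex_smulDr complex_smulZl complex_smulZr
  complex_starK complex_starD complex_starZ complex_starM.

End complex_scalars.

Section function_star_algebra.
Context {R : realType} (X : Type) (E : starAlgType R).

Definition fun_smul (f g : X -> E) : X -> E := fun x => f x ** g x.
Definition fun_star (f : X -> E) : X -> E := fun x => star (f x).

Fact fun_smulA : associative fun_smul.
Proof. by move=> f g h; apply/funext => x; exact: smulA. Qed.
Fact fun_smulDl : left_distributive fun_smul +%R.
Proof. by move=> f g h; apply/funext => x; exact: smulDl. Qed.
Fact fun_smulDr : right_distributive fun_smul +%R.
Proof. by move=> f g h; apply/funext => x; exact: smulDr. Qed.
Fact fun_smulZl (c : R[i]) (f g : X -> E) :
  fun_smul (c *: f) g = c *: fun_smul f g.
Proof. by apply/funext => x; exact: smulZl. Qed.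
Fact fun_smulZr (c : R[i]) (f g : X -> E) :
  fun_smul f (c *: g) = c *: fun_smul f g.
Proof. by apply/funext => x; exact: smulZr. Qed.
Fact fun_starK : involutive fun_star.
Proof. by move=> f; apply/funext => x; exact: starK. Qed.
Fact fun_starD : {morph fun_star : f g / f + g}.
Proof. by move=> f g; apply/funext => x; exact: starD. Qed.
Fact fun_starZ (c : R[i]) (f : X -> E) :
  fun_star (c *: f) = conjC c *: fun_star f.
Proof. by apply/funext => x; exact: starZ. Qed.
Fact fun_starM (f g : X -> E) :
  fun_star (fun_smul f g) = fun_smul (fun_star g) (fun_star f).
Proof. by apply/funext => x; exact: starM. Qed.

HB.instance Definition _ := @Lmodule_isStarAlgebra.Build R (X -> E)
  _ _ fun_smulA fun_smulDl fun_smulDr fun_smulZl fun_smulZr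
  fun_starK fun_starD fun_starZ fun_starM.

End function_star_algebra.

Record starSub {R : realType} (E : starAlgType R) := StarSub {
  starSub_set :> set E;
  starSub0 : starSub_set 0;
  starSubL : forall (c : R[i]) (x y : E),
    starSub_set x -> starSub_set y -> starSub_set (c *: x + y);
  starSubM : forall x y : E,
    starSub_set x -> starSub_set y -> starSub_set (x ** y);
  starSubS : forall x : E, starSub_set x -> starSub_set (star x)
}.

Section subalgebra.
Context {R : realType} {E : starAlgType R} (S : starSub E).

Definition starSub_pred : {pred E} := fun x => x \in (S : set E).

Fact starSub_submod : submod_closed starSub_pred.
Proof.
split; first by apply/mem_set; exact: starSub0.
by move=> c x y /set_mem Sx /set_mem Sy; apply/mem_set; exact: starSubL.
Qed.

HB.instance Definition _ := GRing.isSubmodClosed.Build R[i] E starSub_pred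
  (GRing.submod_closed_semi starSub_submod).

Record subalg := Subalg {subalg_val : E; subalg_valP : subalg_val \in starSub_pred}.

HB.instance Definition _ := [isSub for subalg_val].
HB.instance Definition _ := [Choice of subalg by <:].
HB.instance Definition _ := [SubChoice_isSubLmodule of subalg by <:].

Implicit Types x y z : subalg.

Fact subalg_smul_subproof x y : val x ** val y \in starSub_pred.
Proof. by apply/mem_set/starSubM; exact/set_mem/valP. Qed.
Fact subalg_star_subproof x : star (val x) \in starSub_pred.
Proof. by apply/mem_set/starSubS; exact/set_mem/valP. Qed.

Definition subalg_smul x y := Subalg (subalg_smul_subproof x y).
Definition subalg_star x := Subalg (subalg_star_subproof x).

Fact subalg_smulA : associative subalg_smul.
Proof. by move=> x y z; apply/val_inj; exact: smulA. Qed.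
Fact subalg_smulDl : left_distributive subalg_smul +%R.
Proof. by move=> x y z; apply/val_inj; exact: smulDl. Qed.
Fact subalg_smulDr : right_distributive subalg_smul +%R.
Proof. by move=> x y z; apply/val_inj; exact: smulDr. Qed.
Fact subalg_smulZl (c : R[i]) x y :
  subalg_smul (c *: x) y = c *: subalg_smul x y.
Proof. by apply/val_inj; exact: smulZl. Qed.
Fact subalg_smulZr (c : R[i]) x y :
  subalg_smul x (c *: y) = c *: subalg_smul x y.
Proof. by apply/val_inj; exact: smulZr. Qed.
Fact subalg_starK : involutive subalg_star.
Proof. by move=> x; apply/val_inj; exact: starK. Qed.
Fact subalg_starD : {morph subalg_star : x y / x + y}.
Proof. by move=> x y; apply/val_inj; exact: starD. Qed.
Fact subalg_starZ (c : R[i]) x : subalg_star (c *: x) = conjC c *: subalg_star x.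
Proof. by apply/val_inj; exact: starZ. Qed.
Fact subalg_starM x y :
  subalg_star (subalg_smul x y) = subalg_smul (subalg_star y) (subalg_star x).
Proof. by apply/val_inj; exact: starM. Qed.

HB.instance Definition _ := @Lmodule_isStarAlgebra.Build R subalg
  _ _ subalg_smulA subalg_smulDl subalg_smulDr subalg_smulZl subalg_smulZr
  subalg_starK subalg_starD subalg_starZ subalg_starM.

End subalgebra.

Definition mksub {R : realType} {E : starAlgType R} (S : starSub E) (x : E)
  (Sx : (S : set E) x) : subalg S := Subalg (mem_set Sx).

Record starIdeal {R : realType} (E : starAlgType R) := StarIdeal {
  starIdeal_set :> set E;
  starIdeal0 : starIdeal_set 0;
  starIdealL : forall (c : R[i]) (x y : E),
    starIdeal_set x -> starIdeal_set y -> starIdeal_set (c *: x + y);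
  starIdealMl : forall x y : E, starIdeal_set y -> starIdeal_set (x ** y);
  starIdealMr : forall x y : E, starIdeal_set x -> starIdeal_set (x ** y);
  starIdealS : forall x : E, starIdeal_set x -> starIdeal_set (star x)
}.

Section quotient_algebra.
Context {R : realType} {E : starAlgType R} (J : starIdeal E).
Local Open Scope quotient_scope.

Definition ideal_rel (x y : E) : bool := (x - y) \in (J : set E).

Fact idealD (x y : E) : starIdeal_set J x -> starIdeal_set J y -> starIdeal_set J (x + y).
Proof. by move=> Jx Jy; rewrite -[x]scale1r; exact: starIdealL. Qed.
Fact idealN (x : E) : starIdeal_set J x -> starIdeal_set J (- x).
Proof.
by move=> Jx; rewrite -scaleN1r -[_ *: _]addr0; apply: starIdealL => //; exact: starIdeal0.
Qed.

Fact ideal_rel_equiv : equiv_class_of ideal_rel.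
Proof.
split.
- by move=> x; rewrite /ideal_rel subrr; apply/mem_set; exact: starIdeal0.
- have sym x y : ideal_rel x y -> ideal_rel y x.
    by move=> /set_mem Jxy; apply/mem_set; rewrite -opprB; exact: idealN.
  by move=> x y; apply/idP/idP; exact: sym.
- move=> y x z /set_mem Jxy /set_mem Jyz; apply/mem_set.
  by rewrite -(subrKA y); exact: idealD.
Qed.

Canonical ideal_rel_equivRel := EquivRelPack ideal_rel_equiv.
Canonical ideal_rel_encModRel := defaultEncModRel ideal_rel.

Definition quotalg := {eq_quot ideal_rel}.

HB.instance Definition _ : EqQuotient E ideal_rel quotalg := EqQuotient.on quotalg.
HB.instance Definition _ := Choice.on quotalg.

Lemma quotalg_eqP (x y : E) : \pi_quotalg x = \pi_quotalg y <-> starIdeal_set J (x - y).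
Proof.
by split=> [/eqmodP/set_mem//|Jxy]; apply/eqmodP/mem_set.
Qed.

Lemma quotalg_repr (x : E) : starIdeal_set J (repr (\pi_quotalg x) - x).
Proof. by apply/quotalg_eqP; rewrite reprK. Qed.

Implicit Types x y z : quotalg.

Definition quotalg_zero : quotalg := \pi_quotalg 0.
Definition quotalg_opp x : quotalg := \pi_quotalg (- repr x).
Definition quotalg_add x y : quotalg := \pi_quotalg (repr x + repr y).
Definition quotalg_scale (c : R[i]) x : quotalg := \pi_quotalg (c *: repr x).
Definition quotalg_smul x y : quotalg := \pi_quotalg (repr x ** repr y).
Definition quotalg_star x : quotalg := \pi_quotalg (star (repr x)).

Lemma pi_quotalgN (x : E) : quotalg_opp (\pi_quotalg x) = \pi_quotalg (- x).
Proof. by apply/quotalg_eqP; rewrite -opprD; apply/idealN/quotalg_repr. Qed.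
Lemma pi_quotalgD (x y : E) : quotalg_add (\pi_quotalg x) (\pi_quotalg y) = \pi_quotalg (x + y).
Proof. by apply/quotalg_eqP; rewrite opprD addrACA; apply: idealD; exact: quotalg_repr. Qed.
Lemma pi_quotalgZ (c : R[i]) (x : E) : quotalg_scale c (\pi_quotalg x) = \pi_quotalg (c *: x).
Proof.
apply/quotalg_eqP; rewrite -scalerBr -[_ *: _]addr0.
by apply: starIdealL; [exact: quotalg_repr|exact: starIdeal0].
Qed.
Lemma pi_quotalgM (x y : E) : quotalg_smul (\pi_quotalg x) (\pi_quotalg y) = \pi_quotalg (x ** y).
Proof.
apply/quotalg_eqP; rewrite -(subrKA (repr (\pi_quotalg x) ** y)) -smulBr -smulBl.
by apply: idealD; [apply: starIdealMl|apply: starIdealMr]; exact: quotalg_repr.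
Qed.
Lemma pi_quotalgS (x : E) : quotalg_star (\pi_quotalg x) = \pi_quotalg (star x).
Proof. by apply/quotalg_eqP; rewrite -starB; apply/starIdealS/quotalg_repr. Qed.

Fact quotalg_addA : associative quotalg_add.
Proof.
elim/quotW=> x; elim/quotW=> y; elim/quotW=> z.
by rewrite (pi_quotalgD y z) (pi_quotalgD x y) (pi_quotalgD x) pi_quotalgD addrA.
Qed.
Fact quotalg_addC : commutative quotalg_add.
Proof.
by elim/quotW=> x; elim/quotW=> y; rewrite (pi_quotalgD x y) (pi_quotalgD y x) addrC.
Qed.
Fact quotalg_add0 : left_id quotalg_zero quotalg_add.
Proof.
by elim/quotW=> x; rewrite (pi_quotalgD 0 x) add0r.
Qed.
Fact quotalg_addN : left_inverse quotalg_zero quotalg_opp quotalg_add.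
Proof.
by elim/quotW=> x; rewrite (pi_quotalgN x) (pi_quotalgD (- x) x) addNr.
Qed.

HB.instance Definition _ := GRing.isZmodule.Build quotalg
  quotalg_addA quotalg_addC quotalg_add0 quotalg_addN.

Fact quotalg_scaleA (a b : R[i]) x :
  quotalg_scale a (quotalg_scale b x) = quotalg_scale (a * b) x.
Proof.
by elim/quotW: x => x; rewrite (pi_quotalgZ b x) (pi_quotalgZ a) (pi_quotalgZ (a * b)) scalerA.
Qed.
Fact quotalg_scale1 : left_id 1 quotalg_scale.
Proof.
by elim/quotW=> x; rewrite (pi_quotalgZ 1 x) scale1r.
Qed.
Fact quotalg_scaleDr : right_distributive quotalg_scale +%R.
Proof.
move=> c; elim/quotW=> x; elim/quotW=> y.
by rewrite [_ + _](pi_quotalgD x y) (pi_quotalgZ c x) (pi_quotalgZ c y)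
  (pi_quotalgZ c) [RHS](pi_quotalgD (c *: x)) scalerDr.
Qed.
Fact quotalg_scaleDl x : {morph quotalg_scale^~ x : a b / a + b}.
Proof.
elim/quotW: x => x a b.
by rewrite (pi_quotalgZ a x) (pi_quotalgZ b x) (pi_quotalgZ (a + b) x)
  [RHS](pi_quotalgD (a *: x)) scalerDl.
Qed.

HB.instance Definition _ := GRing.Zmodule_isLmodule.Build R[i] quotalg
  quotalg_scaleA quotalg_scale1 quotalg_scaleDr quotalg_scaleDl.

Fact quotalg_smulA : associative quotalg_smul.
Proof.
elim/quotW=> x; elim/quotW=> y; elim/quotW=> z.
by rewrite (pi_quotalgM y z) (pi_quotalgM x y) (pi_quotalgM x) pi_quotalgM smulA.
Qed.
Fact quotalg_smulDl : left_distributive quotalg_smul +%R.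
Proof.
elim/quotW=> x; elim/quotW=> y; elim/quotW=> z.
by rewrite [_ + _ in LHS](pi_quotalgD x y) (pi_quotalgM x z) (pi_quotalgM y z)
  (pi_quotalgM (x + y) z) [RHS](pi_quotalgD (x ** z)) smulDl.
Qed.
Fact quotalg_smulDr : right_distributive quotalg_smul +%R.
Proof.
elim/quotW=> x; elim/quotW=> y; elim/quotW=> z.
by rewrite [_ + _ in LHS](pi_quotalgD y z) (pi_quotalgM x y) (pi_quotalgM x z)
  (pi_quotalgM x (y + z)) [RHS](pi_quotalgD (x ** y)) smulDr.
Qed.
Fact quotalg_smulZl (c : R[i]) x y :
  quotalg_smul (c *: x) y = c *: quotalg_smul x y.
Proof.
elim/quotW: x => x; elim/quotW: y => y.
by rewrite [c *: _ in LHS](pi_quotalgZ c x) (pi_quotalgM x y)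
  (pi_quotalgM (c *: x) y) [RHS](pi_quotalgZ c) smulZl.
Qed.
Fact quotalg_smulZr (c : R[i]) x y :
  quotalg_smul x (c *: y) = c *: quotalg_smul x y.
Proof.
elim/quotW: x => x; elim/quotW: y => y.
by rewrite [c *: _ in LHS](pi_quotalgZ c y) (pi_quotalgM x y)
  (pi_quotalgM x (c *: y)) [RHS](pi_quotalgZ c) smulZr.
Qed.
Fact quotalg_starK : involutive quotalg_star.
Proof.
by elim/quotW=> x; rewrite (pi_quotalgS x) (pi_quotalgS (star x)) starK.
Qed.
Fact quotalg_starD : {morph quotalg_star : x y / x + y}.
Proof.
elim/quotW=> x; elim/quotW=> y.
by rewrite [_ + _ in LHS](pi_quotalgD x y) (pi_quotalgS x) (pi_quotalgS y)
  (pi_quotalgS (x + y)) [RHS](pi_quotalgD (star x)) starD.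
Qed.
Fact quotalg_starZ (c : R[i]) x : quotalg_star (c *: x) = conjC c *: quotalg_star x.
Proof.
elim/quotW: x => x.
by rewrite [c *: _ in LHS](pi_quotalgZ c x) (pi_quotalgS x) (pi_quotalgS (c *: x))
  [RHS](pi_quotalgZ (conjC c)) starZ.
Qed.
Fact quotalg_starM x y :
  quotalg_star (quotalg_smul x y) = quotalg_smul (quotalg_star y) (quotalg_star x).
Proof.
elim/quotW: x => x; elim/quotW: y => y.
by rewrite (pi_quotalgM x y) (pi_quotalgS x) (pi_quotalgS y) (pi_quotalgS (x ** y))
  (pi_quotalgM (star y) (star x)) starM.
Qed.

HB.instance Definition _ := @Lmodule_isStarAlgebra.Build R quotalg
  _ _ quotalg_smulA quotalg_smulDl quotalg_smulDr quotalg_smulZl quotalg_smulZr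
  quotalg_starK quotalg_starD quotalg_starZ quotalg_starM.

Definition quot_proj (x : E) : quotalg := \pi_quotalg x.

Definition quot_norm (p : E -> R) (x : quotalg) : R :=
  inf (p @` [set a | quot_proj a = x]).

End quotient_algebra.

Section quot_proj_theory.
Context {R : realType} {E : starAlgType R} (J : starIdeal E).
Implicit Types x y : E.

Lemma quot_proj_eq x y :
  quot_proj J x = quot_proj J y <-> (J : set E) (x - y).
Proof. exact: quotalg_eqP. Qed.

Lemma quot_projP (X : quotalg J) : exists x, X = quot_proj J x.
Proof. by exists (repr X); rewrite /quot_proj reprK. Qed.

Lemma quot_projL (c : R[i]) x y :
  quot_proj J (c *: x + y) = c *: quot_proj J x + quot_proj J y.
Proof.
by rewrite /quot_proj [c *: _ in RHS]pi_quotalgZ [RHS](pi_quotalgD J (c *: x)).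
Qed.

Lemma quot_proj0 : quot_proj J 0 = 0.
Proof. by []. Qed.

Lemma quot_projM x y : quot_proj J (x ** y) = quot_proj J x ** quot_proj J y.
Proof. by rewrite /quot_proj [RHS](pi_quotalgM J x). Qed.

Lemma quot_projS x : quot_proj J (star x) = star (quot_proj J x).
Proof. by rewrite /quot_proj [RHS](pi_quotalgS J x). Qed.

Definition starSub_quot (S : starSub E) : starSub (quotalg J).
Proof.
exists (quot_proj J @` S).
- by exists 0 => //; exact: starSub0.
- move=> c _ _ [x Sx <-] [y Sy <-]; exists (c *: x + y); first exact: starSubL.
  exact: quot_projL.
- move=> _ _ [x Sx <-] [y Sy <-]; exists (x ** y); first exact: starSubM.
  exact: quot_projM.
- move=> _ [x Sx <-]; exists (star x); first exact: starSubS.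
  exact: quot_projS.
Defined.

Definition starSub_restr (S T : starSub E) : starSub (subalg T).
Proof.
exists [set x | (S : set E) (val x)].
- exact: starSub0.
- by move=> c x y Sx Sy; exact: starSubL.
- by move=> x y Sx Sy; exact: starSubM.
- by move=> x Sx; exact: starSubS.
Defined.

End quot_proj_theory.

Lemma norm_star {R : realType} {A : cstarAlgType R} (x : A) : `|star x| = `|x|.
Proof.
have le_star (y : A) : `|y| <= `|star y|.
  have [->|y0] := eqVneq y 0; first by rewrite normr0 normr_ge0.
  rewrite -(ler_pM2r (_ : 0 < `|y|)) ?normr_gt0// -expr2 -norm_star_smul.
  exact: norm_smul_le.
by apply/eqP; rewrite eq_le le_star -{2}(starK x) le_star.
Qed.

Section continuous_functions.
Context {R : realType} (X : topologicalType).

Definition continuous_sub : starSub (X -> R[i]^o).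
Proof.
exists [set f : X -> R[i]^o | continuous f].
- by move=> x; exact: cst_continuous.
- move=> c f g cf cg x.
  by apply: (@cvgD _ R[i]^o); [apply: cvgZl_tmp; exact: cf|exact: cg].
- by move=> f g cf cg x; apply: (@cvgM R[i]); [exact: cf|exact: cg].
- move=> f cf x; apply/cvgrPdist_lt => e e0.
  have /cvgrPdist_lt/(_ e e0) := cf x.
  apply: filterS => y; congr (_ < e).
  by rewrite -(norm_conjC (f x - f y)) rmorphB.
Defined.

Definition contfun := subalg continuous_sub.

Fact contfun_one_subproof : (continuous_sub : set _) (fun _ => 1).
Proof. by move=> x; exact: cst_continuous. Qed.

Definition contfun_one : contfun := mksub contfun_one_subproof.

Definition contfun_norm (f : contfun) : R := sup [set rnorm (val f x) | x in setT].

End continuous_functions.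
Arguments contfun_one {R X}.

Section positivity.
Context {R : realType} {E : starAlgType R}.

Definition positive (x : E) := exists y : E, x = star y ** y.

Definition positive_mx n (x : 'M[E]_n) :=
  exists y : 'M[E]_n, forall i j, x i j = \sum_k star (y k i) ** y k j.

End positivity.

Section order_zero_maps.
Context {R : realType} {E F : starAlgType R}.

Definition completely_positive (phi : E -> F) :=
  forall n (x : 'M[E]_n), positive_mx x -> positive_mx (map_mx phi x).

Definition contractive (p : E -> R) (q : F -> R) (phi : E -> F) :=
  forall x, q (phi x) <= p x.

Definition order_zero (phi : E -> F) :=
  forall a b, positive a -> positive b -> a ** b = 0 -> phi a ** phi b = 0.

Definition is_one (e : E) := forall x, e ** x = x /\ x ** e = x.

End order_zero_maps.

HB.mixin Record isTopologicalGroup G of PointedTopological G & Group G := {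
  mulg_continuous : continuous (fun x : G * G => (x.1 * x.2)%g);
  invg_continuous : continuous (fun x : G => (x^-1)%g)
}.

#[short(type="topGroupType")]
HB.structure Definition TopologicalGroup :=
  {G of PointedTopological G & Group G & isTopologicalGroup G}.

Record subgroup (G : topGroupType) := Subgroup {
  subgroup_set :> set G;
  subgroup1 : subgroup_set 1%g;
  subgroupM : forall x y, subgroup_set x -> subgroup_set y ->
    subgroup_set (x * y)%g;
  subgroupV : forall x, subgroup_set x -> subgroup_set (x^-1)%g
}.

Definition cocompact (G : topGroupType) (H : subgroup G) :=
  exists2 K : set G, compact K &
    forall g, exists k h, [/\ K k, (H : set G) h & g = (k * h)%g].

Definition locally_compact_group (G : topGroupType) :=
  hausdorff_space G /\ locally_compact [set: G].

Definition residually_compact (G : topGroupType) :=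
  locally_compact_group G /\
  forall g : G, g <> 1%g ->
    exists H : subgroup G, [/\ closed H, cocompact H & ~ (H : set G) g].

Section coset_space.
Context {G : topGroupType} (H : subgroup G).
Local Open Scope quotient_scope.

Definition coset_rel (x y : G) : bool := (x^-1 * y)%g \in (H : set G).

Fact coset_rel_equiv : equiv_class_of coset_rel.
Proof.
split.
- by move=> x; apply/mem_set; rewrite mulVg; exact: subgroup1.
- have sym x y : coset_rel x y -> coset_rel y x.
    by move=> /set_mem Hxy; apply/mem_set; rewrite -[x]invgK -invgM; exact: subgroupV.
  by move=> x y; apply/idP/idP; exact: sym.
- move=> y x z /set_mem Hxy /set_mem Hyz; apply/mem_set.
  have -> : (x^-1 * z = (x^-1 * y) * (y^-1 * z))%g by rewrite -mulgA mulVKg.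
  exact: subgroupM.
Qed.

Canonical coset_rel_equivRel := EquivRelPack coset_rel_equiv.
Canonical coset_rel_encModRel := defaultEncModRel coset_rel.

Definition coset_space : topologicalType :=
  quotient_topology {eq_quot coset_rel}.

Definition coset_proj (s : G) : coset_space := \pi_{eq_quot coset_rel} s.

Definition coset_translate (g : G) (x : coset_space) : coset_space :=
  coset_proj (g * repr (x : {eq_quot coset_rel}))%g.

Lemma coset_proj_eq s t :
  coset_proj s = coset_proj t <-> (H : set G) (s^-1 * t)%g.
Proof.
rewrite /coset_proj; split=> [/eqmodP/set_mem//|Hst].
exact/eqmodP/mem_set.
Qed.

Lemma coset_translateE g s :
  coset_translate g (coset_proj s) = coset_proj (g * s)%g.
Proof.
apply/coset_proj_eq; rewrite invgM -mulgA mulKg.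
by apply/coset_proj_eq; rewrite /coset_proj reprK.
Qed.

Lemma coset_translate_continuous g : continuous (coset_translate g).
Proof.
apply/quotient_continuous.
have -> : coset_translate g \o \pi_coset_space = coset_proj \o (fun s => (g * s)%g).
  by apply/funext => s; exact: coset_translateE.
move=> s; apply: continuous_comp; last exact: pi_continuous.
apply: (@continuous2_cvg _ _ _ _ (nbhs s) _ (fun=> g) id (fun a b : G => (a * b)%g) g s).
- exact: (@mulg_continuous G (g, s)).
- exact: cvg_cst.
- exact: cvg_id.
Qed.

Context {R : realType}.

Fact coset_shift_subproof (g : G) (f : contfun (R := R) coset_space) :
  (continuous_sub coset_space : set _)
    (fun x => (val f : coset_space -> R[i]^o) (coset_translate g^-1%g x)).
Proof.
move=> x; apply: continuous_comp; first exact: coset_translate_continuous.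
by have := set_mem (valP f); exact.
Qed.

Definition coset_shift (g : G) (f : contfun (R := R) coset_space) :
    contfun (R := R) coset_space :=
  mksub (@coset_shift_subproof g f).

End coset_space.

(* An action of G on A by *-automorphisms, continuous in the point-norm
   topology.  Bijectivity follows from the group laws; action_norm, which
   *-automorphisms of C*-algebras satisfy automatically, is recorded because the
   induced actions on sequence algebras are built from it. *)
Record action {R : realType} (G : topGroupType) (A : cstarAlgType R) := Action {
  action_fun :> G -> {linear A -> A};
  action_smul : forall g (a b : A),
    action_fun g (a ** b) = action_fun g a ** action_fun g b;
  action_star : forall g (a : A), action_fun g (star a) = star (action_fun g a);
  action_norm : forall g (a : A), `|action_fun g a| = `|a|;
  action1 : forall a : A, action_fun 1%g a = a;
  actionM : forall g h (a : A),
    action_fun (g * h)%g a = action_fun g (action_fun h a);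
  action_continuous : forall a : A, continuous (fun g => action_fun g a)
}.

Section sequence_algebra.
Context {R : realType} (A : cstarAlgType R).

Definition bounded_seqs : starSub (nat -> A).
Proof.
exists [set a : nat -> A | exists M : R[i], forall n, `|a n| <= M].
- by exists 0 => n; rewrite normr0.
- move=> c a b [M aM] [N bN]; exists (`|c| * M + N) => n.
  rewrite (le_trans (ler_normD _ _))// lerD// normrZ.
  exact: ler_wpM2l.
- move=> a b [M aM] [N bN]; exists (M * N) => n.
  by rewrite (le_trans (norm_smul_le _ _))// ler_pM.
- by move=> a [M aM]; exists M => n; rewrite /= norm_star.
Defined.

Definition linf := subalg bounded_seqs.

Definition linf_norm (a : linf) : R := sup [set rnorm (val a n) | n in setT].

Lemma linf_bounded (a : linf) : exists M : R[i], forall n, `|val a n| <= M.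
Proof. exact: (set_mem (valP a)). Qed.

Lemma linf_bounded_gt0 (a : linf) :
  exists2 M : R[i], 0 < M & forall n, `|val a n| <= M.
Proof.
have [M aM] := linf_bounded a; exists (M + 1).
  by rewrite ltr_wpDl// (le_trans _ (aM 0%N)).
by move=> n; rewrite (le_trans (aM n))// lerDl.
Qed.

Definition null_seqs : starIdeal linf.
Proof.
exists [set a : linf | (val a : nat -> A) n @[n --> \oo] --> (0 : A)].
- exact: cvg_cst.
- move=> c a b a0 b0; rewrite -[0]addr0 -{1}(scaler0 A c).
  by apply: cvgD => //; exact: cvgZl_tmp.
- move=> a b /cvgr0Pnorm_lt b0; have [M M0 aM] := linf_bounded_gt0 a.
  apply/cvgr0Pnorm_lt => e e0; have := b0 _ (divr_gt0 e0 M0).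
  apply: filterS => n bn; rewrite (le_lt_trans (norm_smul_le _ _))//.
  rewrite (le_lt_trans (ler_wpM2r _ (aM n)))//.
  by rewrite mulrC -ltr_pdivlMr.
- move=> a b /cvgr0Pnorm_lt a0; have [M M0 bM] := linf_bounded_gt0 b.
  apply/cvgr0Pnorm_lt => e e0; have := a0 _ (divr_gt0 e0 M0).
  apply: filterS => n an; rewrite (le_lt_trans (norm_smul_le _ _))//.
  rewrite (le_lt_trans (ler_wpM2l _ (bM n)))//.
  by rewrite -ltr_pdivlMr.
- move=> a /cvgr0Pnorm_lt a0; apply/cvgr0Pnorm_lt => e /a0.
  by apply: filterS => n /=; rewrite norm_star.
Defined.

Definition Ainf := quotalg null_seqs.

Definition Ainf_norm : Ainf -> R := quot_norm linf_norm.

Fact const_seq_subproof (a : A) : (bounded_seqs : set _) (fun _ => a).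
Proof. by exists `|a|. Qed.

Definition const_seq (a : A) : Ainf :=
  quot_proj null_seqs (mksub (@const_seq_subproof a)).

Lemma const_seqL (c : R[i]) (a b : A) :
  const_seq (c *: a + b) = c *: const_seq a + const_seq b.
Proof. by rewrite /const_seq -quot_projL; congr quot_proj; exact: val_inj. Qed.

Lemma const_seqS (a : A) : const_seq (star a) = star (const_seq a).
Proof. by rewrite /const_seq -quot_projS; congr quot_proj; exact: val_inj. Qed.

Section central_sequences.
Variable D : starSub A.

(* A_oo \cap D'. *)
Definition commutant : starSub Ainf.
Proof.
exists [set x : Ainf | forall d, (D : set A) d ->
  x ** const_seq d = const_seq d ** x].
- by move=> d Dd; rewrite smul0x smulx0.
- by move=> c x y xD yD d Dd; rewrite smulDl smulDr smulZl smulZr xD// yD.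
- by move=> x y xD yD d Dd; rewrite -smulA yD// smulA xD// smulA.
- move=> x xD d Dd; apply: (can_inj starK); rewrite !starM starK -const_seqS.
  by rewrite xD//; exact: starSubS.
Defined.

(* Ann(D, A_oo); it is automatically contained in A_oo \cap D'. *)
Definition annihilator : starIdeal (subalg commutant).
Proof.
exists [set x : subalg commutant | forall d, (D : set A) d ->
  val x ** const_seq d = 0 /\ const_seq d ** val x = 0].
- by move=> d Dd; rewrite smul0x smulx0.
- move=> c x y xD yD d Dd; have [x1 x2] := xD d Dd; have [y1 y2] := yD d Dd.
  have -> : val (c *: x + y) = c *: val x + val y by [].
  by rewrite smulDl smulDr smulZl smulZr x1 x2 y1 y2 scaler0 addr0.
- move=> x y yD d Dd; have [y1 y2] := yD d Dd; split.
    by rewrite /= -smulA y1 smulx0.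
  have xC : val x ** const_seq d = const_seq d ** val x by exact: (set_mem (valP x)).
  by rewrite /= smulA -xC -smulA y2 smulx0.
- move=> x y xD d Dd; have [x1 x2] := xD d Dd; split.
    have yC : val y ** const_seq d = const_seq d ** val y by exact: (set_mem (valP y)).
    by rewrite /= -smulA yC smulA x1 smul0x.
  by rewrite /= smulA x2 smul0x.
- move=> x xD d Dd; have [x1 x2] := xD _ (starSubS Dd); split.
    by apply: (can_inj starK); rewrite starM starK star0 -const_seqS.
  by apply: (can_inj starK); rewrite starM starK star0 -const_seqS.
Defined.

(* F(D, A_oo). *)
Definition central_quot := quotalg annihilator.

Definition central_quot_norm : central_quot -> R :=
  quot_norm (fun x : subalg commutant => Ainf_norm (val x)).

End central_sequences.

Context {G : topGroupType} (alpha : action G A).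

(* The condition says that g |-> (alpha_g(a_n))_n is continuous for the sup norm. *)
Definition continuous_seqs : starSub linf.
Proof.
exists [set a : linf | forall (g0 : G) (e : R[i]), 0 < e ->
  \forall g \near g0, forall n,
    `|alpha g (val a n) - alpha g0 (val a n)| <= e].
- move=> g0 e e0; apply: nearW => g n.
  have -> : val (0 : linf) n = 0 by [].
  by rewrite (raddf0 (alpha g)) (raddf0 (alpha g0)) subrr normr0 ltW.
- move=> c a b ca cb g0 e e0; have k0 : 0 < `|c| + 1 by rewrite ltr_wpDl.
  have {ca} := ca g0 _ (divr_gt0 e0 k0); have {cb} := cb g0 _ (divr_gt0 e0 k0).
  apply: filterS2 => g bg ag n.
  have -> : val (c *: a + b) n = c *: val a n + val b n by [].
  rewrite (linearP (alpha g)) (linearP (alpha g0)) opprD addrACA -scalerBr (le_trans (ler_normD _ _))//.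
  rewrite normrZ (le_trans (lerD (ler_wpM2l _ (ag n)) (bg n)))//.
  by rewrite -[X in _ + X]mul1r -mulrDl mulrC divfK// gt_eqF.
- move=> a b ca cb g0 e e0.
  have [M M0 aM] := linf_bounded_gt0 a; have [N N0 bN] := linf_bounded_gt0 b.
  have k0 : 0 < M + N by rewrite addr_gt0.
  have {ca} := ca g0 _ (divr_gt0 e0 k0); have {cb} := cb g0 _ (divr_gt0 e0 k0).
  apply: filterS2 => g bg ag n.
  rewrite /= !action_smul -(subrKA (alpha g (val a n) ** alpha g0 (val b n))).
  rewrite -smulBr -smulBl (le_trans (ler_normD _ _))//.
  rewrite (le_trans (lerD (norm_smul_le _ _) (norm_smul_le _ _)))// !action_norm.
  rewrite (le_trans (lerD (ler_pM _ _ (aM n) (bg n)) (ler_pM _ _ (ag n) (bN n))))//.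
  by rewrite [e / _ * N]mulrC -mulrDl mulrC divfK// gt_eqF.
- move=> a ca g0 e e0; have := ca g0 e e0; apply: filterS => g ag n.
  by rewrite /= !action_star -starB norm_star; exact: ag.
Defined.

(* A_oo^(alpha). *)
Definition Ainf_cont : starSub Ainf := starSub_quot null_seqs continuous_seqs.

Fact linf_act_subproof g (a : linf) :
  (bounded_seqs : set _) (fun n => alpha g (val a n)).
Proof. by have [M aM] := linf_bounded a; exists M => n; rewrite action_norm. Qed.

Definition linf_act g (a : linf) : linf := mksub (@linf_act_subproof g a).

Definition Ainf_act g (x : Ainf) : Ainf := quot_proj null_seqs (linf_act g (repr x)).

Lemma Ainf_actE g a :
  Ainf_act g (quot_proj null_seqs a) = quot_proj null_seqs (linf_act g a).
Proof.
apply/quot_proj_eq; have /cvgr0Pnorm_lt h := quotalg_repr null_seqs a.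
apply/cvgr0Pnorm_lt => e /h; apply: filterS => n.
rewrite -(action_norm alpha g); congr (`|_| < e).
exact: (raddfB (alpha g)).
Qed.

Lemma Ainf_actM g x y : Ainf_act g (x ** y) = Ainf_act g x ** Ainf_act g y.
Proof.
have [a ->] := quot_projP x; have [b ->] := quot_projP y.
rewrite -quot_projM !Ainf_actE -quot_projM; congr quot_proj.
by apply/val_inj/funext => n; exact: action_smul.
Qed.

Lemma Ainf_act_const g d : Ainf_act g (const_seq d) = const_seq (alpha g d).
Proof. by rewrite Ainf_actE; congr quot_proj; exact: val_inj. Qed.

Definition action_invariant (D : set A) := forall g d, D d -> D (alpha g d).

Section induced_action.
Variables (D : starSub A) (Dinv : action_invariant D).

(* F^(alpha)(D, A_oo). *)
Definition central_quot_cont : starSub (central_quot D) :=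
  starSub_quot (annihilator D) (starSub_restr Ainf_cont (commutant D)).

Definition central_alg := subalg central_quot_cont.

Definition central_alg_norm (x : central_alg) : R := central_quot_norm (val x).

Fact commutant_act_subproof g (x : subalg (commutant D)) :
  (commutant D : set _) (Ainf_act g (val x)).
Proof.
move=> d Dd; have -> : d = alpha g (alpha g^-1%g d) by rewrite -actionM mulgV action1.
rewrite -Ainf_act_const -!Ainf_actM; congr Ainf_act.
by apply: (set_mem (valP x)); exact: Dinv.
Qed.

Definition commutant_act g (x : subalg (commutant D)) : subalg (commutant D) :=
  mksub (@commutant_act_subproof g x).

Definition central_quot_act g (x : central_quot D) : central_quot D :=
  quot_proj (annihilator D) (commutant_act g (repr x)).

End induced_action.

End sequence_algebra.

Definition separable_set {T : topologicalType} (D : set T) :=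
  exists S : set T, [/\ countable S, S `<=` D & D `<=` closure S].

Section rokhlin_dimension.
Context {R : realType} {G : topGroupType} {A : cstarAlgType R}.
Variables (alpha : action G A) (H : subgroup G).

Definition rokhlin_dim_le (d : nat) : Prop :=
  forall D : starSub A, closed (D : set A) -> separable_set (D : set A) ->
  forall Dinv : action_invariant alpha D,
  exists phi : 'I_d.+1 ->
      {linear contfun (R := R) (coset_space H) -> central_alg alpha D},
    (forall l, [/\ completely_positive (phi l),
      contractive (@contfun_norm R (coset_space H)) (@central_alg_norm R A G alpha D)
        (phi l),
      order_zero (phi l) &
      forall g f, val (phi l (coset_shift g f)) =
                  central_quot_act Dinv g (val (phi l f))]) /\
    is_one (\sum_l phi l contfun_one).

Definition rokhlin_dim : \bar R :=
  ereal_inf [set (d%:R : R)%:E | d in rokhlin_dim_le].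

End rokhlin_dimension.

Record hilbertType (R : realType) := HilbertType {
  hilbert_sort :> completeNormedModType R[i];
  inner : {dot hilbert_sort for conjC};
  inner_norm : forall h : hilbert_sort, `|h| ^+ 2 = inner h h
}.

Definition lin_indep {R : realType} {V : lmodType R[i]} n (x : 'I_n -> V) :=
  forall c : 'I_n -> R[i], \sum_i c i *: x i = 0 -> forall i, c i = 0.

Section operators.
Context {R : realType} {H : hilbertType R}.
Implicit Types T : H -> H.

Definition opnorm T : R := sup [set rnorm (T h) | h in [set h : H | `|h| <= 1]].

Definition compact_operator T :=
  linear T /\ compact (closure (T @` [set h : H | `|h| <= 1])).

Definition adjoint_operators T T' :=
  forall h k : H, inner H (T h) k = inner H h (T' k).

End operators.

Definition separable_infinite_dim {R : realType} (H : hilbertType R) :=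
  separable_set [set: H] /\ forall n, exists x : 'I_n -> H, lin_indep x.

Definition borel (T : ptopologicalType) := g_sigma_algebraType (@open T).

Section haar.
Context {R : realType} {G : topGroupType}.
Variable mu : {measure set (borel G) -> \bar R}.

(* On a second countable locally compact group such a Borel measure is
   automatically regular. *)
Definition left_haar :=
  [/\ forall (g : G) (X : set (borel G)), measurable X ->
        mu [set (g * x)%g | x in X] = mu X,
      forall K : set G, compact K -> (mu K < +oo)%E &
      forall U : set G, open U -> U !=set0 -> (0 < mu U)%E].

(* Delta is the modular function: mu(X r) = Delta(r) mu(X). *)
Definition modular_function (Delta : G -> R) :=
  forall r : G, 0 < Delta r /\
    forall X : set (borel G), measurable X ->
      mu [set (x * r)%g | x in X] = ((Delta r)%:E * mu X)%E.

Definition complex_integral (f : G -> R[i]) : R[i] :=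
  Complex (\int[mu]_x complex.Re (f x)) (\int[mu]_x complex.Im (f x)).

(* The weak integral of a vector-valued function: v = \int f dmu when this holds
   after applying any bounded linear functional.  It is only used for continuous
   compactly supported f. *)
Definition is_integral {V : normedModType R[i]} (f : G -> V) (v : V) :=
  forall psi : {linear V -> R[i]^o}, continuous psi ->
    psi v = complex_integral (fun s => psi (f s)).

End haar.

Section crossed_product.
Context {R : realType} {G : topGroupType} {A : cstarAlgType R}.
Variables (alpha : action G A) (mu : {measure set (borel G) -> \bar R}).
Variable Delta : G -> R.

Definition Cc : set (G -> A) :=
  [set f | continuous f /\
    exists2 K : set G, compact K & forall s, ~ K s -> f s = 0].

Definition is_convolution (f g h : G -> A) :=
  forall s : G, is_integral mu (fun r => f r ** alpha r (g (r^-1 * s)%g)) (h s).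

Definition Cc_star (f : G -> A) : G -> A :=
  fun s => (Delta s^-1%g)%:C%C *: alpha s (star (f s^-1%g)).

Record covariant_rep (H : hilbertType R) (pi : A -> {linear H -> H})
    (U : G -> {linear H -> H}) : Prop := CovariantRep {
  cov_continuous : forall a, continuous (pi a);
  cov_linear : forall (c : R[i]) (a b : A) (h : H),
    pi (c *: a + b) h = c *: pi a h + pi b h;
  cov_smul : forall (a b : A) (h : H), pi (a ** b) h = pi a (pi b h);
  cov_star : forall a : A, adjoint_operators (pi a) (pi (star a));
  cov_unit : forall h : H, U 1%g h = h;
  cov_mulg : forall (s t : G) (h : H), U (s * t)%g h = U s (U t h);
  cov_unitary : forall (s : G) (h k : H), inner H (U s h) (U s k) = inner H h k;
  cov_strong : forall h : H, continuous (fun s => U s h);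
  cov_covariant : forall (s : G) (a : A) (h : H),
    pi (alpha s a) (U s h) = U s (pi a h)
}.

(* T is the integrated form (pi \rtimes U)(f) = \int pi(f(s)) U_s dmu(s). *)
Definition is_integrated_form (H : hilbertType R) (pi : A -> {linear H -> H})
    (U : G -> {linear H -> H}) (f : G -> A) (T : H -> H) :=
  forall h : H, is_integral mu (fun s => pi (f s) (U s h)) (T h).

Definition universal_norm (f : G -> A) : R :=
  sup [set r | exists (H : hilbertType R) (pi : A -> {linear H -> H})
                      (U : G -> {linear H -> H}) (T : H -> H),
    [/\ covariant_rep pi U, is_integrated_form pi U f T & r = opnorm T]].

(* B, with the map iota, is the completion of the *-algebra C_c(G, A) in its
   universal norm; this determines the full crossed product up to isomorphism.
   Only the restriction of iota to C_c(G, A) is relevant. *)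
Record is_full_crossed_product (B : cstarAlgType R) (iota : (G -> A) -> B) :
    Prop := IsFullCrossedProduct {
  crossed_linear : forall (c : R[i]) f g, Cc f -> Cc g ->
    iota (c *: f + g) = c *: iota f + iota g;
  crossed_smul : forall f g h, Cc f -> Cc g -> Cc h -> is_convolution f g h ->
    iota h = iota f ** iota g;
  crossed_star : forall f, Cc f -> iota (Cc_star f) = star (iota f);
  crossed_norm : forall f, Cc f -> rnorm (iota f) = universal_norm f;
  crossed_dense : closure (iota @` Cc) = setT
}.

End crossed_product.

Definition cstar_isomorphic {R : realType} (A B : cstarAlgType R) :=
  exists f : {linear A -> B}, [/\ bijective f,
    forall x y, f (x ** y) = f x ** f y & forall x, f (star x) = star (f x)].

(* T is a C*-tensor product of B with the compact operators on H, with elementary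
   tensors t b x: the algebraic tensor product embeds in T as a dense
   *-subalgebra.  As the compact operators are nuclear, the norm is unique and T
   is determined up to isomorphism. *)
Record is_tensor_compacts {R : realType} (B : cstarAlgType R) (H : hilbertType R)
    (T : cstarAlgType R) (t : B -> (H -> H) -> T) : Prop := IsTensorCompacts {
  tensor_linearl : forall x, compact_operator x -> linear (t^~ x);
  tensor_linearr : forall (b : B) (c : R[i]) x y,
    compact_operator x -> compact_operator y ->
    t b (c *: x + y) = c *: t b x + t b y;
  tensor_smul : forall (a b : B) x y, compact_operator x -> compact_operator y ->
    t (a ** b) (x \o y) = t a x ** t b y;
  tensor_star : forall (b : B) x y, compact_operator x -> compact_operator y ->
    adjoint_operators x y -> t (star b) y = star (t b x);
  tensor_injective : forall n (b : 'I_n -> B) (x : 'I_n -> H -> H),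
    (forall i, compact_operator (x i)) -> lin_indep x ->
    \sum_i t (b i) (x i) = 0 -> forall i, b i = 0;
  tensor_dense : closure [set s : T | exists n (b : 'I_n -> B) (x : 'I_n -> H -> H),
    (forall i, compact_operator (x i)) /\ s = \sum_i t (b i) (x i)] = setT
}.

Definition stable {R : realType} (B : cstarAlgType R) :=
  exists (H : hilbertType R) (T : cstarAlgType R) (t : B -> (H -> H) -> T),
    [/\ separable_infinite_dim H, is_tensor_compacts t & cstar_isomorphic T B].

(* Main.v *)
(** A C*-algebra E with a strictly positive element is stable as soon as every finite
    subset of E is moved by multipliers of bounded norm, isometrically up to a constant
    and up to small errors, onto a set orthogonal to it.  Orthogonalizing infinitely many
    such multipliers yields isometries s_i with orthogonal ranges whose range projections
    sum strictly to 1, and then sum_ij x_ij s_i b s_j^* realizes the tensor product of b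
    with the compact operator (x_ij) inside E itself.

    In the crossed product such multipliers come from the Rokhlin maps phi_l.  As H is not
    open, cosets of H are null sets, so for a suitable choice of signs a phase theta on G/H
    oscillates: the averages of e^(i theta) over translations close to 1 are uniformly
    small.  An order zero map phi sends e^(i theta) to an element a with a^* a close to
    phi(1)^2, while the averages of the translates alpha_g(a) almost vanish.  The unitaries
    u_g with g close to 1 almost fix given elements x and z of the crossed product, hence
    z^* a x is close to the average of z^* alpha_g(a) x and therefore small.  Choosing the
    phases theta_0, ..., theta_d one after the other makes the elements a_l x almost
    orthogonal to each other, and r = a_0 + ... + a_d satisfies
    (r x)^* (r x) >= x^* x / (d + 1) up to a small error, because the phi_l(1) sum to 1. *)

Require Import Defs.
From HB Require Import structures.
From mathcomp Require Import all_boot all_order all_algebra.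
From mathcomp Require Import all_classical all_reals all_analysis.
From mathcomp Require Import complex zify ring lra.

Set Implicit Arguments.
Unset Strict Implicit.
Unset Printing Implicit Defensive.

Import Order.TTheory GRing.Theory Num.Theory Num.Def.
Import numFieldNormedType.Exports.

Local Open Scope classical_set_scope.
Local Open Scope ring_scope.

(** * Modules, norms and square roots *)

(** An order zero map gives direct access only to orthogonality, while the argument asks for the
    modulus of phi(e^(i theta)). The phase is therefore replaced by a combination of powers of one
    unimodular number close to 1, carried by a partition of unity in which only neighbours overlap;
    phi(xi)^* phi(xi) - phi(1)^2 then reduces to products of neighbours with small coefficients.
    Elements of the central sequence algebra are handled through representing sequences: every
    requirement concerns finitely many vectors and holds for all large indices, so one index yields
    the multiplier r. The bound 1 / (d + 1) is the Cauchy-Schwarz inequality for d + 1 summands. The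
    signs in the phase are settled one after the other, each time keeping the sign that does not
    exceed the mean of the squared averages. Spectral theory is replaced by norm estimates: square
    roots are fixed points of contractions, positivity of s is a bound on the norm of l - s, and
    multipliers are adjointable operators, which form a unital algebra where such arguments
    apply. *)

Notation "r %:c" := (real_complex _ r) (at level 1, format "r %:c") : ring_scope.

(** Syntax for the reflective tactic [lmod]: an identity between module expressions is split into
    one scalar identity per atom, which [ring] or [field] then closes. *)
Inductive mexp (K : Type) : Type :=
  | MVar of nat | MAdd of mexp K & mexp K | MOpp of mexp K
  | MScale of K & mexp K | MZero.

Section module_expressions.
Variables (K : pzRingType) (V : lmodType K).

Fixpoint meval (env : seq V) (e : mexp K) : V :=
  match e with
  | MVar i => nth 0 env i
  | MAdd a b => meval env a + meval env b
  | MOpp a => - meval env a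
  | MScale c a => c *: meval env a
  | MZero => 0
  end.

(** [Nat.eqb] is used because it computes under the [cbn] call of [lmod], which thus leaves bare
    scalar coefficients. *)
Fixpoint mcoef (e : mexp K) (i : nat) : K :=
  match e with
  | MVar j => if Nat.eqb i j then 1 else 0
  | MAdd a b => mcoef a i + mcoef b i
  | MOpp a => - mcoef a i
  | MScale c a => c * mcoef a i
  | MZero => 0
  end.

Fixpoint mall (a b : mexp K) (n : nat) : Prop :=
  match n with
  | 0 => True
  | n'.+1 => mcoef a n' = mcoef b n' /\ mall a b n'
  end.

Lemma mevalE env e : meval env e = \sum_(i < size env) mcoef e i *: nth 0 env i.
Proof.
elim: e => /= [j|a -> b ->|a ->|c a ->|].
- have eqbE (i : nat) : Nat.eqb i j = (i == j).
    by elim: i j => [|i IH] [|j] //=; rewrite IH.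
  under eq_bigr do rewrite eqbE.
  have [ji|ij] := ltnP j (size env).
    rewrite (bigD1 (Ordinal ji))//= eqxx scale1r big1 ?addr0// => i.
    by rewrite -val_eqE/= => /negPf ->; rewrite scale0r.
  rewrite nth_default// big1// => i _; rewrite (_ : (val i == j) = false) ?scale0r//.
  by apply/negP => /eqP ij'; have := ltn_ord i; rewrite ij' ltnNge ij.
- by rewrite -big_split/=; apply: eq_bigr => i _; rewrite scalerDl.
- by rewrite -sumrN; apply: eq_bigr => i _; rewrite scaleNr.
- by rewrite scaler_sumr; apply: eq_bigr => i _; rewrite scalerA.
- by rewrite big1// => i _; rewrite scale0r.
Qed.

Lemma meval_eq env a b : mall a b (size env) -> meval env a = meval env b.
Proof.
move=> h; rewrite !mevalE; apply: eq_bigr => i _; congr (_ *: _).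
move: (size env) (val i) (ltn_ord i) h => n; elim: n => // n IH j.
by rewrite ltnS leq_eqVlt => /orP[/eqP->|jn] /= [h1 h2] //; exact: IH.
Qed.

End module_expressions.

Ltac lm_index x env :=
  lazymatch env with
  | ?y :: ?t =>
    match constr:(Set) with
    | _ => let _ := match constr:(Set) with _ => constr_eq x y end in constr:(0%N)
    | _ => let k := lm_index x t in constr:((S k)%N)
    end
  end.
Ltac lm_insert x env :=
  match constr:(Set) with
  | _ => let _ := lm_index x env in env
  | _ => constr:(x :: env)
  end.
Ltac lm_env env t :=
  lazymatch t with
  | @Algebra.add _ ?a ?b => let e := lm_env env a in lm_env e b
  | @Algebra.opp _ ?a => lm_env env a
  | @GRing.scale _ _ _ ?a => lm_env env a
  | @Algebra.zero _ => env
  | ?u => lm_insert u env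
  end.
Ltac lm_reify K env t :=
  lazymatch t with
  | @Algebra.add _ ?a ?b =>
    let x := lm_reify K env a in let y := lm_reify K env b in constr:(@MAdd K x y)
  | @Algebra.opp _ ?a => let x := lm_reify K env a in constr:(@MOpp K x)
  | @GRing.scale _ _ ?c ?a => let x := lm_reify K env a in constr:(@MScale K c x)
  | @Algebra.zero _ => constr:(@MZero K)
  | _ => let i := lm_index t env in constr:(@MVar K i)
  end.
(* An identity in a module holds as soon as the coefficients of every atom agree. *)
Ltac lmod V :=
  unfold reverse_coercion;
  lazymatch goal with
  | |- ?a = ?b =>
    let W := constr:(V : GRing.Lmodule.type _) in
    let K := lazymatch type of W with GRing.Lmodule.type ?K => constr:(K) end in
    let env := lm_env (@nil (GRing.Lmodule.sort W)) a in
    let env := lm_env env b in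
    let x := lm_reify K env a in
    let y := lm_reify K env b in
    apply: (@meval_eq K W env x y); cbn [mall mcoef size Nat.eqb];
    repeat split
  end.

Section real_norm.
Context {R : realType} {V : normedModType R[i]}.
Implicit Types x y : V.

Lemma Re_ge0 (z : R[i]) : 0 <= z -> z = (complex.Re z)%:c.
Proof. by case: z => a b; rewrite lecE/= => /andP[/eqP-> _]. Qed.

Lemma rnormE x : `|x| = (rnorm x)%:c.
Proof. exact: Re_ge0. Qed.

Lemma le_rnorm x r : (`|x| <= r%:c) = (rnorm x <= r).
Proof. by rewrite rnormE lecR. Qed.

Lemma lt_rnorm x r : (`|x| < r%:c) = (rnorm x < r).
Proof. by rewrite rnormE ltcR. Qed.

Lemma rnorm_ge0 x : 0 <= rnorm x.
Proof. by rewrite -lecR -rnormE; exact: normr_ge0. Qed.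

Lemma rnormD x y : rnorm (x + y) <= rnorm x + rnorm y.
Proof. by rewrite -lecR raddfD/= -!rnormE ler_normD. Qed.

Lemma rnormN x : rnorm (- x) = rnorm x.
Proof. by rewrite /rnorm normrN. Qed.

Lemma rnormB x y : rnorm (x - y) = rnorm (y - x).
Proof. by rewrite /rnorm distrC. Qed.

Lemma rnorm0_eq0 x : rnorm x = 0 -> x = 0.
Proof. by move=> h; apply/normr0_eq0; rewrite rnormE h. Qed.

Lemma rnorm0 : rnorm (0 : V) = 0.
Proof. by rewrite /rnorm normr0. Qed.

Definition cabs (c : R[i]) : R := complex.Re `|c|.

Lemma cabsE (c : R[i]) : `|c| = (cabs c)%:c.
Proof. exact: Re_ge0. Qed.

Lemma rnormZ c x : rnorm (c *: x) = cabs c * rnorm x.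
Proof. by apply/(@complexI R); rewrite -rnormE normrZ rmorphM/= -cabsE -rnormE. Qed.

Lemma cabs_ge0 c : 0 <= cabs c.
Proof. by rewrite -lecR -cabsE; exact: normr_ge0. Qed.

Lemma cabs_real (r : R) : cabs r%:c = `|r|.
Proof. by apply/(@complexI R); rewrite -cabsE normc_def/= expr0n addr0 sqrtr_sqr. Qed.

Lemma cabsM c d : cabs (c * d) = cabs c * cabs d.
Proof. by apply/(@complexI R); rewrite -cabsE normrM rmorphM/= -!cabsE. Qed.

Lemma cabsD c d : cabs (c + d) <= cabs c + cabs d.
Proof. by rewrite -lecR rmorphD/= -!cabsE ler_normD. Qed.

Lemma cabsN c : cabs (- c) = cabs c.
Proof. by rewrite /cabs normrN. Qed.

Lemma cabs_conj c : cabs (conjC c) = cabs c.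
Proof. by rewrite /cabs norm_conjC. Qed.

Lemma cabs1 : cabs 1 = 1. Proof. by rewrite /cabs normr1. Qed.
Lemma cabs0 : cabs 0 = 0. Proof. by rewrite /cabs normr0. Qed.

Lemma cabs_i : cabs 'i%C = 1.
Proof. by rewrite /cabs normc_def/= expr0n expr1n add0r sqrtr1. Qed.

Lemma cabs_sqr c : ((cabs c) ^+ 2)%:c = c * conjC c.
Proof. by rewrite rmorphXn/= -cabsE normCK. Qed.

Lemma conjC_real (r : R) : conjC (r%:c) = r%:c.
Proof. by apply/conj_Creal; rewrite complex_real. Qed.

Lemma conjC_i : conjC ('i%C : R[i]) = - 'i%C.
Proof. by apply/eqP; rewrite eq_complex/= oppr0 !eqxx. Qed.

Lemma rnorm_real (r : R) x : rnorm (r%:c *: x) = `|r| * rnorm x.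
Proof. by rewrite rnormZ cabs_real. Qed.

End real_norm.

Lemma expr_small {R : realType} (q e : R) : 0 <= q -> q < 1 -> 0 < e ->
  exists n, forall m, (n <= m)%N -> q ^+ m <= e.
Proof.
move=> q0 q1 e0; have : (q ^+ n @[n --> \oo] --> (0 : R)).
  by apply: cvg_expr; rewrite ger0_norm.
move=> /cvgrPdist_le/(_ _ e0) [n _ h]; exists n => m nm.
by have := h m nm; rewrite /= sub0r normrN ger0_norm// exprn_ge0.
Qed.

(** A C*-norm is kept as separate data on a star algebra so that the same lemmas serve a C*-algebra,
    the adjointable operators on it and the complex numbers. Completeness is phrased with sequences
    and real bounds. *)
Record cnorm {R : realType} (E : starAlgType R) := CNorm {
  cn :> E -> R;
  cnD : forall x y, cn (x + y) <= cn x + cn y;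
  cnZ : forall c x, cn (c *: x) = cabs c * cn x;
  cn_eq0 : forall x, cn x = 0 -> x = 0;
  cnM : forall x y, cn (x ** y) <= cn x * cn y;
  cn_cstar : forall x, cn (star x ** x) = cn x ^+ 2;
  cn_complete : forall u : nat -> E,
    (forall e, 0 < e -> exists n, forall m, (n <= m)%N -> cn (u m - u n) <= e) ->
    exists l, forall e, 0 < e -> exists n, forall m, (n <= m)%N -> cn (u m - l) <= e
}.

Section cnorm_theory.
Context {R : realType} {E : starAlgType R} (N : cnorm E).
Implicit Types x y z : E.

Lemma cn0 : N 0 = 0.
Proof. by rewrite -(scale0r (0 : E)) cnZ cabs0 mul0r. Qed.

Lemma cnN x : N (- x) = N x.
Proof. by rewrite -scaleN1r cnZ cabsN cabs1 mul1r. Qed.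

Lemma cnB x y : N (x - y) = N (y - x).
Proof. by rewrite -cnN opprB. Qed.

Lemma cn_ge0 x : 0 <= N x.
Proof. by have := cnD N x (- x); rewrite subrr cn0 cnN; lra. Qed.

Lemma cnBD x y : N (x - y) <= N x + N y.
Proof. by rewrite -(cnN y) cnD. Qed.

Lemma cn_tri z x y : N (x - y) <= N (x - z) + N (z - y).
Proof. by rewrite -(subrKA z x) cnD. Qed.

Lemma cn_real (r : R) x : N (r%:c *: x) = `|r| * N x.
Proof. by rewrite cnZ cabs_real. Qed.

Lemma cn_star x : N (star x) = N x.
Proof.
have le_star y : N y <= N (star y).
  have [->|y0] := eqVneq (N y) 0; first exact: cn_ge0.
  rewrite -(ler_pM2r (_ : 0 < N y)) ?lt_neqAle ?cn_ge0 1?eq_sym ?y0//.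
  by rewrite -expr2 -cn_cstar cnM.
by apply/eqP; rewrite eq_le le_star -{2}(starK x) le_star.
Qed.

Lemma cn_cstar' x : N (x ** star x) = N x ^+ 2.
Proof. by rewrite -{1}(starK x) cn_cstar cn_star. Qed.

Lemma cn_eqP x : (forall e, 0 < e -> N x <= e) -> x = 0.
Proof.
move=> h; apply: (@cn_eq0 _ _ N); apply/eqP; rewrite eq_le cn_ge0 andbT.
by apply/ler_addgt0Pl => e e0; rewrite addr0; exact: h.
Qed.

Lemma starN x : star (- x) = - star x.
Proof. by rewrite -scaleN1r starZ rmorphN rmorph1 scaleN1r. Qed.

Lemma starZr (r : R) x : star (r%:c *: x) = r%:c *: star x.
Proof. by rewrite starZ conjC_real. Qed.

Definition cn_closed (P : set E) :=
  forall l, (forall e, 0 < e -> exists2 x, P x & N (x - l) <= e) -> P l.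

Lemma cn_closedI (P Q : set E) : cn_closed P -> cn_closed Q -> cn_closed (P `&` Q).
Proof.
move=> cP cQ l h; split; [apply: cP|apply: cQ] => e e0;
  by have [x [Px Qx] xl] := h e e0; exists x.
Qed.

Lemma cn_closed_le a r : cn_closed [set x | N (x - a) <= r].
Proof.
move=> l h /=; apply/ler_addgt0Pl => e e0; have [x /= xa xl] := h e e0.
by rewrite (le_trans (cn_tri x _ _))// lerD// cnB.
Qed.

(* f is only used as an additive Lipschitz map. *)
Lemma cn_closed_ker (f : E -> E) C : 0 <= C ->
  (forall x y, N (f x - f y) <= C * N (x - y)) -> cn_closed [set x | f x = 0].
Proof.
move=> C0 fC l h /=; apply: cn_eqP => e e0.
have d0 : 0 < e / (C + 1) by rewrite divr_gt0// ltr_wpDl.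
have [x /= fx xl] := h _ d0; rewrite -[f l]subr0 -fx (le_trans (fC _ _))//.
rewrite cnB (le_trans (ler_wpM2l C0 xl))// mulrCA ger_pMr//.
by rewrite ler_pdivrMr ?mul1r ?lerDl// ltr_wpDl.
Qed.

Lemma cn_closed_sa : cn_closed [set x | star x = x].
Proof.
move=> l h; have : star l - l = 0.
  apply: (@cn_closed_ker (fun x => star x - x) 2 _ _ l) => //= [x y|e e0].
    have -> : star x - x - (star y - y) = star (x - y) - (x - y).
      by rewrite starB; lmod E; ring.
    by rewrite (le_trans (cnBD _ _))// cn_star; lra.
  by have [x /= sx xl] := h e e0; exists x; rewrite ?sx ?subrr.
by move/eqP; rewrite subr_eq0 => /eqP.
Qed.

Lemma cn_closed_comm a : cn_closed [set x | x ** a = a ** x].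
Proof.
move=> l h; have : l ** a - a ** l = 0.
  apply: (@cn_closed_ker (fun x => x ** a - a ** x) (2 * N a) _ _ l) => /=.
  - by rewrite mulr_ge0 ?cn_ge0.
  - move=> x y.
    have -> : x ** a - a ** x - (y ** a - a ** y) = (x - y) ** a - a ** (x - y).
      by rewrite smulBl smulBr; lmod E; ring.
    rewrite (le_trans (cnBD _ _))// (le_trans (lerD (cnM _ _ _) (cnM _ _ _)))//.
    by rewrite [N (x - y) * _]mulrC; lra.
  - by move=> e e0; have [x /= sx xl] := h e e0; exists x; rewrite ?sx ?subrr.
by move/eqP; rewrite subr_eq0 => /eqP.
Qed.

(** Banach's fixed point theorem on a closed set. The set [P] carries self-adjointness, norm bounds
    and commutation relations over to the fixed point. *)
Lemma cn_fixpoint (F : E -> E) (P : set E) (q : R) x0 :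
  0 <= q -> q < 1 -> cn_closed P -> P x0 -> (forall x, P x -> P (F x)) ->
  (forall x y, P x -> P y -> N (F x - F y) <= q * N (x - y)) ->
  exists2 x, P x & F x = x.
Proof.
move=> q0 q1 cP P0 PF Fq; pose u n := iter n F x0; pose d := N (u 1%N - u 0%N).
have Pu n : P (u n) by elim: n => //= n; exact: PF.
have d0 : 0 <= d by exact: cn_ge0.
have du n : N (u n.+1 - u n) <= q ^+ n * d.
  elim: n => [|n IH]; first by rewrite expr0 mul1r.
  have := Fq _ _ (Pu n.+1) (Pu n); rewrite -[F (u n.+1)]/(u n.+2) -[F (u n)]/(u n.+1).
  by move=> /le_trans; apply; rewrite exprS -mulrA ler_wpM2l.
have q1' : 0 < 1 - q by rewrite subr_gt0.
have dk n k : N (u (n + k)%N - u n) <= q ^+ n * (d / (1 - q)) * (1 - q ^+ k).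
  elim: k => [|k IH]; first by rewrite addn0 subrr cn0 expr0 subrr mulr0.
  rewrite (le_trans (cn_tri (u (n + k)%N) _ _))// addnS (le_trans (lerD (du _) IH))//.
  by rewrite exprD exprS le_eqVlt; apply/orP; left; apply/eqP; field; rewrite gt_eqF.
have cu : forall e, 0 < e -> exists n, forall m, (n <= m)%N -> N (u m - u n) <= e.
  move=> e e0; have D0 : 0 < d / (1 - q) + 1 by rewrite ltr_wpDl// divr_ge0// ltW.
  have [n hn] := expr_small q0 q1 (divr_gt0 e0 D0); exists n => m nm.
  rewrite -(subnKC nm) (le_trans (dk _ _))//.
  have qk : 0 <= q ^+ (m - n) by rewrite exprn_ge0.
  have qn := hn n (leqnn n); rewrite ler_pdivlMr// in qn.
  have qn0 : 0 <= q ^+ n by rewrite exprn_ge0.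
  have dq : 0 <= d / (1 - q) by rewrite divr_ge0// ltW.
  have h1 : q ^+ n * (d / (1 - q)) * (1 - q ^+ (m - n)) <= q ^+ n * (d / (1 - q)).
    by apply: ler_piMr; [exact: mulr_ge0|lra].
  by rewrite (le_trans h1)// (le_trans _ qn)// ler_wpM2l// lerDl.
have [l ul] := cn_complete cu; exists l.
  by apply: cP => e /ul[n hn]; exists (u n) => //; exact: hn.
have Pl : P l by apply: cP => e /ul[n hn]; exists (u n) => //; exact: hn.
apply/eqP; rewrite -subr_eq0; apply/eqP/cn_eqP => e e0.
have e2 : 0 < e / 2 by rewrite divr_gt0.
have [n hn] := ul _ e2; rewrite (le_trans (cn_tri (u n.+1) _ _))//.
have h1 := hn n.+1 (leqnSn _); have h2 := hn n (leqnn _).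
have h3 := Fq l (u n) Pl (Pu n); have Fu : F (u n) = u n.+1 by [].
rewrite Fu in h3; rewrite cnB in h2.
have := cn_ge0 (l - u n); nra.
Qed.

(* y = 1 - (1 - x)^(1/2). *)
Lemma cn_sqrt x (q : R) : q < 1 -> N x <= q -> star x = x ->
  exists y, [/\ 2%:c *: y = x + y ** y, star y = y, N y <= q &
    forall a, x ** a = a ** x -> y ** a = a ** y].
Proof.
move=> q1 xq xs; have q0 : 0 <= q by rewrite (le_trans _ xq) ?cn_ge0.
(* [F y - F z] is half of y (y - z) + (y - z) z, so [F] contracts by [q] on the ball of radius [q].
   Solving for y = 1 - root keeps the equation meaningful without a unit. *)
pose F y := (2^-1)%:c *: (x + y ** y).
pose P := [set y | N (y - 0) <= q] `&` ([set y | star y = y] `&`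
  [set y | forall a, x ** a = a ** x -> y ** a = a ** y]).
have cP : cn_closed P.
  apply: cn_closedI; first exact: cn_closed_le.
  apply: cn_closedI; first exact: cn_closed_sa.
  move=> l h a xa; apply: (@cn_closed_comm a) => e /h[y /= /(_ _ xa) ya yl].
  by exists y.
have PF y : P y -> P (F y).
  move=> [/= yq [ys yc]]; rewrite subr0 in yq; split; [|split] => /=.
  - rewrite subr0 cn_real ger0_norm ?invr_ge0//.
    have := cnD N x (y ** y); have := cnM N y y; have := cn_ge0 y.
    have := cn_ge0 (x + y ** y); nra.
  - by rewrite starZr starD starM ys xs.
  - move=> a xa; rewrite smulZl smulZr smulDl smulDr xa.
    by rewrite -(smulA y y) (yc a xa) smulA (yc a xa) -smulA.
have [||y [/= yq [ys yc]] Fy] := @cn_fixpoint F P q 0 q0 q1 cP _ PF.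
- split; [|split] => /=; first by rewrite subrr cn0.
    exact: star0.
  by move=> a _; rewrite smul0x smulx0.
- move=> y z [/= yq [ys yc]] [/= zq _]; rewrite !subr0 in yq zq.
  have -> : F y - F z = (2^-1)%:c *: (y ** (y - z) + (y - z) ** z).
    by rewrite /F smulBr smulBl; lmod E; ring.
  rewrite cn_real ger0_norm ?invr_ge0//.
  have h1 := cnD N (y ** (y - z)) ((y - z) ** z).
  have h2 := cnM N y (y - z); have h3 := cnM N (y - z) z.
  have := cn_ge0 (y - z); nra.
exists y; split => //; last by rewrite subr0 in yq.
by rewrite -{1}Fy /F scalerA -rmorphM/= divff// scale1r.
Qed.

End cnorm_theory.

Definition expand_smul {R : realType} {E : starAlgType R} :=
  (@smulDl R E, @smulDr R E, @smulNl R E, @smulNr R E, @smulZl R E,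
   @smulZr R E, @smulA R E, @smul0x R E, @smulx0 R E).

Definition expand_star {R : realType} {E : starAlgType R} :=
  (@starD R E, @starN R E, @starZr R E, @starZ R E, @starM R E, @starK R E,
   @star0 R E, @conjC_i R, @conjC_real R).

(** * Positive elements *)

(** If [y] exceeded [r], Bernoulli's inequality would make (y / r)^(2m) grow at least like m^2,
    faster than the linear factor. Exponents 2^k suffice, and for them the norm of a self-adjoint
    power is known exactly. *)
Lemma growth_le {R : realType} (y r C : R) : 0 <= y -> 0 < r ->
  (forall k, y ^+ (2 ^ k)%N <= C * (1 + (2 ^ k)%:R) * r ^+ (2 ^ k)%N) -> y <= r.
Proof.
move=> y0 r0 h; rewrite leNgt; apply/negP => ry.
have C0 : 0 < C.
  rewrite ltNge; apply/negP => C0; have := h 0%N; rewrite expn0 !expr1.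
  have : 0 <= (1 + 1%:R) * r by rewrite mulr_ge0// ltW.
  rewrite -mulrA; nra.
pose a := y / r - 1; have a0 : 0 < a by rewrite subr_gt0 ltr_pdivlMr// mul1r.
have ya : y = (1 + a) * r by rewrite /a; field; rewrite gt_eqF.
have bern m : 1 + m%:R * a <= (1 + a) ^+ m.
  elim: m => [|m IH]; first by rewrite mul0r addr0 expr0.
  rewrite exprS -natr1; have : 0 <= m%:R * a * a by rewrite !mulr_ge0// ltW.
  nra.
have aa : 0 < 3 * C / (a * a) by rewrite divr_gt0 ?mulr_gt0.
have [k hk] : exists k, 3 * C / (a * a) < (2 ^ k)%:R.
  have /ltW/archi_boundP := aa; set m := Num.bound _ => am; exists m.
  by rewrite (lt_le_trans am)// ler_nat ltnW// ltn_expl.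
have := h k.+1; rewrite ya exprMn ler_pM2r ?exprn_gt0//.
rewrite expnS mulnC muln2 -addnn exprD natrD.
set m := (2 ^ k)%N in hk *; have m1 : 1 <= m%:R :> R by rewrite ler1n expn_gt0.
have := bern m; rewrite ltr_pdivrMr ?mulr_gt0// in hk.
set z := (1 + a) ^+ m; move: m%:R hk m1 => t hk t1 tz.
have ta : 0 < t * a by rewrite mulr_gt0//; lra.
have : (t * a) * (t * a) < z * z by apply: ltr_pM; lra.
have : 3 * C * t < t * (a * a) * t by rewrite ltr_pM2r//; lra.
by move: (z * z) => zz; have : C <= C * t by [rewrite ler_peMr// ltW]; nra.
Qed.

Record ucnorm {R : realType} (M : starAlgType R) := UCNorm {
  ucn :> cnorm M;
  uone : M;
  uoneP : is_one uone
}.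

Section unital.
Context {R : realType} {M : starAlgType R} (N : ucnorm M).
Implicit Types (x y z s t a b c : M) (r l h : R).
Local Notation "1e" := (uone N).
Local Notation sc r := (r%:c *: 1e).

Lemma smul1x x : 1e ** x = x. Proof. by have [] := uoneP N x. Qed.
Lemma smulx1 x : x ** 1e = x. Proof. by have [] := uoneP N x. Qed.
Lemma star1 : star 1e = 1e.
Proof. by rewrite -[LHS]smul1x -{1}[1e]starK -starM smul1x starK. Qed.

Lemma cn1 : N 1e <= 1.
Proof.
have := cn_cstar N 1e; rewrite star1 smul1x => h.
by rewrite leNgt; apply/negP => n1; have : N 1e < N 1e ^+ 2 by [rewrite ltr_eXnr]; lra.
Qed.

Lemma cn_sc r : N (sc r) <= `|r|.
Proof. by rewrite cn_real ler_piMr// cn1. Qed.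

Definition expand_one := (smul1x, smulx1, star1).

(** Positivity without spectra: for self-adjoint s, that l - s has norm at most l says that the
    spectrum of s lies in [0, 2l]. Sums of positive elements are then immediate. *)
Definition pos s := star s = s /\ exists2 l, 0 <= l & N (sc l - s) <= l.

Lemma pos_sa s : pos s -> star s = s. Proof. by case. Qed.

Lemma posD s t : pos s -> pos t -> pos (s + t).
Proof.
move=> [ss [l l0 sl]] [ts [k k0 tk]]; split; first by rewrite starD ss ts.
exists (l + k); first exact: addr_ge0.
have -> : sc (l + k) - (s + t) = (sc l - s) + (sc k - t) by lmod M; ring.
by rewrite (le_trans (cnD _ _ _))// lerD.
Qed.

Lemma posZ r s : 0 <= r -> pos s -> pos (r%:c *: s).
Proof.
move=> r0 [ss [l l0 sl]]; split; first by rewrite starZr ss.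
exists (r * l); first exact: mulr_ge0.
have -> : sc (r * l) - r%:c *: s = r%:c *: (sc l - s) by lmod M; ring.
by rewrite cn_real ger0_norm// ler_wpM2l.
Qed.

Lemma pos_scalar r : 0 <= r -> pos (sc r).
Proof.
move=> r0; split; first by rewrite starZr star1.
by exists r; rewrite // subrr cn0.
Qed.

Lemma pos_norm_sub s h : star s = s -> N s <= h -> pos (sc h - s).
Proof.
move=> ss sh; split; first by rewrite starB starZr star1 ss.
exists h; first by rewrite (le_trans _ sh)// cn_ge0.
by have -> : sc h - (sc h - s) = s by lmod M; ring.
Qed.

Lemma pos_norm_add s h : star s = s -> N s <= h -> pos (s + sc h).
Proof.
move=> ss sh; have -> : s + sc h = sc h - - s by lmod M; ring.
by apply: pos_norm_sub; rewrite ?starN ?ss ?cnN.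
Qed.

(* b + ic is unitary. *)
Lemma cn_sqrt_le1 b c : star b = b -> star c = c -> c ** b = b ** c ->
  c ** c = 1e - b ** b -> N c <= 1.
Proof.
move=> bs cs cb cc; pose w := b + 'i%C *: c.
have ii : 'i%C * 'i%C = -1 :> R[i] by rewrite -expr2 sqr_i.
have wsE : star w = b - 'i%C *: c.
  by rewrite /w starD starZ conjC_i bs cs; lmod M; ring.
have : N (star w ** w) <= 1.
  have -> : star w ** w = 1e.
    rewrite wsE /w !expand_smul cb !scalerA ii cc; lmod M; ring.
  exact: cn1.
rewrite cn_cstar expr_le1 ?cn_ge0// => w1.
have -> : c = ((- 2^-1)%:c * 'i%C) *: (w - star w).
  have -> : w - star w = (2%:c * 'i%C) *: c by rewrite wsE /w; lmod M; ring.
  rewrite scalerA mulrACA ii -rmorphM/= mulNr mulVf ?pnatr_eq0//.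
  by rewrite rmorphN rmorph1 mulrNN mulr1 scale1r.
rewrite cnZ cabsM cabs_i mulr1 cabs_real normrN ger0_norm ?invr_ge0//.
by have := cnBD N w (star w); rewrite cn_star; lra.
Qed.

Lemma sqrt_one_sub_sq b : star b = b -> N b < 1 ->
  exists c, [/\ star c = c, c ** c = 1e - b ** b, N c <= 1, pos c &
    forall a, b ** b ** a = a ** (b ** b) -> c ** a = a ** c].
Proof.
move=> bs b1; have b0 := cn_ge0 N b.
have q1 : N b ^+ 2 < 1 by rewrite expr_lt1.
have bq : N (b ** b) <= N b ^+ 2 by rewrite expr2 cnM.
have [|y [y2 ys yq yc]] := cn_sqrt q1 bq; first by rewrite starM bs.
have cs : star (1e - y) = 1e - y by rewrite starB star1 ys.
have cc : (1e - y) ** (1e - y) = 1e - b ** b.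
  have -> : (1e - y) ** (1e - y) = 1e - 2%:c *: y + y ** y.
    by rewrite !expand_smul !expand_one; lmod M; ring.
  by rewrite y2; lmod M; ring.
have ca a : b ** b ** a = a ** (b ** b) -> (1e - y) ** a = a ** (1e - y).
  by move=> /yc ya; rewrite !expand_smul !expand_one ya.
exists (1e - y); split => //.
  by apply: cn_sqrt_le1 bs cs _ cc; apply: ca; rewrite !smulA.
split=> //; exists 1; rewrite // (_ : sc 1 - _ = y); last by lmod M; ring.
by rewrite (le_trans yq)// ltW.
Qed.

(** Scaled to norm below 1, [b] has a partner [c] of norm at most 1 with c^2 = 1 - b^2, which is the
    bound in [pos] with l = 1. *)
Lemma pos_sq b : star b = b -> pos (b ** b).
Proof.
move=> bs; pose n := N b + 1; have n0 : 0 < n by rewrite ltr_wpDl// cn_ge0.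
have b's : star ((n^-1)%:c *: b) = (n^-1)%:c *: b by rewrite starZr bs.
have b'1 : N ((n^-1)%:c *: b) < 1.
  rewrite cn_real ger0_norm ?invr_ge0 1?ltW// mulrC ltr_pdivrMr// mul1r /n.
  by lra.
have [c [cs cc c1 _ _]] := sqrt_one_sub_sq b's b'1.
have -> : b ** b = (n ^+ 2)%:c *: (((n^-1)%:c *: b) ** ((n^-1)%:c *: b)).
  rewrite !expand_smul !scalerA -!rmorphM/=.
  by rewrite (_ : _ * _ = 1) ?scale1r//; field; rewrite gt_eqF.
apply: posZ; first exact: sqr_ge0.
split; first by rewrite starM b's.
exists 1 => //; rewrite scale1r -cc (le_trans (cnM _ _ _))//.
by rewrite mulr_ile1 ?cn_ge0.
Qed.

(** The shift by [r] brings the element fed to [cn_sqrt] down to norm l / (l + r) < 1, where the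
    iteration contracts strictly. Facts about [s] itself follow as [r] tends to 0. *)
Lemma pos_root s r : pos s -> 0 < r ->
  exists k, [/\ star k = k, k ** k = s + sc r, pos k &
    forall a, s ** a = a ** s -> k ** a = a ** k].
Proof.
move=> [ss [l l0 sl]] r0; have lr : 0 < l + r by rewrite ltr_wpDl.
pose x := ((l + r)^-1)%:c *: (sc l - s).
have xs : star x = x by rewrite starZr starB starZr star1 ss.
have q1 : l / (l + r) < 1 by rewrite ltr_pdivrMr// mul1r ltrDl.
have xq : N x <= l / (l + r).
  rewrite cn_real ger0_norm; last by rewrite invr_ge0 ltW.
  by rewrite [leLHS]mulrC ler_wpM2r// invr_ge0 ltW.
have [y [y2 ys yq yc]] := cn_sqrt q1 xq xs.
pose g := Num.sqrt (l + r); have gg : g * g = l + r by rewrite -expr2 sqr_sqrtr// ltW.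
exists (g%:c *: (1e - y)); split.
- by rewrite starZr starB star1 ys.
- rewrite smulZl smulZr scalerA -rmorphM gg/=.
  have -> : (1e - y) ** (1e - y) = 1e - 2%:c *: y + y ** y.
    by rewrite !expand_smul !expand_one; lmod M; ring.
  rewrite y2; have -> : 1e - (x + y ** y) + y ** y = 1e - x by lmod M; ring.
  rewrite scalerBr /x scalerA -[in X in _ - X]rmorphM/= mulfV ?gt_eqF// rmorph1.
  by lmod M; ring.
- apply: posZ; first exact: sqrtr_ge0.
  split; first by rewrite starB star1 ys.
  exists 1; rewrite // (_ : sc 1 - _ = y); last by lmod M; ring.
  by rewrite (le_trans yq)// ltW.
- move=> a sa; have ya : y ** a = a ** y.
    by apply: yc; rewrite /x !expand_smul !expand_one sa; lmod M; ring.
  by rewrite !expand_smul !expand_one ya.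
Qed.

(* For commuting square roots a, b of h - s and h + s, the element w = a + ib
   has star w ** w = 2h, and the real part of w ** w is - 2s. *)
Lemma pos_norm_le s h : 0 <= h -> pos (sc h - s) -> pos (sc h + s) -> N s <= h.
Proof.
move=> h0 p1 p2; apply/ler_addgt0Pl => r r0.
have [a [sa aa _ ca]] := pos_root p1 r0.
have [b [sb bb _ cb]] := pos_root p2 r0.
have ab : a ** b = b ** a.
  apply: ca; apply/esym/cb; rewrite !expand_smul !expand_one; lmod M; ring.
pose w := a + 'i%C *: b; have wsE : star w = a - 'i%C *: b.
  by rewrite /w starD starZ conjC_i sa sb; lmod M; ring.
have ii : 'i%C * 'i%C = -1 :> R[i] by rewrite -expr2 sqr_i.
have w2 : N w ^+ 2 <= 2 * (r + h).
  rewrite -cn_cstar (_ : _ ** w = sc (2 * (r + h))).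
    by rewrite (le_trans (cn_sc _))// ger0_norm// mulr_ge0// addr_ge0// ltW.
  rewrite wsE /w !expand_smul ab !scalerA ii aa bb; lmod M; ring.
have -> : s = (- 4^-1)%:c *: (w ** w + star w ** star w).
  rewrite wsE /w !expand_smul ab !scalerA ii aa bb.
  by lmod M; by field.
rewrite cn_real normrN ger0_norm ?invr_ge0//.
have := cnD N (w ** w) (star w ** star w).
have := cnM N w w; have := cnM N (star w) (star w); rewrite cn_star; lra.
Qed.

(** The definition of [pos] provides one [l]; here every [l] above the norm is seen to work, which
    is what makes positivity stable under limits. *)
Lemma posP s l : pos s -> N s <= l -> N (sc l - s) <= l.
Proof.
move=> ps sl; have l0 : 0 <= l by rewrite (le_trans _ sl)// cn_ge0.
apply: pos_norm_le => //; first by have -> : sc l - (sc l - s) = s by lmod M; ring.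
by apply: posD; [exact: pos_scalar|apply: pos_norm_sub => //; exact: pos_sa].
Qed.

Lemma pos_norm_mono a b : pos a -> pos (b - a) -> N a <= N b.
Proof.
move=> pa pba; have pb : pos b by rewrite -(subrK a b); exact: posD.
apply: pos_norm_le; first exact: cn_ge0.
  have -> : sc (N b) - a = (sc (N b) - b) + (b - a) by lmod M; ring.
  by apply: posD => //; apply: pos_norm_sub => //; exact: pos_sa.
by apply: posD => //; exact/pos_scalar/cn_ge0.
Qed.

Lemma pos_closed s : (forall r, 0 < r -> pos (s + sc r)) -> pos s.
Proof.
move=> h; split.
  have /pos_sa := h 1 ltr01; rewrite starD starZr star1; exact: addIr.
exists (N s + 1); first by rewrite addr_ge0// cn_ge0.
apply/ler_addgt0Pl => r r0; have := @posP _ (r + (N s + 1)) (h r r0).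
have -> : sc (r + (N s + 1)) - (s + sc r) = sc (N s + 1) - s by lmod M; ring.
apply; have := cnD N s (sc r); have := cn_sc r; rewrite gtr0_norm//; lra.
Qed.

Lemma pos_near s t r : pos t -> star s = s -> N (s - t) <= r -> pos (s + sc r).
Proof.
move=> pt ss st; have -> : s + sc r = t + ((s - t) + sc r) by lmod M; ring.
by apply: posD => //; apply: pos_norm_add => //; rewrite starB ss (pos_sa pt).
Qed.

Lemma pos_limit s : star s = s ->
  (forall r, 0 < r -> exists2 t, pos t & N (s - t) <= r) -> pos s.
Proof.
move=> ss h; apply: pos_closed => r /h[t pt st]; exact: pos_near pt ss st.
Qed.

(** Commuting case of [pos_conj], needed before [pos_star_smul] is available: with an approximate
    root k of a, the element b a b is close to the square of k b. *)
Lemma pos_mul a b : pos a -> star b = b -> a ** b = b ** a -> pos (b ** a ** b).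
Proof.
move=> pa bs ab; apply: pos_limit => [|r r0].
  by rewrite !starM bs (pos_sa pa) smulA.
have d0 : 0 < r / (N (b ** b) + 1) by rewrite divr_gt0// ltr_wpDl// cn_ge0.
have [k [sk kk _ kc]] := pos_root pa d0; have kb := kc _ ab.
exists ((k ** b) ** (k ** b)); first by apply: pos_sq; rewrite starM bs sk kb.
have -> : b ** a ** b - (k ** b) ** (k ** b) = - (r / (N (b ** b) + 1))%:c *: (b ** b).
  have -> : (k ** b) ** (k ** b) = b ** (k ** k) ** b by rewrite {1}kb !smulA.
  rewrite kk !expand_smul !expand_one.
  by move: (_%:c) => u; lmod M; ring.
rewrite scaleNr cnN cn_real gtr0_norm// mulrAC ler_pdivrMr ?ltr_wpDl ?cn_ge0//.
by rewrite ler_pM2l// lerDl.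
Qed.

Definition spow x n := iter n (smul x) 1e.

Lemma spowS x n : spow x n.+1 = x ** spow x n. Proof. by []. Qed.

Lemma spow_comm a x n : a ** x = x ** a -> a ** spow x n = spow x n ** a.
Proof.
move=> ax; elim: n => [|n IH]; first by rewrite smul1x smulx1.
by rewrite spowS smulA ax -smulA IH smulA.
Qed.

Lemma spowSr x n : spow x n.+1 = spow x n ** x.
Proof. by rewrite spowS spow_comm. Qed.

Lemma spowD x m n : spow x (m + n) = spow x m ** spow x n.
Proof. by elim: m => [|m IH]; rewrite ?smul1x// addSn !spowS IH smulA. Qed.

Lemma star_spow x n : star x = x -> star (spow x n) = spow x n.
Proof.
by move=> xs; elim: n => [|n IH]; rewrite ?star1// spowS starM IH xs -spowSr.
Qed.

Lemma cn_spow x n : N (spow x n) <= N x ^+ n.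
Proof.
elim: n => [|n IH]; first exact: cn1.
by rewrite spowS exprS (le_trans (cnM _ _ _))// ler_wpM2l// cn_ge0.
Qed.

Lemma cn_spow2 x k : star x = x -> N (spow x (2 ^ k)) = N x ^+ (2 ^ k)%N.
Proof.
move=> xs; elim: k => [|k IH]; first by rewrite expn0 expr1 /spow/= smulx1.
rewrite expnS mulnC muln2 -addnn spowD -{1}(star_spow _ xs) cn_cstar IH.
by rewrite -exprM muln2 addnn.
Qed.

(* Y t = t X below bounds the powers of Y by those of X. *)
Lemma pos_sub_swap t k : 0 <= k -> pos (sc k - star t ** t) -> pos (sc k - t ** star t).
Proof.
move=> k0 pk; pose L := N (sc k - star t ** t) + 1.
have L0 : 0 < L by rewrite ltr_wpDl// cn_ge0.
pose X := sc L + star t ** t; pose Y := sc L + t ** star t.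
have r0 : 0 < L + k by rewrite ltr_wpDr.
have Ys : star Y = Y by rewrite /Y !expand_star star1.
have XL : N X <= L + k.
  have -> : X = sc (L + k) - (sc k - star t ** t) by rewrite /X; lmod M; ring.
  by apply: posP => //; rewrite /L; lra.
have YX n : spow Y n ** t = t ** spow X n.
  elim: n => [|n IH]; first by rewrite smul1x smulx1.
  rewrite !spowS -smulA IH smulA.
  have -> : Y ** t = t ** X by rewrite /X /Y !expand_smul !expand_one.
  by rewrite smulA.
pose T := N t ^+ 2; have T0 : 0 <= T by exact: sqr_ge0.
(* The recursion Y^(n+1) = L Y^n + t X^n t^* leaves a factor linear in n in front of (L + k)^n,
   which [growth_le] removes. *)
have Yn n : N (spow Y n) <= (1 + n%:R * (T / (L + k))) * (L + k) ^+ n.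
  elim: n => [|n IH]; first by rewrite mul0r addr0 expr0 mulr1 cn1.
  have -> : spow Y n.+1 = L%:c *: spow Y n + t ** spow X n ** star t.
    rewrite spowSr {2}/Y !expand_smul !expand_one YX//.
  rewrite (le_trans (cnD _ _ _))// cn_real gtr0_norm//.
  have h : N (t ** spow X n ** star t) <= T * (L + k) ^+ n.
    rewrite (le_trans (cnM _ _ _))// cn_star /T expr2 mulrAC ler_wpM2r ?cn_ge0//.
    rewrite (le_trans (cnM _ _ _))// ler_wpM2l ?cn_ge0//.
    by rewrite (le_trans (cn_spow _ _))// lerXn2r// ?nnegrE ?cn_ge0// ltW.
  have p0 : 0 <= (L + k) ^+ n by rewrite exprn_ge0// ltW.
  have c0 : 0 <= 1 + n%:R * (T / (L + k)).
    by rewrite addr_ge0// mulr_ge0// divr_ge0// ltW.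
  rewrite (le_trans (lerD (ler_wpM2l (ltW L0) IH) h))//.
  have -> : (1 + n.+1%:R * (T / (L + k))) * (L + k) ^+ n.+1 =
    (L + k) * ((1 + n%:R * (T / (L + k))) * (L + k) ^+ n) + T * (L + k) ^+ n.
    by rewrite exprS -natr1; field; rewrite gt_eqF.
  by rewrite lerD2r ler_wpM2r ?mulr_ge0// lerDl.
split; first by rewrite !expand_star star1.
exists (L + k); first exact: ltW.
have -> : sc (L + k) - (sc k - t ** star t) = Y by rewrite /Y; lmod M; ring.
apply: (@growth_le _ _ _ (1 + T / (L + k))) => //; first exact: cn_ge0.
move=> j; rewrite -cn_spow2// (le_trans (Yn _))// ler_wpM2r//.
  by rewrite exprn_ge0// ltW.
have : 0 <= T / (L + k) by rewrite divr_ge0// ltW.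
have : 0 <= (2 ^ j)%:R :> R by [].
by move: (_ / _) ((2 ^ j)%:R) => u v v0 u0; nra.
Qed.

(* Kelley and Vaught: v approximates twice the negative part of star z ** z, and
   t = z ** v has star t ** t small above and star t ** t + t ** star t positive. *)
Lemma pos_star_smul z : pos (star z ** z).
Proof.
have [x xE] : exists x, x = star z ** z by exists (star z ** z).
have xs : star x = x by rewrite xE !expand_star.
rewrite -xE.
apply: pos_closed => r r0; pose e := r / 2; have e0 : 0 < e by rewrite divr_gt0.
(* [m] approximates the modulus of [x]: its square is x^2 + e^2. *)
have [m [ms mm pm mc]] := pos_root (pos_sq xs) (mulr_gt0 e0 e0).
have xm : m ** x = x ** m by apply: mc; rewrite smulA.
have [v vE] : exists v, v = m - x by exists (m - x).
have vs : star v = v by rewrite vE starB ms xs.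
have mv : m ** v = v ** m by rewrite vE smulBl smulBr xm.
have [t tE] : exists t, t = z ** v by exists (z ** v).
have tt : star t ** t = v ** x ** v by rewrite tE starM vs xE !smulA.
have vxv : v ** x ** v = (e * e)%:c *: v - v ** m ** v.
  have vx : v ** x = sc (e * e) - v ** m.
    apply: (addIr (v ** m)); rewrite subrK -smulDr.
    rewrite (_ : v ** _ = m ** m - x ** x).
      by rewrite mm; lmod M; ring.
    by rewrite vE !expand_smul xm; lmod M; ring.
  by rewrite vx !expand_smul !expand_one.
pose kp := e * e * N v; have kp0 : 0 <= kp by rewrite !mulr_ge0 ?cn_ge0// ltW.
have p1 : pos (sc kp - star t ** t).
  have -> : sc kp - star t ** t = (e * e)%:c *: (sc (N v) - v) + v ** m ** v.
    by rewrite tt vxv /kp; lmod M; ring.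
  apply: posD; last exact: pos_mul.
  by apply: posZ; [rewrite mulr_ge0// ltW|exact: pos_norm_sub].
have p2 : pos (star t ** t + t ** star t).
  have [u uE] : exists u, u = t - star t by exists (t - star t).
  have us : star u = - u by rewrite uE !expand_star; lmod M; ring.
  have ii : 'i%C * 'i%C = -1 :> R[i] by rewrite -expr2 sqr_i.
  have -> : star t ** t + t ** star t = (2^-1)%:c *:
      ((t + star t) ** (t + star t) + ('i%C *: u) ** ('i%C *: u)).
    rewrite (smulZl 'i%C u) (smulZr 'i%C u) scalerA ii scaleN1r uE !expand_smul.
    by lmod M; by field.
  apply: posZ; first by rewrite invr_ge0.
  apply: posD; apply: pos_sq; first by rewrite starD starK addrC.
  by rewrite starZ conjC_i us scalerN scaleNr opprK.
have p3 : pos (sc kp + star t ** t).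
  have -> : sc kp + star t ** t = (star t ** t + t ** star t) + (sc kp - t ** star t).
    by lmod M; ring.
  by apply: posD => //; exact: pos_sub_swap.
have tk := pos_norm_le kp0 p1 p3.
have v3 : N (v ** v ** v) <= 3 * kp.
  have -> : v ** v ** v = (e * e)%:c *: v - 2%:c *: (v ** x ** v).
    have -> : v ** v ** v = v ** m ** v - v ** x ** v by rewrite {2}vE smulBr smulBl.
    by rewrite vxv; lmod M; ring.
  have ee : 0 <= e * e by rewrite mulr_ge0// ltW.
  rewrite (le_trans (cnBD _ _ _))// !cn_real !ger0_norm// -tt.
  by rewrite /kp in tk *; lra.
(* The fourth power of the norm of [v] is the norm of v^4, at most 3 kp times the norm of [v], that
   is, 3 e^2 times its square. *)
have v2e : N v <= 2 * e.
  have [->|v0] := eqVneq (N v) 0; first by rewrite mulr_ge0// ltW.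
  have vp : 0 < N v by rewrite lt_neqAle eq_sym v0 cn_ge0.
  have v4 : N v ^+ 4 = N (v ** v ** v ** v).
    have := cn_spow2 2 vs; rewrite -[(2 ^ 2)%N]/4%N !spowS [spow v 0]/(uone N).
    by rewrite smulx1 !smulA.
  have : N v ^+ 4 <= 3 * kp * N v.
    by rewrite v4 (le_trans (cnM _ _ _))// ler_wpM2r// cn_ge0.
  rewrite /kp (_ : _ ^+ 4 = N v ^+ 2 * N v * N v); last by ring.
  rewrite !mulrA !ler_pM2r// => h.
  by rewrite -(ler_pXn2r (n := 2)) ?nnegrE ?mulr_ge0 1?ltW//; nra.
have -> : x + sc r = m + (- v + sc r) by rewrite vE; lmod M; ring.
apply: posD => //; apply: pos_norm_add; rewrite ?starN ?vs// cnN (le_trans v2e)// /e.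
by lra.
Qed.

Lemma pos_conj s x : pos s -> pos (star x ** s ** x).
Proof.
move=> ps; apply: pos_limit => [|r r0].
  by rewrite !expand_star (pos_sa ps) smulA.
have d0 : 0 < r / (N (star x ** x) + 1) by rewrite divr_gt0// ltr_wpDl// cn_ge0.
have [k [sk kk _ _]] := pos_root ps d0.
exists (star (k ** x) ** (k ** x)); first exact: pos_star_smul.
have -> : star x ** s ** x - star (k ** x) ** (k ** x) =
    - (r / (N (star x ** x) + 1))%:c *: (star x ** x).
  have -> : star (k ** x) ** (k ** x) = star x ** (k ** k) ** x.
    by rewrite starM sk !smulA.
  rewrite kk !expand_smul !expand_one.
  by move: (_%:c) => u; lmod M; ring.
rewrite scaleNr cnN cn_real gtr0_norm// mulrAC ler_pdivrMr ?ltr_wpDl ?cn_ge0//.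
by rewrite ler_pM2l// lerDl.
Qed.

(** S / L is the square of c = 1 - y, and the inverse w of c is the fixed point of w |-> 1 + y w,
    the sum of the Neumann series. Then k = w / sqrt L. *)
Lemma pos_inv_sqrt S d : 0 < d -> pos (S - sc d) ->
  exists k, [/\ star k = k, k ** S ** k = 1e & k ** k ** S = 1e].
Proof.
move=> d0 pS; have Ss : star S = S.
  by have /pos_sa := pS; rewrite starB starZr star1 => /addIr.
pose L := N S + d; have L0 : 0 < L by rewrite ltr_wpDl// cn_ge0.
pose x := 1e - (L^-1)%:c *: S; pose q := 1 - d / L.
have xs : star x = x by rewrite starB star1 starZr Ss.
have q1 : q < 1 by rewrite /q ltrBlDr ltrDl divr_gt0.
have q0 : 0 <= q by rewrite subr_ge0 ler_pdivrMr// mul1r /L lerDr cn_ge0.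
have xq : N x <= q.
  have Li : 0 <= L^-1 by rewrite invr_ge0 ltW.
  apply: pos_norm_le => //.
    have -> : sc q - x = (L^-1)%:c *: (S - sc d) by rewrite /q /x; lmod M; ring.
    exact: posZ.
  have -> : sc q + x = sc q + (L^-1)%:c *: (sc L - S).
    rewrite /x; lmod M; last by ring.
    have LL : (L^-1)%:c * L%:c = 1 :> R[i] by rewrite -rmorphM/= mulVf ?gt_eqF.
  by rewrite !subr0 !mulr1 LL; ring.
  apply: posD; first exact: pos_scalar.
  by apply: posZ => //; apply: pos_norm_sub => //; rewrite /L lerDl ltW.
have [y [y2 ys yq _]] := cn_sqrt q1 xq xs.
have [c cE] : exists c, c = 1e - y by exists (1e - y).
have cc : c ** c = (L^-1)%:c *: S.
  have -> : c ** c = 1e - 2%:c *: y + y ** y.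
    by rewrite cE !expand_smul !expand_one; lmod M; ring.
  by rewrite y2 /x; lmod M; ring.
have q1' : 0 < 1 - q by rewrite subr_gt0.
pose P := [set w | N (w - 0) <= (1 - q)^-1] `&` ([set w | star w = w] `&`
  [set w | w ** y = y ** w]).
have [||||w [/= wq [ws wy]] wE] :=
    @cn_fixpoint R M N (fun w => 1e + y ** w) P q 0 q0 q1 _ _.
- apply: cn_closedI; first exact: cn_closed_le.
  by apply: cn_closedI; [exact: cn_closed_sa|exact: cn_closed_comm].
- by rewrite /P/= subr0 cn0 star0 smul0x smulx0 invr_ge0 ltW.
- move=> w [/= wq [ws wy]]; rewrite subr0 in wq; split; [|split] => /=.
  + rewrite subr0 (le_trans (cnD _ _ _))//.
    have -> : (1 - q)^-1 = 1 + q * (1 - q)^-1 by field; rewrite gt_eqF.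
    by rewrite lerD ?cn1// (le_trans (cnM _ _ _))// ler_pM ?cn_ge0.
  + by rewrite starD star1 starM ws ys wy.
  + by rewrite smulDl smulDr smul1x smulx1 -smulA wy.
- move=> w w' _ _.
  have -> : 1e + y ** w - (1e + y ** w') = y ** (w - w') by rewrite smulBr; lmod M; ring.
  by rewrite (le_trans (cnM _ _ _))// ler_wpM2r// cn_ge0.
have cw : c ** w = 1e by rewrite cE smulBl smul1x -{1}wE addrK.
have wc : w ** c = 1e by rewrite -cw cE smulBr smulBl wy smul1x smulx1.
have SE : S = L%:c *: (c ** c) by rewrite cc scalerA -rmorphM/= divff ?gt_eqF// scale1r.
pose g := (Num.sqrt L)^-1; have gg : (g%:c * L%:c * g%:c : R[i]) = 1.
  rewrite -!rmorphM/= mulrAC -invrM ?unitfE ?sqrtr_eq0 -?ltNge//.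
  by rewrite -expr2 sqr_sqrtr ?mulVf ?gt_eqF// ltW.
exists (g%:c *: w); split; first by rewrite starZr ws.
- have wccw : w ** (c ** c) ** w = 1e by rewrite smulA wc smul1x cw.
  rewrite SE !(smulZl, smulZr) wccw !scalerA (_ : _ * _ = 1) ?scale1r//.
  by rewrite -gg; ring.
- have wwcc : w ** w ** (c ** c) = 1e by rewrite -smulA (smulA w c) wc smul1x wc.
  rewrite SE !(smulZl, smulZr) wwcc !scalerA (_ : _ * _ = 1) ?scale1r//.
  by rewrite -gg; ring.
Qed.

(* sum_(k < m) b^2 c^(2k) = 1 - c^(2m) is a sum of decreasing terms. *)
Lemma cn_mul_spow_sqrt b c m : star b = b -> star c = c -> c ** b = b ** c ->
  c ** c = 1e - b ** b -> N c <= 1 -> m%:R * N (b ** spow c m) ^+ 2 <= 1.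
Proof.
move=> bs cs cb cc c1.
have cpn n : N (spow c n) <= 1.
  by rewrite (le_trans (cn_spow _ _))// exprn_ile1// cn_ge0.
have bcn n : b ** spow c n = spow c n ** b by rewrite spow_comm.
pose f n := star (b ** spow c n) ** (b ** spow c n).
have fE n : f n = spow c (n + n) - spow c (n.+1 + n.+1).
  rewrite /f starM (star_spow _ cs) bs -smulA (smulA b) [b ** b]
    (_ : _ = 1e - c ** c); last by rewrite cc; lmod M; ring.
  rewrite !expand_smul !expand_one spowD addnS addSn !spowS.
  have -> : spow c n ** c ** c ** spow c n = spow c (n.+2 + n) by rewrite spowD !spowSr.
  by rewrite !addSn !spowS.
have fmono n : pos (f n - f n.+1).
  have -> : f n - f n.+1 = star (b ** spow c n) ** (b ** b) ** (b ** spow c n).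
    have -> : b ** b = 1e - c ** c by rewrite cc; lmod M; ring.
    rewrite /f spowS !starM (star_spow n cs) cs bs; set X := spow c n.
    have e1 : X ** c ** b = X ** b ** c by rewrite -smulA cb smulA.
    have e2 : b ** (c ** X) = c ** (b ** X) by rewrite !smulA cb.
    by rewrite e1 e2 !smulBr !smulBl smulx1 !smulA.
  by apply: pos_conj; exact: pos_sq.
have fm n : pos (f n - f m) \/ (m < n)%N.
  have [nm|] := leqP n m; last by right.
  left; rewrite -(subnKC nm); elim: (m - n)%N => [|j IH].
    by rewrite addn0 subrr -(scale0r 1e) -(rmorph0 (real_complex R)); exact: pos_scalar.
  rewrite addnS -(subrKA (f (n + j)%N)); exact: posD.
have sumf j : (j <= m)%N -> pos (1e - spow c (j + j) - j%:R%:c *: f m).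
  elim: j => [|j IH] jm.
    rewrite subrr sub0r rmorph0 scale0r oppr0 -(scale0r 1e) -(rmorph0 (real_complex R)).
    exact: pos_scalar.
  have -> : 1e - spow c (j.+1 + j.+1) - j.+1%:R%:c *: f m =
     (1e - spow c (j + j) - j%:R%:c *: f m) + (f j - f m).
    by rewrite (fE j) -natr1 (rmorphD (real_complex R)); lmod M; ring.
  apply: posD; first by apply: IH; exact: ltnW.
  by have [//|] := fm j; rewrite ltnNge ltnW.
have pm : pos (sc 1 - m%:R%:c *: f m).
  have -> : sc 1 - m%:R%:c *: f m =
     1e - spow c (m + m) - m%:R%:c *: f m + spow c (m + m) by lmod M; ring.
  apply: posD; first exact: sumf.
  by rewrite spowD -{1}(star_spow m cs); exact: pos_star_smul.
have := @pos_norm_mono (m%:R%:c *: f m) (sc 1) (posZ _ (pos_star_smul _)) pm.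
rewrite cn_real ger0_norm// /f cn_cstar => h.
by rewrite (le_trans (h _))// (le_trans (cn_sc _))// normr1.
Qed.

End unital.

(** * Multipliers *)

Lemma ler_of_sqr {R : realType} (a b : R) : 0 <= b -> a ^+ 2 <= b ^+ 2 -> a <= b.
Proof.
move=> b0 ab; rewrite leNgt; apply/negP => ba.
have : b * b < a * a by apply: ltr_pM.
by move: ab; rewrite !expr2; lra.
Qed.

Section limits.
Context {R : realType} {E : starAlgType R} (N : cnorm E).
Implicit Types (u v : nat -> E) (x y l : E).

Definition tends u l :=
  forall e, 0 < e -> exists n, forall m, (n <= m)%N -> N (u m - l) <= e.

Lemma tends_cst l : tends (fun=> l) l.
Proof. by move=> e e0; exists 0%N => m _; rewrite subrr cn0 ltW. Qed.

Lemma tendsD u v x y : tends u x -> tends v y -> tends (fun n => u n + v n) (x + y).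
Proof.
move=> ux vy e e0; have e2 : 0 < e / 2 by rewrite divr_gt0.
have [n hn] := ux _ e2; have [k hk] := vy _ e2; exists (maxn n k) => m.
rewrite geq_max => /andP[/hn h1 /hk h2].
have -> : u m + v m - (x + y) = (u m - x) + (v m - y) by lmod E; ring.
by rewrite (le_trans (cnD _ _ _))//; lra.
Qed.

Lemma tends_lip (f : E -> E) C u x : 0 <= C ->
  (forall a b, N (f a - f b) <= C * N (a - b)) -> tends u x -> tends (f \o u) (f x).
Proof.
move=> C0 fC ux e e0; have d0 : 0 < e / (C + 1) by rewrite divr_gt0// ltr_wpDl.
have [n hn] := ux _ d0; exists n => m /hn h; rewrite (le_trans (fC _ _))//.
rewrite (le_trans (ler_wpM2l C0 h))// mulrCA ger_pMr//.
by rewrite ler_pdivrMr ?mul1r ?lerDl// ltr_wpDl.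
Qed.

Lemma tendsZ c u x : tends u x -> tends (fun n => c *: u n) (c *: x).
Proof.
apply: (@tends_lip (fun x => c *: x) (cabs c)); first exact: cabs_ge0.
by move=> a b; rewrite -scalerBr cnZ.
Qed.

Lemma tends_star u x : tends u x -> tends (fun n => star (u n)) (star x).
Proof.
apply: (@tends_lip star 1) => // a b.
by rewrite -starB cn_star mul1r.
Qed.

Lemma tends_smull a u x : tends u x -> tends (fun n => a ** u n) (a ** x).
Proof.
apply: (@tends_lip (fun x => a ** x) (N a)); first exact: cn_ge0.
by move=> b c; rewrite -smulBr cnM.
Qed.

Lemma tends_smulr a u x : tends u x -> tends (fun n => u n ** a) (x ** a).
Proof.
apply: (@tends_lip (fun x => x ** a) (N a)); first exact: cn_ge0.
by move=> b c; rewrite -smulBl mulrC cnM.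
Qed.

Lemma tendsM u v x y : tends u x -> tends v y -> tends (fun n => u n ** v n) (x ** y).
Proof.
move=> ux vy e e0.
have a0 : 0 < e / (2 * (N y + 1)) by rewrite divr_gt0 ?mulr_gt0// ltr_wpDl ?cn_ge0.
have b0 : 0 < e / (2 * (N x + 1)) by rewrite divr_gt0 ?mulr_gt0// ltr_wpDl ?cn_ge0.
have [n1 h1] := ux _ a0; have [n2 h2] := vy _ b0; have [n3 h3] := vy _ ltr01.
exists (maxn n1 (maxn n2 n3)) => m; rewrite !geq_max => /and3P[/h1 {}h1 /h2 {}h2 /h3 {}h3].
have -> : u m ** v m - x ** y = (u m - x) ** v m + x ** (v m - y).
  by rewrite smulBl smulBr; lmod E; ring.
rewrite (le_trans (cnD _ _ _))// (splitr e) lerD// (le_trans (cnM _ _ _))//.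
  have vb : N (v m) <= N y + 1.
    by have := cnD N (v m - y) y; rewrite subrK; lra.
  rewrite (le_trans (ler_pM (cn_ge0 _ _) (cn_ge0 _ _) h1 vb))// le_eqVlt.
  by apply/orP; left; apply/eqP; field; rewrite gt_eqF// ltr_wpDl ?cn_ge0.
rewrite (le_trans (ler_wpM2l (cn_ge0 _ _) h2))//.
have -> : e / 2 = (N x + 1) * (e / (2 * (N x + 1))).
  by field; rewrite gt_eqF// ltr_wpDl ?cn_ge0.
by rewrite ler_wpM2r ?lerDl// ltW.
Qed.

Lemma tends_uniq u x y : tends u x -> tends u y -> x = y.
Proof.
move=> ux uy; apply/eqP; rewrite -subr_eq0; apply/eqP/(@cn_eqP _ _ N) => e e0.
have e2 : 0 < e / 2 by rewrite divr_gt0.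
have [n hn] := ux _ e2; have [k hk] := uy _ e2.
have := hn (maxn n k) (leq_maxl _ _); have := hk (maxn n k) (leq_maxr _ _).
have := cn_tri N (u (maxn n k)) x y; rewrite (cnB N x (u _)); lra.
Qed.

Lemma tends_le u x r : tends u x -> (forall n, N (u n) <= r) -> N x <= r.
Proof.
move=> ux ur; apply/ler_addgt0Pl => e /ux[n hn].
have := hn n (leqnn _); have := ur n; have := cn_tri N (u n) x 0.
by rewrite !subr0 (cnB N x); lra.
Qed.

Lemma tends_ext u v x : (forall n, u n = v n) -> tends u x -> tends v x.
Proof. by move=> uv ux e /ux[n hn]; exists n => m /hn; rewrite uv. Qed.

Definition cauchy_cn u :=
  forall e, 0 < e -> exists n, forall m, (n <= m)%N -> N (u m - u n) <= e.

Lemma cauchy_tends u : cauchy_cn u -> exists l, tends u l.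
Proof. exact: cn_complete. Qed.

End limits.

Section cstar_cnorm.
Context {R : realType} {E : cstarAlgType R}.
Implicit Types x y : E.

Fact rnorm_smul_le x y : rnorm (x ** y) <= rnorm x * rnorm y.
Proof. by rewrite -lecR rmorphM/= -!rnormE norm_smul_le. Qed.

Fact rnorm_cstar x : rnorm (star x ** x) = rnorm x ^+ 2.
Proof. by apply/(@complexI R); rewrite rmorphXn/= -!rnormE norm_star_smul. Qed.

Lemma pos_complex (e : R[i]) : 0 < e -> e = (complex.Re e)%:c /\ 0 < complex.Re e.
Proof.
move=> e0; have ee := Re_ge0 (ltW e0); split => //.
by rewrite -ltcR -ee.
Qed.

Fact rnorm_complete (V : completeNormedModType R[i]) (u : nat -> V) :
  (forall e, 0 < e -> exists n, forall m, (n <= m)%N -> rnorm (u m - u n) <= e) ->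
  exists l, forall e, 0 < e -> exists n, forall m, (n <= m)%N -> rnorm (u m - l) <= e.
Proof.
move=> cu; have : cvg (u n @[n --> \oo]).
  apply: cauchy_cvg; apply: cauchy_exP => e /pos_complex[-> e0].
  have e2 : 0 < complex.Re e / 2 by rewrite divr_gt0.
  have [n hn] := cu _ e2; exists (u n); exists n => // m /hn h.
  rewrite /= -ball_normE/= distrC lt_rnorm; lra.
set l := lim _ => ul; exists l => e e0.
have /cvgrPdist_le/(_ e%:c) := ul; rewrite ltcR => /(_ e0)[n _ hn].
by exists n => m /hn; rewrite /= distrC le_rnorm.
Qed.

Definition cstar_cnorm : cnorm E :=
  @CNorm R E rnorm rnormD rnormZ rnorm0_eq0 rnorm_smul_le rnorm_cstar
    (@rnorm_complete E).

Lemma rnorm_star x : rnorm (star x) = rnorm x.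
Proof. exact: (cn_star cstar_cnorm). Qed.

Lemma star_smul_inj x y : (forall z, star z ** x = star z ** y) -> x = y.
Proof.
move=> h; apply/eqP; rewrite -subr_eq0; apply/eqP/rnorm0_eq0/eqP.
by rewrite -sqrf_eq0 -rnorm_cstar smulBr h subrr rnorm0.
Qed.

End cstar_cnorm.

(* Adjointable operators on E regarded as a Hilbert module over itself; they form
   the multiplier algebra of E. *)
Record adj {R : realType} (E : cstarAlgType R) := Adj {
  adj_fun :> E -> E;
  adj_adj : E -> E;
  adjP : forall x y, star (adj_fun x) ** y = star x ** adj_adj y;
  adj_bounded : exists C, forall x, rnorm (adj_fun x) <= C * rnorm x
}.

Section adjointable.
Context {R : realType} {E : cstarAlgType R}.
Implicit Types (S T U : adj E) (x y z : E).

Lemma adjP' T x y : star (adj_adj T x) ** y = star x ** T y.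
Proof. by apply: (can_inj starK); rewrite !starM !starK adjP. Qed.

Lemma adj_ext S T : (forall x, S x = T x) -> S = T.
Proof.
case: S => f f' fP fb; case: T => g g' gP gb /= fg.
have {}fg : f = g by apply/funext.
case: g / fg gP gb => gP gb.
have fg' : f' = g'.
  by apply/funext => y; apply: star_smul_inj => z; rewrite -fP -gP.
by case: g' / fg' gP => gP; congr Adj; exact: Prop_irrelevance.
Qed.

Lemma adj_linear T c x y : T (c *: x + y) = c *: T x + T y.
Proof.
apply: star_smul_inj => z; rewrite -adjP' smulDr smulZr !adjP'.
by rewrite smulDr smulZr.
Qed.

Lemma adjD T x y : T (x + y) = T x + T y.
Proof. by have := adj_linear T 1 x y; rewrite !scale1r. Qed.

Lemma adj0 T : T 0 = 0.
Proof. by apply: (addIr (T 0)); rewrite -adjD !add0r. Qed.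

Lemma adjZ T c x : T (c *: x) = c *: T x.
Proof. by have := adj_linear T c x 0; rewrite adj0 !addr0. Qed.

Lemma adjN T x : T (- x) = - T x.
Proof. by rewrite -scaleN1r adjZ scaleN1r. Qed.

Lemma adjB T x y : T (x - y) = T x - T y.
Proof. by rewrite adjD adjN. Qed.

Lemma adj_smul T x y : T (x ** y) = T x ** y.
Proof. by apply: star_smul_inj => z; rewrite -adjP' !smulA adjP'. Qed.

(** The square of the norm of f'(x) is the norm of f(f'(x))^* x, so an adjoint inherits the bound of
    its operator. *)
Lemma adj_bound_of (f f' : E -> E) C : 0 <= C ->
  (forall x y, star (f x) ** y = star x ** f' y) ->
  (forall x, rnorm (f x) <= C * rnorm x) -> forall x, rnorm (f' x) <= C * rnorm x.
Proof.
move=> C0 fP fC x; have [->|y0] := eqVneq (rnorm (f' x)) 0.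
  by rewrite mulr_ge0// rnorm_ge0.
have y1 : 0 < rnorm (f' x) by rewrite lt_neqAle eq_sym y0 rnorm_ge0.
rewrite -(ler_pM2r y1) -expr2 -rnorm_cstar -fP (le_trans (rnorm_smul_le _ _))//.
by rewrite rnorm_star -mulrA [_ * rnorm (f' x)]mulrC mulrA ler_wpM2r// rnorm_ge0.
Qed.

Definition adj_norm T := inf [set C | 0 <= C /\ forall x, rnorm (T x) <= C * rnorm x].

Lemma adj_norm_set T : has_inf [set C | 0 <= C /\ forall x, rnorm (T x) <= C * rnorm x].
Proof.
split; last by exists 0 => C [].
have [C TC] := adj_bounded T; exists `|C|; split => // x.
by rewrite (le_trans (TC x))// ler_wpM2r ?rnorm_ge0// ler_norm.
Qed.

Lemma adj_norm_ge0 T : 0 <= adj_norm T.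
Proof. by apply: lb_le_inf => [|C []//]; have [] := adj_norm_set T. Qed.

Lemma le_adj_norm T x : rnorm (T x) <= adj_norm T * rnorm x.
Proof.
have [x0|x0] := eqVneq (rnorm x) 0.
  by have [C TC] := adj_bounded T; rewrite x0 mulr0; have := TC x; rewrite x0 mulr0.
have x1 : 0 < rnorm x by rewrite lt_neqAle eq_sym x0 rnorm_ge0.
rewrite -ler_pdivrMr//; apply: lb_le_inf => [|C [_ TC]]; first by have [] := adj_norm_set T.
by rewrite ler_pdivrMr.
Qed.

Lemma adj_norm_min T C : 0 <= C -> (forall x, rnorm (T x) <= C * rnorm x) ->
  adj_norm T <= C.
Proof. by move=> C0 TC; apply: ge_inf; [by have [] := adj_norm_set T|split]. Qed.

Fact zero_adj_subproof x y : star (0 : E) ** y = star x ** 0.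
Proof. by rewrite star0 smul0x smulx0. Qed.
Fact zero_adj_bounded : exists C : R, forall x : E, rnorm (0 : E) <= C * rnorm x.
Proof. by exists 0 => x; rewrite rnorm0 mul0r. Qed.
Definition zero_adj := Adj zero_adj_subproof zero_adj_bounded.

Fact add_adj_subproof S T x y :
  star (S x + T x) ** y = star x ** (adj_adj S y + adj_adj T y).
Proof. by rewrite starD smulDl smulDr !adjP. Qed.
Fact add_adj_bounded S T : exists C, forall x, rnorm (S x + T x) <= C * rnorm x.
Proof.
exists (adj_norm S + adj_norm T) => x; rewrite (le_trans (rnormD _ _))// mulrDl.
by rewrite lerD// le_adj_norm.
Qed.
Definition add_adj S T := Adj (add_adj_subproof S T) (add_adj_bounded S T).

Fact scale_adj_subproof c T x y :
  star (c *: T x) ** y = star x ** (conjC c *: adj_adj T y).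
Proof. by rewrite starZ smulZl smulZr !adjP. Qed.
Fact scale_adj_bounded (c : R[i]) T : exists C, forall x, rnorm (c *: T x) <= C * rnorm x.
Proof.
exists (cabs c * adj_norm T) => x; rewrite rnormZ -mulrA ler_wpM2l ?cabs_ge0//.
exact: le_adj_norm.
Qed.
Definition scale_adj c T := Adj (scale_adj_subproof c T) (scale_adj_bounded c T).
Definition opp_adj T := scale_adj (-1) T.

Fact mul_adj_subproof S T x y :
  star (S (T x)) ** y = star x ** (adj_adj T (adj_adj S y)).
Proof. by rewrite !adjP. Qed.
Fact mul_adj_bounded S T : exists C, forall x, rnorm (S (T x)) <= C * rnorm x.
Proof.
exists (adj_norm S * adj_norm T) => x; rewrite (le_trans (le_adj_norm _ _))//.
by rewrite -mulrA ler_wpM2l ?adj_norm_ge0// le_adj_norm.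
Qed.
Definition mul_adj S T := Adj (mul_adj_subproof S T) (mul_adj_bounded S T).

Fact star_adj_bounded T : exists C, forall x, rnorm (adj_adj T x) <= C * rnorm x.
Proof.
exists (adj_norm T); apply: (@adj_bound_of T); first exact: adj_norm_ge0.
  exact: adjP.
exact: le_adj_norm.
Qed.
Definition star_adj T := Adj (adjP' T) (star_adj_bounded T).

Definition one_adj : adj E.
Proof.
exists id id => //; exists 1 => x; by rewrite mul1r.
Defined.

HB.instance Definition _ := gen_eqMixin (adj E).
HB.instance Definition _ := gen_choiceMixin (adj E).

Fact add_adjA : associative add_adj.
Proof. by move=> S T U; apply: adj_ext => x /=; rewrite addrA. Qed.
Fact add_adjC : commutative add_adj.
Proof. by move=> S T; apply: adj_ext => x /=; rewrite addrC. Qed.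
Fact add_adj0 : left_id zero_adj add_adj.
Proof. by move=> S; apply: adj_ext => x /=; rewrite add0r. Qed.
Fact add_adjN : left_inverse zero_adj opp_adj add_adj.
Proof. by move=> S; apply: adj_ext => x /=; rewrite scaleN1r addNr. Qed.

HB.instance Definition _ := GRing.isZmodule.Build (adj E)
  add_adjA add_adjC add_adj0 add_adjN.

Fact scale_adjA (a b : R[i]) T : scale_adj a (scale_adj b T) = scale_adj (a * b) T.
Proof. by apply: adj_ext => x /=; rewrite scalerA. Qed.
Fact scale_adj1 : left_id 1 scale_adj.
Proof. by move=> T; apply: adj_ext => x /=; rewrite scale1r. Qed.
Fact scale_adjDr : right_distributive scale_adj +%R.
Proof. by move=> a S T; apply: adj_ext => x /=; rewrite scalerDr. Qed.
Fact scale_adjDl T : {morph scale_adj^~ T : a b / a + b}.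
Proof. by move=> a b; apply: adj_ext => x /=; rewrite scalerDl. Qed.

HB.instance Definition _ := GRing.Zmodule_isLmodule.Build R[i] (adj E)
  scale_adjA scale_adj1 scale_adjDr scale_adjDl.

Fact mul_adjA : associative mul_adj.
Proof. by move=> S T U; apply: adj_ext. Qed.
Fact mul_adjDl : left_distributive mul_adj +%R.
Proof. by move=> S T U; apply: adj_ext. Qed.
Fact mul_adjDr : right_distributive mul_adj +%R.
Proof. by move=> S T U; apply: adj_ext => x /=; rewrite adjD. Qed.
Fact mul_adjZl (c : R[i]) S T : mul_adj (c *: S) T = c *: mul_adj S T.
Proof. by apply: adj_ext. Qed.
Fact mul_adjZr (c : R[i]) S T : mul_adj S (c *: T) = c *: mul_adj S T.
Proof. by apply: adj_ext => x /=; rewrite adjZ. Qed.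
Fact star_adjK : involutive star_adj.
Proof. by move=> S; apply: adj_ext. Qed.
Fact star_adjD : {morph star_adj : S T / S + T}.
Proof. by move=> S T; apply: adj_ext. Qed.
Fact star_adjZ (c : R[i]) T : star_adj (c *: T) = conjC c *: star_adj T.
Proof. by apply: adj_ext. Qed.
Fact star_adjM S T : star_adj (mul_adj S T) = mul_adj (star_adj T) (star_adj S).
Proof. by apply: adj_ext. Qed.

HB.instance Definition _ := @Lmodule_isStarAlgebra.Build R (adj E)
  _ _ mul_adjA mul_adjDl mul_adjDr mul_adjZl mul_adjZr
  star_adjK star_adjD star_adjZ star_adjM.

Lemma addE_adj S T x : (S + T) x = S x + T x. Proof. by []. Qed.
Lemma scaleE_adj c T x : (c *: T) x = c *: T x. Proof. by []. Qed.
Lemma oppE_adj T x : (- T) x = - T x.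
Proof. by rewrite -scaleN1r scaleE_adj scaleN1r. Qed.
Lemma subE_adj S T x : (S - T) x = S x - T x.
Proof. by rewrite addE_adj oppE_adj. Qed.
Lemma mulE_adj S T x : (S ** T) x = S (T x). Proof. by []. Qed.
Lemma star_adjP T x y : star (T x) ** y = star x ** star T y. Proof. exact: adjP. Qed.
Lemma sumE_adj I (r : seq I) (P : pred I) (F : I -> adj E) x :
  (\sum_(i <- r | P i) F i) x = \sum_(i <- r | P i) F i x.
Proof. by elim/big_rec2: _ => // i y S _ <-. Qed.

Local Notation n_ := (@cstar_cnorm R E).

(* Pointwise limits of bounded sequences are adjointable once the adjoints converge
   pointwise as well. *)
Lemma strict_limit (u : nat -> adj E) K : 0 <= K -> (forall n, adj_norm (u n) <= K) ->
  (forall x, cauchy_cn n_ (fun n => u n x)) ->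
  (forall x, cauchy_cn n_ (fun n => star (u n) x)) ->
  exists T : adj E, [/\ adj_norm T <= K, forall x, tends n_ (fun n => u n x) (T x) &
    forall x, tends n_ (fun n => star (u n) x) (star T x)].
Proof.
move=> K0 uK cu cu'.
have [f uf] := choice (fun x => cauchy_tends (cu x)).
have [f' uf'] := choice (fun x => cauchy_tends (cu' x)).
have fP x y : star (f x) ** y = star x ** f' y.
  apply: (@tends_uniq _ _ n_ (fun n => star (u n x) ** y)).
    exact/tends_smulr/tends_star.
  apply: (@tends_ext _ _ _ (fun n => star x ** star (u n) y)).
    by move=> n; rewrite star_adjP.
  exact: tends_smull.
have fK x : rnorm (f x) <= K * rnorm x.
  apply: (tends_le (uf x)) => n; rewrite (le_trans (le_adj_norm _ _))//.
  by rewrite ler_wpM2r ?rnorm_ge0.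
exists (Adj fP (ex_intro _ K fK)); split => //.
exact: adj_norm_min.
Qed.

Fact adj_normD S T : adj_norm (S + T) <= adj_norm S + adj_norm T.
Proof.
apply: adj_norm_min => [|x]; first by rewrite addr_ge0// adj_norm_ge0.
by rewrite mulrDl (le_trans (rnormD _ _))// lerD// le_adj_norm.
Qed.

Fact adj_normZ c T : adj_norm (c *: T) = cabs c * adj_norm T.
Proof.
have le d S : adj_norm (d *: S) <= cabs d * adj_norm S.
  apply: adj_norm_min => [|x]; first by rewrite mulr_ge0 ?adj_norm_ge0 ?cabs_ge0.
  by rewrite rnormZ -mulrA ler_wpM2l ?cabs_ge0// le_adj_norm.
apply/eqP; rewrite eq_le le/=; have [->|c0] := eqVneq c 0.
  by rewrite cabs0 mul0r adj_norm_ge0.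
have := le c^-1 (c *: T); rewrite scalerA mulVf// scale1r => h.
have cc : cabs c * cabs c^-1 = 1 by rewrite -cabsM divff// cabs1.
by rewrite (le_trans (ler_wpM2l (cabs_ge0 _) h))// mulrA cc mul1r.
Qed.

Fact adj_norm_eq0 T : adj_norm T = 0 -> T = 0.
Proof.
move=> T0; apply: adj_ext => x; apply: rnorm0_eq0; apply/eqP.
by rewrite eq_le rnorm_ge0 andbT (le_trans (le_adj_norm _ _))// T0 mul0r.
Qed.

Fact adj_normM S T : adj_norm (S ** T) <= adj_norm S * adj_norm T.
Proof.
apply: adj_norm_min => [|x]; first by rewrite mulr_ge0// adj_norm_ge0.
rewrite mulE_adj (le_trans (le_adj_norm _ _))// -mulrA ler_wpM2l ?adj_norm_ge0//.
exact: le_adj_norm.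
Qed.

Fact adj_norm_star T : adj_norm (star T) <= adj_norm T.
Proof.
apply: adj_norm_min; first exact: adj_norm_ge0.
apply: (@adj_bound_of T); first exact: adj_norm_ge0.
  exact: adjP.
exact: le_adj_norm.
Qed.

Fact adj_norm_cstar T : adj_norm (star T ** T) = adj_norm T ^+ 2.
Proof.
apply/eqP; rewrite eq_le; apply/andP; split.
  rewrite (le_trans (adj_normM _ _))// expr2 ler_wpM2r ?adj_norm_ge0//.
  exact: adj_norm_star.
set K := adj_norm (star T ** T); have K0 : 0 <= K by exact: adj_norm_ge0.
have : adj_norm T <= Num.sqrt K.
  apply: adj_norm_min => [|x]; first exact: sqrtr_ge0.
  rewrite -(ler_pXn2r (n := 2)) ?nnegrE ?mulr_ge0 ?sqrtr_ge0 ?rnorm_ge0//.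
  rewrite exprMn sqr_sqrtr// -rnorm_cstar star_adjP -mulE_adj.
  rewrite (le_trans (rnorm_smul_le _ _))// rnorm_star mulrC expr2 mulrA.
  by rewrite ler_wpM2r ?rnorm_ge0// le_adj_norm.
rewrite -(ler_pXn2r (n := 2)) ?nnegrE ?sqrtr_ge0 ?adj_norm_ge0//.
by rewrite sqr_sqrtr.
Qed.

Lemma cauchy_apply (u : nat -> adj E) x :
  (forall e, 0 < e -> exists n, forall m, (n <= m)%N -> adj_norm (u m - u n) <= e) ->
  cauchy_cn n_ (fun n => u n x).
Proof.
move=> cu e e0; have d0 : 0 < e / (rnorm x + 1) by rewrite divr_gt0// ltr_wpDl// rnorm_ge0.
have [n hn] := cu _ d0; exists n => m /hn h /=.
rewrite -subE_adj (le_trans (le_adj_norm _ _))//.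
rewrite (le_trans (ler_wpM2r (rnorm_ge0 x) h))// mulrAC ler_pdivrMr ?ltr_wpDl ?rnorm_ge0//.
by rewrite ler_pM2l// lerDl.
Qed.

Fact adj_norm_complete (u : nat -> adj E) :
  (forall e, 0 < e -> exists n, forall m, (n <= m)%N -> adj_norm (u m - u n) <= e) ->
  exists l, forall e, 0 < e -> exists n, forall m, (n <= m)%N -> adj_norm (u m - l) <= e.
Proof.
move=> cu; have [n0 hn0] := cu 1 ltr01.
pose v n := u (n0 + n)%N; pose K := adj_norm (u n0) + 1.
have cv : forall e, 0 < e -> exists n, forall m, (n <= m)%N -> adj_norm (v m - v n) <= e.
  move=> e e0; have e2 : 0 < e / 2 by rewrite divr_gt0.
  have [n hn] := cu _ e2; exists n => m nm.
  have h1 := hn (n0 + m)%N (leq_trans nm (leq_addl _ _)).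
  have h2 := hn (n0 + n)%N (leq_addl _ _).
  have -> : v m - v n = (u (n0 + m)%N - u n) + (-1) *: (u (n0 + n)%N - u n).
    by rewrite /v; lmod (adj E); ring.
  by rewrite (le_trans (adj_normD _ _))// adj_normZ cabsN cabs1 mul1r; lra.
have K0 : 0 <= K by rewrite addr_ge0// adj_norm_ge0.
have vK n : adj_norm (v n) <= K.
  have -> : v n = u n0 + (v n - u n0) by lmod (adj E); ring.
  by rewrite (le_trans (adj_normD _ _))// lerD2l hn0// leq_addr.
have cv' : forall e, 0 < e -> exists n, forall m, (n <= m)%N ->
    adj_norm (star (v m) - star (v n)) <= e.
  move=> e /cv[n hn]; exists n => m /hn; apply: le_trans.
  by rewrite -starB adj_norm_star.
have [T [_ vT _]] := strict_limit K0 vK (fun x => cauchy_apply x cv)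
  (fun x => cauchy_apply x cv').
exists T => e e0; have e2 : 0 < e / 2 by rewrite divr_gt0.
have [n hn] := cu _ e2; exists n => m nm; apply: adj_norm_min => [|x]; first exact: ltW.
rewrite subE_adj; apply/ler_addgt0Pl => d d0; have [k hk] := vT x _ d0.
have h1 := hk (maxn k n) (leq_maxl _ _).
have h2 := hn (n0 + maxn k n)%N (leq_trans (leq_maxr _ _) (leq_addl _ _)).
have h3 := hn m nm.
have := rnormD (u m x - v (maxn k n) x) (v (maxn k n) x - T x); rewrite subrKA => h.
rewrite (le_trans h)// addrC lerD// -subE_adj (le_trans (le_adj_norm _ _))//.
rewrite ler_wpM2r ?rnorm_ge0//.
have -> : u m - v (maxn k n) = (u m - u n) + (-1) *: (u (n0 + maxn k n)%N - u n).
  by rewrite /v; lmod (adj E); ring.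
by rewrite (le_trans (adj_normD _ _))// adj_normZ cabsN cabs1 mul1r; lra.
Qed.

Definition adj_cnorm : cnorm (adj E) :=
  CNorm adj_normD adj_normZ adj_norm_eq0 adj_normM adj_norm_cstar adj_norm_complete.

Fact one_adjP : is_one one_adj.
Proof. by move=> T; split; exact: adj_ext. Qed.

Definition adj_ucnorm : ucnorm (adj E) := UCNorm adj_cnorm one_adjP.

Definition lmul (x : E) : adj E.
Proof.
exists (fun y => x ** y) (fun y => star x ** y).
  by move=> y z; rewrite starM smulA.
by exists (rnorm x) => y; exact: rnorm_smul_le.
Defined.

Lemma lmulE x y : lmul x y = x ** y. Proof. by []. Qed.
Lemma lmulD x y : lmul (x + y) = lmul x + lmul y.
Proof. by apply: adj_ext => z /=; rewrite smulDl. Qed.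
Lemma lmulZ c x : lmul (c *: x) = c *: lmul x.
Proof. by apply: adj_ext => z /=; rewrite smulZl. Qed.
Lemma lmulN x : lmul (- x) = - lmul x.
Proof. by rewrite -scaleN1r lmulZ scaleN1r. Qed.
Lemma lmulB x y : lmul (x - y) = lmul x - lmul y.
Proof. by rewrite lmulD lmulN. Qed.
Lemma lmulM x y : lmul (x ** y) = lmul x ** lmul y.
Proof. by apply: adj_ext => z /=; rewrite smulA. Qed.
Lemma lmulS x : lmul (star x) = star (lmul x).
Proof. exact: adj_ext. Qed.
Lemma adj_lmul T x : T ** lmul x = lmul (T x).
Proof. by apply: adj_ext => y; rewrite mulE_adj /= adj_smul. Qed.
Lemma lmul_adj T x : lmul x ** T = lmul (star (star T (star x))).
Proof. by rewrite -[LHS]starK starM -lmulS adj_lmul -lmulS. Qed.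

Lemma cn_lmul x : adj_norm (lmul x) = rnorm x.
Proof.
apply/eqP; rewrite eq_le; apply/andP; split.
  by apply: adj_norm_min => [|y]; [exact: rnorm_ge0|exact: rnorm_smul_le].
have [->|x0] := eqVneq (rnorm x) 0; first exact: adj_norm_ge0.
have x1 : 0 < rnorm x by rewrite lt_neqAle eq_sym x0 rnorm_ge0.
have := le_adj_norm (lmul x) (star x).
rewrite lmulE -{1}(starK x) rnorm_cstar rnorm_star expr2.
by rewrite ler_pM2r.
Qed.

Local Notation N := adj_ucnorm.

(* Polarization with y = t x / k. *)
Lemma adj_norm_quad t k : star t = t -> 0 <= k ->
  (forall x, pos N (k%:c *: (star (lmul x) ** lmul x) - star (lmul x) ** t ** lmul x)) ->
  (forall x, pos N (k%:c *: (star (lmul x) ** lmul x) + star (lmul x) ** t ** lmul x)) ->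
  adj_norm t <= k.
Proof.
move=> ts k0 p1 p2; apply/ler_addgt0Pl => r r0; rewrite addrC.
have kr : 0 < k + r by rewrite ltr_wpDl.
apply: adj_norm_min => [|x]; first exact: ltW.
have p1' y : pos N ((k + r)%:c *: (star (lmul y) ** lmul y) - star (lmul y) ** t ** lmul y).
  rewrite rmorphD scalerDl addrAC; apply: posD; first exact: p1.
  by apply: posZ; [exact: ltW|exact: pos_star_smul].
have p2' y : pos N ((k + r)%:c *: (star (lmul y) ** lmul y) + star (lmul y) ** t ** lmul y).
  rewrite rmorphD scalerDl addrAC; apply: posD; first exact: p2.
  by apply: posZ; [exact: ltW|exact: pos_star_smul].
(* The first bound at x + t x / q and the second at x - t x / q add up to 2 / q times q^2 x^* x - (t
   x)^* (t x). *)
move: (k + r) kr p1' p2' => q q0 {}p1 {}p2; have {}p1 := p1 (x + (q^-1)%:c *: t x).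
have {}p2 := p2 (x - (q^-1)%:c *: t x); have := posD p1 p2 => {p1 p2}.
set X := lmul x; have Yx : lmul (t x) = t ** X by rewrite adj_lmul.
have z0 : q%:c != 0 :> R[i] by rewrite fmorph_eq0 gt_eqF.
have -> : q%:c *: (star (lmul (x + (q^-1)%:c *: t x)) ** lmul (x + (q^-1)%:c *: t x)) -
   star (lmul (x + (q^-1)%:c *: t x)) ** t ** lmul (x + (q^-1)%:c *: t x) +
   (q%:c *: (star (lmul (x - (q^-1)%:c *: t x)) ** lmul (x - (q^-1)%:c *: t x)) +
   star (lmul (x - (q^-1)%:c *: t x)) ** t ** lmul (x - (q^-1)%:c *: t x)) =
   (2 / q)%:c *: ((q ^+ 2)%:c *: (star X ** X) - star (t ** X) ** (t ** X)).
  rewrite lmulB lmulD !lmulZ Yx -/X !expand_star !ts !expand_smul.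
  rewrite !rmorphM !fmorphV/= rmorph_nat; move: q%:c z0 => z z0.
  by lmod (adj E); by field.
move=> /(posZ (ltW (divr_gt0 q0 (ltr0n R 2)))).
have e1 : q / 2%:R * (2 / q) = 1 by field; rewrite gt_eqF.
rewrite scalerA -rmorphM/= e1 rmorph1 scale1r => /(pos_norm_mono (pos_star_smul _ _)).
rewrite cn_cstar cn_real ger0_norm ?sqr_ge0// cn_cstar -exprMn.
have q0' := ltW q0; rewrite ler_pXn2r ?nnegrE ?mulr_ge0 ?cn_ge0// => h.
by rewrite -cn_lmul -adj_lmul (le_trans h)//= cn_lmul.
Qed.

(** For k the norm of [t] and s = k - t, the hypothesis bounds the quadratic form of [s] from above
    by k, and [s] is positive; [adj_norm_quad] turns this into the norm bound in [pos]. *)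
Lemma pos_adj t : star t = t -> (forall x, pos N (star (lmul x) ** t ** lmul x)) -> pos N t.
Proof.
move=> ts p; split => //; exists (N t); first exact: cn_ge0.
set k := N t; set s := _ - t.
have pk := pos_norm_sub ts (lexx (N t)); rewrite -/k -/s in pk.
have sE x : star (lmul x) ** s ** lmul x =
    k%:c *: (star (lmul x) ** lmul x) - star (lmul x) ** t ** lmul x.
  by rewrite /s !expand_smul smulx1.
apply: adj_norm_quad; [exact: pos_sa pk|exact: cn_ge0|move=> x|move=> x].
  by rewrite sE opprB addrC subrK.
apply: posD; last exact: pos_conj.
by apply: posZ; [exact: cn_ge0|exact: pos_star_smul].
Qed.

End adjointable.

(** Dependent choice over finite histories. It produces the shifts, the isometries and the phases,
    each of which has to be compatible with all earlier ones. *)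
Lemma history_choice (T : Type) (P : seq T -> T -> Prop) :
  (forall s, exists x, P s x) -> exists f : nat -> T, forall n, P (mkseq f n) (f n).
Proof.
move=> /choice[F PF]; pose s n := iter n (fun s => rcons s (F s)) [::].
exists (fun n => F (s n)) => n; rewrite (_ : mkseq _ n = s n)//.
elim: n => // n IH; rewrite /= -IH /mkseq -addn1 iotaD add0n map_cat/= cats1.
by rewrite -/(mkseq _ n) IH.
Qed.

Section geometric.
Context {R : realType}.
Local Notation w := (2^-1 : R).

Lemma half_ge0 n : 0 <= w ^+ n. Proof. by rewrite exprn_ge0// invr_ge0. Qed.

Lemma half_le1 n : w ^+ n <= 1.
Proof. by rewrite exprn_ile1// ?invr_ge0// invf_le1// ler1n. Qed.

Lemma half_mono m n : (m <= n)%N -> w ^+ n <= w ^+ m.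
Proof.
by move=> mn; rewrite -(subnK mn) exprD ler_piMl// ?half_ge0// half_le1.
Qed.

Lemma half_small (e : R) : 0 < e -> exists n, forall m, (n <= m)%N -> w ^+ m <= e.
Proof. by apply: expr_small; rewrite ?invr_ge0// invf_lt1// ltr1n. Qed.

Lemma sum_half m n : \sum_(m <= k < n) w ^+ k <= 2 * w ^+ m.
Proof.
have [mn|/ltnW nm] := leqP m n; last by rewrite big_geq// mulr_ge0// half_ge0.
suff : \sum_(m <= k < n) w ^+ k <= 2 * w ^+ m - 2 * w ^+ n.
  by have := half_ge0 n; lra.
rewrite -(subnKC mn); elim: (n - m)%N => [|p IH].
  by rewrite addn0 big_geq// subrr.
rewrite addnS big_nat_recr/= ?leq_addr// (le_trans (lerD IH (lexx _)))//.
by rewrite exprS; have := half_ge0 (m + p); lra.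
Qed.

End geometric.

Lemma cn_sum {R : realType} {E : starAlgType R} (N : cnorm E) I (r : seq I)
    (P : pred I) (F : I -> E) :
  N (\sum_(i <- r | P i) F i) <= \sum_(i <- r | P i) N (F i).
Proof.
elim/big_rec2: _ => [|i y x _ h]; first by rewrite cn0.
by rewrite (le_trans (cnD _ _ _))// lerD2l.
Qed.

Lemma smul_sumr {R : realType} {E : starAlgType R} I (r : seq I) (P : pred I)
    (F : I -> E) a : a ** (\sum_(i <- r | P i) F i) = \sum_(i <- r | P i) a ** F i.
Proof. by elim/big_rec2: _ => [|i y x _ <-]; rewrite ?smulx0// smulDr. Qed.

Lemma smul_suml {R : realType} {E : starAlgType R} I (r : seq I) (P : pred I)
    (F : I -> E) a : (\sum_(i <- r | P i) F i) ** a = \sum_(i <- r | P i) F i ** a.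
Proof. by elim/big_rec2: _ => [|i y x _ <-]; rewrite ?smul0x// smulDl. Qed.

Lemma star_sum {R : realType} {E : starAlgType R} I (r : seq I) (P : pred I)
    (F : I -> E) : star (\sum_(i <- r | P i) F i) = \sum_(i <- r | P i) star (F i).
Proof. by elim/big_rec2: _ => [|i y x _ <-]; rewrite ?star0// starD. Qed.

Lemma tends0_le {R : realType} {E F : starAlgType R} (N : cnorm E) (N' : cnorm F)
    (u : nat -> E) (v : nat -> F) (C : R) :
  0 <= C -> (forall n, N (u n) <= C * N' (v n)) -> tends N' v 0 -> tends N u 0.
Proof.
move=> C0 uv v0 e e0; have d0 : 0 < e / (C + 1) by rewrite divr_gt0// ltr_wpDl.
have [n hn] := v0 _ d0; exists n => m /hn; rewrite !subr0 => h.
rewrite (le_trans (uv m))// (le_trans (ler_wpM2l C0 h))// mulrCA ger_pMr//.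
by rewrite ler_pdivrMr ?mul1r ?lerDl// ltr_wpDl.
Qed.

(** * Strictly positive elements *)

Section strictly_positive_elements.
Context {R : realType} {E : cstarAlgType R}.
Local Notation M := (adj E).
Local Notation N := (@adj_ucnorm R E).
Local Notation n_ := (@cstar_cnorm R E).
Local Notation "1e" := (uone N).
Local Notation sc r := (r%:c *: 1e).
Local Notation w := (2^-1 : R).

(** Strict positivity of [h] is expressed by c = (1 - h^2)^(1/2): its powers tend strongly to 0, so
    the partial sums of c^k h^2 c^k, equal to 1 - c^(2n), tend strongly to 1. *)
Record strictly_positive (h : E) (c : M) : Prop := StrictlyPositive {
  spos_sa : star h = h;
  spos_sac : star c = c;
  spos_sq : c ** c = 1e - lmul h ** lmul h;
  spos_le1 : N c <= 1;
  spos_comm : c ** lmul h = lmul h ** c;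
  spos_tends : forall x, tends n_ (fun n => spow N c n x) 0
}.

Lemma cauchy_half {F : starAlgType R} (P : cnorm F) (u : nat -> F) K :
  0 <= K -> (forall n, P (u n.+1 - u n) <= K * w ^+ n) -> cauchy_cn P u.
Proof.
move=> K0 uK e e0; have d0 : 0 < e / (2 * K + 1) by rewrite divr_gt0// ltr_wpDl// mulr_ge0.
have [n hn] := half_small d0; exists n => m nm.
suff h : P (u m - u n) <= K * (2 * w ^+ n).
  have := hn n (leqnn _); rewrite ler_pdivlMr ?ltr_wpDl ?mulr_ge0//.
  by have := @half_ge0 R n; nra.
apply: (@le_trans _ _ (K * \sum_(n <= k < m) w ^+ k)); last first.
  by rewrite ler_wpM2l// sum_half.
rewrite -(subnKC nm); elim: (m - n)%N => [|p IH].
  by rewrite addn0 subrr cn0 big_geq// mulr0.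
rewrite addnS big_nat_recr/= ?leq_addr// mulrDr [leRHS]addrC.
by rewrite (le_trans (cn_tri P (u (n + p)%N) _ _))// lerD.
Qed.

(** [h] is a weighted sum of the u_n u_n^*, with weights that keep its norm at most 1/2, so that the
    root [c] exists. The index n in the hypothesis may depend on [x]. By [cn_mul_spow_sqrt] the norm
    of h c^m is at most m^(-1/2), which makes c^m small on each u_k, and x is close to some u_k
    x. *)
Lemma strictly_positive_exists (u : nat -> E) :
  (forall x e, 0 < e -> exists n, rnorm (u n ** x - x) <= e) ->
  exists h c, strictly_positive h c.
Proof.
move=> uP; pose l n := w ^+ n.+2 / (rnorm (u n) ^+ 2 + 1).
have D0 n : 0 < rnorm (u n) ^+ 2 + 1 by rewrite ltr_wpDl// sqr_ge0.
have l0 n : 0 < l n by rewrite divr_gt0// exprn_gt0// invr_gt0.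
pose a n := (l n)%:c *: (u n ** star (u n)).
have as_ n : star (a n) = a n by rewrite starZr starM starK.
have aw n : rnorm (a n) <= w ^+ n.+2.
  rewrite rnorm_real gtr0_norm// -{1}(starK (u n)) rnorm_cstar rnorm_star /l.
  by rewrite mulrAC ler_pdivrMr// ler_pM2l ?exprn_gt0 ?invr_gt0// lerDl.
have ap n : pos N (lmul (a n)).
  rewrite lmulZ lmulM lmulS; apply: posZ; first exact: ltW.
  by rewrite -{1}(starK (lmul (u n))); exact: pos_star_smul.
pose S n := \sum_(0 <= k < n) a k.
have [h Sh] : exists h, tends n_ S h.
  apply: cauchy_tends; apply: (@cauchy_half _ _ _ 1) => // n.
  rewrite /S big_nat_recr//= addrAC subrr add0r mul1r (le_trans (aw n))// half_mono//.
  by rewrite ltnW.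
have Ss n : star (S n) = S n.
  rewrite /S; elim: n => [|n IH]; first by rewrite big_geq// star0.
  by rewrite big_nat_recr//= starD IH as_.
have hs : star h = h.
  by apply: (tends_uniq (tends_star Sh)); apply: (tends_ext _ Sh) => n; rewrite Ss.
have h1 : rnorm h <= w.
  apply: (tends_le Sh) => n; rewrite (le_trans (cn_sum _ _ _ _))//.
  apply: (@le_trans _ _ (w ^+ 2 * \sum_(0 <= k < n) w ^+ k)).
    by rewrite mulr_sumr; apply: ler_sum => k _; rewrite -exprD; exact: aw.
  have := @sum_half R 0 n; rewrite expr0 expr2; lra.
have hl : N (lmul h) < 1 by rewrite /= cn_lmul (le_lt_trans h1)// invf_lt1// ltr1n.
have lhs : star (lmul h) = lmul h by rewrite -lmulS hs.
have [c [cs cc c1 _ ccomm]] := sqrt_one_sub_sq lhs hl.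
have ch : c ** lmul h = lmul h ** c by apply: ccomm; rewrite !smulA.
have cpn n : N (spow N c n) <= 1.
  by rewrite (le_trans (cn_spow _ _ _))// exprn_ile1// cn_ge0.
have ha k : pos N (lmul h - lmul (a k)).
  apply: pos_limit => [|r /Sh[n hn]]; first by rewrite starB lhs -lmulS as_.
  exists (lmul (S (maxn n k.+1)) - lmul (a k)).
    rewrite /S (@big_cat_nat _ _ _ k)//=; last by rewrite leq_max leqnSn orbT.
    rewrite (@big_ltn _ _ _ k) ?leq_max ?leqnn ?orbT//.
    rewrite !lmulD.
    have sumpos i j : pos N (lmul (\sum_(i <= q < j) a q)).
      elim/big_rec: _ => [|q x _ px]; last by rewrite lmulD; exact: posD.
      rewrite (_ : lmul 0 = sc 0); first exact: pos_scalar.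
      by rewrite rmorph0 scale0r -[0 in LHS](scale0r (0 : E)) lmulZ scale0r.
    set X := lmul _; set Y := lmul (a k); set Z := lmul (\sum_(_ <= _ < _) _).
    have -> : X + (Y + Z) - Y = X + Z by lmod (adj E); ring.
    by apply: posD; exact: sumpos.
  have -> : lmul h - lmul (a k) - (lmul (S (maxn n k.+1)) - lmul (a k)) =
    lmul (h - S (maxn n k.+1)) by rewrite lmulB; lmod (adj E); ring.
  by rewrite /= cn_lmul rnormB hn// leq_maxl.
have hc n : n%:R * N (lmul h ** spow N c n) ^+ 2 <= 1 by exact: cn_mul_spow_sqrt.
have hcn e : 0 < e -> exists n, forall m, (n <= m)%N -> N (lmul h ** spow N c m) <= e.
  move=> e0; have e2 : 0 < e ^+ 2 by rewrite exprn_gt0.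
  have /ltW/archi_boundP := divr_gt0 (@ltr01 R) e2; set n := Num.bound _ => hn.
  exists n => m nm; apply: ler_of_sqr; first exact: ltW.
  rewrite -(ler_pM2l (_ : 0 < m%:R)).
    rewrite (le_trans (hc m))// -ler_pdivrMr// ltW// (lt_le_trans hn)//.
    by rewrite ler_nat.
  by rewrite (lt_le_trans _ (_ : n%:R <= _)) ?ler_nat// (le_lt_trans _ hn)// divr_ge0// ltW.
exists h, c; split => // x e e0.
have e2 : 0 < e / 2 by rewrite divr_gt0.
have [k hk] := uP x _ e2; pose C := (rnorm x + 1) ^+ 2 / l k.
have C0 : 0 < C by rewrite divr_gt0// exprn_gt0// ltr_wpDl// rnorm_ge0.
have d0 : 0 < (e / 2) ^+ 2 / C by rewrite divr_gt0// exprn_gt0.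
have [n hn] := hcn _ d0; exists n => m nm; rewrite subr0.
have -> : spow N c m x = spow N c m (x - u k ** x) + spow N c m (u k) ** x.
  by rewrite adjB -adj_smul subrK.
rewrite (le_trans (cnD _ _ _))// (splitr e) lerD//.
  rewrite (le_trans (le_adj_norm _ _))// (le_trans (ler_wpM2r (rnorm_ge0 _) (cpn m)))//.
  by rewrite mul1r rnormB.
rewrite (le_trans (rnorm_smul_le _ _))//.
(* u_k u_k^* is at most h / l_k, so the norm of c^m u_k is controlled by that of h c^m. *)
have uk2 : rnorm (spow N c m (u k)) ^+ 2 <= (l k)^-1 * ((e / 2) ^+ 2 / C).
  rewrite -cn_lmul -adj_lmul -[adj_norm _]/(N _) -cn_cstar'.
  have -> : (spow N c m ** lmul (u k)) ** star (spow N c m ** lmul (u k)) =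
     (l k)^-1%:c *: (star (spow N c m) ** lmul (a k) ** spow N c m).
    rewrite starM (star_spow _ _ cs) /a lmulZ lmulM lmulS !expand_smul scalerA.
    by rewrite -rmorphM/= mulVf ?gt_eqF// rmorph1 scale1r.
  rewrite cn_real gtr0_norm ?invr_gt0// ler_pM2l ?invr_gt0//.
  rewrite (le_trans _ (hn m nm))//.
  apply: (@le_trans _ _ (N (star (spow N c m) ** lmul h ** spow N c m))).
    apply: pos_norm_mono; first exact: pos_conj.
    by rewrite -smulBl -smulBr; exact: pos_conj.
  rewrite (le_trans (cnM _ _ _))// (star_spow _ _ cs).
  have -> : spow N c m ** lmul h = lmul h ** spow N c m by rewrite spow_comm.
  by rewrite ler_piMr ?cn_ge0// cpn.
apply: ler_of_sqr; first exact: ltW.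
rewrite exprMn.
have x1 : rnorm x ^+ 2 <= (rnorm x + 1) ^+ 2.
  by rewrite lerXn2r ?nnegrE ?addr_ge0 ?rnorm_ge0// lerDl.
rewrite (le_trans (ler_pM _ _ uk2 x1)) ?sqr_ge0// le_eqVlt; apply/orP; left.
by apply/eqP; rewrite /C; field; rewrite !gt_eqF// ltr_wpDl// rnorm_ge0.
Qed.

(** 1 - c^(2n) is a left multiple of h by the factorization 1 - c^2 = h^2, and c^(2n) x tends to
    0. *)
Lemma strictly_positive_dense h c x e : strictly_positive h c -> 0 < e ->
  exists y, rnorm (h ** y - x) <= e.
Proof.
move=> [hs cs cc c1 ch ct] e0; have [n hn] := ct x _ e0.
suff [y hy] : exists y, h ** y - x = - spow N c n.*2 x.
  by exists y; rewrite hy rnormN -(subr0 (_ x)) hn// -addnn leq_addr.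
have {}cc z : z = c (c z) + h ** (h ** z).
  have := congr1 (fun T : M => T z) cc.
  by rewrite mulE_adj subE_adj mulE_adj /= => ->; rewrite subrK.
have {ch}ch z : c (h ** z) = h ** c z by have := congr1 (fun T : M => T z) ch.
elim: n {hn} => [|n [y hy]]; first by exists 0; rewrite smulx0 sub0r.
exists (y + h ** spow N c n.*2 x); rewrite smulDr addrAC hy doubleS !spowS !mulE_adj.
by rewrite [X in - X + _]cc; lmod E; ring.
Qed.

End strictly_positive_elements.

(** * Absorbing isometries *)

Section shifts.
Context {R : realType} {E : cstarAlgType R}.
Local Notation M := (adj E).
Local Notation N := (@adj_ucnorm R E).
Local Notation n_ := (@cstar_cnorm R E).
Local Notation "1e" := (uone N).
Local Notation sc r := (r%:c *: 1e).
Local Notation w := (2^-1 : R).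

(* Up to a constant, r moves the finite set F isometrically onto a set orthogonal
   to F. *)
Definition has_shifts :=
  exists d C : R, [/\ 0 < d, 0 <= C & forall (F : seq E) (e : R), 0 < e ->
    exists r : M, [/\ N r <= C,
      forall x, x \in F -> pos N (star (lmul (r x)) ** lmul (r x) -
        d%:c *: (star (lmul x) ** lmul x) + sc e) &
      forall x z, x \in F -> z \in F -> rnorm (star z ** r x) <= e]].

Lemma rnorm_lmul (x : E) : rnorm x = N (lmul x).
Proof. by rewrite -cn_lmul. Qed.

Lemma adj_norm_inner (T : M) K : 0 <= K ->
  (forall x y, rnorm (star y ** T x) <= K * rnorm x * rnorm y) -> adj_norm T <= K.
Proof.
move=> K0 h; apply: adj_norm_min => // x.
have [->|y0] := eqVneq (rnorm (T x)) 0; first by rewrite mulr_ge0// rnorm_ge0.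
have y1 : 0 < rnorm (T x) by rewrite lt_neqAle eq_sym y0 rnorm_ge0.
by rewrite -(ler_pM2r y1) -expr2 -rnorm_cstar.
Qed.

Variables (h : E) (c : M) (hc : strictly_positive h c).
(** The elements g_n = c^n h form a partition of unity, the g_n^* g_n summing strongly to 1. A
    multiplier will be assembled from what it does to them. *)
Let g n : E := spow N c n h.

Lemma lmul_g n : lmul (g n) = lmul h ** spow N c n.
Proof. by rewrite -adj_lmul spow_comm// (spos_comm hc). Qed.

Lemma gg n : star (lmul (g n)) ** lmul (g n) =
  star (spow N c n) ** spow N c n - star (spow N c n.+1) ** spow N c n.+1.
Proof.
have cs := spos_sac hc.
rewrite lmul_g starM -lmulS (spos_sa hc) !(star_spow _ _ cs) -smulA (smulA (lmul h)).
have -> : lmul h ** lmul h = 1e - c ** c by rewrite (spos_sq hc); lmod (adj E); ring.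
rewrite !expand_smul !expand_one; congr (_ - _).
by rewrite -spowSr spowS -!smulA -spowS.
Qed.

Lemma sum_gg m n : (m <= n)%N ->
  \sum_(m <= k < n) star (lmul (g k)) ** lmul (g k) =
  star (spow N c m) ** spow N c m - star (spow N c n) ** spow N c n.
Proof.
move=> mn; under eq_bigr do rewrite gg.
rewrite -(subnKC mn); elim: (n - m)%N => [|p IH].
  by rewrite addn0 big_geq// subrr.
by rewrite addnS big_nat_recr/= ?leq_addr// IH; lmod (adj E); ring.
Qed.

Lemma cn_spow_le1 n : N (spow N c n) <= 1.
Proof.
by rewrite (le_trans (cn_spow _ _ _))// exprn_ile1// ?cn_ge0// (spos_le1 hc).
Qed.

(** Pairs (j, n) are enumerated and r_jn is chosen for the finite set made of h, g_n and all earlier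
    r_im g_m. The geometric weights make the errors summable over all pairs. *)
Lemma shift_entries (d C eta : R) : 0 < eta ->
  (forall (F : seq E) (e : R), 0 < e ->
    exists r : M, [/\ N r <= C,
      forall x, x \in F -> pos N (star (lmul (r x)) ** lmul (r x) -
        d%:c *: (star (lmul x) ** lmul x) + sc e) &
      forall x z, x \in F -> z \in F -> rnorm (star z ** r x) <= e]) ->
  exists r : nat -> nat -> M, [/\ forall j n, N (r j n) <= C,
    forall j n, pos N (star (lmul (r j n (g n))) ** lmul (r j n (g n)) -
        d%:c *: (star (lmul (g n)) ** lmul (g n)) + sc (eta * w ^+ (j + n))),
    forall j n, rnorm (h ** r j n (g n)) <= eta * w ^+ (j + n) &
    forall i m j n, (i, m) != (j, n) ->
      rnorm (star (r i m (g m)) ** r j n (g n)) <= eta * w ^+ (i + m + (j + n))].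
Proof.
move=> eta0 H.
pose pr k : nat * nat := odflt (0, 0)%N (unpickle k).
have prK p : pr (pickle p) = p by rewrite /pr pickleK.
pose P (s : seq M) (r : M) := forall j n, pr (size s) = (j, n) ->
  [/\ N r <= C, pos N (star (lmul (r (g n))) ** lmul (r (g n)) -
        d%:c *: (star (lmul (g n)) ** lmul (g n)) + sc (eta * w ^+ (j + n))),
    rnorm (h ** r (g n)) <= eta * w ^+ (j + n) &
    forall l, (l < size s)%N ->
      rnorm (star (nth 0 s l (g (pr l).2)) ** r (g n)) <=
        eta * w ^+ ((pr l).1 + (pr l).2 + (j + n))].
have [s|r rP] := @history_choice M P.
  case jnE: (pr (size s)) => [j n].
  (* [K] exceeds every exponent that occurs, so one tolerance meets all requirements at this
     stage. *)
  pose K := (j + n + \sum_(l < size s) ((pr l).1 + (pr l).2))%N.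
  have e0 : 0 < eta * w ^+ K by rewrite mulr_gt0// exprn_gt0// invr_gt0.
  have [r [rC rd rz]] :=
    H [:: h, g n & [seq nth 0 s l (g (pr l).2) | l <- iota 0 (size s)]] _ e0.
  have eK q : (q <= K)%N -> eta * w ^+ K <= eta * w ^+ q.
    by move=> qK; rewrite ler_pM2l// half_mono.
  have jnK : (j + n <= K)%N by rewrite leq_addr.
  have gF : g n \in [:: h, g n & [seq nth 0 s l (g (pr l).2) | l <- iota 0 (size s)]].
    by rewrite !inE eqxx orbT.
  exists r => j' n'; rewrite jnE => -[<- <-]; split => //.
  - have := rd _ gF => p.
    set A := _ + sc _ in p *; set A' := _ + sc _.
    have -> : A' = A + sc (eta * w ^+ (j + n) - eta * w ^+ K).
      by rewrite /A /A'; lmod (adj E); ring.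
    by apply: posD => //; apply: pos_scalar; rewrite subr_ge0 eK.
  - rewrite -{1}(spos_sa hc) (le_trans (rz _ _ gF _)) ?eK//.
    by rewrite !inE eqxx.
  - move=> l ls; rewrite (le_trans (rz _ _ gF _)) ?eK//.
      by rewrite !inE (map_f (fun l => nth 0 s l (g (pr l).2))) ?orbT// mem_iota.
    by rewrite addnC leq_add2l (bigD1 (Ordinal ls))//= leq_addr.
have rP' j n : pr (size (mkseq r (pickle (j, n)))) = (j, n) by rewrite size_mkseq prK.
exists (fun j n => r (pickle (j, n))); split.
- by move=> j n; have [] := rP _ _ _ (rP' j n).
- by move=> j n; have [] := rP _ _ _ (rP' j n).
- by move=> j n; have [] := rP _ _ _ (rP' j n).
have main i m j n : (pickle (i, m) < pickle (j, n))%N ->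
    rnorm (star (r (pickle (i, m)) (g m)) ** r (pickle (j, n)) (g n)) <=
    eta * w ^+ (i + m + (j + n)).
  move=> lt; have [_ _ _] := rP _ _ _ (rP' j n); rewrite size_mkseq => /(_ _ lt).
  by rewrite nth_mkseq// prK.
move=> i m j n ne; have [/main//|/main lt|] := ltngtP (pickle (i, m)) (pickle (j, n)).
  by rewrite -rnorm_star starM starK addnC.
by move/(congr1 pr); rewrite !prK => /eqP; rewrite (negPf ne).
Qed.

(** S_j is the strict sum over n of the operators r_jn g_n. As these are almost orthogonal, S_j^*
    S_j is close to the sum of the g_n^* r_jn^* r_jn g_n, which is at least d times the sum of the
    g_n^* g_n up to small errors. *)
Lemma shift_sequence : has_shifts ->
  exists (S : nat -> M) (K d : R), [/\ 0 < d, forall j, N (S j) <= K,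
    forall j, pos N (star (S j) ** S j - sc d),
    forall i, tends N (fun j => star (S i) ** S j) 0 &
    tends N (fun j => lmul h ** S j) 0].
Proof.
(* Cross terms cost 8 eta and the single entries 2 eta; with eta = d / 20 half of d survives. *)
move=> [d [C [d0 C0 H]]]; pose eta := d / 20; have eta0 : 0 < eta by rewrite divr_gt0.
have [r [rC rd rh rr]] := shift_entries eta0 H.
pose v j n := r j n (g n); pose V j n := lmul (v j n).
have VV i m j n : (i, m) != (j, n) ->
    N (star (V i m) ** V j n) <= eta * w ^+ (i + m + (j + n)).
  by move=> ne; rewrite -lmulS -lmulM /= cn_lmul rr.
have Vu j n : pos N ((C ^+ 2)%:c *: (star (lmul (g n)) ** lmul (g n)) - star (V j n) ** V j n).
  have -> : (C ^+ 2)%:c *: (star (lmul (g n)) ** lmul (g n)) - star (V j n) ** V j n =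
     star (lmul (g n)) ** (sc (C ^+ 2) - star (r j n) ** r j n) ** lmul (g n).
    by rewrite /V /v -adj_lmul starM !expand_smul smulx1.
  apply: pos_conj; apply: pos_norm_sub; first by rewrite starM starK.
  by rewrite cn_cstar lerXn2r ?nnegrE ?cn_ge0// rC.
pose D j m n := \sum_(m <= k < n) V j k.
have DS j m n : (m <= n)%N -> D j m n.+1 = D j m n + V j n.
  by move=> mn; rewrite /D big_nat_recr.
have DV j m n : N (star (D j m n) ** V j n) <= 2 * eta * w ^+ n * w ^+ m.
  apply: (@le_trans _ _ (\sum_(m <= k < n) eta * w ^+ n * w ^+ k)).
    rewrite /D !big_nat; apply: (@le_trans _ _ (\sum_(m <= k < n | (m <= k < n)%N)
       N (star (V j k) ** V j n))).
      by rewrite star_sum smul_suml; exact: cn_sum.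
    apply: ler_sum => k /andP[_ kn]; rewrite (le_trans (VV _ _ _ _ _))//.
      by apply/eqP => -[e]; move: kn; rewrite e ltnn.
    by rewrite -mulrA -exprD ler_pM2l// half_mono// [(n + k)%N]addnC leq_add// leq_addl.
  have e0 : 0 <= eta * w ^+ n by rewrite mulr_ge0 ?half_ge0// ltW.
  rewrite -mulr_sumr (le_trans (ler_wpM2l e0 (sum_half m n)))//.
  by rewrite le_eqVlt; apply/orP; left; apply/eqP; ring.
have DD j m n : (m <= n)%N ->
    N (star (D j m n) ** D j m n - \sum_(m <= k < n) star (V j k) ** V j k) <=
    4 * eta * w ^+ m * \sum_(m <= k < n) w ^+ k.
  move=> mn; rewrite -(subnKC mn); elim: (n - m)%N => [|p IH].
    by rewrite addn0 /D !big_geq// star0 smul0x subrr cn0 mulr0.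
  rewrite addnS DS ?leq_addr// !(big_nat_recr (m + p))/= ?leq_addr//.
  set X := D j m (m + p) in IH *; set Y := V j (m + p); set Z := \sum_(_ <= _ < _) _ in IH *.
  have -> : star (X + Y) ** (X + Y) - (Z + star Y ** Y) =
    (star X ** X - Z) + (star X ** Y + star (star X ** Y)).
    by rewrite !expand_star !expand_smul; lmod (adj E); ring.
  rewrite -[adj_norm _]/(N _) (le_trans (cnD _ _ _))// mulrDr lerD// (le_trans (cnD _ _ _))// cn_star.
  by have := DV j m (m + p)%N; rewrite -/X -/Y; nra.
have DD8 j m n : (m <= n)%N ->
    N (star (D j m n) ** D j m n - \sum_(m <= k < n) star (V j k) ** V j k) <=
    8 * eta * w ^+ m.
  move=> mn; rewrite (le_trans (DD j m n mn))//.
  have := @sum_half R m n; have := @half_ge0 R m; have := @half_le1 R m.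
  set t := w ^+ m; set s := \sum_(_ <= _ < _) _ => t1 t0 s2.
  have : t * s <= 2 * t by nra.
  by rewrite -!mulrA (mulrCA 4) (mulrCA 8) ler_pM2l//; lra.
have selfa (I : seq nat) (F : nat -> M) : (forall k, star (F k) = F k) ->
    star (\sum_(k <- I) F k) = \sum_(k <- I) F k.
  by move=> Fs; elim/big_rec: _ => [|k x _ xs]; rewrite ?star0// starD Fs xs.
have DDs j m n : star (star (D j m n) ** D j m n - \sum_(m <= k < n) star (V j k) ** V j k) =
   star (D j m n) ** D j m n - \sum_(m <= k < n) star (V j k) ** V j k.
  by rewrite starB starM starK; congr (_ - _); apply: selfa => k; rewrite starM starK.
have Dup j m n : (m <= n)%N -> pos N ((C ^+ 2)%:c *: (star (spow N c m) ** spow N c m) +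
    sc (8 * eta * w ^+ m) - star (D j m n) ** D j m n).
  move=> mn; set B := \sum_(m <= k < n) star (V j k) ** V j k.
  have -> : (C ^+ 2)%:c *: (star (spow N c m) ** spow N c m) + sc (8 * eta * w ^+ m) -
     star (D j m n) ** D j m n =
     ((C ^+ 2)%:c *: (\sum_(m <= k < n) star (lmul (g k)) ** lmul (g k)) - B) +
     ((C ^+ 2)%:c *: (star (spow N c n) ** spow N c n)) +
     (sc (8 * eta * w ^+ m) - (star (D j m n) ** D j m n - B)).
    by rewrite sum_gg//; lmod (adj E); ring.
  apply: posD; last by apply: pos_norm_sub; [exact: DDs|exact: DD8].
  apply: posD; last by apply: posZ; [exact: sqr_ge0|exact: pos_star_smul].
  rewrite /B scaler_sumr -sumrB.
  elim/big_rec: _ => [|k x _ px]; last exact: posD.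
  by rewrite -(scale0r 1e) -(rmorph0 (real_complex R)); exact: pos_scalar.
have Dlow j n : pos N (star (D j 0 n) ** D j 0 n -
    d%:c *: (1e - star (spow N c n) ** spow N c n) + sc (10 * eta)).
  set B := \sum_(0 <= k < n) star (V j k) ** V j k.
  have -> : star (D j 0 n) ** D j 0 n -
    d%:c *: (1e - star (spow N c n) ** spow N c n) + sc (10 * eta) =
    (star (D j 0 n) ** D j 0 n - B + sc (8 * eta)) +
    ((B - d%:c *: (\sum_(0 <= k < n) star (lmul (g k)) ** lmul (g k)) +
      sc (eta * \sum_(0 <= k < n) w ^+ (j + k))) +
     sc (eta * (2 - \sum_(0 <= k < n) w ^+ (j + k)))).
    by rewrite sum_gg// (_ : spow N c 0 = 1e)// (star1 N) (smul1x N); lmod (adj E); ring.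
  apply: posD.
    apply: pos_norm_add; first exact: DDs.
    by rewrite (le_trans (DD8 j 0%N n _))// expr0 mulr1.
  apply: posD; last first.
    apply: pos_scalar; rewrite mulr_ge0 ?(ltW eta0)// subr_ge0.
    apply: le_trans (_ : \sum_(0 <= k < n) w ^+ k <= _).
      by apply: ler_sum => k _; rewrite half_mono// leq_addl.
    by have := @sum_half R 0 n; rewrite expr0 mulr1.
  rewrite /B scaler_sumr mulr_sumr rmorph_sum/= scaler_suml -sumrB -big_split/=.
  elim/big_rec: _ => [|k x _ px]; last by apply: posD => //; exact: rd.
  by rewrite -(scale0r 1e) -(rmorph0 (real_complex R)); exact: pos_scalar.
(* Tails of the sum are dominated by c^m, whose powers tend strongly to 0, plus a geometric error.
   This gives convergence on vectors. *)
have Dx j m n x : (m <= n)%N -> rnorm (D j m n x) ^+ 2 <=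
    C ^+ 2 * rnorm (spow N c m x) ^+ 2 + 8 * eta * w ^+ m * rnorm x ^+ 2.
  move=> mn; rewrite !rnorm_lmul -!adj_lmul -!cn_cstar.
  have e0 : 0 <= 8 * eta * w ^+ m by rewrite !mulr_ge0 ?half_ge0// ltW.
  apply: (@le_trans _ _ (N (star (lmul x) ** ((C ^+ 2)%:c *:
      (star (spow N c m) ** spow N c m) + sc (8 * eta * w ^+ m)) ** lmul x))).
    have -> : star (D j m n ** lmul x) ** (D j m n ** lmul x) =
      star (lmul x) ** (star (D j m n) ** D j m n) ** lmul x.
      by rewrite starM !smulA.
    apply: pos_norm_mono; first by apply: pos_conj; exact: pos_star_smul.
    by rewrite -smulBl -smulBr; apply: pos_conj; exact: Dup.
  by rewrite !expand_smul smulx1 (le_trans (cnD _ _ _))// !cn_real !ger0_norm ?sqr_ge0.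
pose K := C + 8 * eta + 1.
have eta8 : 0 <= 8 * eta by rewrite mulr_ge0// ltW.
have K0 : 0 <= K by rewrite !addr_ge0.
have DK j m n : N (D j m n) <= K.
  have [nm|mn] := leqP n m; first by rewrite /D big_geq// cn0.
  apply: adj_norm_min => // x; apply: ler_of_sqr; first by rewrite mulr_ge0// rnorm_ge0.
  rewrite (le_trans (Dx j m n x (ltnW mn)))// exprMn.
  have h1 : rnorm (spow N c m x) ^+ 2 <= rnorm x ^+ 2.
    rewrite lerXn2r ?nnegrE ?rnorm_ge0// (le_trans (le_adj_norm _ _))//.
    by rewrite ler_piMl ?rnorm_ge0//; exact: cn_spow_le1.
  have C2 : 0 <= C ^+ 2 by exact: sqr_ge0.
  rewrite (le_trans (lerD (ler_wpM2l C2 h1) (lexx _)))// -mulrDl ler_wpM2r ?sqr_ge0//.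
  have h2 := @half_le1 R m; have h3 := @half_ge0 R m.
  have : 8 * eta * w ^+ m <= 8 * eta by rewrite ler_piMr.
  by rewrite /K !expr2; nra.
have Dsub j m n x : (m <= n)%N -> D j 0 n x - D j 0 m x = D j m n x.
  move=> mn; have -> : D j 0 n = D j 0 m + D j m n by rewrite /D -big_cat_nat.
  by rewrite addE_adj addrAC subrr add0r.
have cauchyD j x : cauchy_cn n_ (fun n => D j 0 n x).
  move=> e e0; pose t := e ^+ 2 / 2; have t0 : 0 < t by rewrite divr_gt0// exprn_gt0.
  have a0 : 0 < Num.sqrt (t / (C ^+ 2 + 1)).
    by rewrite sqrtr_gt0 divr_gt0// ltr_wpDl// sqr_ge0.
  have b0 : 0 < t / (8 * eta * rnorm x ^+ 2 + 1).
    by rewrite divr_gt0// ltr_wpDl// mulr_ge0// sqr_ge0.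
  have [n1 hn1] := spos_tends hc x a0; have [n2 hn2] := half_small b0.
  exists (maxn n1 n2) => m nm; rewrite /= Dsub//.
  apply: ler_of_sqr; first exact: ltW.
  rewrite (le_trans (Dx j _ _ x nm))// (_ : e ^+ 2 = t + t); last by rewrite /t; field.
  have := hn1 _ (leq_maxl n1 n2); have := hn2 _ (leq_maxr n1 n2); rewrite subr0 /=.
  rewrite ler_pdivlMr; last by rewrite ltr_wpDl// mulr_ge0// sqr_ge0.
  set y := rnorm (spow N c _ x) => h2 h1; apply: lerD; last first.
    by apply: le_trans h2; have := @half_ge0 R (maxn n1 n2); lra.
  have : y ^+ 2 <= t / (C ^+ 2 + 1).
    rewrite -[leRHS]sqr_sqrtr; last by rewrite divr_ge0 ?addr_ge0 ?sqr_ge0// ltW.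
    by rewrite lerXn2r ?nnegrE ?rnorm_ge0 ?sqrtr_ge0.
  rewrite ler_pdivlMr ?ltr_wpDl ?sqr_ge0//; apply: le_trans.
  by rewrite mulrC ler_wpM2l ?sqr_ge0// lerDl.
have hD j m n : N (lmul h ** D j m n) <= 2 * eta * w ^+ (j + m).
  apply: (@le_trans _ _ (\sum_(m <= k < n) eta * w ^+ j * w ^+ k)).
    apply: (@le_trans _ _ (\sum_(m <= k < n) N (lmul h ** V j k))).
      by rewrite /D smul_sumr; exact: cn_sum.
    apply: ler_sum => k _; rewrite -lmulM -mulrA -exprD /= cn_lmul; exact: rh.
  have e0 : 0 <= eta * w ^+ j by rewrite mulr_ge0 ?half_ge0// ltW.
  rewrite -mulr_sumr (le_trans (ler_wpM2l e0 (sum_half m n)))//.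
  by rewrite exprD le_eqVlt; apply/orP; left; apply/eqP; ring.
(* The adjoints converge on the dense set of multiples h y, because every h r_jn g_n was made
   small. *)
have cauchyD' j x : cauchy_cn n_ (fun n => star (D j 0 n) x).
  move=> e e0; have e1 : 0 < e / (2 * (K + 1)) by rewrite divr_gt0 ?mulr_gt0 ?ltr_wpDl.
  have [y hy] := strictly_positive_dense x hc e1.
  have e2 : 0 < e / (4 * eta * rnorm y + 1).
    by rewrite divr_gt0// ltr_wpDl// !mulr_ge0 ?rnorm_ge0// ltW.
  have [n hn] := half_small e2; exists n => m nm /=.
  have -> : star (D j 0 m) x - star (D j 0 n) x = star (D j n m) x.
    rewrite -subE_adj -starB; congr (adj_fun (star _) x); apply: adj_ext => z.
    by rewrite subE_adj Dsub.
  have -> : star (D j n m) x = star (D j n m) (x - h ** y) + star (D j n m) (h ** y).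
    by rewrite -adjD subrK.
  rewrite (le_trans (rnormD _ _))// (splitr e) lerD//.
    rewrite (le_trans (le_adj_norm _ _))// rnormB.
    have := cn_star N (D j n m); rewrite /= => ->.
    have h1 : adj_norm (D j n m) * rnorm (h ** y - x) <= K * (e / (2 * (K + 1))).
      by apply: ler_pM; [exact: adj_norm_ge0|exact: rnorm_ge0|exact: DK|].
    rewrite (le_trans h1)//; have -> : e / 2 = (K + 1) * (e / (2 * (K + 1))).
      by field; rewrite gt_eqF// ltr_wpDl.
    by rewrite ler_wpM2r ?lerDl// ltW.
  have -> : star (D j n m) (h ** y) = star (lmul h ** D j n m) y.
    by rewrite starM -lmulS (spos_sa hc).
  rewrite (le_trans (le_adj_norm _ _))//; have := cn_star N (lmul h ** D j n m).
  rewrite /= => ->; rewrite (le_trans (ler_wpM2r (rnorm_ge0 _) (hD j n m)))//.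
  have := hn n (leqnn _); rewrite ler_pdivlMr; last first.
    by rewrite ltr_wpDl// !mulr_ge0 ?rnorm_ge0// ltW.
  have h1 : w ^+ (j + n) <= w ^+ n by rewrite half_mono// leq_addl.
  have h2 := @half_ge0 R n; have y0 := rnorm_ge0 y.
  have : eta * rnorm y * w ^+ (j + n) <= eta * rnorm y * w ^+ n.
    by rewrite ler_wpM2l// mulr_ge0// ltW.
  lra.
have lim j := strict_limit K0 (DK j 0%N) (cauchyD j) (cauchyD' j).
have [S SP] := choice lim; have {lim}SD j x : tends n_ (fun n => D j 0 n x) (S j x).
  by have [_ + _] := SP j; exact.
exists S, K, (d / 2); split; first by rewrite divr_gt0.
- by move=> j; have [] := SP j.
- move=> j; apply: pos_adj; first by rewrite starB starM starK starZr star1.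
  move=> x; apply: pos_limit.
    rewrite !starM starK smulA; congr (_ ** _ ** _).
    by rewrite starB starM starK starZr star1.
  pose X := lmul x; move=> e e0.
  have e2 : 0 < e / 2 by rewrite divr_gt0.
  pose A n := star X ** (star (D j 0 n) ** D j 0 n -
    d%:c *: (1e - star (spow N c n) ** spow N c n) + sc (10 * eta)) ** X.
  have AE n : A n = star (lmul (D j 0 n x)) ** lmul (D j 0 n x) - (d / 2)%:c *: (star X ** X) +
     d%:c *: (star (lmul (spow N c n x)) ** lmul (spow N c n x)).
    rewrite /A -!adj_lmul -/X !expand_star !expand_smul smulx1.
    rewrite (_ : 10 * eta = d - d / 2); last by rewrite /eta; field.
    by lmod (adj E); ring.
  have tA : tends N A (star (lmul (S j x)) ** lmul (S j x) - (d / 2)%:c *: (star X ** X) +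
     d%:c *: (star (lmul 0) ** lmul 0)).
    apply: (@tends_ext _ _ _ (fun n => _) _ _ (fun n => esym (AE n))).
    have tl (u : nat -> E) y : tends n_ u y -> tends N (fun n => star (lmul (u n)) ** lmul (u n))
       (star (lmul y) ** lmul y).
      move=> uy; apply: (@tends_ext _ _ _ (fun n => lmul (star (u n) ** u n))).
        by move=> n; rewrite lmulM lmulS.
      have -> : star (lmul y) ** lmul y = lmul (star y ** y) by rewrite lmulM lmulS.
      have : tends n_ (fun n => star (u n) ** u n) (star y ** y).
        by apply: tendsM => //; exact: tends_star.
      by move=> t e' /t[n hn]; exists n => m /hn; rewrite -lmulB /= cn_lmul.
    apply: tendsD; last by apply: tendsZ; apply: tl; exact: (spos_tends hc).
    by apply: tendsD; [exact: tl|exact: tends_cst].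
  have [n hn] := tA _ e0; exists (A n).
    by apply: pos_conj; exact: Dlow.
  rewrite cnB; move: (hn n (leqnn _)); apply: le_trans.
  rewrite le_eqVlt; apply/orP; left; apply/eqP; congr (N _).
  rewrite -(adj_lmul (S j)) -/X.
  have -> : lmul 0 = 0 :> M by rewrite -(scale0r (0 : E)) lmulZ scale0r.
  by rewrite !expand_star !expand_smul smulx1; lmod (adj E); ring.
- move=> i e e0; have e4 : 0 < e / (4 * eta) by rewrite divr_gt0// mulr_gt0.
  have [n hn] := half_small e4; exists (maxn n i.+1) => j.
  rewrite geq_max => /andP[nj ij]; rewrite subr0.
  have Dij p : N (star (D i 0 p) ** D j 0 p) <= e.
    rewrite star_sum smul_suml (le_trans (cn_sum _ _ _ _))//.
    apply: (@le_trans _ _ (\sum_(0 <= k < p) (\sum_(0 <= l < p) eta * w ^+ j * w ^+ k * w ^+ l))).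
      apply: ler_sum => k _; rewrite smul_sumr (le_trans (cn_sum _ _ _ _))//.
      apply: ler_sum => l _; rewrite (le_trans (VV _ _ _ _ _))//.
        by apply/eqP => -[ij']; move: ij; rewrite ij' ltnn.
      have -> : eta * w ^+ j * w ^+ k * w ^+ l = eta * w ^+ (j + k + l).
        by rewrite !exprD; ring.
      by rewrite ler_pM2l//; apply: half_mono; lia.
    apply: (@le_trans _ _ (\sum_(0 <= k < p) eta * w ^+ j * 2 * w ^+ k)).
      apply: ler_sum => k _; rewrite -mulr_sumr.
      have c0 : 0 <= eta * w ^+ j * w ^+ k by rewrite !mulr_ge0 ?half_ge0// ltW.
      rewrite (le_trans (ler_wpM2l c0 (sum_half 0 p)))// expr0 le_eqVlt.
      by apply/orP; left; apply/eqP; ring.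
    rewrite -mulr_sumr; have s2 := @sum_half R 0 p; rewrite expr0 mulr1 in s2.
    have := hn j nj; rewrite ler_pdivlMr ?mulr_gt0//; apply: le_trans.
    have c0 : 0 <= eta * w ^+ j * 2 by rewrite !mulr_ge0 ?half_ge0// ltW.
    rewrite (le_trans (ler_wpM2l c0 s2))// le_eqVlt.
    by apply/orP; left; apply/eqP; ring.
  apply: adj_norm_inner => [|x y]; first exact: ltW.
  rewrite mulE_adj -star_adjP.
  apply: (tends_le (tendsM (tends_star (SD i y)) (SD j x))) => p.
  rewrite star_adjP -mulE_adj (le_trans (rnorm_smul_le _ _))// rnorm_star mulrC.
  rewrite ler_wpM2r ?rnorm_ge0// (le_trans (le_adj_norm _ _))//.
  by rewrite ler_wpM2r ?rnorm_ge0//; exact: Dij.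
move=> e e0; have e2 : 0 < e / (2 * eta) by rewrite divr_gt0// mulr_gt0.
have [n hn] := half_small e2; exists n => j nj; rewrite subr0.
apply: adj_norm_min => [|x]; first exact: ltW.
apply: (tends_le (tends_smull h (SD j x))) => p.
rewrite -lmulE -mulE_adj (le_trans (le_adj_norm _ _))// ler_wpM2r ?rnorm_ge0//.
rewrite (le_trans (hD j 0%N p))// addn0; have := hn j nj.
by rewrite ler_pdivlMr ?mulr_gt0// mulrC.
Qed.

End shifts.

Section isometries.
Context {R : realType} {E : cstarAlgType R}.
Local Notation M := (adj E).
Local Notation N := (@adj_ucnorm R E).
Local Notation n_ := (@cstar_cnorm R E).
Local Notation "1e" := (uone N).
Local Notation sc r := (r%:c *: 1e).
Local Notation w := (2^-1 : R).
Implicit Types (s f : nat -> M) (t : M).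

Definition orthonormal s n := forall i j, (i < n)%N -> (j < n)%N ->
  star (s i) ** s j = if i == j then 1e else 0.

Definition range_proj s n : M := \sum_(0 <= i < n) s i ** star (s i).

Lemma range_projS s n : range_proj s n.+1 = range_proj s n + s n ** star (s n).
Proof. by rewrite /range_proj big_nat_recr. Qed.

Lemma range_proj_sa s n : star (range_proj s n) = range_proj s n.
Proof.
by rewrite star_sum; apply: eq_bigr => i _; rewrite starM starK.
Qed.

Lemma orthonormal_range s n m i : orthonormal s n -> (i < n)%N -> (m <= n)%N ->
  star (s i) ** range_proj s m = if (i < m)%N then star (s i) else 0.
Proof.
move=> so ni; elim: m => [|m IH] mn; first by rewrite /range_proj big_geq// smulx0.
rewrite range_projS smulDr (IH (ltnW mn)) smulA (so i m ni mn) ltnS.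
have [im|mi|->] := ltngtP i m.
- by rewrite smul0x addr0.
- by rewrite smul0x addr0.
- by rewrite (smul1x N) add0r.
Qed.

Lemma range_proj_idem s n : orthonormal s n ->
  range_proj s n ** range_proj s n = range_proj s n.
Proof.
move=> so; rewrite {1}/range_proj smul_suml [in RHS]/range_proj [LHS]big_nat [RHS]big_nat.
apply: eq_bigr => i /andP[_ ni].
by rewrite -smulA (orthonormal_range so ni (leqnn n)) ni.
Qed.

Lemma proj_norm_le1 t : star t = t -> t ** t = t -> N t <= 1.
Proof.
move=> ts tt; have := cn_cstar N t; rewrite ts tt => h.
by rewrite leNgt; apply/negP => n1; have : N t < N t ^+ 2 by [rewrite ltr_eXnr]; lra.
Qed.

Lemma one_sub_range s n : orthonormal s n -> [/\ star (1e - range_proj s n) = 1e - range_proj s n,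
  (1e - range_proj s n) ** (1e - range_proj s n) = 1e - range_proj s n,
  N (1e - range_proj s n) <= 1 &
  forall i, (i < n)%N -> star (s i) ** (1e - range_proj s n) = 0].
Proof.
move=> so; have e1 : star (1e - range_proj s n) = 1e - range_proj s n.
  by rewrite starB (star1 N) range_proj_sa.
have e2 : (1e - range_proj s n) ** (1e - range_proj s n) = 1e - range_proj s n.
  have := range_proj_idem so; move: (range_proj s n) => q qq.
  by rewrite !expand_smul !(smul1x N) !(smulx1 N) qq; lmod (adj E); ring.
split => //; first exact: proj_norm_le1.
move=> i ni; rewrite smulBr (smulx1 N) (orthonormal_range so ni (leqnn n)) ni.
by rewrite subrr.
Qed.

Lemma tends_sum {F : starAlgType R} (P : cnorm F) I (r : seq I) (u : I -> nat -> F)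
    (l : I -> F) : (forall i, tends P (u i) (l i)) ->
  tends P (fun n => \sum_(i <- r) u i n) (\sum_(i <- r) l i).
Proof.
move=> ul; elim: r => [|i r IH].
  by rewrite big_nil; apply: (tends_ext _ (tends_cst P 0)) => n; rewrite big_nil.
rewrite big_cons; apply: (@tends_ext _ _ _ (fun n => u i n + \sum_(j <- r) u j n)).
  by move=> n; rewrite big_cons.
exact: tendsD.
Qed.

Variables (h : E) (c : M) (hc : strictly_positive h c).
Variables (S : nat -> M) (K d : R).
Hypotheses (d0 : 0 < d) (SK : forall j, N (S j) <= K)
  (Spos : forall j, pos N (star (S j) ** S j - sc d))
  (SS : forall i, tends N (fun j => star (S i) ** S j) 0)
  (hS : tends N (fun j => lmul h ** S j) 0).

(** The invariant that leaves room for further isometries: ranges built so far are asymptotically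
    orthogonal to the S_j. *)
Let asymp t := tends N (fun j => star t ** S j) 0.

(* Large multiples kp of h make the new isometry absorb h up to K / kp. *)
Lemma extend_isometries f n kp : 0 < kp -> orthonormal f n ->
  (forall i, (i < n)%N -> asymp (f i)) ->
  exists t, [/\ asymp t, star t ** t = 1e, forall i, (i < n)%N -> star (f i) ** t = 0 &
    N ((1e - range_proj f n - t ** star t) ** lmul h) <= K / kp].
Proof.
move=> kp0 fo fa; have [qs qq q1 fq] := one_sub_range fo.
have QS : tends N (fun j => range_proj f n ** S j) 0.
  apply: (@tends_ext _ _ _
    (fun j => \sum_(i <- index_iota 0 n) (f i ** (if (i < n)%N then star (f i) ** S j else 0)))).
    move=> j; rewrite /range_proj smul_suml !big_nat; apply: eq_bigr => i /andP[_ ni].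
    by rewrite ni smulA.
  rewrite [X in tends _ _ X](_ : 0 = \sum_(0 <= i < n) f i ** 0); last first.
    by rewrite big1// => i _; rewrite smulx0.
  apply: tends_sum => i; apply: tends_smull.
  by have [ni|_] := boolP (i < n)%N; [exact: fa|exact: tends_cst].
have [q qdef] : exists q : M, q = 1e - range_proj f n by exists (1e - range_proj f n).
rewrite -qdef in qs qq q1 fq *.
have qE j : q ** S j = S j - range_proj f n ** S j by rewrite qdef smulBl (smul1x N).
have [Z ZE] : exists Z : M, Z = q ** lmul h by exists (q ** lmul h).
have hs : star (lmul h) = lmul h by rewrite -lmulS (spos_sa hc).
have ZS : star Z = lmul h ** q by rewrite ZE starM qs hs.
have ZSt : tends N (fun j => star Z ** S j) 0.
  apply: (@tends_ext _ _ _ (fun j => lmul h ** S j + (-1) *: (lmul h ** (range_proj f n ** S j)))).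
    by move=> j; rewrite ZS -smulA qE smulBr scaleN1r.
  rewrite [X in tends _ _ X](_ : 0 = 0 + (-1) *: (lmul h ** 0)); last first.
    by rewrite smulx0 scaler0 addr0.
  by apply: tendsD => //; apply: tendsZ; exact: tends_smull.
have K0 : 0 <= K by rewrite (le_trans _ (SK 0%N)) ?cn_ge0.
have d2 : 0 < d / 2 by rewrite divr_gt0.
have d4 : 0 < d / 8 / kp by rewrite !divr_gt0.
have d5 : 0 < d / 8 / (K + 1) by rewrite !divr_gt0// ltr_wpDl.
have [n1 hn1] := ZSt _ d4; have [n2 hn2] := QS _ d5.
pose j := maxn n1 n2.
(* [T] combines the part of kp h outside the previous ranges with a far shift S_j. The cross terms
   [W] are small, so T^* T stays above d / 2 and T (T^* T)^(-1/2) is an isometry. *)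
have [T TE] : exists T : M, T = kp%:c *: Z + q ** S j by exists (kp%:c *: Z + q ** S j).
have ZSj : N (star Z ** S j) <= d / 8 / kp by rewrite -(subr0 (_ ** _)) hn1// leq_maxl.
have QSj : N (range_proj f n ** S j) <= d / 8 / (K + 1).
  by rewrite -(subr0 (_ ** _)) hn2// leq_maxr.
have qZ : q ** Z = Z by rewrite ZE smulA qq.
have Zq : star Z ** q = star Z by rewrite ZS -smulA qq.
have qT : q ** T = T by rewrite TE smulDr smulZr qZ smulA qq.
have Tq : star T ** q = star T by rewrite -{2}qT starM qs.
pose W := kp%:c *: (star Z ** S j + star (star Z ** S j)) -
  star (S j) ** range_proj f n ** S j.
have Ws : star W = W.
  rewrite /W starB starZr starD starK; congr (_ *: _ - _); first exact: addrC.
  by rewrite !starM starK range_proj_sa smulA.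
have TT : star T ** T = (kp ^+ 2)%:c *: (star Z ** Z) + star (S j) ** S j + W.
  rewrite {2}TE smulDr smulZr smulA Tq TE starD starZr starM qs !smulDl !smulZl.
  rewrite -!(smulA (star (S j))) qZ qE smulBr /W starM starK -smulA.
  by lmod (adj E); ring.
have WN : N W <= d / 2.
  rewrite /W (le_trans (cnBD _ _ _))// cn_real gtr0_norm//.
  have h1 := cnD N (star Z ** S j) (star (star Z ** S j)).
  rewrite cn_star in h1.
  have h2 : N (star (S j) ** range_proj f n ** S j) <= K * (d / 8 / (K + 1)).
    rewrite -smulA (le_trans (cnM _ _ _))// cn_star ler_pM ?cn_ge0//.
  have h3 : K * (d / 8 / (K + 1)) <= d / 8.
    rewrite mulrA ler_pdivrMr ?ltr_wpDl//; nra.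
  have h4 : kp * (d / 8 / kp) = d / 8 by field; rewrite gt_eqF.
  have : kp * N (star Z ** S j + star (star Z ** S j)) <= kp * (d / 8 / kp + d / 8 / kp).
    by rewrite ler_pM2l//; lra.
  by rewrite mulrDr h4; lra.
have pT : pos N (star T ** T - sc (d / 2)).
  have -> : star T ** T - sc (d / 2) = (kp ^+ 2)%:c *: (star Z ** Z) +
      (star (S j) ** S j - sc d) + (W + sc (d / 2)).
    rewrite TT; have -> : d%:c = (d / 2)%:c + (d / 2)%:c :> R[i].
      by rewrite -rmorphD -splitr.
    by lmod (adj E); ring.
  apply: posD; last exact: pos_norm_add.
  by apply: posD => //; apply: posZ; [exact: sqr_ge0|exact: pos_star_smul].
have [k [ks kTk kkT]] := pos_inv_sqrt d2 pT.
have qt : q ** (T ** k) = T ** k by rewrite smulA qT.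
have fT i : (i < n)%N -> star (f i) ** T = 0.
  by move=> /fq fiq; rewrite -qT smulA fiq smul0x.
exists (T ** k); split.
- apply: (@tends_ext _ _ _ (fun m => k ** (kp%:c *: (star Z ** S m) +
     (star (S j) ** S m + (-1) *: (star (S j) ** (range_proj f n ** S m)))))).
    move=> m; rewrite starM ks -smulA; congr (_ ** _).
    rewrite TE starD starZr starM qs smulDl smulZl -(smulA _ q) qE smulBr.
    by rewrite scaleN1r.
  have -> : 0 = k ** (kp%:c *: 0 + (0 + (-1) *: (star (S j) ** 0))) :> M.
    by rewrite smulx0 !scaler0 !addr0 smulx0.
  apply: tends_smull; apply: tendsD; first exact: tendsZ.
  by apply: tendsD => //; apply: tendsZ; exact: tends_smull.
- by rewrite starM ks !smulA -(smulA k (star T)).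
- by move=> i /fT fiT; rewrite smulA fiT smul0x.
have [t tE] : exists t : M, t = T ** k by exists (T ** k).
rewrite -tE; rewrite -tE in qt.
have [p pE] : exists p : M, p = q - t ** star t by exists (q - t ** star t).
have tt : star t ** t = 1e by rewrite tE starM ks !smulA -(smulA k (star T)).
have tq : star t ** q = star t by rewrite -{2}qt starM qs.
have ps : star p = p by rewrite pE starB starM starK qs.
have pq : p ** q = p by rewrite pE smulBl qq -smulA tq.
have pp : p ** p = p.
  have pt : p ** t = 0 by rewrite pE smulBl qt -smulA tt (smulx1 N) subrr.
  by rewrite {2}pE smulBr pq smulA pt smul0x subr0.
have pT0 : p ** T = 0.
  rewrite pE smulBl qT tE starM ks.
  have -> : T ** k ** (k ** star T) ** T = T ** (k ** k ** (star T ** T)).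
    by rewrite !smulA.
  rewrite kkT (smulx1 N).
  by rewrite subrr.
(* The projection [p] annihilates T = kp Z + q S_j, hence p Z = - p S_j / kp, small for large kp. *)
have pZ : p ** lmul h = (- kp^-1)%:c *: (p ** S j).
  have -> : p ** lmul h = p ** Z by rewrite ZE smulA pq.
  have : p ** Z = (kp^-1)%:c *: (p ** T - p ** (q ** S j)).
    rewrite -smulBr TE addrK smulZr scalerA -rmorphM/= mulVf ?gt_eqF// rmorph1.
    by rewrite scale1r.
  by move=> ->; rewrite pT0 sub0r smulA pq scalerN rmorphN scaleNr.
have kpV : 0 <= kp^-1 by rewrite invr_ge0 ltW.
rewrite -pE pZ cn_real normrN ger0_norm// [leRHS]mulrC ler_wpM2l//.
rewrite (le_trans (cnM _ _ _))// (le_trans _ (SK j))// ler_piMl ?cn_ge0//.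
exact: proj_norm_le1.
Qed.

(** At stage n the multiple kp = (K + 1) 2^n leaves a remainder of norm at most 2^-n on h. Multiples
    of h are dense, so the range projections tend strongly to 1. *)
Lemma isometry_decomposition : exists s : nat -> M,
  (forall n, orthonormal s n) /\ forall x, tends n_ (fun n => range_proj s n x) x.
Proof.
have K0 : 0 <= K by rewrite (le_trans _ (SK 0%N)) ?cn_ge0.
pose good (l : seq M) := orthonormal (nth 0 l) (size l) /\
  forall i, (i < size l)%N -> asymp (nth 0 l i).
(* [P] is conditional on [good] because [history_choice] asks for a value after every list; the
   sequence obtained has only good prefixes, by induction. *)
pose P (l : seq M) t := good l -> [/\ asymp t, star t ** t = 1e,
  forall i, (i < size l)%N -> star (nth 0 l i) ** t = 0 &
  N ((1e - range_proj (nth 0 l) (size l) - t ** star t) ** lmul h) <= w ^+ size l].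
have [l|s sP] := @history_choice M P.
  have [[lo la]|nl] := pselect (good l); last by exists 0 => /nl.
  have kp0 : 0 < (K + 1) / w ^+ size l.
    by rewrite divr_gt0 ?exprn_gt0 ?invr_gt0// ltr_wpDl.
  have [t [t1 t2 t3 t4]] := extend_isometries kp0 lo la; exists t => _; split => //.
  rewrite (le_trans t4)// invf_div mulrA ler_pdivrMr ?ltr_wpDl// mulrC.
  by rewrite ler_wpM2l ?half_ge0// lerDl.
have nthE n i : (i < n)%N -> nth 0 (mkseq s n) i = s i by exact: nth_mkseq.
have goodP n : orthonormal s n -> (forall i, (i < n)%N -> asymp (s i)) -> good (mkseq s n).
  move=> so sa; split; rewrite size_mkseq => i.
    by move=> j ni nj; rewrite !nthE// so.
  by move=> ni; rewrite nthE//; exact: sa.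
have projE n : range_proj (nth 0 (mkseq s n)) n = range_proj s n.
  by rewrite /range_proj !big_nat; apply: eq_bigr => i /andP[_ ni]; rewrite !nthE.
have so n : orthonormal s n /\ forall i, (i < n)%N -> asymp (s i).
  elim: n => [|n [so sa]]; first by split.
  have [t1 t2 t3 _] := sP n (goodP n so sa); rewrite size_mkseq in t3.
  have {}t3 i : (i < n)%N -> star (s i) ** s n = 0.
    by move=> ni; rewrite -(t3 i ni) nthE.
  split=> [i j|i]; rewrite !ltnS.
    rewrite (leq_eqVlt i n) (leq_eqVlt j n) => /predU1P[->|ni] /predU1P[->|nj].
    - by rewrite eqxx.
    - rewrite gtn_eqF//; apply: (can_inj starK).
      by rewrite starM starK t3// star0.
    - by rewrite ltn_eqF// t3.
    - exact: so.
  by rewrite leq_eqVlt => /predU1P[->//|]; exact: sa.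
exists s; split => [n|x e e0]; first by have [] := so n.
have e2 : 0 < e / 2 by rewrite divr_gt0.
have [y hy] := strictly_positive_dense x hc e2.
have e3 : 0 < e / 2 / (rnorm y + 1) by rewrite divr_gt0// ltr_wpDl// rnorm_ge0.
have [n hn] := half_small e3; exists n.+1 => -[//|m]; rewrite ltnS => nm.
have [so1 so2] := so m; have [_ _ _ hm] := sP m (goodP m so1 so2).
rewrite size_mkseq projE -addrA -opprD -range_projS in hm.
have [_ _ q1 _] := one_sub_range (so m.+1).1.
rewrite -[n_ _]/(rnorm _) rnormB; set q := 1e - _ in hm q1.
have -> : x - range_proj s m.+1 x = q (x - h ** y) + (q ** lmul h) y.
  by rewrite mulE_adj lmulE -adjD subrK /q subE_adj.
rewrite (le_trans (rnormD _ _))// (splitr e) lerD// (le_trans (le_adj_norm _ _))//.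
  rewrite rnormB (le_trans _ hy)// ler_piMl ?rnorm_ge0//.
rewrite (le_trans (ler_wpM2r (rnorm_ge0 _) hm))//.
rewrite (le_trans (ler_wpM2r (rnorm_ge0 _) (hn m nm)))// mulrAC ler_pdivrMr.
  by rewrite ler_wpM2l ?lerDl// ltW.
by rewrite ltr_wpDl// rnorm_ge0.
Qed.

End isometries.

(** * The standard Hilbert space *)

Section complex_norm.
Context {R : realType}.
Implicit Types a b : R[i].

Lemma cabs_eq0 a : cabs a = 0 -> a = 0.
Proof. by move=> h; apply/eqP; rewrite -normr_eq0 cabsE h. Qed.

Lemma cabs_sum I (r : seq I) (P : pred I) (F : I -> R[i]) :
  cabs (\sum_(i <- r | P i) F i) <= \sum_(i <- r | P i) cabs (F i).
Proof.
elim/big_rec2: _ => [|i y x _ h]; first by rewrite cabs0.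
by rewrite (le_trans (cabsD _ _))// lerD2l.
Qed.

Lemma cabs_Re a : `|complex.Re a| <= cabs a.
Proof. by rewrite -lecR -cabsE; exact: normc_ge_Re. Qed.

Lemma cabs_Im a : `|complex.Im a| <= cabs a.
Proof.
have := cabs_Re (- 'i%C * a); rewrite cabsM cabsN cabs_i mul1r.
by case: a => x y /=; rewrite !(mul0r, mulN1r, oppr0, sub0r, opprK, add0r, mulNr, mul1r).
Qed.

Lemma cabs_ReIm a : cabs a <= `|complex.Re a| + `|complex.Im a|.
Proof.
case: a => x y /=; have -> : (x +i* y)%C = x%:c + 'i%C * y%:c.
  by apply/eqP; rewrite eq_complex/= !(mul0r, mul1r, addr0, add0r, mulr0, subr0) !eqxx.
by rewrite (le_trans (cabsD _ _))// cabsM cabs_i mul1r !cabs_real.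
Qed.

Fact complex_complete (u : nat -> R[i]) :
  (forall e, 0 < e -> exists n, forall m, (n <= m)%N -> cabs (u m - u n) <= e) ->
  exists l, forall e, 0 < e -> exists n, forall m, (n <= m)%N -> cabs (u m - l) <= e.
Proof.
move=> cu.
have real (v : nat -> R) : (forall m n, `|v m - v n| <= cabs (u m - u n)) ->
    exists l, forall e, 0 < e -> exists n, forall m, (n <= m)%N -> `|v m - l| <= e.
  move=> vu; have : cvg (v n @[n --> \oo]).
    apply: cauchy_cvg; apply: cauchy_exP => e e0.
    have e2 : 0 < e / 2 by rewrite divr_gt0.
    have [n hn] := cu _ e2; exists (v n); exists n => // m /hn h.
    by rewrite /= -ball_normE/= distrC (le_lt_trans (vu _ _))//; lra.
  set l := lim _ => vl; exists l => e e0.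
  have /cvgrPdist_le/(_ e e0)[n _ hn] := vl.
  by exists n => m /hn; rewrite /= distrC.
have [|a ha] := real (fun n => complex.Re (u n)).
  by move=> m n; rewrite -raddfB cabs_Re.
have [|b hb] := real (fun n => complex.Im (u n)).
  by move=> m n; rewrite -raddfB cabs_Im.
exists (a +i* b)%C => e e0; have e2 : 0 < e / 2 by rewrite divr_gt0.
have [n hn] := ha _ e2; have [k hk] := hb _ e2; exists (maxn n k) => m.
rewrite geq_max => /andP[/hn h1 /hk h2]; rewrite (le_trans (cabs_ReIm _))//.
by rewrite !raddfB/=; lra.
Qed.

Fact complex_cstar a : cabs (conjC a * a) = cabs a ^+ 2.
Proof. by rewrite cabsM cabs_conj expr2. Qed.

Definition complex_cnorm : cnorm R[i]^o :=
  @CNorm R R[i]^o cabs cabsD cabsM cabs_eq0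
    (fun a b => eq_ind_r (fun t => t <= _) (lexx _) (cabsM a b)) complex_cstar complex_complete.

Lemma cabs_pos_real (r : R) : 0 <= r -> cabs r%:c = r.
Proof. by move=> r0; rewrite cabs_real ger0_norm. Qed.

End complex_norm.

Section square_sums.
Context {R : realType} (I : Type) (s : seq I).
Implicit Types x y : I -> R.

(** Bounds a > A and b > B allow division; the weighted inequality between arithmetic and geometric
    means with weights b / a and a / b applies, and a limit recovers A and B. *)
Lemma cauchy_schwarz x y A B : 0 <= A -> 0 <= B ->
  \sum_(i <- s) x i ^+ 2 <= A ^+ 2 -> \sum_(i <- s) y i ^+ 2 <= B ^+ 2 ->
  \sum_(i <- s) x i * y i <= A * B.
Proof.
move=> A0 B0 hx hy; suff h a b : A < a -> B < b -> \sum_(i <- s) x i * y i <= a * b.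
  apply/ler_addgt0Pl => e e0; pose d := Num.min 1 (e / (A + B + 1)).
  have AB : 0 < A + B + 1 by rewrite ltr_wpDl// addr_ge0.
  have d0 : 0 < d by rewrite lt_min ltr01 divr_gt0.
  have d1 : d <= 1 by rewrite ge_min lexx.
  have d2 : d * (A + B + 1) <= e by rewrite -ler_pdivlMr// ge_min lexx orbT.
  have := h (A + d) (B + d); rewrite !ltrDl => /(_ d0 d0); nra.
move=> Aa Bb; have a0 : 0 < a by exact: le_lt_trans Aa.
have b0 : 0 < b by exact: le_lt_trans Bb.
apply: (@le_trans _ _ (\sum_(i <- s) (b / a / 2 * x i ^+ 2 + a / b / 2 * y i ^+ 2))).
  apply: ler_sum => i _; rewrite -subr_ge0.
  have -> : b / a / 2 * x i ^+ 2 + a / b / 2 * y i ^+ 2 - x i * y i =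
     (b * x i - a * y i) ^+ 2 / (2 * a * b) by field; rewrite !gt_eqF.
  by rewrite divr_ge0 ?sqr_ge0// !mulr_ge0// ltW.
rewrite big_split/= -!mulr_sumr.
have x2 : \sum_(i <- s) x i ^+ 2 <= a ^+ 2.
  by rewrite (le_trans hx)// lerXn2r ?nnegrE// ltW.
have y2 : \sum_(i <- s) y i ^+ 2 <= b ^+ 2.
  by rewrite (le_trans hy)// lerXn2r ?nnegrE// ltW.
have c1 : 0 <= b / a / 2 by rewrite !divr_ge0// ltW.
have c2 : 0 <= a / b / 2 by rewrite !divr_ge0// ltW.
rewrite (le_trans (lerD (ler_wpM2l c1 x2) (ler_wpM2l c2 y2)))// le_eqVlt.
by apply/orP; left; apply/eqP; field; rewrite !gt_eqF.
Qed.

Lemma minkowski x y A B : 0 <= A -> 0 <= B ->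
  \sum_(i <- s) x i ^+ 2 <= A ^+ 2 -> \sum_(i <- s) y i ^+ 2 <= B ^+ 2 ->
  \sum_(i <- s) (x i + y i) ^+ 2 <= (A + B) ^+ 2.
Proof.
move=> A0 B0 hx hy; have hxy := cauchy_schwarz A0 B0 hx hy.
have -> : \sum_(i <- s) (x i + y i) ^+ 2 = \sum_(i <- s) x i ^+ 2 +
   (2 * \sum_(i <- s) x i * y i + \sum_(i <- s) y i ^+ 2).
  by rewrite mulr_sumr -!big_split/=; apply: eq_bigr => i _; ring.
by rewrite !expr2 in hx hy *; lra.
Qed.

End square_sums.

Section l2_space.
Context {R : realType}.
Implicit Types x y : nat -> R[i]^o.

Definition psq x n : R := \sum_(0 <= k < n) cabs (x k) ^+ 2.

Lemma psq_ge0 x n : 0 <= psq x n.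
Proof. by apply: sumr_ge0 => i _; exact: sqr_ge0. Qed.

Lemma psq_mono x m n : (m <= n)%N -> psq x m <= psq x n.
Proof.
move=> mn; rewrite /psq (@big_cat_nat _ _ _ m 0 n)//= lerDl.
by apply: sumr_ge0 => i _; exact: sqr_ge0.
Qed.

Lemma psqZ c x n : psq (c *: x) n = cabs c ^+ 2 * psq x n.
Proof. by rewrite /psq mulr_sumr; apply: eq_bigr => i _; rewrite -exprMn -cabsM. Qed.

Lemma psqD x y n A B : 0 <= A -> 0 <= B -> psq x n <= A ^+ 2 -> psq y n <= B ^+ 2 ->
  psq (x + y) n <= (A + B) ^+ 2.
Proof.
move=> A0 B0 hx hy; apply: le_trans (minkowski A0 B0 hx hy).
apply: ler_sum => i _; rewrite lerXn2r ?nnegrE ?addr_ge0 ?cabs_ge0//.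
exact: cabsD.
Qed.

Definition l2_pred : {pred (nat -> R[i]^o)} :=
  fun x => `[< exists2 C, 0 <= C & forall n, psq x n <= C ^+ 2 >].

Fact l2_submod : submod_closed l2_pred.
Proof.
split.
  apply/asboolP; exists 0 => // n; rewrite /psq big1 ?sqr_ge0// => i _.
  by rewrite [(0 : nat -> _) i]/0 cabs0 expr0n.
move=> c x y /asboolP[A A0 xA] /asboolP[B B0 yB]; apply/asboolP.
exists (cabs c * A + B); first by rewrite addr_ge0// mulr_ge0// cabs_ge0.
move=> n; apply: psqD => //; first by rewrite mulr_ge0// cabs_ge0.
by rewrite psqZ exprMn ler_wpM2l// sqr_ge0.
Qed.

HB.instance Definition _ := GRing.isSubmodClosed.Build R[i] (nat -> R[i]^o) l2_pred
  (GRing.submod_closed_semi l2_submod).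

Record l2 := L2 {l2_val : nat -> R[i]^o; l2_valP : l2_val \in l2_pred}.

HB.instance Definition _ := [isSub for l2_val].
HB.instance Definition _ := [Choice of l2 by <:].
HB.instance Definition _ := [SubChoice_isSubLmodule of l2 by <:].

End l2_space.
Arguments l2 R : clear implicits.

Section l2_norm.
Context {R : realType}.
Implicit Types x y z : l2 R.

Definition l2norm x : R := Num.sqrt (sup [set psq (val x) n | n in setT]).

Lemma l2_has_sup x : has_sup [set psq (val x) n | n in setT].
Proof.
split; first by exists (psq (val x) 0); exists 0%N.
have /asboolP[C _ xC] := valP x; exists (C ^+ 2) => _ [n _ <-]; exact: xC.
Qed.

Lemma l2norm_ge0 x : 0 <= l2norm x. Proof. exact: sqrtr_ge0. Qed.

Lemma l2norm_sqr x : l2norm x ^+ 2 = sup [set psq (val x) n | n in setT].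
Proof.
rewrite sqr_sqrtr// (le_trans (psq_ge0 (val x) 0))//.
by apply: sup_upper_bound; [exact: l2_has_sup|exists 0%N].
Qed.

Lemma psq_le x n : psq (val x) n <= l2norm x ^+ 2.
Proof. by rewrite l2norm_sqr; apply: sup_upper_bound; [exact: l2_has_sup|exists n]. Qed.

Lemma l2norm_le x A : 0 <= A -> (forall n, psq (val x) n <= A ^+ 2) -> l2norm x <= A.
Proof.
move=> A0 xA; apply: ler_of_sqr => //; rewrite l2norm_sqr.
by apply: sup_le_ub; [by have [] := l2_has_sup x|move=> _ [n _ <-]; exact: xA].
Qed.

Lemma psq_tends x e : 0 < e -> exists n, forall m, (n <= m)%N ->
  l2norm x ^+ 2 - psq (val x) m <= e.
Proof.
move=> e0; have [_ [n _ <-] hn] := sup_adherent e0 (l2_has_sup x).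
exists n => m nm; have := psq_mono (val x) nm.
by move: hn; rewrite -l2norm_sqr; lra.
Qed.

Lemma cabs_l2 x k : cabs (val x k) <= l2norm x.
Proof.
apply: ler_of_sqr; first exact: l2norm_ge0.
apply: le_trans (psq_le x k.+1); rewrite /psq big_nat_recr//= lerDr.
exact: psq_ge0.
Qed.

Fact l2normD x y : (l2norm (x + y))%:c <= (l2norm x)%:c + (l2norm y)%:c :> R[i].
Proof.
rewrite -rmorphD lecR; apply: l2norm_le => [|n]; first by rewrite addr_ge0// l2norm_ge0.
by apply: psqD; rewrite ?l2norm_ge0// psq_le.
Qed.

Fact l2normZ (c : R[i]) x : (l2norm (c *: x))%:c = `|c| * (l2norm x)%:c :> R[i].
Proof.
have le d y : l2norm (d *: y) <= cabs d * l2norm y.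
  apply: l2norm_le => [|n]; first by rewrite mulr_ge0 ?l2norm_ge0 ?cabs_ge0.
  by rewrite psqZ exprMn ler_wpM2l ?sqr_ge0// psq_le.
rewrite cabsE -rmorphM; congr (_%:c).
apply/eqP; rewrite eq_le le/=; have [->|c0] := eqVneq c 0.
  by rewrite cabs0 mul0r l2norm_ge0.
have := le c^-1 (c *: x); rewrite scalerA mulVf// scale1r => h.
have cc : cabs c * cabs c^-1 = 1 by rewrite -cabsM divff// cabs1.
by rewrite (le_trans (ler_wpM2l (cabs_ge0 _) h))// mulrA cc mul1r.
Qed.

Fact l2norm_eq0 x : (l2norm x)%:c = 0 :> R[i] -> x = 0.
Proof.
move=> /(@complexI R) x0; apply/val_inj/funext => k; apply: cabs_eq0; apply/eqP.
by rewrite eq_le cabs_ge0 andbT -x0 cabs_l2.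
Qed.

HB.instance Definition _ := Lmodule_isNormed.Build R[i] (l2 R) l2normD l2normZ l2norm_eq0.

Lemma rnorm_l2 x : rnorm x = l2norm x. Proof. by []. Qed.

End l2_norm.

Section l2_complete.
Context {R : realType}.
Implicit Types x y z : l2 R.
Local Notation w := (2^-1 : R).

Lemma psq_coord (u : nat -> nat -> R[i]^o) (l : nat -> R[i]^o) N e :
  (forall k, tends complex_cnorm (fun n => u n k) (l k)) -> 0 < e ->
  exists n, forall m, (n <= m)%N -> psq (u m - l) N <= e.
Proof.
move=> ul; elim: N e => [|N IH] e e0.
  by exists 0%N => m _; rewrite /psq big_geq// ltW.
have e2 : 0 < e / 2 by rewrite divr_gt0.
have s0 : 0 < Num.sqrt (e / 2) by rewrite sqrtr_gt0.
have [n hn] := IH _ e2; have [k hk] := ul N _ s0; exists (maxn n k) => m.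
rewrite geq_max => /andP[/hn h1 /hk h2].
rewrite /psq big_nat_recr//= (splitr e) lerD//.
rewrite -[leRHS]sqr_sqrtr ?(ltW e2)//.
by rewrite lerXn2r ?nnegrE ?cabs_ge0 ?sqrtr_ge0.
Qed.

(** A Cauchy filter contains balls of radius 2^-n. Their centres converge coordinatewise, and
    partial square sums carry the bounds over to the limit. *)
Fact l2_complete (F : set_system (l2 R)) : ProperFilter F -> cauchy F -> cvg F.
Proof.
move=> FF Fc.
have aux1 (a b p q r : R) : r <= a + b -> a < q -> b < p -> q <= p -> r <= 2 * p.
  by move=> *; lra.
have aux2 (a b p e : R) : a <= 3 * p -> b < p -> p <= e / 5 -> 0 < e -> a + b < e.
  by move=> *; lra.
have w0 n : 0 < (w ^+ n)%:c :> R[i] by rewrite ltcR exprn_gt0// invr_gt0.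
have [x xF] := choice (fun n => (cauchyP F).1 Fc _ (w0 n)).
have xB n y : ball (x n) (w ^+ n)%:c y = (l2norm (x n - y) < w ^+ n).
  by rewrite -ball_normE/= ltcR.
have xx n m : (n <= m)%N -> l2norm (x m - x n) <= 2 * w ^+ n.
  move=> nm; have [y []] := filter_ex (filterI (xF n) (xF m)).
  rewrite !xB => h1 h2; rewrite -!rnorm_l2 in h1 h2 *.
  have := rnormD (x m - y) (y - x n); rewrite subrKA (rnormB y).
  by move=> h; exact: aux1 h h2 h1 (@half_mono R _ _ nm).
have coord k : cauchy_cn complex_cnorm (fun n => val (x n) k).
  move=> e e0; have e2 : 0 < e / 2 by rewrite divr_gt0.
  have [n hn] := half_small e2; exists n => m nm.
  rewrite (_ : _ - _ = val (x m - x n) k)// (le_trans (cabs_l2 _ _))//.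
  rewrite (le_trans (xx n m nm))//; have := hn n (leqnn _); lra.
have [l lP] := choice (fun k => cauchy_tends (coord k)).
have xl n N : psq (val (x n) - l) N <= (3 * w ^+ n) ^+ 2.
  have e0 : 0 < (w ^+ n) ^+ 2 by rewrite !exprn_gt0// invr_gt0.
  have [k hk] := psq_coord N lP e0; have := hk _ (leq_maxr n k).
  set m := maxn n k => h.
  have -> : val (x n) - l = (-1) *: (val (x m - x n)) + (val (x m) - l).
    by apply/funext => j; rewrite scaleN1r opprB addrA subrK.
  have -> : 3 * w ^+ n = 2 * w ^+ n + w ^+ n by ring.
  apply: psqD => //; rewrite ?mulr_ge0 ?half_ge0//.
  rewrite psqZ cabsN cabs1 expr1n mul1r (le_trans (psq_le _ _))//.
  by rewrite lerXn2r ?nnegrE ?l2norm_ge0 ?mulr_ge0 ?half_ge0// xx// leq_maxl.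
have ll : l \in l2_pred.
  apply/asboolP; exists (3 * w ^+ 0 + l2norm (x 0%N)).
    by rewrite addr_ge0 ?l2norm_ge0// mulr_ge0// half_ge0.
  move=> n; have -> : l = (-1) *: (val (x 0%N) - l) + val (x 0%N).
    by apply/funext => j; rewrite scaleN1r opprB subrK.
  apply: psqD; rewrite ?l2norm_ge0 ?mulr_ge0 ?half_ge0 ?psq_le//.
  by rewrite psqZ cabsN cabs1 expr1n mul1r.
apply/cvg_ex; exists (L2 ll); apply/cvg_ballP => e /pos_complex[eE e0].
have e4 : 0 < complex.Re e / 5 by rewrite divr_gt0.
have [n hn] := half_small e4; apply: filterS (xF n) => y; rewrite xB => h.
rewrite -ball_normE/= eE ltcR.
have h3 : l2norm (x n - L2 ll) <= 3 * w ^+ n.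
  by apply: l2norm_le; [rewrite mulr_ge0// half_ge0|exact: xl].
rewrite -!rnorm_l2 in h h3.
have h5 := rnormD (L2 ll - x n) (x n - y).
rewrite subrKA in h5; rewrite rnormB in h3; apply: (le_lt_trans h5).
exact: aux2 h3 h (hn n (leqnn n)) e0.
Qed.

HB.instance Definition _ := Uniform_isComplete.Build (l2 R) l2_complete.

Definition ip x y n : R[i]^o := \sum_(0 <= k < n) val x k * conjC (val y k).

Lemma ip_cauchy x y : cauchy_cn complex_cnorm (ip x y).
Proof.
move=> e e0; have [n hn] := psq_tends x e0; have [k hk] := psq_tends y e0.
exists (maxn n k) => m nm; have kk : (maxn n k <= m)%N by [].
rewrite /ip (@big_cat_nat _ _ _ (maxn n k) 0 m)//= addrAC subrr add0r.
rewrite (le_trans (cabs_sum _ _ _))//.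
apply: (@le_trans _ _ (\sum_(maxn n k <= i < m)
    (cabs (val x i) ^+ 2 / 2 + cabs (val y i) ^+ 2 / 2))).
  apply: ler_sum => i _; rewrite cabsM cabs_conj.
  by have := sqr_ge0 (cabs (val x i) - cabs (val y i)); rewrite !expr2; lra.
have tail (z : l2 R) : l2norm z ^+ 2 - psq (val z) (maxn n k) <= e ->
    \sum_(maxn n k <= i < m) cabs (val z i) ^+ 2 <= e.
  apply: le_trans; have := psq_le z m.
  by rewrite /psq (@big_cat_nat _ _ _ (maxn n k) 0 m)//=; lra.
rewrite big_split/= -!mulr_suml.
have := tail x (hn _ (leq_maxl _ _)); have := tail y (hk _ (leq_maxr _ _)); lra.
Qed.

Definition l2_inner x y : R[i] := sval (cid (cauchy_tends (ip_cauchy x y))).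

Lemma l2_innerP x y : tends complex_cnorm (ip x y) (l2_inner x y).
Proof. by rewrite /l2_inner; case: cid. Qed.

Lemma l2_inner_eq x y l : tends complex_cnorm (ip x y) l -> l2_inner x y = l.
Proof. exact/tends_uniq/l2_innerP. Qed.

Fact l2_hermitian x y : l2_inner x y = (-1) ^+ false * conjC (l2_inner y x).
Proof.
rewrite expr0 mul1r; apply: l2_inner_eq.
apply: (tends_ext _ (tends_star (l2_innerP y x))) => n.
rewrite [LHS]rmorph_sum; apply: eq_bigr => k _.
by rewrite -[LHS]/(conjC (val y k * conjC (val x k))) rmorphM/= conjCK mulrC.
Qed.

Fact l2_linearl y : linear_for *%R (fun x => l2_inner x y).
Proof.
move=> c x z; apply: l2_inner_eq.
have := tendsD (@tendsZ _ _ complex_cnorm c _ _ (l2_innerP x y)) (l2_innerP z y).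
apply: tends_ext => n; rewrite scaler_sumr -big_split/=; apply: eq_bigr => k _.
rewrite (_ : val (c *: x + z) k = c * val x k + val z k)// mulrDl.
by congr (_ + _); exact: mulrA.
Qed.

Fact l2_linearr x : linear_for (conjC \; *%R) (l2_inner x).
Proof.
move=> c y z; rewrite l2_hermitian l2_linearl rmorphD rmorphM/= mulrDr.
by rewrite !expr0 !mul1r [l2_inner x y]l2_hermitian [l2_inner x z]l2_hermitian !expr0 !mul1r.
Qed.

Fact l2_bilinear : bilinear_for *%R (conjC \; *%R) l2_inner.
Proof. by split=> [y|x]; [exact: l2_linearl|exact: l2_linearr]. Qed.

Lemma l2_inner_norm x : (l2norm x)%:c ^+ 2 = l2_inner x x.
Proof.
apply/esym/l2_inner_eq => e /(psq_tends x)[n hn]; exists n => m nm.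
have -> : ip x x m = (psq (val x) m)%:c.
  rewrite [RHS](rmorph_sum (real_complex R)); apply: eq_bigr => k _.
  exact/esym/cabs_sqr.
rewrite -[complex_cnorm _]/(cabs _) -rmorphXn -rmorphB cabs_real distrC.
rewrite ger0_norm; first exact: hn.
by rewrite subr_ge0 psq_le.
Qed.

Fact l2_positive x : x != 0 -> 0 < l2_inner x x.
Proof.
move=> x0; rewrite -l2_inner_norm -rmorphXn ltcR exprn_gt0//.
rewrite lt_neqAle l2norm_ge0 andbT eq_sym; apply: contra x0 => /eqP x0.
by apply/eqP/l2norm_eq0; rewrite x0.
Qed.

HB.instance Definition _ := bilinear_isBilinear.Build R[i] (l2 R) (l2 R) R[i]
  *%R (conjC \; *%R) l2_inner l2_bilinear.
HB.instance Definition _ :=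
  isHermitianSesquilinear.Build R[i] (l2 R) false conjC l2_inner l2_hermitian.
HB.instance Definition _ := isDotProduct.Build R[i] (l2 R) l2_inner l2_positive.

Definition l2H : hilbertType R := @HilbertType R (l2 R) l2_inner l2_inner_norm.

End l2_complete.
Arguments l2H R : clear implicits.

Section l2_basis.
Context {R : realType}.
Implicit Types x y : l2 R.
Local Notation nl := (@l2norm R).

Lemma l2normB x y : nl (x - y) = nl (y - x).
Proof. by rewrite -!rnorm_l2 rnormB. Qed.

Lemma l2normZE c x : nl (c *: x) = cabs c * nl x.
Proof. by rewrite -!rnorm_l2 rnormZ. Qed.

Lemma l2norm_triangle x y : nl (x + y) <= nl x + nl y.
Proof. by rewrite -!rnorm_l2 rnormD. Qed.

Definition l2_seq (n : nat) (f : nat -> R[i]) : nat -> R[i]^o :=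
  fun k => if (k < n)%N then f k else 0.

Lemma psq_l2_seq n f m : psq (l2_seq n f) m <= psq f n.
Proof.
have [mn|/ltnW nm] := leqP m n.
  apply: le_trans (psq_mono _ mn); rewrite /psq; apply: ler_sum => k _.
  by rewrite /l2_seq; case: ifP => // _; rewrite cabs0 expr0n sqr_ge0.
rewrite /psq (@big_cat_nat _ _ _ n 0 m)//= [X in _ + X]big_nat [X in _ + X]big1 ?addr0.
  by rewrite !big_nat; apply: ler_sum => k /andP[_ kn]; rewrite /l2_seq kn.
by move=> k /andP[nk _]; rewrite /l2_seq ltnNge nk cabs0 expr0n.
Qed.

Fact l2_seq_pred n f : l2_seq n f \in l2_pred.
Proof.
apply/asboolP; exists (Num.sqrt (psq f n)); first exact: sqrtr_ge0.
by move=> m; rewrite sqr_sqrtr ?psq_ge0// psq_l2_seq.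
Qed.

Definition fin_l2 n f : l2 R := L2 (l2_seq_pred n f).
Arguments fin_l2 : simpl never.

Lemma fin_l2E n f k : val (fin_l2 n f) k = if (k < n)%N then f k else 0.
Proof. by []. Qed.

(** Sealed together with its coordinates, so that [l2e] does not unfold in later computations. *)
Fact l2e_exists (k : nat) : {x : l2 R | forall i, l2_val x i = (i == k)%:R}.
Proof.
exists (fin_l2 k.+1 (fun i => (i == k)%:R)) => i.
rewrite -[LHS]/(val (fin_l2 k.+1 (fun i => (i == k)%:R)) i) fin_l2E.
have [->|ik] := eqVneq i k; first by rewrite ltnSn.
by case: ifP.
Qed.

Definition l2e (k : nat) : l2 R := sval (l2e_exists k).

Lemma l2eE k i : l2_val (l2e k) i = (i == k)%:R.
Proof. by rewrite /l2e; case: l2e_exists. Qed.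

Lemma l2e_norm k : nl (l2e k) <= 1.
Proof.
apply: l2norm_le => // m; rewrite expr1n.
apply: (le_trans (psq_mono _ (leq_addr k.+1 m))); rewrite /psq.
rewrite (bigD1_seq k) ?mem_index_iota ?iota_uniq ?addnS ?ltnS ?leq_addl//=.
rewrite l2eE eqxx cabs1 expr1n big1 ?addr0// => i /negPf ik.
by rewrite l2eE ik cabs0 expr0n.
Qed.

Lemma l2_innerE x k : l2_inner x (l2e k) = val x k.
Proof.
apply: l2_inner_eq => e e0; exists k.+1 => m km.
rewrite /ip (bigD1_seq k)/= ?mem_index_iota ?iota_uniq// big1 ?addr0.
  by rewrite l2eE eqxx rmorph1 mulr1 subrr cabs0 ltW.
by move=> i /negPf ik; rewrite l2eE ik rmorph0 mulr0.
Qed.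

Definition trunc n x : l2 R := fin_l2 n (val x).
Arguments trunc : simpl never.

Lemma truncE n x k : val (trunc n x) k = if (k < n)%N then val x k else 0.
Proof. by []. Qed.

Lemma trunc_linear n c x y : trunc n (c *: x + y) = c *: trunc n x + trunc n y.
Proof.
apply/val_inj/funext => k.
rewrite -[RHS]/(c * val (trunc n x) k + val (trunc n y) k) !truncE.
by case: ifP => // _; rewrite mulr0 addr0.
Qed.

Lemma truncB n x y : trunc n (x - y) = trunc n x - trunc n y.
Proof. by rewrite addrC -scaleN1r trunc_linear scaleN1r addrC. Qed.

Lemma trunc_norm n x : nl (trunc n x) <= nl x.
Proof.
apply: l2norm_le => [|m]; first exact: l2norm_ge0.
exact: le_trans (psq_l2_seq _ _ _) (psq_le x n).
Qed.

Lemma tail_sqr n x : nl (x - trunc n x) ^+ 2 <= nl x ^+ 2 - psq (val x) n.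
Proof.
have E k : val (x - trunc n x) k = if (k < n)%N then 0 else val x k.
  rewrite -[LHS]/(val x k - val (trunc n x) k) truncE.
  by case: ifP => _; rewrite ?subrr ?subr0.
have h m : psq (val (x - trunc n x)) m <= nl x ^+ 2 - psq (val x) n.
  apply: (le_trans (psq_mono _ (leq_addr n m))); rewrite lerBrDr.
  apply: le_trans (psq_le x (m + n)%N); rewrite le_eqVlt; apply/orP; left; apply/eqP.
  rewrite /psq; under eq_bigr do rewrite E.
  rewrite !(@big_cat_nat _ _ _ n 0 (m + n)) ?leq_addl//=.
  rewrite [X in X + _ + _ = _]big_nat [X in X + _ + _ = _]big1 ?add0r; last first.
    by move=> k /andP[_ kn]; rewrite kn cabs0 expr0n.
  rewrite addrC; congr (_ + _); rewrite [LHS]big_nat [RHS]big_nat.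
  by apply: eq_bigr => k /andP[nk _]; rewrite ltnNge nk.
have t0 : 0 <= nl x ^+ 2 - psq (val x) n by rewrite subr_ge0 psq_le.
rewrite -[leRHS]sqr_sqrtr// lerXn2r ?nnegrE ?sqrtr_ge0 ?l2norm_ge0//.
by apply: l2norm_le => [|m]; rewrite ?sqrtr_ge0// sqr_sqrtr.
Qed.

Lemma trunc_tends x e : 0 < e -> exists n, forall m, (n <= m)%N -> nl (x - trunc m x) <= e.
Proof.
move=> e0; have e2 : 0 < e ^+ 2 by rewrite exprn_gt0.
have [n hn] := psq_tends x e2; exists n => m /hn h.
by apply: ler_of_sqr; [exact: ltW|exact: le_trans (tail_sqr m x) h].
Qed.

Lemma tail_norm n x : nl (x - trunc n x) <= nl x.
Proof.
apply: ler_of_sqr; first exact: l2norm_ge0.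
by rewrite (le_trans (tail_sqr n x))// gerBl psq_ge0.
Qed.

Lemma fin_l2_sum n f : fin_l2 n f = \sum_(0 <= k < n) f k *: l2e k.
Proof.
apply/val_inj/funext => j; rewrite fin_l2E.
have -> : val (\sum_(0 <= k < n) f k *: l2e k) j =
    \sum_(0 <= k < n) f k * l2_val (l2e k) j.
  by elim/big_rec2: _ => // k a b _ <-.
have [jn|nj] := ltnP j n; last first.
  rewrite big_nat big1// => k /andP[_ kn]; rewrite l2eE gtn_eqF ?mulr0//.
  exact: leq_trans kn nj.
rewrite (bigD1_seq j)/= ?mem_index_iota ?iota_uniq// big1 ?addr0.
  by rewrite l2eE eqxx mulr1.
by move=> i /negPf ij; rewrite l2eE eq_sym ij mulr0.
Qed.

Lemma trunc_coord_norm n x : nl (trunc n x) <= \sum_(0 <= k < n) cabs (val x k).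
Proof.
rewrite /trunc fin_l2_sum; elim/big_rec2: _ => [|k a b _ h].
  by rewrite -rnorm_l2 rnorm0.
rewrite (le_trans (l2norm_triangle _ _))// lerD// l2normZE ler_piMr ?cabs_ge0//.
exact: l2e_norm.
Qed.

Lemma l2_separable : separable_set [set: l2 R].
Proof.
pose q (p : rat * rat) : R[i] := (ratr p.1 +i* ratr p.2)%C.
pose g (s : seq (rat * rat)) := fin_l2 (size s) (fun k => q (nth (0, 0) s k)).
exists (range g); split=> //.
  exact: sub_countable (card_image_le _ _) (countableP _).
move=> x _ B /nbhs_ballP[e /pos_complex[eE e0] eB].
have e4 : 0 < complex.Re e / 4 by rewrite divr_gt0.
have [n hn] := trunc_tends x e4; set d := complex.Re e in eE e0 e4 hn.
have n0 : 0 < n%:R + 1 :> R by rewrite ltr_wpDl.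
have dn : 0 < d / 4 / (n%:R + 1) / 2 by rewrite !divr_gt0.
have rat_near (r : R) : exists p : rat, `|r - ratr p| <= d / 4 / (n%:R + 1) / 2.
  have [p pr] := @rat_in_itvoo R r (r + d / 4 / (n%:R + 1) / 2) ltac:(by rewrite ltrDl).
  exists p; move: pr; rewrite in_itv/= => /andP[h1 h2].
  by rewrite distrC ger0_norm; lra.
have qnear z : exists p, cabs (z - q p) <= d / 4 / (n%:R + 1).
  have [p1 h1] := rat_near (complex.Re z); have [p2 h2] := rat_near (complex.Im z).
  exists (p1, p2); rewrite (le_trans (cabs_ReIm _))// !raddfB/=; lra.
have [p pP] := choice qnear.
exists (g (mkseq (fun k => p (val x k)) n)); split; first by exists (mkseq (fun k => p (val x k)) n).
apply: eB; rewrite -ball_normE/= eE ltcR.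
set y := g _.
have h1 : nl (trunc n x - y) <= d / 4.
  apply: l2norm_le => [|m]; first exact: ltW.
  have -> : val (trunc n x - y) = l2_seq n (fun k => val x k - q (p (val x k))).
    apply/funext => k; rewrite -[LHS]/(val (trunc n x) k - val y k) truncE.
    rewrite /y /g fin_l2E /l2_seq size_mkseq; case: ifP => kn; last by rewrite subrr.
    by rewrite nth_mkseq.
  rewrite (le_trans (psq_l2_seq _ _ _))// /psq.
  apply: (@le_trans _ _ (\sum_(0 <= k < n) (d / 4 / (n%:R + 1)) ^+ 2)).
    by apply: ler_sum => k _; rewrite lerXn2r ?nnegrE ?cabs_ge0// divr_ge0 ?ltW.
  have dE : d / 4 = d / 4 / (n%:R + 1) * (n%:R + 1) by rewrite divfK// gt_eqF.
  have aux (N t : R) : 0 <= N -> N * t ^+ 2 <= (t * (N + 1)) ^+ 2.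
    by move=> N0; rewrite exprMn [leRHS]mulrC ler_wpM2r ?sqr_ge0//; nra.
  rewrite big_const_nat subn0 iter_addr_0 -[_ *+ n]mulr_natl.
  have := aux n%:R (d / 4 / (n%:R + 1)) (ler0n _ _).
  by rewrite -dE.
have := l2norm_triangle (x - trunc n x) (trunc n x - y); rewrite subrKA.
have aux (a b c t : R) : b <= t / 4 -> 0 < t / 4 -> a <= t / 4 -> c <= a + b -> c < t by lra.
exact: (aux _ _ _ d h1 e4 (hn n (leqnn _))).
Qed.

Lemma l2_infinite_dim n : exists x : 'I_n -> l2 R, lin_indep x.
Proof.
exists (fun i => l2e i) => c c0 i.
have := congr1 (fun x => val x (i : nat)) c0.
have -> : val (\sum_j c j *: l2e j) (i : nat) = \sum_j c j * l2_val (l2e j) i.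
  by elim/big_rec2: _ => // k a b _ <-.
rewrite (bigD1 i)//= big1 ?addr0; first by rewrite l2eE eqxx mulr1.
by move=> j ji; rewrite l2eE eq_sym -val_eqE in ji *; rewrite (negPf ji) mulr0.
Qed.

Lemma l2_separable_infinite_dim : separable_infinite_dim (l2H R).
Proof. by split; [exact: l2_separable|exact: l2_infinite_dim]. Qed.

End l2_basis.

Section compact_operators.
Context {R : realType}.
Implicit Types x : l2 R -> l2 R.
Local Notation nl := (@l2norm R).

Lemma linear_ball x C : linear x -> 0 <= C -> (forall h, nl h <= 1 -> nl (x h) <= C) ->
  forall h, nl (x h) <= C * nl h.
Proof.
move=> lx C0 xC h; have [h0|h0] := eqVneq (nl h) 0.
  have -> : h = 0 by apply: l2norm_eq0; rewrite h0.
  have -> : x 0 = 0.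
    by have := lx (-1) 0 0; rewrite scaler0 addr0 scaleN1r addNr.
  by rewrite -!rnorm_l2 !rnorm0 mulr0.
have hp : 0 < nl h by rewrite lt_neqAle eq_sym h0 l2norm_ge0.
have := xC ((nl h)^-1%:c *: h); rewrite l2normZE cabs_real gtr0_norm ?invr_gt0// mulVf//.
have -> : x ((nl h)^-1%:c *: h) = (nl h)^-1%:c *: x h.
  have x0 : x 0 = 0 by have := lx (-1) 0 0; rewrite scaler0 addr0 scaleN1r addNr.
  by have := lx (nl h)^-1%:c h 0; rewrite addr0 x0 addr0.
rewrite l2normZE cabs_real gtr0_norm ?invr_gt0// => /(_ (lexx _)).
by rewrite mulrC ler_pdivrMr.
Qed.

Lemma compact_uniform (K : set (l2 R)) (P : nat -> l2 R -> Prop) : compact K ->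
  (forall y, K y -> exists e n, 0 < e /\ forall z m, nl (z - y) <= e -> (n <= m)%N -> P m z) ->
  exists n, forall m y, (n <= m)%N -> K y -> P m y.
Proof.
move=> /compact_near_coveringP/(_ nat \oo P _) h KP.
have [|n _ hn] := h; last by exists n => m y nm; exact: hn.
move=> y /KP[e [n [e0 yP]]].
exists (ball y e%:c, [set m | (n <= m)%N]).
  by split; [apply: nbhsx_ballx; rewrite ltcR|exists n].
move=> [z m] /= [+ nm]; rewrite -ball_normE/= distrC ltcR => /ltW zy.
exact: yP.
Qed.

(** Truncations are contractive and converge pointwise to the identity, hence uniformly on the
    compact closure of the image of the unit ball. *)
Lemma compact_cutl x : compact_operator (H := l2H R) x ->
  [/\ linear x, exists2 C, 0 <= C & forall h, nl (x h) <= C * nl h &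
   forall e, 0 < e -> exists n, forall m h, (n <= m)%N ->
     nl (x h - trunc m (x h)) <= e * nl h].
Proof.
move=> [lx cx]; have im h : nl h <= 1 -> closure (x @` [set h : l2H R | `|h| <= 1]) (x h).
  by move=> h1; apply: subset_closure; exists h => //=; rewrite -[1]/(1%:c) lecR.
split=> //.
  have [|n hn] := compact_uniform (P := fun m y => nl y <= m%:R) cx.
    move=> y _; exists 1, (Num.bound (nl y + 1)); split=> // z m zy nm.
    have := l2norm_triangle (z - y) y; rewrite subrK => /le_trans; apply.
    have b0 : 0 <= nl y + 1 by rewrite addr_ge0// l2norm_ge0.
    rewrite addrC (le_trans (lerD (lexx _) zy))// ltW//.
    by rewrite (lt_le_trans (archi_boundP b0))// ler_nat.
  exists n%:R => // h; apply: linear_ball => // {}h h1; exact: hn (im h h1).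
move=> e e0; have e2 : 0 < e / 3 by rewrite divr_gt0.
have [|n hn] := compact_uniform (P := fun m y => nl (y - trunc m y) <= e) cx.
  move=> y _; have [n hn] := trunc_tends y e2; exists (e / 3), n; split=> // z m zy /hn h.
  have -> : z - trunc m z = (z - y) + ((y - trunc m y) + trunc m (y - z)).
    by rewrite truncB; lmod (l2 R); ring.
  rewrite (le_trans (l2norm_triangle _ _))//.
  have := l2norm_triangle (y - trunc m y) (trunc m (y - z)).
  by have := trunc_norm m (y - z); rewrite (l2normB y z); lra.
exists n => m h nm.
have lt : linear (fun h => x h - trunc m (x h)).
  by move=> c a b; rewrite lx trunc_linear; lmod (l2 R); ring.
by apply: (linear_ball lt) => [|{}h h1]; [exact: ltW|exact: hn (im h h1)].
Qed.

Definition entry x i j : R[i] := val (x (l2e j)) i.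

Lemma linear0_l2 x : linear x -> x 0 = 0.
Proof. by move=> lx; have := lx (-1) 0 0; rewrite scaler0 addr0 scaleN1r addNr. Qed.

Lemma linear_fin x n f i : linear x ->
  val (x (fin_l2 n f)) i = \sum_(0 <= j < n) f j * entry x i j.
Proof.
move=> lx; rewrite fin_l2_sum; elim/big_rec2: _ => [|k a b _ <-].
  by rewrite linear0_l2.
by rewrite lx.
Qed.

(* The coordinate functional h |-> (x h)_i is given by the i-th row of x. *)
Lemma row_l2 x C i : linear x -> 0 <= C -> (forall h, nl (x h) <= C * nl h) ->
  forall n, psq (fun j => conjC (entry x i j)) n <= C ^+ 2.
Proof.
move=> lx C0 xC n; pose f j := conjC (entry x i j); pose k := fin_l2 n f.
have kk : nl k <= Num.sqrt (psq f n).
  apply: l2norm_le => [|m]; first exact: sqrtr_ge0.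
  by rewrite sqr_sqrtr ?psq_ge0// psq_l2_seq.
have xk : val (x k) i = (psq f n)%:c.
  rewrite /k linear_fin// /psq [RHS](rmorph_sum (real_complex R)).
  by apply: eq_bigr => j _; rewrite [RHS](cabs_sqr (f j)) conjCK.
have := cabs_l2 (x k) i; rewrite xk cabs_pos_real ?psq_ge0// => h.
have {}h := le_trans h (xC k).
have {}h := le_trans h (ler_wpM2l C0 kk).
have s0 : 0 <= Num.sqrt (psq f n) by exact: sqrtr_ge0.
rewrite -[leLHS]sqr_sqrtr ?psq_ge0//; rewrite -{1}[psq f n]sqr_sqrtr ?psq_ge0// in h.
rewrite -/f; move: (Num.sqrt _) s0 h => q q0 h.
rewrite lerXn2r ?nnegrE// leNgt; apply/negP => Cq; move: h; rewrite expr2; nra.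
Qed.

Lemma compact_tail_coord x C i e : linear x -> 0 <= C ->
  (forall h, nl (x h) <= C * nl h) -> 0 < e ->
  exists n, forall m h, (n <= m)%N -> cabs (val (x (h - trunc m h)) i) <= e * nl h.
Proof.
move=> lx C0 xC e0.
have rl : (fun j => conjC (entry x i j)) \in l2_pred.
  by apply/asboolP; exists C => //; exact: row_l2.
pose r := L2 rl; have [n hn] := trunc_tends r e0; exists n => m h /hn rm.
set k := h - trunc m h; apply/ler_addgt0Pl => d d0.
have d1 : 0 < d / (C + 1) by rewrite divr_gt0// ltr_wpDl.
have [N hN] := trunc_tends k d1; have kN := hN N (leqnn N).
have -> : val (x k) i = val (x (k - trunc N k)) i + val (x (trunc N k)) i.
  have {1}-> : k = 1 *: (k - trunc N k) + trunc N k by rewrite scale1r subrK.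
  by rewrite lx scale1r.
rewrite (le_trans (cabsD _ _))// lerD//.
  rewrite (le_trans (cabs_l2 _ _))// (le_trans (xC _))// (le_trans (ler_wpM2l C0 kN))//.
  by rewrite mulrA ler_pdivrMr ?ltr_wpDl//; nra.
rewrite linear_fin// (le_trans (cabs_sum _ _ _))//.
have kE j : val k j = if (j < m)%N then 0 else val h j.
  rewrite -[LHS]/(val h j - val (trunc m h) j) truncE.
  by case: ifP => _; rewrite ?subrr ?subr0.
have rE j : val (r - trunc m r) j = if (j < m)%N then 0 else conjC (entry x i j).
  rewrite -[LHS]/(val r j - val (trunc m r) j) truncE.
  by case: ifP => _; rewrite ?subrr ?subr0.
apply: (@le_trans _ _ (nl (r - trunc m r) * nl h)); last first.
  by rewrite ler_wpM2r// l2norm_ge0.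
apply: (@le_trans _ _ (\sum_(0 <= j < N) cabs (val (r - trunc m r) j) * cabs (val k j))).
  apply: ler_sum => j _; rewrite cabsM kE rE; case: ifP => _.
    by rewrite cabs0 mul0r mulr0.
  by rewrite cabs_conj mulrC.
apply: cauchy_schwarz; rewrite ?l2norm_ge0//; first exact: psq_le.
apply: (le_trans (psq_le k N)); rewrite lerXn2r ?nnegrE ?l2norm_ge0//.
exact: tail_norm.
Qed.

(** No adjoint is formed: after truncation on the left only finitely many coordinates of x h remain,
    and each is a functional given by a square summable row, small on tails. *)
Lemma compact_cutr x : compact_operator (H := l2H R) x -> forall e, 0 < e ->
  exists n, forall m h, (n <= m)%N -> nl (x (h - trunc m h)) <= e * nl h.
Proof.
move=> /compact_cutl[lx [C C0 xC] xt] e e0; have e2 : 0 < e / 2 by rewrite divr_gt0.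
have [n0 hn0] := xt _ e2.
have [n hn] : exists n, forall m h, (n <= m)%N ->
    \sum_(0 <= i < n0) cabs (val (x (h - trunc m h)) i) <= e / 2 * nl h.
  elim: n0 (e / 2) e2 {hn0} => [|N IH] d d0.
    exists 0%N => m h _; rewrite big_geq// mulr_ge0 ?l2norm_ge0//; exact: ltW.
  have d2 : 0 < d / 2 by rewrite divr_gt0.
  have [n1 h1] := IH _ d2; have [n2 h2] := compact_tail_coord N lx C0 xC d2.
  exists (maxn n1 n2) => m h; rewrite geq_max => /andP[m1 m2].
  rewrite big_nat_recr//= (splitr d) mulrDl lerD//; [exact: h1|exact: h2].
exists n => m h nm; set k := h - trunc m h.
rewrite -(subrK (trunc n0 (x k)) (x k)) (le_trans (l2norm_triangle _ _))//.
rewrite (splitr e) mulrDl lerD//.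
  rewrite (le_trans (hn0 n0 k (leqnn _)))// ler_wpM2l ?(ltW e2)//.
  exact: tail_norm.
by rewrite (le_trans (trunc_coord_norm _ _))// hn.
Qed.

End compact_operators.

(** * Tensoring with the compact operators *)

Section matrix_bounds.
Context {R : realType} (n : nat).
Implicit Types (F G : 'M[R[i]]_n) (v u : 'cV[R[i]]_n).

Definition vsq v : R := \sum_i cabs (v i 0) ^+ 2.

Lemma vsq_ge0 v : 0 <= vsq v.
Proof. by apply: sumr_ge0 => i _; exact: sqr_ge0. Qed.

Definition mx_bounded F (b : R) := forall v, vsq (F *m v) <= b ^+ 2 * vsq v.

Lemma mx_boundedM F G a b : mx_bounded F a -> mx_bounded G b -> mx_bounded (F *m G) (a * b).
Proof.
move=> Fa Gb v; rewrite -mulmxA (le_trans (Fa _))//.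
by rewrite (le_trans (ler_wpM2l (sqr_ge0 a) (Gb v)))// exprMn mulrA.
Qed.

Definition mx_adj F : 'M[R[i]]_n := \matrix_(i, j) conjC (F j i).

(** For u = F^* v the square of the norm of u is the inner product of v with F u, at most b times
    the norms of v and u. *)
Lemma mx_bounded_adj F b : 0 <= b -> mx_bounded F b -> mx_bounded (mx_adj F) b.
Proof.
move=> b0 Fb v; set u := mx_adj F *m v.
have e : (vsq u)%:c = \sum_j v j 0 * conjC ((F *m u) j 0).
  rewrite /vsq (rmorph_sum (real_complex R)).
  transitivity (\sum_i \sum_j conjC (F j i) * v j 0 * conjC (u i 0)).
    apply: eq_bigr => i _; rewrite -mulr_suml [LHS](cabs_sqr (u i 0)).
    by congr (_ * _); rewrite mxE; apply: eq_bigr => j _; rewrite mxE.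
  rewrite exchange_big; apply: eq_bigr => j _; rewrite mxE rmorph_sum mulr_sumr.
  by apply: eq_bigr => i _; rewrite rmorphM/=; ring.
have u0 := vsq_ge0 u.
have h : vsq u <= Num.sqrt (vsq v) * (b * Num.sqrt (vsq u)).
  rewrite -[leLHS](cabs_pos_real u0) e (le_trans (cabs_sum _ _ _))//.
  under eq_bigr do rewrite cabsM cabs_conj.
  apply: cauchy_schwarz; rewrite ?mulr_ge0 ?sqrtr_ge0//.
    by rewrite sqr_sqrtr ?vsq_ge0.
  by rewrite exprMn sqr_sqrtr// Fb.
have sv := sqrtr_ge0 (vsq v); have su := sqrtr_ge0 (vsq u).
rewrite -[leLHS]sqr_sqrtr// -[vsq v]sqr_sqrtr ?vsq_ge0// -exprMn.
rewrite lerXn2r ?nnegrE ?mulr_ge0//.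
rewrite -{1}[vsq u]sqr_sqrtr// in h.
move: (Num.sqrt _) (Num.sqrt _) sv su h => p q p0 q0 h.
have [->|pn] := eqVneq p 0; first by rewrite mulr_ge0.
have p1 : 0 < p by rewrite lt_neqAle eq_sym pn.
by rewrite -(ler_pM2r p1) -expr2 (le_trans h)// mulrCA mulrA.
Qed.

Lemma mx_bounded_entry F b i j : 0 <= b -> mx_bounded F b -> cabs (F i j) <= b.
Proof.
move=> b0 Fb; apply: ler_of_sqr => //; have := Fb (delta_mx j 0).
have -> : vsq (delta_mx j 0) = 1.
  rewrite /vsq (bigD1 j)//= mxE !eqxx cabs1 expr1n big1 ?addr0// => k /negPf kj.
  by rewrite mxE kj cabs0 expr0n.
rewrite mulr1; apply: le_trans; rewrite -colE /vsq (bigD1 i)//= mxE lerDl.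
by apply: sumr_ge0 => k _; exact: sqr_ge0.
Qed.

End matrix_bounds.

Section compact_tensor.
Context {R : realType} {E : cstarAlgType R}.
Local Notation M := (adj E).
Local Notation N := (@adj_ucnorm R E).
Local Notation n_ := (@cstar_cnorm R E).
Local Notation "1e" := (uone N).
Local Notation sc r := (r%:c *: 1e).
Local Notation nl := (@l2norm R).
Variable s : nat -> M.
Hypothesis so : forall n, orthonormal s n.
Hypothesis sP : forall x, tends n_ (fun n => range_proj s n x) x.

Lemma ss i j : star (s i) ** s j = if i == j then 1e else 0.
Proof. by apply: (@so (maxn i j).+1); rewrite ltnS ?leq_maxl ?leq_maxr. Qed.

(** Matrices act through the matrix units s_i s_j^*; orthonormality of the s_i makes this
    multiplicative and compatible with adjoints. *)
Definition mxrep n (F : 'M[R[i]]_n) : M := \sum_i \sum_j F i j *: (s i ** star (s j)).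

Lemma star_mxrep n (F : 'M[R[i]]_n) (j : 'I_n) :
  star (s j) ** mxrep F = \sum_l F j l *: star (s l).
Proof.
rewrite /mxrep smul_sumr (bigD1 j)//= [X in _ + X]big1 ?addr0.
  by rewrite smul_sumr; apply: eq_bigr => l _; rewrite smulZr smulA ss eqxx (smul1x N).
move=> i ij; rewrite smul_sumr big1// => l _.
by rewrite smulZr smulA ss val_eqE eq_sym (negPf ij) smul0x scaler0.
Qed.

Lemma mxrepM n (F G : 'M[R[i]]_n) : mxrep F ** mxrep G = mxrep (F *m G).
Proof.
rewrite {1}/mxrep smul_suml; apply: eq_bigr => i _; rewrite smul_suml.
under eq_bigr do rewrite smulZl -smulA star_mxrep smul_sumr scaler_sumr.
rewrite exchange_big; apply: eq_bigr => l _; rewrite mxE scaler_suml.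
by apply: eq_bigr => j _; rewrite smulZr scalerA.
Qed.

Lemma mxrep_adj n (F : 'M[R[i]]_n) : star (mxrep F) = mxrep (mx_adj F).
Proof.
rewrite star_sum; under eq_bigr do rewrite star_sum.
rewrite exchange_big; apply: eq_bigr => i _; apply: eq_bigr => j _.
by rewrite mxE starZ starM starK.
Qed.

Lemma isometry_norm i : N (s i) <= 1.
Proof.
apply: ler_of_sqr => //; rewrite -cn_cstar ss eqxx expr1n; exact: cn1.
Qed.

Lemma mxrep_crude n (F : 'M[R[i]]_n) b : 0 <= b -> mx_bounded F b ->
  N (mxrep F) <= (n * n)%:R * b.
Proof.
move=> b0 Fb; rewrite (le_trans (cn_sum _ _ _ _))//.
apply: (@le_trans _ _ (\sum_(i < n) \sum_(j < n) b)).
  apply: ler_sum => i _; rewrite (le_trans (cn_sum _ _ _ _))//.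
  apply: ler_sum => j _; rewrite cnZ -[leRHS]mulr1 ler_pM ?cabs_ge0 ?cn_ge0//.
    exact: mx_bounded_entry.
  rewrite (le_trans (cnM _ _ _))// cn_star mulr_ile1 ?cn_ge0 ?isometry_norm//.
by rewrite !sumr_const !card_ord -mulrnA mulr_natl.
Qed.

(* The crude bound is applied to the powers of F^* F. *)
Lemma mxrep_bound n (F : 'M[R[i]]_n) b : 0 < b -> mx_bounded F b -> N (mxrep F) <= b.
Proof.
move=> b0 Fb; pose P := mx_adj F *m F; have b2 : 0 < b ^+ 2 by rewrite exprn_gt0.
have Pb : mx_bounded P (b ^+ 2).
  by rewrite expr2; apply: mx_boundedM => //; apply: mx_bounded_adj => //; exact: ltW.
have SP : star (mxrep F) ** mxrep F = mxrep P by rewrite mxrep_adj mxrepM.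
have Ss : star (mxrep P) = mxrep P by rewrite -SP starM starK.
have pow m : exists2 G : 'M[R[i]]_n, spow N (mxrep P) m.+1 = mxrep G &
    mx_bounded G ((b ^+ 2) ^+ m.+1).
  elim: m => [|m [G e Gb]].
    by exists P; rewrite ?expr1// spowS /= (smulx1 N).
  exists (P *m G); first by rewrite spowS e mxrepM.
  by rewrite exprS; exact: mx_boundedM.
apply: ler_of_sqr; first exact: ltW.
rewrite -cn_cstar SP; apply: (@growth_le _ _ _ (n * n)%:R) => // [|k].
  exact: cn_ge0.
rewrite -cn_spow2//; have k0 : (0 < 2 ^ k)%N by rewrite expn_gt0.
rewrite -(prednK k0); have [G -> Gb] := pow (2 ^ k).-1.
have c0 : 0 <= (b ^+ 2) ^+ (2 ^ k).-1.+1 by rewrite exprn_ge0// ltW.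
rewrite (le_trans (mxrep_crude c0 Gb))// ler_wpM2r// ler_peMr// lerDl.
by [].
Qed.

(** The amplification of [b] along the first n isometries. It commutes with [mxrep], and the product
    of the two is the cut-off elementary tensor. *)
Definition diag n (b : E) : M := \sum_(i < n) s i ** lmul b ** star (s i).

Lemma star_diag n b (j : 'I_n) : star (s j) ** diag n b = lmul b ** star (s j).
Proof.
rewrite /diag smul_sumr (bigD1 j)//= big1 ?addr0; first by rewrite !smulA ss eqxx (smul1x N).
by move=> i ij; rewrite !smulA ss val_eqE eq_sym (negPf ij) !smul0x.
Qed.

(** With k the square of the norm of b and D the amplification, k - D^* D is the sum of k (1 - p_n)
    and of the conjugates s_i (k - b^* b) s_i^*, hence positive. *)
Lemma diag_norm n b : N (diag n b) <= rnorm b.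
Proof.
apply: ler_of_sqr; first exact: rnorm_ge0.
have -> : rnorm b ^+ 2 = N (star (lmul b) ** lmul b) by rewrite cn_cstar -rnorm_lmul.
set k := N (star _ ** _); rewrite -cn_cstar.
have dd : star (diag n b) ** diag n b =
    \sum_(i < n) s i ** (star (lmul b) ** lmul b) ** star (s i).
  rewrite {1}/diag star_sum smul_suml; apply: eq_bigr => i _.
  by rewrite !starM starK -!smulA star_diag.
apply: (@le_trans _ _ (N (sc k))); last first.
  by rewrite (le_trans (cn_sc _ _))// ger0_norm// cn_ge0.
apply: pos_norm_mono; first exact: pos_star_smul.
have -> : sc k - star (diag n b) ** diag n b = k%:c *: (1e - range_proj s n) +
   \sum_(i < n) star (star (s i)) ** (sc k - star (lmul b) ** lmul b) ** star (s i).
  rewrite dd /range_proj big_mkord scalerBr -addrA; congr (_ + _).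
  rewrite scaler_sumr -!sumrN -big_split; apply: eq_bigr => i _ /=.
  by rewrite starK smulBr smulBl smulZr smulZl (smulx1 N) addrA addNr sub0r.
apply: posD.
  apply: posZ; first exact: cn_ge0.
  have [ps pp _ _] := one_sub_range (@so n).
  by rewrite -pp -{1}ps; exact: pos_star_smul.
elim/big_rec: _ => [|i x _ px].
  by rewrite -(scale0r 1e) -(rmorph0 (real_complex R)); exact: pos_scalar.
apply: posD => //; apply: pos_conj; apply: pos_norm_sub => //.
by rewrite starM starK.
Qed.

Lemma diag_mxrep n b (F : 'M[R[i]]_n) : diag n b ** mxrep F = mxrep F ** diag n b.
Proof.
rewrite /mxrep smul_sumr smul_suml; apply: eq_bigr => i _.
rewrite smul_sumr smul_suml; apply: eq_bigr => j _.
rewrite smulZr smulZl; congr (_ *: _); rewrite -[RHS]smulA star_diag smulA.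
rewrite smulA /diag smul_suml (bigD1 i)//= [X in _ + X]big1 ?addr0.
  by rewrite -[_ ** star (s i) ** s i]smulA ss eqxx (smulx1 N).
by move=> k ki; rewrite -[_ ** star (s k) ** s i]smulA ss val_eqE (negPf ki) smulx0.
Qed.

Lemma diagM n a b : diag n a ** diag n b = diag n (a ** b).
Proof.
rewrite {1}/diag smul_suml; apply: eq_bigr => i _.
by rewrite -!smulA star_diag lmulM !smulA.
Qed.

Lemma lmul0 : lmul (0 : E) = 0.
Proof. by rewrite -(subrr 0) lmulB subrr. Qed.

Lemma lmul_sum I (r : seq I) (F : I -> E) : lmul (\sum_(i <- r) F i) = \sum_(i <- r) lmul (F i).
Proof. exact: (big_morph _ (@lmulD R E) lmul0). Qed.

Lemma lmul_inj : injective (@lmul R E).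
Proof.
move=> x y xy; apply/eqP; rewrite -subr_eq0; apply/eqP/rnorm0_eq0.
by rewrite rnorm_lmul lmulB xy subrr cn0.
Qed.

(** The element s_i b s_j^*; right multiplication by the multiplier s_j^* is written as a left one
    under the involution. *)
Definition munit i j (b : E) : E := s i (star (s j (star b))).

Lemma lmul_munit i j b : lmul (munit i j b) = s i ** lmul b ** star (s j).
Proof. by rewrite /munit -adj_lmul -smulA lmul_adj starK. Qed.

Lemma munit_linear i j : linear (munit i j).
Proof. by move=> c a b; rewrite /munit starD starZ adjD adjZ starD starZ conjCK adjD adjZ. Qed.

Lemma star_munit i j b : star (munit i j b) = munit j i (star b).
Proof. by apply: lmul_inj; rewrite lmulS !lmul_munit !starM starK lmulS smulA. Qed.

Definition tensor_cut n b (x : l2 R -> l2 R) : E :=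
  \sum_(i < n) \sum_(j < n) entry x i j *: munit i j b.

Lemma lmul_tensor_cut n b x :
  lmul (tensor_cut n b x) = mxrep (\matrix_(i < n, j < n) entry x i j) ** diag n b.
Proof.
rewrite /tensor_cut lmul_sum /mxrep smul_suml; apply: eq_bigr => i _.
rewrite lmul_sum smul_suml; apply: eq_bigr => j _.
by rewrite lmulZ lmul_munit mxE smulZl -!smulA star_diag.
Qed.

Lemma entry_bounded n x b : linear x -> 0 <= b -> (forall h, nl (x h) <= b * nl h) ->
  mx_bounded (\matrix_(i < n, j < n) entry x i j) b.
Proof.
move=> lx b0 xb v; pose f k : R[i] := oapp (fun j : 'I_n => v j 0) 0 (insub k).
have fE (j : 'I_n) : f j = v j 0 by rewrite /f valK.
have hv : nl (fin_l2 n f) <= Num.sqrt (vsq v).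
  apply: l2norm_le => [|m]; first exact: sqrtr_ge0.
  rewrite sqr_sqrtr ?vsq_ge0// (le_trans (psq_l2_seq _ _ _))// /psq big_mkord.
  by apply: ler_sum => j _; rewrite fE.
have -> : vsq (\matrix_(i < n, j < n) entry x i j *m v) = psq (val (x (fin_l2 n f))) n.
  rewrite /psq big_mkord; apply: eq_bigr => i _; congr (cabs _ ^+ 2).
  rewrite mxE linear_fin// big_mkord; apply: eq_bigr => j _.
  by rewrite mxE fE mulrC.
apply: (le_trans (psq_le _ _)); rewrite -[vsq v]sqr_sqrtr ?vsq_ge0// -exprMn.
rewrite lerXn2r ?nnegrE ?l2norm_ge0 ?mulr_ge0 ?sqrtr_ge0//.
exact: le_trans (xb _) (ler_wpM2l b0 hv).
Qed.

Lemma tensor_cut_bound n b x c : linear x -> 0 < c -> (forall h, nl (x h) <= c * nl h) ->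
  rnorm (tensor_cut n b x) <= c * rnorm b.
Proof.
move=> lx c0 xc; rewrite rnorm_lmul lmul_tensor_cut (le_trans (cnM _ _ _))//.
apply: ler_pM; rewrite ?cn_ge0 ?diag_norm//.
by apply: mxrep_bound => //; apply: entry_bounded => //; exact: ltW.
Qed.

Lemma entryB (x y : l2 R -> l2 R) i j : entry (fun h => x h - y h) i j = entry x i j - entry y i j.
Proof. by []. Qed.

Lemma tensor_cutB n b x y :
  tensor_cut n b (fun h => x h - y h) = tensor_cut n b x - tensor_cut n b y.
Proof.
rewrite /tensor_cut -sumrB; apply: eq_bigr => i _; rewrite -sumrB.
by apply: eq_bigr => j _; rewrite entryB scalerBl.
Qed.

Lemma tensor_cut_mul n a b x y : linear x ->
  tensor_cut n a x ** tensor_cut n b y = tensor_cut n (a ** b) (fun h => x (trunc n (y h))).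
Proof.
move=> lx; apply: lmul_inj; rewrite lmulM !lmul_tensor_cut.
rewrite -smulA [diag n a ** _]smulA diag_mxrep -smulA diagM smulA mxrepM.
congr (mxrep _ ** _); apply/matrixP => i j; rewrite !mxE /entry /trunc linear_fin// big_mkord.
by apply: eq_bigr => k _; rewrite !mxE mulrC.
Qed.

Lemma entry_trunc m (x : l2 R -> l2 R) i j : linear x ->
  entry (fun h => trunc m (x (trunc m h))) i j =
  if (i < m)%N && (j < m)%N then entry x i j else 0.
Proof.
move=> lx; rewrite /entry truncE; case: ifP => //= im.
have -> : trunc m (l2e j) = if (j < m)%N then l2e j else 0 :> l2 R.
  have eE k : val (l2e j : l2 R) k = (k == j)%:R by exact: l2eE.
  apply/val_inj/funext => k; rewrite truncE eE; case: (ltnP j m) => jm.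
    rewrite eE; case: ltnP => // mk; case: eqP => // kj.
    by move: (leq_trans jm mk); rewrite kj ltnn.
  case: ltnP => // km; case: eqP => // kj.
  by move: (leq_trans km jm); rewrite kj ltnn.
by case: ifP => // _; rewrite linear0_l2.
Qed.

Lemma tensor_cut_trunc n m b x : linear x -> (m <= n)%N ->
  tensor_cut n b (fun h => trunc m (x (trunc m h))) = tensor_cut m b x.
Proof.
move=> lx mn; rewrite /tensor_cut.
rewrite (big_ord_widen n (fun i => \sum_(j < m) entry x i j *: munit i j b)) // [RHS]big_mkcond.
apply: eq_bigr => i _; case: ifP => im; last first.
  by rewrite big1// => j _; rewrite entry_trunc// im scale0r.
rewrite (big_ord_widen n (fun j => entry x i j *: munit i j b)) // [RHS]big_mkcond.
apply: eq_bigr => j _; rewrite entry_trunc// im /=.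
by case: ifP => // _; rewrite scale0r.
Qed.

Lemma linearB_l2 (x : l2 R -> l2 R) h k : linear x -> x (h - k) = x h - x k.
Proof. by move=> lx; rewrite -scaleN1r addrC lx scaleN1r addrC. Qed.

Lemma compact_cut x : compact_operator (H := l2H R) x -> forall e, 0 < e ->
  exists n, forall m h, (n <= m)%N -> nl (x h - trunc m (x (trunc m h))) <= e * nl h.
Proof.
move=> cx e e0; have e2 : 0 < e / 2 by rewrite divr_gt0.
have [lx _ /(_ _ e2)[n hn]] := compact_cutl cx; have [k hk] := compact_cutr cx e2.
exists (maxn n k) => m h; rewrite geq_max => /andP[nm km].
have -> : x h - trunc m (x (trunc m h)) = (x h - trunc m (x h)) + trunc m (x (h - trunc m h)).
  by rewrite linearB_l2// truncB; lmod (l2 R); ring.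
rewrite (le_trans (l2norm_triangle _ _))// (splitr e) mulrDl lerD ?hn//.
by rewrite (le_trans (trunc_norm _ _))// hk.
Qed.

Lemma tensor_cut_cauchy b x : compact_operator (H := l2H R) x ->
  cauchy_cn n_ (fun n => tensor_cut n b x).
Proof.
move=> cx e e0; have e1 : 0 < e / (rnorm b + 1) by rewrite divr_gt0// ltr_wpDl// rnorm_ge0.
have [lx _ _] := compact_cutl cx; have [n hn] := compact_cut cx e1.
exists n => m nm; rewrite -(tensor_cut_trunc b lx nm) -tensor_cutB -[n_ _]/(rnorm _).
rewrite (le_trans (@tensor_cut_bound m b _ _ _ e1 (fun h => hn n h (leqnn _))))//.
  by move=> c h k; rewrite lx trunc_linear lx trunc_linear; lmod (l2 R); ring.
rewrite mulrAC ler_pdivrMr ?ltr_wpDl ?rnorm_ge0//.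
by rewrite ler_wpM2l ?lerDl// ltW.
Qed.

(** The limit of the cut-offs when it exists, with default value 0; for compact [x] the cut-offs
    form a Cauchy sequence. *)
Definition tensor_map b (x : l2 R -> l2 R) : E :=
  xget 0 [set z | tends n_ (fun n => tensor_cut n b x) z].

Lemma tensor_map_eq b x z : tends n_ (fun n => tensor_cut n b x) z -> tensor_map b x = z.
Proof. by move=> xz; rewrite /tensor_map; case: xgetP => [y _ /tends_uniq|/(_ z)//]; exact. Qed.

Lemma tensor_mapP b x : compact_operator (H := l2H R) x ->
  tends n_ (fun n => tensor_cut n b x) (tensor_map b x).
Proof. by move=> /(@tensor_cut_cauchy b)/cauchy_tends[z xz]; rewrite (tensor_map_eq xz). Qed.

(** The product of the cut-offs at n differs from the cut-off of the product by that of x (1 - p_n)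
    y, with p_n the truncation; it is small because [x] is compact on the right side too, by
    [compact_cutr]. *)
Lemma tensor_map_smul a b x y : compact_operator (H := l2H R) x -> compact_operator (H := l2H R) y ->
  tensor_map (a ** b) (x \o y) = tensor_map a x ** tensor_map b y.
Proof.
move=> cx cy; apply: tensor_map_eq.
have [lx _ _] := compact_cutl cx; have [ly [C C0 yC] _] := compact_cutl cy.
apply: (@tends_ext _ _ _ (fun n => tensor_cut n a x ** tensor_cut n b y +
    tensor_cut n (a ** b) (fun h => x (y h - trunc n (y h))))) => [n|].
  rewrite tensor_cut_mul//.
  have -> : (fun h => x (y h - trunc n (y h))) = (fun h => x (y h) - x (trunc n (y h))).
    by apply/funext => h; rewrite linearB_l2.
  by rewrite tensor_cutB addrC subrK.
rewrite -[tensor_map a x ** _]addr0; apply: tendsD; first by apply: tendsM; exact: tensor_mapP.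
have [K K0 ab] : exists2 K, 0 < K & (C + 1) * rnorm (a ** b) <= K.
  have c0 : 0 <= (C + 1) * rnorm (a ** b) by rewrite mulr_ge0 ?rnorm_ge0// addr_ge0.
  by exists ((C + 1) * rnorm (a ** b) + 1); [rewrite ltr_wpDl|rewrite lerDl].
move=> e e0; have [n hn] := compact_cutr cx (divr_gt0 e0 K0).
have C1 : 0 < C + 1 by rewrite ltr_wpDl.
exists n => m nm; rewrite subr0 -[n_ _]/(rnorm _).
have p0 : 0 < e / K * (C + 1) by rewrite mulr_gt0// divr_gt0.
rewrite (le_trans (@tensor_cut_bound m _ _ _ _ p0 _))//.
- move=> c h k; rewrite -lx; congr x; rewrite ly trunc_linear.
  by lmod (l2 R); ring.
- move=> h; rewrite (le_trans (hn _ _ nm))// -mulrA ler_wpM2l ?(ltW (divr_gt0 e0 K0))//.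
  by rewrite (le_trans (yC _))// ler_wpM2r ?l2norm_ge0// lerDl.
- rewrite -mulrA mulrAC ler_pdivrMr// ler_wpM2l//; exact: ltW.
Qed.

Lemma tensor_map_linearl x : compact_operator (H := l2H R) x -> linear (tensor_map^~ x).
Proof.
move=> cx c a b; apply: tensor_map_eq.
apply: (@tends_ext _ _ _ (fun n => c *: tensor_cut n a x + tensor_cut n b x)) => [n|].
  rewrite /tensor_cut scaler_sumr -big_split; apply: eq_bigr => i _ /=.
  rewrite scaler_sumr -big_split; apply: eq_bigr => j _ /=.
  by rewrite munit_linear scalerDr !scalerA mulrC.
by apply: tendsD; [apply: tendsZ|]; exact: tensor_mapP.
Qed.

Lemma tensor_map_linearr b c x y :
  compact_operator (H := l2H R) x -> compact_operator (H := l2H R) y ->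
  tensor_map b (c *: x + y) = c *: tensor_map b x + tensor_map b y.
Proof.
move=> cx cy; apply: tensor_map_eq.
apply: (@tends_ext _ _ _ (fun n => c *: tensor_cut n b x + tensor_cut n b y)) => [n|].
  rewrite /tensor_cut scaler_sumr -big_split; apply: eq_bigr => i _ /=.
  rewrite scaler_sumr -big_split; apply: eq_bigr => j _ /=.
  by rewrite scalerA -scalerDl.
by apply: tendsD; [apply: tendsZ|]; exact: tensor_mapP.
Qed.

Lemma tensor_map_star b x y : compact_operator (H := l2H R) x ->
  adjoint_operators (H := l2H R) x y -> tensor_map (star b) y = star (tensor_map b x).
Proof.
move=> cx xy; apply: tensor_map_eq.
apply: (@tends_ext _ _ _ (fun n => star (tensor_cut n b x))) => [n|]; last first.
  by apply: tends_star; exact: tensor_mapP.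
rewrite /tensor_cut star_sum; under eq_bigr do rewrite star_sum.
rewrite exchange_big; apply: eq_bigr => i _; apply: eq_bigr => j _.
rewrite starZ star_munit; congr (_ *: _).
have := xy (l2e i) (l2e j); rewrite -[LHS]/(l2_inner _ _) -[RHS]/(l2_inner _ _).
by rewrite l2_innerE l2_hermitian mul1r l2_innerE /entry => ->; rewrite conjCK.
Qed.

(** The matrix coefficient s_k^* z s_l. On the image of an elementary tensor it returns a scalar
    multiple of [b], which yields injectivity. *)
Definition tensor_coord k l (z : E) : E := star (star (s l) (star (star (s k) z))).

Lemma tensor_coordE k l z : lmul (tensor_coord k l z) = star (s k) ** lmul z ** s l.
Proof. by rewrite adj_lmul lmul_adj. Qed.

Lemma tensor_coordB k l a b : tensor_coord k l (a - b) = tensor_coord k l a - tensor_coord k l b.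
Proof. by apply: lmul_inj; rewrite lmulB !tensor_coordE lmulB smulBr smulBl. Qed.

Lemma tensor_coordD k l a b : tensor_coord k l (a + b) = tensor_coord k l a + tensor_coord k l b.
Proof. by apply: lmul_inj; rewrite lmulD !tensor_coordE lmulD smulDr smulDl. Qed.

Lemma tensor_coord_norm k l z : rnorm (tensor_coord k l z) <= rnorm z.
Proof.
have a (t : M) y : N t <= 1 -> rnorm (t y) <= rnorm y.
  by move=> t1; rewrite (le_trans (le_adj_norm _ _))// ler_piMl ?rnorm_ge0.
have sN i : N (star (s i)) <= 1 by rewrite cn_star isometry_norm.
by rewrite /tensor_coord rnorm_star (le_trans (a _ _ (sN l)))// rnorm_star a.
Qed.

Lemma tensor_coord_munit k l i j b :
  tensor_coord k l (munit i j b) = if (k == i) && (j == l) then b else 0.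
Proof.
apply: lmul_inj; rewrite tensor_coordE lmul_munit !smulA ss -!smulA ss.
case: eqP => _; last by rewrite smul0x lmul0.
by case: eqP => _; rewrite ?smulx0 ?lmul0// (smul1x N) (smulx1 N).
Qed.

Lemma tensor_coord_map k l b x : compact_operator (H := l2H R) x ->
  tensor_coord k l (tensor_map b x) = entry x k l *: b.
Proof.
move=> cx; have xb := tensor_mapP b cx.
have h1 : tends n_ (tensor_coord k l \o (fun n => tensor_cut n b x))
    (tensor_coord k l (tensor_map b x)).
  apply: (@tends_lip _ _ _ _ 1) => // u v; rewrite mul1r -tensor_coordB.
  exact: tensor_coord_norm.
apply: (tends_uniq h1) => e e0; exists (maxn k l).+1 => m; rewrite gtn_max => /andP[km lm] /=.
suff -> : tensor_coord k l (tensor_cut m b x) = entry x k l *: b.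
  by rewrite subrr rnorm0 ltW.
have c0 : tensor_coord k l 0 = 0 by rewrite -(subrr 0) tensor_coordB !subrr.
have cS I (r : seq I) (F : I -> E) : tensor_coord k l (\sum_(i <- r) F i) =
    \sum_(i <- r) tensor_coord k l (F i).
  exact: (big_morph _ (tensor_coordD k l) c0).
have cZ (c : R[i]) z : tensor_coord k l (c *: z) = c *: tensor_coord k l z.
  by apply: lmul_inj; rewrite lmulZ !tensor_coordE lmulZ smulZr smulZl.
rewrite /tensor_cut cS (bigD1 (Ordinal km))//= [X in _ + X]big1 ?addr0; last first.
  move=> i; rewrite -val_eqE/= eq_sym => /negPf ik; rewrite cS big1// => j _.
  by rewrite cZ tensor_coord_munit ik scaler0.
rewrite cS (bigD1 (Ordinal lm))//= [X in _ + X]big1 ?addr0; last first.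
  by move=> j; rewrite -val_eqE/= => /negPf jl; rewrite cZ tensor_coord_munit jl andbF scaler0.
by rewrite cZ tensor_coord_munit !eqxx.
Qed.

End compact_tensor.

(** Gaussian elimination: [a ord0] is nonzero at some [p0], which expresses [b ord0] through the
    other vectors and removes it from the remaining equations. *)
Lemma indep_injective {R : realType} {V : lmodType R[i]} (P : Type) n (a : 'I_n -> P -> R[i])
    (b : 'I_n -> V) :
  (forall c : 'I_n -> R[i], (forall p, \sum_i c i * a i p = 0) -> forall i, c i = 0) ->
  (forall p, \sum_i a i p *: b i = 0) -> forall i, b i = 0.
Proof.
elim: n a b => [a b _ _ []//|n IH a b ai ab].
have [p0 ap0] : exists p0, a ord0 p0 != 0.
  apply: contrapT => /forallNP a0.
  suff : (1 : R[i]) = 0 by apply/eqP; rewrite oner_neq0.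
  have := ai (fun i => (i == ord0)%:R) _ ord0; rewrite eqxx; apply=> p.
  rewrite big_ord_recl big1 ?addr0 ?mul1r => [|i _]; last by rewrite mul0r.
  by have /negP := a0 p; rewrite negbK => /eqP.
pose r i := a i p0 / a ord0 p0.
have b0 : b ord0 = - \sum_(i < n) r (lift ord0 i) *: b (lift ord0 i).
  apply: (scalerI ap0); rewrite scalerN scaler_sumr; apply/eqP.
  rewrite -addr_eq0; apply/eqP; rewrite -[RHS](ab p0) big_ord_recl; congr (_ + _).
  by apply: eq_bigr => i _; rewrite scalerA /r mulrC divfK.
have bl (i : 'I_n) : b (lift ord0 i) = 0.
  apply: (IH (fun i p => a (lift ord0 i) p - r (lift ord0 i) * a ord0 p)
    (fun i => b (lift ord0 i)) _ _ i) => [c ca {}i|p].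
    pose c' (i : 'I_n.+1) := if unlift ord0 i is Some j then c j
      else - \sum_j c j * r (lift ord0 j).
    have := ai c' _ (lift ord0 i); rewrite /c' liftK; apply=> p.
    rewrite big_ord_recl unlift_none mulNr mulr_suml addrC -[RHS](ca p) -sumrB.
    by apply: eq_bigr => j _; rewrite liftK; ring.
  have := ab p; rewrite big_ord_recl b0 scalerN scaler_sumr addrC -sumrB => abp; rewrite -[RHS]abp.
  by apply: eq_bigr => j _; rewrite scalerBl scalerA [_ * r _]mulrC.
move=> i; case: (unliftP ord0 i) => [j ->//|->].
by rewrite b0 big1 ?oppr0// => j _; rewrite bl scaler0.
Qed.

Section stable.
Context {R : realType} {E : cstarAlgType R}.
Local Notation M := (adj E).
Local Notation N := (@adj_ucnorm R E).
Local Notation n_ := (@cstar_cnorm R E).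
Local Notation "1e" := (uone N).
Local Notation nl := (@l2norm R).
Implicit Types x : l2 R -> l2 R.

Definition rank_one i j (h : l2 R) : l2 R := val h j *: l2e i.

Lemma rank_one_linear i j : linear (rank_one i j).
Proof.
move=> c h k; rewrite /rank_one scalerA -scalerDl; congr (_ *: _).
Qed.

(** The image of the unit ball lies in the image of a compact square of coefficients under a
    continuous map. *)
Lemma rank_one_compact i j : compact_operator (H := l2H R) (rank_one i j).
Proof.
split; first exact: rank_one_linear.
pose f (p : R * R) : l2 R := (p.1 +i* p.2)%C *: l2e i.
have fc : continuous f.
  move=> p; apply/cvg_ballP => e /pos_complex[-> e0].
  have e2 : 0 < complex.Re e / 2 by rewrite divr_gt0.
  have : nbhs p (ball p.1 (complex.Re e / 2) `*` ball p.2 (complex.Re e / 2)).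
    by exists (ball p.1 (complex.Re e / 2), ball p.2 (complex.Re e / 2)) => //;
      split; exact: nbhsx_ballx.
  apply: filterS => q [/= q1 q2]; rewrite -ball_normE/= ltcR -[X in X < _]/(nl (f p - f q)).
  rewrite -!ball_normE/= in q1 q2; rewrite /f -scalerBl l2normZE.
  rewrite (le_lt_trans (ler_wpM2l (cabs_ge0 _) (l2e_norm i)))// mulr1.
  by rewrite (le_lt_trans (cabs_ReIm _))//= (splitr (complex.Re e)) ltrD.
pose K := f @` ([set` `[(-1 : R), 1]] `*` [set` `[(-1 : R), 1]]).
have cK : compact K.
  apply: continuous_compact; first exact: continuous_subspaceT.
  by apply: compact_setX; exact: segment_compact.
apply: (subclosed_compact (@closed_closure _ _) cK).
have /closure_id -> : closed K by exact: (compact_closed (@norm_hausdorff _ _) cK).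
apply: closure_subset.
move=> _ [h h1 <-]; exists (complex.Re (val h j), complex.Im (val h j)); last first.
  by rewrite /f /rank_one/=; case: (val h j).
have hj : cabs (val h j) <= 1.
  by rewrite (le_trans (cabs_l2 _ _))//; move: h1; rewrite /= -[1]/(1%:c) lecR.
split=> /=; rewrite in_itv/= -ler_norml (le_trans _ hj)//; [exact: cabs_Re|exact: cabs_Im].
Qed.

Lemma entry_zero x C : linear x -> 0 <= C -> (forall h, nl (x h) <= C * nl h) ->
  (forall i j, entry x i j = 0) -> forall h, x h = 0.
Proof.
move=> lx C0 xC x0 h; have xt n : x (trunc n h) = 0.
  apply/val_inj/funext => i; rewrite /trunc linear_fin// big1// => j _.
  by rewrite x0 mulr0.
suff : nl (x h) <= 0.
  move=> h0; apply: (@l2norm_eq0 R (x h)); congr (_%:c).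
  by apply: le_anti; rewrite h0 l2norm_ge0.
apply/ler_addgt0Pl => d d0; rewrite addr0.
have d1 : 0 < d / (C + 1) by rewrite divr_gt0// ltr_wpDl.
have [n /(_ n (leqnn n)) hn] := trunc_tends h d1.
rewrite -[x h]subr0 -(xt n) -linearB_l2// (le_trans (xC _))//.
rewrite (le_trans (ler_wpM2l C0 hn))// mulrA ler_pdivrMr ?ltr_wpDl//; nra.
Qed.

Lemma l2_sum_bounded n (c : 'I_n -> R[i]) (x : 'I_n -> l2 R -> l2 R) :
  (forall i, linear (x i)) -> (forall i, exists2 C, 0 <= C & forall h, nl (x i h) <= C * nl h) ->
  linear (\sum_i c i *: x i) /\ exists2 C, 0 <= C & forall h, nl ((\sum_i c i *: x i) h) <= C * nl h.
Proof.
move=> lx bx; elim/big_rec: _ => [|i y _ [ly [C C0 yC]]].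
  split; first by move=> a h k; rewrite scaler0 addr0.
  by exists 0 => // h; rewrite mul0r -rnorm_l2 rnorm0.
have yE h : (c i *: x i + y) h = c i *: x i h + y h by [].
split; first by move=> a h k; rewrite !yE lx ly; lmod (l2 R); ring.
have [D D0 xD] := bx i; exists (cabs (c i) * D + C) => [|h].
  by rewrite addr_ge0 ?mulr_ge0 ?cabs_ge0.
rewrite yE (le_trans (l2norm_triangle _ _))// l2normZE mulrDl lerD// -mulrA.
by rewrite ler_wpM2l ?cabs_ge0.
Qed.

Variable s : nat -> M.
Hypothesis so : forall n, orthonormal s n.
Hypothesis sP : forall z : E, tends n_ (fun n => range_proj s n z) z.
Local Notation t := (tensor_map s).

Lemma tensor_map_injective n (b : 'I_n -> E) (x : 'I_n -> l2 R -> l2 R) :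
  (forall i, compact_operator (H := l2H R) (x i)) -> lin_indep x ->
  \sum_i t (b i) (x i) = 0 -> forall i, b i = 0.
Proof.
move=> cx li bx.
apply: (@indep_injective R E (nat * nat) n (fun i p => entry (x i) p.1 p.2)) => [c c0|p].
  apply: li; have [lS [C C0 SC]] := @l2_sum_bounded n c x
      (fun i => let: And3 a _ _ := compact_cutl (cx i) in a)
      (fun i => let: And3 _ a _ := compact_cutl (cx i) in a).
  apply/funext; apply: entry_zero lS C0 SC _ => k l; rewrite -[RHS](c0 (k, l)).
  rewrite /entry; elim/big_rec2: _ => // i u v _ <-.
  by [].
have := congr1 (tensor_coord s p.1 p.2) bx.
have t0 : tensor_coord s p.1 p.2 0 = 0 by rewrite -(subrr 0) tensor_coordB !subrr.
rewrite t0 (big_morph _ (tensor_coordD _ _ _) t0) => h; rewrite -[RHS]h.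
by apply: eq_bigr => i _; rewrite tensor_coord_map.
Qed.

Lemma tensor_map_rank_one i j b : t b (rank_one i j) = munit s i j b.
Proof.
apply: tensor_map_eq => e e0; exists (maxn i j).+1 => m; rewrite gtn_max => /andP[im jm].
have rE k l : entry (rank_one i j) k l = (k == i)%:R * (l == j)%:R.
  rewrite /entry /rank_one -[LHS]/(l2_val (l2e l) j * l2_val (l2e i) k) !l2eE.
  by rewrite mulrC [j == l]eq_sym.
rewrite /tensor_cut (bigD1 (Ordinal im))//= [X in _ + X - _]big1 ?addr0; last first.
  move=> k; rewrite -val_eqE/= => /negPf ik; rewrite big1// => l _.
  by rewrite rE ik mul0r scale0r.
rewrite (bigD1 (Ordinal jm))//= [X in _ + X - _]big1 ?addr0; last first.
  by move=> l; rewrite -val_eqE/= => /negPf jl; rewrite rE jl mulr0 scale0r.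
by rewrite rE !eqxx mul1r scale1r subrr rnorm0 ltW.
Qed.

Lemma range_proj_sum n z : range_proj s n (star (range_proj s n (star z))) =
  \sum_(i < n) \sum_(j < n) munit s i j (tensor_coord s i j z).
Proof.
apply: (@lmul_inj R E); rewrite -adj_lmul -[range_proj s n in X in _ ** X]range_proj_sa.
rewrite -[lmul (star _)]lmul_adj smulA lmul_sum {1}/range_proj big_mkord smul_suml.
rewrite smul_suml; apply: eq_bigr => i _; rewrite /range_proj big_mkord smul_sumr lmul_sum.
by apply: eq_bigr => j _; rewrite lmul_munit tensor_coordE !smulA.
Qed.

(** z is approximated by p z p with p a range projection. As p converges only pointwise, convergence
    is used at z and at its adjoint; p z p is a finite sum of tensors with rank one operators. *)
Lemma tensor_map_dense : closure [set z : E | exists n (b : 'I_n -> E) (x : 'I_n -> l2 R -> l2 R),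
    (forall i, compact_operator (H := l2H R) (x i)) /\ z = \sum_i t (b i) (x i)] = setT.
Proof.
apply/seteqP; split=> // z _ B /nbhs_ballP[e /pos_complex[-> e0] eB].
set d := complex.Re e in e0 eB; have d2 : 0 < d / 3 by rewrite divr_gt0.
have [n hn] := sP z d2; have [k hk] := sP (star z) d2.
pose m := maxn n k; have {}hn := hn m (leq_maxl _ _); have {}hk := hk m (leq_maxr _ _).
exists (range_proj s m (star (range_proj s m (star z)))); split; last first.
  apply: eB; rewrite -ball_normE/= lt_rnorm rnormB.
  rewrite -[n_ _]/(rnorm _) in hn; rewrite -[n_ _]/(rnorm _) in hk.
  have pm : N (range_proj s m) <= 1 by apply: proj_norm_le1; [exact: range_proj_sa|exact: range_proj_idem].
  set p := range_proj s m in hn hk pm *.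
  have -> : p (star (p (star z))) - z = p (star (p (star z) - star z)) + (p z - z).
    by rewrite starB starK adjB addrA subrK.
  rewrite (le_lt_trans (rnormD _ _))//.
  have := le_adj_norm p (star (p (star z) - star z)); rewrite rnorm_star.
  have := ler_wpM2r (rnorm_ge0 (p (star z) - star z)) pm; rewrite mul1r.
  rewrite -[adj_norm p]/(N p); have aux (a b c u v t : R) :
    u <= t / 3 -> v <= t / 3 -> 0 < t -> c <= v -> a <= c -> a + u < t by lra.
  by move=> h1 h2; exact: (aux _ 0 _ _ _ d hn hk e0 h1 h2).
rewrite range_proj_sum pair_big/=.
pose v (q : 'I_#|{: 'I_m * 'I_m}|) := enum_val q.
exists #|{: 'I_m * 'I_m}|, (fun q => tensor_coord s (v q).1 (v q).2 z),
  (fun q => rank_one (v q).1 (v q).2).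
split; first by move=> q; exact: rank_one_compact.
under [RHS]eq_bigr do rewrite tensor_map_rank_one.
rewrite -(big_enum_val (fun q : 'I_m * 'I_m => munit s q.1 q.2 (tensor_coord s q.1 q.2 z))).
by apply: eq_bigl => q; rewrite inE.
Qed.

(** The tensor product is realized on [E] itself, so the isomorphism that [stable] asks for is the
    identity. *)
Lemma stable_of_isometries : stable E.
Proof.
exists (l2H R), E, t; split; first exact: l2_separable_infinite_dim.
  split.
  - by move=> x cx; exact: tensor_map_linearl.
  - by move=> b c x y cx cy; exact: tensor_map_linearr.
  - by move=> a b x y cx cy; exact: tensor_map_smul.
  - by move=> b x y cx cy; exact: tensor_map_star.
  - exact: tensor_map_injective.
  - exact: tensor_map_dense.
by exists idfun; split=> //; exists id.
Qed.

End stable.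

(** * Vector-valued Haar integrals *)

Lemma le_eps {R : realType} (a b c : R) : (forall e, 0 < e -> a <= b + c * e) -> a <= b.
Proof.
move=> h; apply/ler_addgt0Pr => e e0; have c0 : 0 < `|c| + 1 by rewrite ltr_wpDl.
rewrite (le_trans (h _ (divr_gt0 e0 c0)))// lerD2l mulrA ler_pdivrMr// [leRHS]mulrC.
rewrite ler_wpM2r ?(ltW e0)// (le_trans (ler_norm c))// lerDl.
by [].
Qed.

Section finite_partitions.
Context {d} {T : measurableType d} {R : realType} (mu : {measure set T -> \bar R}).
Implicit Types (K C : set T).

Definition meas C : R := fine (mu C).

Definition finite_meas K := measurable K /\ (mu K < +oo)%E.

Definition finite_partition K (I : finType) (E : I -> set T) :=
  [/\ forall i, measurable (E i), forall i j x, E i x -> E j x -> i = j &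
      forall x, K x <-> exists i, E i x].

Lemma meas_ge0 C : 0 <= meas C.
Proof. by rewrite fine_ge0. Qed.

Lemma meas0 : meas set0 = 0.
Proof. by rewrite /meas measure0. Qed.

Lemma finite_measS K C : finite_meas K -> measurable C -> C `<=` K -> finite_meas C.
Proof.
move=> [mK Koo] mC CK; split=> //; apply: le_lt_trans Koo.
by apply: le_measure => //; rewrite inE.
Qed.

Lemma finite_meas_fin K : finite_meas K -> mu K \is a fin_num.
Proof. by move=> [mK Koo]; rewrite ge0_fin_numE. Qed.

Lemma measU K A B : finite_meas K -> measurable A -> measurable B -> A `<=` K -> B `<=` K ->
  A `&` B = set0 -> meas (A `|` B) = meas A + meas B.
Proof.
move=> fK mA mB AK BK AB; rewrite /meas measureU// fineD//.
  by apply: finite_meas_fin; exact: finite_measS AK.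
by apply: finite_meas_fin; exact: finite_measS BK.
Qed.

Lemma measS K A B : finite_meas K -> measurable A -> measurable B -> A `<=` B -> B `<=` K ->
  meas A <= meas B.
Proof.
move=> fK mA mB AB BK; rewrite /meas fine_le//.
- by apply: finite_meas_fin; apply: finite_measS fK _ _ => //; exact: subset_trans BK.
- by apply: finite_meas_fin; exact: finite_measS fK _ _.
- by apply: le_measure => //; rewrite inE.
Qed.

(** Stated for an arbitrary finitely additive [phi], since it is applied both to the measure and to
    real integrals. *)
Lemma partition_additive (phi : set T -> R) K (I : finType) (E : I -> set T) C :
  finite_partition K E -> measurable C -> C `<=` K -> phi set0 = 0 ->
  (forall A B, measurable A -> measurable B -> A `<=` K -> B `<=` K ->
    A `&` B = set0 -> phi (A `|` B) = phi A + phi B) ->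
  phi C = \sum_i phi (C `&` E i).
Proof.
move=> [mE dE cE] mC CK phi0 phiU.
suff h (s : seq I) : uniq s ->
    measurable (C `&` [set x | exists2 i, i \in s & E i x]) /\
    phi (C `&` [set x | exists2 i, i \in s & E i x]) = \sum_(i <- s) phi (C `&` E i).
  have [_ <-] := h _ (index_enum_uniq I); congr phi; apply/seteqP; split=> x; last by case.
  by move=> Cx; split=> //; have [i Ei] := (cE x).1 (CK _ Cx); exists i.
elim: s => [_|i s IH /=].
  have -> : C `&` [set x | exists2 i, i \in [::] & E i x] = set0.
    by apply/seteqP; split=> x // [_ []].
  by split; [exact: measurable0|rewrite big_nil].
move=> /andP[si us]; have [mS eS] := IH us; rewrite big_cons -eS.
have -> : C `&` [set x | exists2 j, j \in i :: s & E j x] =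
    (C `&` E i) `|` (C `&` [set x | exists2 i, i \in s & E i x]).
  apply/seteqP; split=> x.
    move=> [Cx [j]]; rewrite inE => /predU1P[->|js] Ej; [by left|right].
    by split=> //; exists j.
  move=> [[Cx Ei]|[Cx [j js Ej]]]; split=> //; first by exists i; rewrite ?mem_head.
  by exists j => //; rewrite inE js orbT.
split; first by apply: measurableU => //; apply: measurableI.
apply: phiU => //; first exact: measurableI.
- by move=> x [/CK].
- by move=> x [/CK].
- apply/seteqP; split=> x // [[_ Ei] [_ [j js Ej]]].
  by move: si; rewrite (dE i j x Ei Ej) js.
Qed.

Lemma meas_partition K (I : finType) (E : I -> set T) C : finite_meas K ->
  finite_partition K E -> measurable C -> C `<=` K ->
  meas C = \sum_i meas (C `&` E i).
Proof.
move=> fK pE mC CK; apply: (partition_additive pE mC CK); first exact: meas0.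
by move=> *; exact: (measU fK).
Qed.

Lemma partition_sub K (I : finType) (E : I -> set T) i : finite_partition K E -> E i `<=` K.
Proof. by move=> [_ _ h] x Ex; apply/h; exists i. Qed.

Lemma partitionI K (I J : finType) (E : I -> set T) (E' : J -> set T) :
  finite_partition K E -> finite_partition K E' ->
  finite_partition K (fun p : I * J => E p.1 `&` E' p.2).
Proof.
move=> [mE dE cE] [mE' dE' cE']; split.
- by move=> p; exact: measurableI.
- by move=> [i j] [i' j'] x [/= a b] [a' b']; rewrite (dE i i' x)// (dE' j j' x).
- move=> x; split=> [Kx|[p [a b]]]; last by apply/cE; exists p.1.
  have [i Ei] := (cE x).1 Kx; have [j Ej] := (cE' x).1 Kx.
  by exists (i, j).
Qed.

Section vector_integral.
Context {V : starAlgType R} (N : cnorm V).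
Implicit Types (f g : T -> V) (v u : V).

Definition simple_integral (I : finType) (E : I -> set T) (F : I -> V) : V :=
  \sum_i (meas (E i))%:c *: F i.

Lemma simple_integral_refine K (I J : finType) (E : I -> set T) (E' : J -> set T) (F : I -> V) :
  finite_meas K -> finite_partition K E -> finite_partition K E' ->
  simple_integral E F = \sum_i \sum_j (meas (E i `&` E' j))%:c *: F i.
Proof.
move=> fK pE pE'; apply: eq_bigr => i _; rewrite -scaler_suml; congr (_ *: _).
rewrite (meas_partition fK pE'); first by rewrite rmorph_sum.
  by have [] := pE.
exact: partition_sub pE.
Qed.

Lemma simple_integral_le K (I J : finType) (E : I -> set T) (E' : J -> set T)
    (F : I -> V) (w : J -> R) :
  finite_meas K -> finite_partition K E -> finite_partition K E' ->
  (forall i j x, E i x -> E' j x -> N (F i) <= w j) ->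
  N (simple_integral E F) <= \sum_j meas (E' j) * w j.
Proof.
move=> fK pE pE' Fw; rewrite (simple_integral_refine F fK pE pE') (le_trans (cn_sum _ _ _ _))//.
apply: (@le_trans _ _ (\sum_i \sum_j meas (E i `&` E' j) * w j)).
  apply: ler_sum => i _; rewrite (le_trans (cn_sum _ _ _ _))//; apply: ler_sum => j _.
  rewrite cnZ cabs_real ger0_norm ?meas_ge0//.
  have [->|/set0P[x [Ex E'x]]] := eqVneq (E i `&` E' j) set0.
    by rewrite meas0 !mul0r.
  by rewrite ler_wpM2l ?meas_ge0//; exact: Fw Ex E'x.
rewrite exchange_big; apply: ler_sum => j _; rewrite -mulr_suml.
under eq_bigr do rewrite setIC.
rewrite -(meas_partition fK pE)//; first by have [] := pE'.
exact: partition_sub pE'.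
Qed.

(** Uniform approximation by simple functions on a finite partition of [K], which suffices for
    continuous functions on compact sets. The norm is a parameter, so vector and scalar integrals
    share one theory. *)
Definition has_integral K f v := forall e, 0 < e ->
  exists (I : finType) (E : I -> set T) (F : I -> V), [/\ finite_partition K E,
    forall i x, E i x -> N (f x - F i) <= e & N (v - simple_integral E F) <= e].

Lemma eq_has_integral K f g v : (forall x, K x -> f x = g x) ->
  has_integral K f v -> has_integral K g v.
Proof.
move=> fg fv e /fv[I [E [F [pE EF vF]]]]; exists I, E, F; split=> // i x Ex.
by rewrite -fg; [exact: EF|exact: partition_sub pE _ Ex].
Qed.

Lemma has_integral_linear K c f g v u : finite_meas K ->
  has_integral K f v -> has_integral K g u -> has_integral K (c *: f + g) (c *: v + u).
Proof.
move=> fK fv gu e e0; have c1 : 0 < cabs c + 1 by rewrite ltr_wpDl// cabs_ge0.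
have e1 := divr_gt0 e0 c1.
have aux a b p q : N (a - p) <= e / (cabs c + 1) -> N (b - q) <= e / (cabs c + 1) ->
    N ((c *: a + b) - (c *: p + q)) <= e.
  move=> h1 h2; have -> : (c *: a + b) - (c *: p + q) = c *: (a - p) + (b - q).
    by lmod V; ring.
  rewrite (le_trans (cnD _ _ _))// cnZ.
  rewrite (le_trans (lerD (ler_wpM2l (cabs_ge0 c) h1) h2))//.
  by rewrite -[X in _ + X]mul1r -mulrDl mulrCA divff ?mulr1// gt_eqF.
have [I [E [F [pE EF vF]]]] := fv _ e1; have [J [E' [F' [pE' EF' vF']]]] := gu _ e1.
exists (I * J)%type, (fun p => E p.1 `&` E' p.2), (fun p => c *: F p.1 + F' p.2).
split; first exact: partitionI.
  by move=> p x [Ex E'x]; apply: aux; [exact: EF|exact: EF'].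
have -> : simple_integral (fun p : I * J => E p.1 `&` E' p.2) (fun p => c *: F p.1 + F' p.2) =
    c *: simple_integral E F + simple_integral E' F'; last exact: aux.
rewrite (simple_integral_refine F fK pE pE') (simple_integral_refine F' fK pE' pE).
rewrite [X in _ + X]exchange_big !pair_big/= scaler_sumr -big_split; apply: eq_bigr => p _ /=.
by rewrite [E' _ `&` _]setIC scalerDr !scalerA mulrC.
Qed.

Lemma has_integral_cst K a : finite_meas K -> has_integral K (fun=> a) ((meas K)%:c *: a).
Proof.
move=> [mK _] e e0; exists unit, (fun=> K), (fun=> a); split.
- by split=> // [[] []//|x]; split=> [|[]//]; exists tt.
- by move=> _ x _; rewrite subrr cn0 ltW.
- by rewrite /simple_integral big_const card_unit/= addr0 subrr cn0 ltW.
Qed.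

Lemma has_integral_bound K f v c : finite_meas K -> has_integral K f v ->
  (forall x, K x -> N (f x) <= c) -> N v <= c * meas K.
Proof.
move=> fK fv fc; apply: (@le_eps _ _ _ (1 + meas K)) => e e0.
have [I [E [F [pE EF vF]]]] := fv _ e0.
have pK : finite_partition K (fun _ : unit => K).
  by split=> [_|[] []//|x]; [by case: fK|split=> [|[]//]; exists tt].
have h : N (simple_integral E F) <= \sum_(j : unit) meas K * (c + e).
  apply: (simple_integral_le fK pE pK) => i _ x Ex Kx.
  have := cn_tri N (f x) (F i) 0; rewrite !subr0 (cnB N (F i)).
  by have := EF i x Ex; have := fc x Kx; lra.
rewrite big_const card_unit/= addr0 in h.
have := cn_tri N (simple_integral E F) v 0; rewrite !subr0; lra.
Qed.

Lemma has_integral_uniq K f v u : finite_meas K ->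
  has_integral K f v -> has_integral K f u -> v = u.
Proof.
move=> fK fv fu; have h : has_integral K (0 : T -> V) (v - u).
  have -> : v - u = (-1) *: u + v by rewrite scaleN1r addrC.
  apply: (eq_has_integral _ (has_integral_linear (-1) fK fu fv)) => x _.
  by rewrite -[LHS]/(-1 *: f x + f x) scaleN1r addNr.
apply/eqP; rewrite -subr_eq0; apply/eqP; apply: (@cn_eq0 _ _ N); apply: le_anti; rewrite cn_ge0 andbT.
rewrite -(mul0r (meas K)); apply: (has_integral_bound fK h) => x _.
by rewrite cn0.
Qed.

Lemma has_integral_extend K K' f v : finite_meas K -> finite_meas K' -> K `<=` K' ->
  (forall x, ~ K x -> f x = 0) -> has_integral K f v -> has_integral K' f v.
Proof.
move=> fK fK' KK' f0 fv e e0; have [I [E [F [pE EF vF]]]] := fv _ e0.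
pose E' (o : option I) := if o is Some i then E i else K' `\` K.
pose F' (o : option I) := if o is Some i then F i else 0.
have [mE dE cE] := pE; exists (option I), E', F'; split.
- split=> [[i|]|[i|] [j|] x//=|x].
  + exact: mE.
  + by apply: measurableD; [case: fK'|case: fK].
  + by move=> a b; rewrite (dE i j x).
  + by move=> /(partition_sub pE) Kx [].
  + by move=> [_ nK] /(partition_sub pE).
  + split=> [K'x|[[i|]]/=]; last 2 first.
    * by move=> /(partition_sub pE)/KK'.
    * by case.
    by have [/cE[i Ei]|nK] := pselect (K x); [exists (Some i)|exists None].
- move=> [i|] x /=; first exact: EF.
  by move=> [_ /f0 ->]; rewrite subrr cn0 ltW.
- have -> : simple_integral E' F' = simple_integral E F; last by [].
  rewrite /simple_integral (bigD1 None)//= scaler0 add0r.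
  rewrite (reindex_omap Some id) => [|[]//]; apply: eq_big => // i.
  by rewrite eqxx.
Qed.

(** The factor [c] covers left translations, with c = 1, and right translations, with c a value of
    the modular function. *)
Lemma has_integral_change K (phi psi : T -> T) c f v : 0 < c ->
  (forall x, psi (phi x) = x) ->
  (forall x, phi (psi x) = x) ->
  (forall C, measurable C -> measurable (phi @` C) /\ mu (phi @` C) = (c%:E * mu C)%E) ->
  has_integral K f v -> has_integral (phi @` K) (f \o psi) (c%:c *: v).
Proof.
move=> c0 phiK psiK mphi fv e e0; have c1 : 0 < c + 1 by rewrite addr_gt0.
have [I [E [F [pE EF vF]]]] := fv _ (divr_gt0 e0 c1); have [mE dE cE] := pE.
have ce : e / (c + 1) <= e by rewrite ler_pdivrMr// ler_peMr ?(ltW e0)// lerDr ltW.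
exists I, (fun i => phi @` E i), F; split.
- split=> [i|i j x [y Ey <-] [z Ez /(congr1 psi)]|x].
  + by have [] := mphi _ (mE i).
  + by rewrite !phiK => zy; apply: (dE i j y) => //; rewrite -zy.
  + split=> [[y /cE[i Ei] <-]|[i [y Ei <-]]]; first by exists i, y.
    by exists y => //; apply/cE; exists i.
- by move=> i _ [x Ex <-]; rewrite /= phiK (le_trans (EF _ _ Ex)).
- have -> : simple_integral (fun i => phi @` E i) F = c%:c *: simple_integral E F.
    rewrite /simple_integral scaler_sumr; apply: eq_bigr => i _.
    rewrite scalerA -rmorphM; congr (_%:c *: _); rewrite /meas (mphi _ (mE i)).2.
    have [->|moo] := eqVneq (mu (E i)) +oo%E.
      by rewrite gt0_muley ?lte_fin//= mulr0.
    by rewrite fineM// ge0_fin_numE// lt_neqAle moo leey.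
  rewrite -scalerBr cnZ cabs_real gtr0_norm//.
  rewrite (le_trans (ler_wpM2l (ltW c0) vF))// mulrCA ler_piMr ?(ltW e0)//.
  by rewrite ler_pdivrMr// mul1r lerDl.
Qed.

End vector_integral.

(** Only real linearity is asked of [psi], so that the involution and complex conjugation are
    covered. *)
Lemma has_integral_map {V V' : starAlgType R} (N : cnorm V) (N' : cnorm V') K
    (psi : V -> V') (C : R) f v : 0 <= C ->
  (forall (r : R) a b, psi (r%:c *: a + b) = r%:c *: psi a + psi b) ->
  (forall a, N' (psi a) <= C * N a) ->
  has_integral N K f v -> has_integral N' K (psi \o f) (psi v).
Proof.
move=> C0 lpsi bpsi fv e e0; have C1 : 0 < C + 1 by rewrite ltr_wpDl.
have [I [E [F [pE EF vF]]]] := fv _ (divr_gt0 e0 C1).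
have psi0 : psi 0 = 0 by have := lpsi (-1) 0 0; rewrite scaler0 add0r rmorphN rmorph1 scaleN1r addNr.
have aux a b : N (a - b) <= e / (C + 1) -> N' (psi a - psi b) <= e.
  have -> : psi a - psi b = psi (a - b).
    by have := lpsi (-1) b a; rewrite rmorphN rmorph1 !scaleN1r addrC => ->; rewrite addrC.
  move=> h; rewrite (le_trans (bpsi _))// (le_trans (ler_wpM2l C0 h))//.
  by rewrite mulrCA ler_piMr ?(ltW e0)// ler_pdivrMr// mul1r lerDl.
exists I, E, (psi \o F); split=> //; first by move=> i x Ex; apply: aux; exact: EF.
have -> : simple_integral E (psi \o F) = psi (simple_integral E F); last exact: aux.
rewrite /simple_integral; elim/big_rec2: _ => [|i a b _ ->]; first by rewrite psi0.
by rewrite lpsi.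
Qed.

Local Notation Cn := (@complex_cnorm R).

(* Real integrals are has_integral for functions with values in R[i]. *)
Lemma has_integral_dominated {V : starAlgType R} (N : cnorm V) K f v (w : T -> R) W :
  finite_meas K -> has_integral N K f v -> has_integral Cn K (fun x => (w x)%:c) W ->
  (forall x, K x -> N (f x) <= w x) -> N v <= complex.Re W.
Proof.
move=> fK fv wW fw; apply: (@le_eps _ _ _ (2 + 2 * meas K)) => e e0.
have [I [E [F [pE EF vF]]]] := fv _ e0; have [J [E' [F' [pE' EF' WF']]]] := wW _ e0.
have h : N (simple_integral E F) <= \sum_j meas (E' j) * (complex.Re (F' j) + 2 * e).
  apply: (simple_integral_le fK pE pE') => i j x Ex E'x.
  have := cn_tri N (f x) (F i) 0; rewrite !subr0 (cnB N (F i)).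
  have Kx : K x by exact: partition_sub pE _ Ex.
  have := EF i x Ex; have := fw x Kx; have := EF' j x E'x.
  rewrite -[Cn _]/(cabs _) cnB => /(le_trans (cabs_Re _)).
  by rewrite raddfB/= ler_norml => /andP[_]; lra.
have hW : \sum_j meas (E' j) * (complex.Re (F' j) + 2 * e) =
    complex.Re (simple_integral E' F') + 2 * e * meas K.
  rewrite (meas_partition fK pE' (proj1 fK))// mulr_sumr /simple_integral raddf_sum -big_split.
  apply: eq_bigr => j _ /=; rewrite setIidr; last exact: partition_sub pE'.
  by rewrite mulrDr [X in _ = _ + X]mulrC; congr (_ + _); case: (F' j) => a b /=; rewrite mul0r subr0.
have := le_trans (cabs_Re _) WF'; rewrite raddfB/= ler_norml => /andP[+ _].
have := cn_tri N (simple_integral E F) v 0; rewrite !subr0; lra.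
Qed.

(** The bridge to the Lebesgue integral: on each piece of the partition the function stays within e
    of a constant. *)
Lemma has_integral_Re K (f : T -> R[i]^o) c : finite_meas K ->
  mu.-integrable K (EFin \o (fun x => complex.Re (f x))) -> has_integral Cn K f c ->
  \int[mu]_(x in K) complex.Re (f x) = complex.Re c.
Proof.
move=> fK If fc; set g := fun x => complex.Re (f x).
suff h : `|\int[mu]_(x in K) g x - complex.Re c| <= 0.
  by apply/eqP; rewrite -subr_eq0 -normr_le0.
apply: (@le_eps _ _ _ (1 + meas K)) => e e0; rewrite add0r.
have [I [E [F [pE EF cF]]]] := fc _ e0; have [mE _ _] := pE.
have IE C : measurable C -> C `<=` K -> mu.-integrable C (EFin \o g).
  by move=> mC CK; apply: integrableS If => //; case: fK.
have gE : \int[mu]_(x in K) g x = \sum_i \int[mu]_(x in E i) g x.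
  rewrite (partition_additive (phi := fun C => \int[mu]_(x in C) g x) pE (proj1 fK))//.
  - by apply: eq_bigr => i _; rewrite setIidr//; exact: partition_sub pE.
  - exact: Rintegral_set0.
  - move=> A B mA mB AK BK AB; rewrite Rintegral_setU//; last exact/disj_set2P.
    by apply: IE; [exact: measurableU|move=> x []; [exact: AK|exact: BK]].
have ge i : `|\int[mu]_(x in E i) g x - meas (E i) * complex.Re (F i)| <= meas (E i) * e.
  have EK := partition_sub pE (i := i); have fE := finite_measS fK (mE i) EK.
  have Ic r : mu.-integrable (E i) (EFin \o (fun=> r)).
    by apply: measurable_bounded_integrable => //; [case: fE|exact: bounded_cst].
  have bd x : E i x -> complex.Re (F i) - e <= g x <= complex.Re (F i) + e.
    move=> /EF h; have := le_trans (cabs_Re _) h; rewrite raddfB/= ler_norml.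
    by rewrite -/(g x) => /andP[h1 h2]; apply/andP; split; lra.
  have h1 : \int[mu]_(x in E i) (complex.Re (F i) - e) <= \int[mu]_(x in E i) g x.
    by apply: le_Rintegral => //; [exact: IE|move=> x /bd/andP[]].
  have h2 : \int[mu]_(x in E i) g x <= \int[mu]_(x in E i) (complex.Re (F i) + e).
    by apply: le_Rintegral => //; [exact: IE|move=> x /bd/andP[]].
  rewrite !Rintegral_cst// -/(meas _) in h1 h2.
  by rewrite ler_norml; apply/andP; split; lra.
have hF : complex.Re (simple_integral E F) = \sum_i meas (E i) * complex.Re (F i).
  rewrite /simple_integral raddf_sum; apply: eq_bigr => i _.
  by case: (F i) => a b /=; rewrite mul0r subr0.
have h1 : `|\int[mu]_(x in K) g x - complex.Re (simple_integral E F)| <= e * meas K.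
  rewrite gE hF -sumrB (le_trans (ler_norm_sum _ _ _))//.
  rewrite (meas_partition fK pE (proj1 fK))// mulr_sumr; apply: ler_sum => i _.
  by rewrite setIidr ?(mulrC e)//; exact: partition_sub pE.
have h2 := le_trans (cabs_Re _) cF; rewrite raddfB/= in h2.
have := ler_distD (complex.Re (simple_integral E F)) (\int[mu]_(x in K) g x) (complex.Re c).
rewrite (distrC (complex.Re (simple_integral E F)) (complex.Re c)) => /le_trans; apply.
by rewrite mulrDl mul1r [leRHS]addrC lerD// mulrC.
Qed.

End finite_partitions.

Lemma image_preimage_inv {X Y : Type} (phi : X -> Y) (psi : Y -> X) (C : set X) :
  (forall x, psi (phi x) = x) -> (forall x, phi (psi x) = x) -> phi @` C = psi @^-1` C.
Proof.
move=> phiK psiK; apply/seteqP; split=> [_ [x Cx <-]|y Cy]; first by rewrite /= phiK.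
by exists (psi y).
Qed.

Lemma mulg_continuousl {G : topGroupType} (g : G) : continuous (fun x => (g * x)%g).
Proof.
move=> s; apply: (@continuous2_cvg _ _ _ _ (nbhs s) _ (fun=> g) id (fun a b : G => (a * b)%g) g s).
- exact: (@mulg_continuous G (g, s)).
- exact: cvg_cst.
- exact: cvg_id.
Qed.

Lemma mulg_continuousr {G : topGroupType} (g : G) : continuous (fun x => (x * g)%g).
Proof.
move=> s; apply: (@continuous2_cvg _ _ _ _ (nbhs s) _ id (fun=> g) (fun a b : G => (a * b)%g) s g).
- exact: (@mulg_continuous G (s, g)).
- exact: cvg_id.
- exact: cvg_cst.
Qed.

(** * Integrals of continuous functions on compact sets of the group *)

Section group_integral.
Context {R : realType} {G : topGroupType} (mu : {measure set (borel G) -> \bar R}).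
Hypothesis lcG : locally_compact_group G.
Hypothesis haar : left_haar mu.
Implicit Types (K C : set G).
Local Notation Cn := (@complex_cnorm R).

Lemma open_measurable_borel (U : set G) : open U -> measurable (U : set (borel G)).
Proof. by move=> oU; exact: sub_sigma_algebra. Qed.

Lemma closed_measurable_borel C : closed C -> measurable (C : set (borel G)).
Proof. by move=> cC; rewrite -[C]setCK; apply: measurableC; apply: open_measurable_borel; exact: closed_openC. Qed.

Lemma compact_is_closed K : compact K -> closed K.
Proof. exact: (compact_closed (proj1 lcG)). Qed.

Lemma compact_finite_meas K : compact K -> finite_meas mu (K : set (borel G)).
Proof.
move=> cK; split; first exact: closed_measurable_borel (compact_is_closed cK).
by have [_ h _] := haar; exact: h.
Qed.

(** A finite subcover is made disjoint by removing the earlier members from each one. The tag [t i]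
    need not lie in its piece [E i]. *)
Lemma fine_partition K (U : G -> set G) : compact K ->
  (forall x, K x -> open (U x) /\ U x x) ->
  exists n (t : 'I_n -> G) (E : 'I_n -> set (borel G)),
    finite_partition (K : set (borel G)) E /\ forall i, K (t i) /\ E i `<=` U (t i).
Proof.
move=> cK KU; have := cK; rewrite compact_cover => /(_ G K U)[].
- by move=> x /KU[].
- by move=> x Kx; exists x => //; case: (KU x Kx).
move=> D DK Kcov; pose s := finmap.enum_fset D; pose t (i : 'I_(size s)) := nth point s i.
pose W (i : 'I_(size s)) := \bigcup_(j in [set j : 'I_(size s) | (j < i)%N]) U (t j).
have Kt i : K (t i) by have := DK (t i) (mem_nth point (ltn_ord i)); rewrite inE.
have oU i : open (U (t i)) by case: (KU _ (Kt i)).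
exists (size s), t, (fun i => K `&` U (t i) `\` W i); split; last first.
  by move=> i; split=> // x [[]].
split.
- move=> i; apply: measurableD; last first.
    by apply: open_measurable_borel; apply: bigcup_open => j _.
  apply: measurableI; first exact: closed_measurable_borel (compact_is_closed cK).
  exact: open_measurable_borel.
- have lem i j x : (K `&` U (t i) `\` W i) x -> (K `&` U (t j) `\` W j) x -> (i <= j)%N.
    move=> [_ nW] [[_ Uj] _]; rewrite leqNgt; apply/negP => ji.
    by apply: nW; exists j.
  by move=> i j x hi hj; apply/val_inj/eqP; rewrite eqn_leq (lem i j x hi hj) (lem j i x hj hi).
- move=> x; split=> [Kx|[i [[]]]//].
  have [y yD Uy] := Kcov x Kx; have ys : y \in s by exact: yD.
  have ex : exists k, (k < size s)%N && `[< U (nth point s k) x >].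
    by exists (index y s); rewrite index_mem ys; apply/asboolP; rewrite nth_index.
  case: (ex_minnP ex) => k /andP[ks /asboolP Ux] kmin; exists (Ordinal ks); split=> //.
  move=> [j /= jk Uj]; have : (k <= j)%N by apply: kmin; rewrite ltn_ord; exact/asboolP.
  by rewrite leqNgt jk.
Qed.

Lemma continuous_borel (psi : G -> G) (C : set (borel G)) : continuous psi -> measurable C ->
  measurable (psi @^-1` C : set (borel G)).
Proof.
move=> cpsi mC; rewrite -[_ @^-1` _]setTI.
have h : measurable_fun [set: borel G] (psi : borel G -> borel G).
  apply: (@measurability _ _ (borel G) (borel G) setT psi (@open G) erefl) => _ [U oU <-].
  rewrite setTI.
  by apply: open_measurable_borel; exact: open_comp.
exact: h.
Qed.

Section existence.
Context {V : starAlgType R} (N : cnorm V).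

Definition cn_continuous (f : G -> V) := forall x e, 0 < e -> \forall y \near x, N (f y - f x) <= e.

Lemma osc_nbhs f x e : cn_continuous f -> 0 < e ->
  exists U : set G, [/\ open U, U x & forall y z, U y -> U z -> N (f y - f z) <= e].
Proof.
move=> cf e0; have e2 : 0 < e / 2 by rewrite divr_gt0.
have := cf x _ e2; rewrite /prop_near1 nbhsE => -[U [oU Ux] UP]; exists U; split=> // y z /UP hy /UP hz.
by have := cn_tri N (f x) (f y) (f z); rewrite (cnB N (f x)); move: hy hz => /=; lra.
Qed.

Lemma fine_osc K f e : compact K -> cn_continuous f -> 0 < e ->
  exists n (t : 'I_n -> G) (E : 'I_n -> set (borel G)),
    [/\ finite_partition (K : set (borel G)) E, forall i, K (t i) &
        forall i x, E i x -> N (f x - f (t i)) <= e].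
Proof.
move=> cK cf e0; have [U UP] := choice (fun x => osc_nbhs x cf e0).
have [n [t [E [pE tE]]]] := @fine_partition K U cK (fun x _ => let: And3 a b _ := UP x in conj a b).
exists n, t, E; split=> // [i|i x Ex]; first by have [] := tE i.
by have [_ Ut h] := UP (t i); apply: h => //; exact: (tE i).2.
Qed.

Lemma simple_integral_close K (I J : finType) (E : I -> set (borel G)) (E' : J -> set (borel G))
    F F' f e e' : finite_meas mu (K : set (borel G)) ->
  finite_partition (K : set (borel G)) E -> finite_partition (K : set (borel G)) E' ->
  (forall i x, E i x -> N (f x - F i) <= e) -> (forall i x, E' i x -> N (f x - F' i) <= e') ->
  N (simple_integral mu E F - simple_integral mu E' F') <= meas mu K * (e + e').
Proof.
move=> fK pE pE' EF EF'.
have -> : simple_integral mu E F - simple_integral mu E' F' =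
    simple_integral mu (fun p : I * J => E p.1 `&` E' p.2) (fun p => F p.1 - F' p.2).
  rewrite (simple_integral_refine F fK pE pE') (simple_integral_refine F' fK pE' pE).
  rewrite [X in _ - X]exchange_big !pair_big/= -sumrB; apply: eq_bigr => p _ /=.
  by rewrite [E' _ `&` _]setIC scalerBr.
have pK : finite_partition (K : set (borel G)) (fun _ : unit => K : set (borel G)).
  by split=> [_|[] []//|x]; [by case: fK|split=> [|[]//]; exists tt].
rewrite (le_trans (simple_integral_le (w := fun=> e + e') fK (partitionI pE pE') pK _))//.
  move=> p _ x [Ex E'x] _; have := cn_tri N (f x) (F p.1) (F' p.2).
  by rewrite (cnB N (F p.1) (f x)); have := EF _ _ Ex; have := EF' _ _ E'x; lra.
by rewrite big_const card_unit/= addr0.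
Qed.

(** Simple integrals over partitions of oscillation at most 2^-n form a Cauchy sequence, as common
    refinements show. *)
Lemma has_integral_ex K f : compact K -> cn_continuous f ->
  exists v, has_integral mu N (K : set (borel G)) f v.
Proof.
move=> cK cf; have fK := compact_finite_meas cK.
pose w n : R := 2^-1 ^+ n; have w0 n : 0 < w n by rewrite exprn_gt0// invr_gt0.
have /choice[u uP] : forall n, exists u, exists (I : finType) (E : I -> set (borel G)) (F : I -> V),
    [/\ finite_partition (K : set (borel G)) E, forall i x, E i x -> N (f x - F i) <= w n &
        u = simple_integral mu E F].
  move=> n; have [m [t [E [pE _ tE]]]] := fine_osc cK cf (w0 n).
  by exists (simple_integral mu E (f \o t)), 'I_m, E, (f \o t).
have uu m n : N (u m - u n) <= meas mu K * (w m + w n).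
  have [I [E [F [pE EF ->]]]] := uP m; have [J [E' [F' [pE' EF' ->]]]] := uP n.
  exact: (simple_integral_close fK pE pE' EF EF').
have m0 := meas_ge0 mu (K : set (borel G)).
have [v uv] : exists v, tends N u v.
  apply: cauchy_tends => e e0; have k0 : 0 < 2 * (meas mu K + 1) by rewrite mulr_gt0// ltr_wpDl.
  have [n hn] := half_small (divr_gt0 e0 k0); exists n => m nm; rewrite (le_trans (uu _ _))//.
  have := hn m nm; have := hn n (leqnn n); rewrite -/(w _) -/(w _) !ler_pdivlMr//.
  by have := w0 m; have := w0 n; nra.
exists v => e e0; have [n hn] := half_small e0; have [k hk] := uv e e0.
have h1 := hn _ (leq_maxl n k); have h2 := hk _ (leq_maxr n k).
have [I [E [F [pE EF uE]]]] := uP (maxn n k); exists I, E, F; split=> //.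
- by move=> i x Ex; exact: le_trans (EF i x Ex) h1.
- by rewrite -uE cnB.
Qed.

End existence.

Lemma cn_continuous_map {V V' : starAlgType R} (N : cnorm V) (N' : cnorm V') (psi : V -> V')
    (C : R) (f : G -> V) : 0 <= C ->
  (forall a b, N' (psi a - psi b) <= C * N (a - b)) -> cn_continuous N f ->
  cn_continuous N' (psi \o f).
Proof.
move=> C0 psiC cf x e e0; have C1 : 0 < C + 1 by rewrite ltr_wpDl.
apply: filterS (cf x _ (divr_gt0 e0 C1)) => y h.
rewrite (le_trans (psiC _ _))// (le_trans (ler_wpM2l C0 h))//.
by rewrite mulrCA ler_piMr ?(ltW e0)// ler_pdivrMr// mul1r lerDl.
Qed.

Lemma cn_continuousP {A : cstarAlgType R} (f : G -> A) :
  continuous f <-> cn_continuous (@cstar_cnorm R A) f.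
Proof.
split=> cf x.
  move=> e e0; have /cvgrPdist_le/(_ e%:c) := cf x; rewrite ltcR => /(_ e0).
  by apply: filterS => y; rewrite le_rnorm rnormB.
apply/cvgrPdist_le => e /pos_complex[-> e0]; apply: filterS (cf x _ e0) => y.
by rewrite le_rnorm rnormB.
Qed.

Lemma cn_continuous_measurable (g : G -> R) : continuous g ->
  measurable_fun [set: borel G] (g : borel G -> R).
Proof.
move=> cg; apply: (measurability _ (measurable_realfun.RGenOInfty.measurableE R)) => // _ [_ [x ->] <-].
rewrite setTI; apply: open_measurable_borel; exact: open_comp.
Qed.

Lemma continuous_integrable K (g : G -> R) : compact K -> continuous g ->
  mu.-integrable (K : set (borel G)) (EFin \o g).
Proof.
move=> cK cg; have [mK Koo] := compact_finite_meas cK.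
apply: measurable_bounded_integrable => //.
  by apply: measurable_funS (cn_continuous_measurable cg).
have : compact (g @` K) by apply: continuous_compact => //; exact: continuous_subspaceT.
move=> /compact_bounded[M [Mr MP]]; exists M; split=> // r Mr' x Kx.
by apply: (MP r Mr'); exists x.
Qed.

Lemma has_integral_complex K (f : G -> R[i]^o) c : compact K -> cn_continuous Cn f ->
  (forall x, ~ K x -> f x = 0) -> has_integral mu Cn (K : set (borel G)) f c ->
  complex_integral mu f = c.
Proof.
move=> cK cf f0 fc; have fK := compact_finite_meas cK.
have red (h : R[i]^o -> R) : h 0 = 0 -> \int[mu]_x h (f x) = \int[mu]_(x in K) h (f x).
  move=> h0; rewrite [RHS]Rintegral_mkcond; apply: eq_Rintegral => x _.
  by rewrite patchE; case: ifPn => // /negP nK; rewrite f0 ?h0// => Kx; apply: nK; rewrite inE.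
have cont (h : R[i]^o -> R) : (forall a b, `|h a - h b| <= cabs (a - b)) -> continuous (h \o f).
  move=> hl x; apply/cvgrPdist_le => e e0; apply: filterS (cf x _ e0) => y /= fy.
  by rewrite distrC (le_trans (hl _ _)).
have cRe : continuous (@complex.Re R \o f).
  by apply: cont => a b; rewrite -raddfB; exact: cabs_Re.
have cIm : continuous (@complex.Im R \o f).
  by apply: cont => a b; rewrite -raddfB; exact: cabs_Im.
have ReE : \int[mu]_x complex.Re (f x) = complex.Re c.
  rewrite red//; apply: has_integral_Re => //; exact: continuous_integrable.
have ImE : \int[mu]_x complex.Im (f x) = complex.Im c.
  (* Multiplication by -i turns the imaginary part into a real part. *)
  rewrite red//; pose psi (a : R[i]^o) : R[i]^o := - 'i%C * a.
  have psiE a : complex.Re (psi a) = complex.Im a.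
    by case: a => x y /=; rewrite !(mul0r, mulN1r, oppr0, sub0r, opprK, add0r, mulNr, mul1r).
  have := @has_integral_map _ _ _ mu _ _ Cn Cn (K : set (borel G)) psi 1 f c ler01.
  have l (r : R) a b : psi (r%:c *: a + b) = r%:c *: psi a + psi b.
    by rewrite /psi mulrDr; congr (_ + _); exact: mulrCA.
  have bd a : Cn (psi a) <= 1 * Cn a.
    by rewrite mul1r -![Cn _]/(cabs _) cabsM cabsN cabs_i mul1r.
  move=> /(_ l bd fc)/(has_integral_Re fK).
  rewrite -psiE => <-; first by apply: eq_Rintegral => x _; rewrite -psiE.
  rewrite (_ : EFin \o _ = EFin \o (@complex.Im R \o f)); first exact: continuous_integrable.
  by apply/funext => x /=; rewrite psiE.
by rewrite /complex_integral ReE ImE; case: (c).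
Qed.

(** Integrals are constructed strongly; testing against a bounded functional gives the weak form in
    which convolutions and integrated forms are defined. *)
Lemma has_integral_is_integral {A : cstarAlgType R} K (f : G -> A) v : compact K ->
  continuous f -> (forall x, ~ K x -> f x = 0) ->
  has_integral mu (@cstar_cnorm R A) (K : set (borel G)) f v -> is_integral mu f v.
Proof.
move=> cK cf f0 fv psi cpsi.
have [C C0 psiC] : exists2 C : R, 0 <= C & forall a, cabs (psi a) <= C * rnorm a.
  have /linear_bounded_continuous/linear_boundedP/pinfty_ex_gt0[r /pos_complex[rE r0] rP] := cpsi.
  exists (complex.Re r); first exact: ltW.
  by move=> a; have := rP a; rewrite rE (rnormE a) -rmorphM lecR.
apply/esym/(has_integral_complex cK) => [|x /f0 ->|]; first last.
- apply: (@has_integral_map _ _ R mu A R[i]^o (@cstar_cnorm R A) Cn (K : set (borel G)) psi C f v C0 _ psiC fv) => r a b.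
  exact: linearP.
- exact: raddf0.
- apply: (cn_continuous_map C0 _ ((cn_continuousP f).1 cf)) => a b.
  by rewrite -raddfB; exact: psiC.
Qed.

Lemma has_integral_left_translate {V : starAlgType R} (N : cnorm V) K (g : G) (f : G -> V) v :
  has_integral mu N (K : set (borel G)) f v ->
  has_integral mu N ([set (g * x)%g | x in K] : set (borel G)) (fun x => f (g^-1 * x)%g) v.
Proof.
move=> fv; rewrite -[v]scale1r -[1]/(1%:c).
apply: (has_integral_change (phi := fun x : borel G => (g * x)%g : borel G)
  (psi := fun x : borel G => (g^-1 * x)%g : borel G) ltr01 _ _ _ fv).
- by move=> x; rewrite mulKg.
- by move=> x; rewrite mulgA mulgV mul1g.
- move=> C mC; have [h _ _] := haar; split; last by rewrite mul1e h.
  rewrite (image_preimage_inv (psi := fun x => (g^-1 * x)%g)) => [|x|x].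
  - by apply: continuous_borel => //; exact: mulg_continuousl.
  - by rewrite mulKg.
  - by rewrite mulgA mulgV mul1g.
Qed.

Lemma has_integral_right_translate (Delta : G -> R) {V : starAlgType R} (N : cnorm V) K (g : G)
    (f : G -> V) v : modular_function mu Delta ->
  has_integral mu N (K : set (borel G)) f v ->
  has_integral mu N ([set (x * g)%g | x in K] : set (borel G)) (fun x => f (x * g^-1)%g)
    ((Delta g)%:c *: v).
Proof.
move=> /(_ g)[D0 DP] fv.
apply: (has_integral_change (phi := fun x : borel G => (x * g)%g : borel G)
  (psi := fun x : borel G => (x * g^-1)%g : borel G) D0 _ _ _ fv).
- by move=> x; rewrite -mulgA mulgV mulg1.
- by move=> x; rewrite -mulgA mulVg mulg1.
- move=> C mC; split; last by rewrite DP.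
  rewrite (image_preimage_inv (psi := fun x => (x * g^-1)%g)) => [|x|x].
  - by apply: continuous_borel => //; exact: mulg_continuousr.
  - by rewrite -mulgA mulgV mulg1.
  - by rewrite -mulgA mulVg mulg1.
Qed.

End group_integral.

Lemma has_integralZ {d} {T : measurableType d} {R : realType} (mu : {measure set T -> \bar R})
    {V : starAlgType R} (N : cnorm V) K c (f : T -> V) v :
  has_integral mu N K f v -> has_integral mu N K (fun x => c *: f x) (c *: v).
Proof.
apply: (has_integral_map (psi := fun a => c *: a) (C := cabs c)).
- exact: cabs_ge0.
- by move=> r a b; lmod V; ring.
- by move=> a; rewrite cnZ.
Qed.

Lemma has_integral0 {d} {T : measurableType d} {R : realType} (mu : {measure set T -> \bar R})
    {V : starAlgType R} (N : cnorm V) K : finite_meas mu K -> has_integral mu N K (fun=> 0) 0.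
Proof. by move=> fK; have := has_integral_cst N 0 fK; rewrite scaler0. Qed.

Lemma cstar_star_continuous {R : realType} {A : cstarAlgType R} : continuous (@star R A).
Proof.
move=> x; apply/cvgrPdist_le => e e0; have : nbhs x (ball x e) by exact: nbhsx_ballx.
by apply: filterS => y; rewrite -ball_normE/= -starB norm_star => /ltW.
Qed.

Lemma cstar_mul_continuous {R : realType} {A : cstarAlgType R} :
  continuous (fun p : A * A => p.1 ** p.2).
Proof.
move=> [a b]; apply/cvgrPdist_le => e /pos_complex[-> e0]; set d := complex.Re e.
have k0 : 0 < rnorm a + rnorm b + 1 by rewrite ltr_wpDl// addr_ge0// rnorm_ge0.
pose k := Num.min 1 (d / (rnorm a + rnorm b + 1)).
have kp : 0 < k by rewrite lt_min ltr01 divr_gt0.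
have : nbhs (a, b) (ball a k%:c `*` ball b k%:c).
  by exists (ball a k%:c, ball b k%:c) => //; split; apply: nbhsx_ballx; rewrite ltcR.
apply: filterS => -[x y] [/= xa yb].
rewrite -!ball_normE/= !lt_rnorm in xa yb; rewrite le_rnorm.
have E (u v z t : A) : u ** v - z ** t = u ** (v - t) + (u - z) ** v - (u - z) ** (v - t).
  by rewrite !expand_smul; lmod A; ring.
rewrite E.
rewrite (le_trans (rnormD _ _))// rnormN.
have h1 := rnorm_smul_le a (b - y); have h2 := rnorm_smul_le (a - x) b.
have h3 := rnorm_smul_le (a - x) (b - y); have h4 := rnormD (a ** (b - y)) ((a - x) ** b).
have kd : k * (rnorm a + rnorm b + 1) <= d.
  by rewrite -ler_pdivlMr// /k ge_min lexx orbT.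
have k1 : k <= 1 by rewrite /k ge_min lexx.
have aux (p q u v m0 m1 m2 r l t : R) : m2 <= p * v -> m1 <= u * q -> m0 <= u * v ->
    r <= m2 + m1 -> l * (p + q + 1) <= t -> l <= 1 -> 0 < l -> u < l -> v < l ->
    0 <= v -> 0 <= u -> 0 <= q -> 0 <= p -> r + m0 <= t.
  move=> h5 h6 h7 h8 h9 l1 l0 ul vl v0 u0 q0 p0.
  have i1 : p * v <= p * l by rewrite ler_wpM2l// ltW.
  have i2 : u * q <= l * q by rewrite ler_wpM2r// ltW.
  have i3 : u * v <= l * 1 by rewrite ler_pM// ltW// (lt_le_trans vl).
  by move: h9; rewrite !mulrDr; lra.
apply: (aux (rnorm a) (rnorm b) _ _ _ _ _ _ _ _ h1 h2 h3 h4 kd k1 kp xa yb); exact: rnorm_ge0.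
Qed.

Section group_topology.
Context {G : topGroupType}.
Implicit Types (K C : set G).

Lemma mulg_continuous2 {T : topologicalType} (f g : T -> G) : continuous f -> continuous g ->
  continuous (fun x => (f x * g x)%g).
Proof.
move=> cf cg x.
apply: (@continuous2_cvg _ _ _ _ (nbhs x) _ f g (fun a b : G => (a * b)%g) (f x) (g x)).
- exact: (@mulg_continuous G (f x, g x)).
- exact: cf.
- exact: cg.
Qed.

Lemma invg_continuous2 {T : topologicalType} (f : T -> G) : continuous f ->
  continuous (fun x => (f x)^-1%g).
Proof. by move=> cf x; apply: continuous_comp; [exact: cf|exact: invg_continuous]. Qed.

Lemma compact_mul K C : compact K -> compact C ->
  compact [set (p.1 * p.2)%g | p in K `*` C].
Proof.
move=> cK cC; apply: continuous_compact; last exact: compact_setX.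
by apply: continuous_subspaceT; exact: mulg_continuous.
Qed.

Lemma compact_inv K : compact K -> compact [set (x^-1)%g | x in K].
Proof.
move=> cK; apply: continuous_compact => //.
by apply: continuous_subspaceT; exact: invg_continuous.
Qed.

Lemma compact_lmul (g : G) K : compact K -> compact [set (g * x)%g | x in K].
Proof.
move=> cK; apply: continuous_compact => //.
by apply: continuous_subspaceT; exact: mulg_continuousl.
Qed.

Lemma compact_rmul (g : G) K : compact K -> compact [set (x * g)%g | x in K].
Proof.
move=> cK; apply: continuous_compact => //.
by apply: continuous_subspaceT; exact: mulg_continuousr.
Qed.

Lemma compact_near {I : Type} (F : set_system I) (P : I -> G -> Prop) K : Filter F ->
  compact K -> (forall x, K x -> filter_prod (nbhs x) F (fun p => P p.2 p.1)) ->
  \forall i \near F, forall x, K x -> P i x.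
Proof. by move=> FF /compact_near_coveringP; apply. Qed.

End group_topology.

(** * Bump functions and the modular function *)

Section bumps.
Context {R : realType} {G : topGroupType} (mu : {measure set (borel G) -> \bar R}).
Hypothesis lcG : locally_compact_group G.
Hypothesis haar : left_haar mu.
Implicit Types (K C : set G).
Local Notation Cn := (@complex_cnorm R).

Lemma compact_nbhs (x : G) : exists2 K, compact K & nbhs x K.
Proof.
have [_ lc] := lcG; have := lc x I; rewrite withinET => -[K xK [cK _]].
by exists K.
Qed.

Lemma cn_continuous_real (w : G -> R) : continuous w ->
  cn_continuous Cn (fun x => (w x)%:c).
Proof.
move=> cw x e e0; have /cvgrPdist_le/(_ e e0) := cw x; apply: filterS => y.
by rewrite distrC -rmorphB -[Cn _]/(cabs _) cabs_real.
Qed.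

Lemma real_has_integral K (w : G -> R) W : finite_meas mu (K : set (borel G)) ->
  has_integral mu Cn (K : set (borel G)) (fun x => (w x)%:c) W -> W = (complex.Re W)%:c.
Proof.
move=> fK wW; have h : has_integral mu Cn (K : set (borel G)) (fun x => (w x)%:c) (conjC (W : R[i])).
  have := @has_integral_map _ _ R mu R[i]^o R[i]^o Cn Cn (K : set (borel G)) (@conjC R[i]) 1
    (fun x => (w x)%:c) W ler01.
  have l (r : R) (a b : R[i]^o) : conjC (r%:c *: a + b) = r%:c *: conjC a + conjC b :> R[i]^o.
    rewrite rmorphD; congr (_ + _); rewrite -[RHS]/(r%:c * conjC a) -[in RHS](conjC_real r).
    exact: rmorphM.
  have bd (a : R[i]^o) : Cn (conjC (a : R[i])) <= 1 * Cn a by rewrite mul1r -[Cn _]/(cabs _) cabs_conj.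
  move=> /(_ l bd wW); apply: eq_has_integral => x _; exact: conjC_real.
have := has_integral_uniq fK h wW; case: (W) => a b /eqP; rewrite eq_complex/= => /andP[_ /eqP].
by move=> bb; apply/eqP; rewrite eq_complex/= eqxx; apply/eqP; lra.
Qed.

(** Complete regularity gives a function equal to 1 at the unit and to 0 outside a small open set.
    The open set where it exceeds 1/2 has positive Haar measure, so its integral is positive and can
    be normalized. *)
Lemma bump (V : set G) : nbhs (1 : G)%g V -> exists (w : G -> R) (K : set G),
  [/\ continuous w /\ compact K, forall x, 0 <= w x, forall x, ~ V x -> w x = 0,
      forall x, ~ K x -> w x = 0 & has_integral mu Cn (K : set (borel G)) (fun x => (w x)%:c) 1].
Proof.
move=> nV; have [K cK nK] := compact_nbhs 1%g.
have : nbhs (1%g : G) (V `&` K) by exact: filterI.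
rewrite nbhsE => -[U [oU U1] UVK].
have [hG lc] := lcG.
have : uniform_separator [set (1 : G)%g] (~` U).
  by apply: (@locally_compact_completely_regular G R lc hG) => //; exact: open_closedC.
move=> /(uniform_separatorP (R := R))[f [cf f01 f1 fU]].
have f1' : f 1%g = 0 by apply: f1; exists 1%g.
have fU' x : ~ U x -> f x = 1 by move=> Ux; apply: fU; exists x.
have fle x : 0 <= f x <= 1 by have := f01 (f x); rewrite /= in_itv/=; apply; exists x.
pose w x := 1 - f x; have w0 x : 0 <= w x by have := fle x; rewrite /w; lra.
have cw : continuous w by move=> x; apply: cvgB; [exact: cvg_cst|exact: cf].
have fK := compact_finite_meas lcG haar cK.
have wU x : ~ U x -> w x = 0 by move=> /fU'; rewrite /w => ->; rewrite subrr.
have [W wW] := has_integral_ex lcG haar cK (cn_continuous_real cw).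
have WE := real_has_integral fK wW; set c := complex.Re W in WE.
pose O := U `&` [set x | 1 / 2 < w x].
have oO : open O.
  by apply: openI => //; apply: (@open_comp _ _ w [set r | 1 / 2 < r]) => //; exact: open_gt.
have OK : O `<=` K by move=> x [/UVK[]].
have mO := open_measurable_borel oO.
have fO := finite_measS fK mO OK.
have O0 : 0 < meas mu O.
  have [_ _ h] := haar; apply: fine_gt0; apply/andP; split; last by case: fO.
  by apply: h => //; exists 1%g; split=> //=; rewrite /w f1' subr0; lra.
have c0 : 0 < c.
  have h1 : has_integral mu Cn (O : set (borel G)) (fun x => if `[< O x >] then (1 / 2)%:c else 0)
      ((meas mu O)%:c *: ((1 / 2)%:c : R[i]^o)).
    apply: (eq_has_integral _ (has_integral_cst Cn ((1 / 2)%:c : R[i]^o) fO)) => x Ox.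
    by rewrite asboolT.
  have nO0 x : ~ O x -> (if `[< O x >] then (1 / 2)%:c else 0) = 0 :> R[i]^o.
    by move=> nO; rewrite asboolF.
  have := has_integral_dominated fK (has_integral_extend fO fK OK nO0 h1) wW.
  have hh : Cn ((meas mu O)%:c *: ((1 / 2)%:c : R[i]^o)) = meas mu O * (1 / 2).
    by rewrite -[_ *: _]/(_ * _) -rmorphM -[Cn _]/(cabs _) cabs_pos_real// mulr_ge0// ltW.
  rewrite hh -/c => hc; apply: (lt_le_trans _ (hc _)); first by rewrite mulr_gt0.
  move=> x _; case: asboolP => [[_ /= Ox]|_]; last by rewrite -[Cn _]/(cabs _) cabs0.
  by rewrite cabs_pos_real ?(ltW Ox)// divr_ge0.
exists (fun x => c^-1 * w x), K; split.
- by split=> // x; apply: cvgM; [exact: cvg_cst|exact: cw].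
- by move=> x; rewrite mulr_ge0// invr_ge0 ltW.
- by move=> x nVx; rewrite wU ?mulr0// => /UVK[].
- by move=> x nKx; rewrite wU ?mulr0// => /UVK[].
- have -> : (1 : R[i]^o) = c^-1%:c *: W.
    by rewrite WE -[_ *: _]/(_ * _) -rmorphM mulVf ?gt_eqF.
  apply: (eq_has_integral _ (has_integralZ c^-1%:c wW)) => x _.
  by rewrite [RHS]rmorphM.
Qed.

Lemma param_integral {V : starAlgType R} (N : cnorm V) K (F : G -> G -> V) : compact K ->
  (forall s, cn_continuous N (F s)) ->
  (forall (s r : G) (e : R), 0 < e -> filter_prod (nbhs r) (nbhs s) (fun p => N (F p.2 p.1 - F s p.1) <= e)) ->
  exists h, cn_continuous N h /\ forall s, has_integral mu N (K : set (borel G)) (F s) (h s).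
Proof.
move=> cK cF jF; have fK := compact_finite_meas lcG haar cK.
have /choice[h hP] s := has_integral_ex lcG haar cK (cF s).
exists h; split=> // s e e0.
have m1 : 0 < meas mu K + 1 by rewrite ltr_wpDl// meas_ge0.
have := @compact_near G G (nbhs s) (fun t r => N (F t r - F s r) <= e / (meas mu K + 1)) K _ cK
  (fun r _ => jF s r _ (divr_gt0 e0 m1)).
move=> hn; have {}hn := hn (nbhs_filter s); apply: filterS hn => t ht.
have hd := has_integral_linear (-1) fK (hP s) (hP t).
have -> : h t - h s = -1 *: h s + h t by rewrite scaleN1r addrC.
apply: (le_trans (has_integral_bound (c := e / (meas mu K + 1)) fK hd _)).
  by move=> x Kx; rewrite -[_ x]/(-1 *: F s x + F t x) scaleN1r addrC; exact: ht.
by rewrite mulrAC ler_pdivrMr// ler_wpM2l ?(ltW e0)// lerDl.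
Qed.

Lemma joint_param {A : cstarAlgType R} (F : G * G -> A) : continuous F ->
  (forall s, cn_continuous (@cstar_cnorm R A) (fun r => F (s, r))) /\
  (forall (s r : G) (e : R), 0 < e -> filter_prod (nbhs r) (nbhs s)
     (fun p => @cstar_cnorm R A (F (p.2, p.1) - F (s, p.1)) <= e)).
Proof.
move=> cF; split=> [s|s r e e0].
  apply/cn_continuousP => r; apply: (@continuous_comp _ _ _ (fun r : G => (s, r)) F); last exact: cF.
  by apply: cvg_pair; [exact: cvg_cst|exact: cvg_id].
have e2 : 0 < e / 2 by rewrite divr_gt0.
have /cvgrPdist_le/(_ (e / 2)%:c) := cF (s, r); rewrite ltcR => /(_ e2).
move=> [[P Q] /= [Ps Qr] PQ]; exists (Q, P) => // -[x y] /= [Qx Py].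
have h1 := PQ (y, x) (conj Py Qx); have h2 := PQ (s, x) (conj (nbhs_singleton Ps) Qx).
rewrite /= !le_rnorm in h1 h2; rewrite /=.
have -> : F (y, x) - F (s, x) = (F (s, r) - F (s, x)) - (F (s, r) - F (y, x)).
  by lmod A; ring.
by rewrite (le_trans (rnormD _ _))// rnormN; lra.
Qed.

Section modular.
Variable Delta : G -> R.
Hypothesis DeltaP : modular_function mu Delta.

Lemma Delta_gt0 g : 0 < Delta g.
Proof. by have [] := DeltaP g. Qed.

Lemma bump_right_translate w K g : has_integral mu Cn (K : set (borel G)) (fun x => (w x)%:c) 1 ->
  has_integral mu Cn ([set (x * g)%g | x in K] : set (borel G)) (fun x => (w (x * g^-1)%g)%:c)
    ((Delta g)%:c : R[i]^o).
Proof.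
move=> wK; have := has_integral_right_translate g DeltaP wK.
by rewrite -[X in has_integral _ _ _ _ X]/(_ * 1) mulr1.
Qed.

(** Both sides are the integral of the right translate by g h of one bump of integral 1. *)
Lemma DeltaM g h : Delta (g * h)%g = Delta g * Delta h.
Proof.
have [w [K [[cw cK] w0 _ wK iw]]] := bump filterT.
have h1 := bump_right_translate (g * h)%g iw.
have := has_integral_right_translate h DeltaP (bump_right_translate g iw).
have -> : [set (x * h)%g | x in [set (x * g)%g | x in K]] = [set (x * (g * h))%g | x in K].
  apply/seteqP; split=> [_ [_ [x Kx <-] <-]|_ [x Kx <-]].
    by exists x => //; rewrite mulgA.
  by exists (x * g)%g; [exists x|rewrite mulgA].
have cK' := @compact_rmul G (g * h)%g K cK.
have -> : (fun x => (w (x * h^-1 * g^-1)%g)%:c) = (fun x => (w (x * (g * h)^-1)%g)%:c : R[i]^o).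
  by apply/funext => x; rewrite invgM mulgA.
move=> /(has_integral_uniq (compact_finite_meas lcG haar cK') h1).
by rewrite -[RHS]/(_ * _) -rmorphM => /(@complexI R); rewrite mulrC.
Qed.

Lemma Delta1 : Delta 1%g = 1.
Proof.
have := DeltaM 1%g 1%g; rewrite mulg1 => h.
by apply: (mulfI (lt0r_neq0 (Delta_gt0 1%g))); rewrite mulr1 -h.
Qed.

Lemma DeltaV g : Delta g^-1%g = (Delta g)^-1.
Proof.
by apply: (mulfI (lt0r_neq0 (Delta_gt0 g))); rewrite -DeltaM mulgV Delta1 mulfV// gt_eqF// Delta_gt0.
Qed.

(** Delta(s) is the integral of the right translate by s of a bump. For s in a compact neighbourhood
    of [r0] the supports lie in one compact set, and the integral depends continuously on the
    parameter. *)
Lemma Delta_continuous : continuous Delta.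
Proof.
have [w [K [[cw cK] w0 _ wK iw]]] := bump filterT.
move=> r0; have [C cC nC] := compact_nbhs r0.
pose K' := [set (p.1 * p.2)%g | p in K `*` C].
have cK' : compact K' by exact: compact_mul.
pose F (p : G * G) : R[i]^o := (w (p.2 * p.1^-1)%g)%:c.
have cFw : continuous (fun p : G * G => w (p.2 * p.1^-1)%g).
  move=> p; apply: continuous_comp; last exact: cw.
  apply: (@mulg_continuous2 G _ snd (fun p => p.1^-1%g)) => q; first exact: cvg_snd.
  by apply: (@invg_continuous2 G _ fst) => z; exact: cvg_fst.
have [h [ch hP]] : exists h, cn_continuous Cn h /\
    forall s, has_integral mu Cn (K' : set (borel G)) (fun r => F (s, r)) (h s).
  apply: (@param_integral _ Cn K' (fun s r => F (s, r)) cK') => [s|s r e e0].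
    apply: cn_continuous_real => r.
    apply: (@continuous_comp _ _ _ (fun r : G => (s, r)) (fun p : G * G => w (p.2 * p.1^-1)%g)); last exact: cFw.
    by apply: cvg_pair; [exact: cvg_cst|exact: cvg_id].
  have e2 : 0 < e / 2 by rewrite divr_gt0.
  have /cvgrPdist_le/(_ _ e2) := cFw (s, r).
  move=> [[P Q] /= [Ps Qr] PQ]; exists (Q, P) => // -[x y] /= [Qx Py].
  have h1 := PQ (y, x) (conj Py Qx); have h2 := PQ (s, x) (conj (nbhs_singleton Ps) Qx).
  rewrite /= -[cabs _]/(cabs (_%:c - _%:c)) -rmorphB cabs_real.
  rewrite /= in h1 h2; have := ler_distD (w (r * s^-1)%g) (w (x * y^-1)%g) (w (x * s^-1)%g).
  move=> /le_trans; apply.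
  by rewrite (splitr e) lerD// distrC.
have hD s : C s -> h s = (Delta s)%:c.
  move=> Cs; apply: (has_integral_uniq (compact_finite_meas lcG haar cK') (hP s)).
  apply: (has_integral_extend _ _ _ _ (bump_right_translate s iw)).
  - exact: compact_finite_meas (@compact_rmul G s K cK).
  - exact: compact_finite_meas cK'.
  - by move=> _ [x Kx <-]; exists (x, s).
  - move=> x nx; rewrite wK// => Kx; apply: nx; exists (x * s^-1)%g => //.
    by rewrite -mulgA mulVg mulg1.
apply/cvgrPdist_le => e e0; have : nbhs r0 (C `&` (fun y => Cn (h y - h r0) <= e)) by apply: filterI nC (ch r0 _ e0).
apply: filterS => s [Cs]; rewrite hD// hD; last exact: nbhs_singleton.
by rewrite -rmorphB -[Cn _]/(cabs _) cabs_real distrC.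
Qed.

End modular.

End bumps.

(** * Multipliers of the crossed product *)

Section hilbert.
Context {R : realType} (H : hilbertType R).
Implicit Types h k : H.
Local Notation "<< h , k >>" := (inner H h k).

Lemma inner_rnorm h : << h, h >> = (rnorm h ^+ 2)%:c.
Proof. by rewrite -inner_norm rnormE rmorphXn. Qed.

Lemma innerBl h k l : << h - k, l >> = << h, l >> - << k, l >>.
Proof. exact: linearBl. Qed.

Lemma innerBr h k l : << l, h - k >> = << l, h >> - << l, k >>.
Proof. exact: linearBr. Qed.

Lemma innerDr h k l : << l, h + k >> = << l, h >> + << l, k >>.
Proof. exact: linearDr. Qed.

Lemma innerZl c h k : << c *: h, k >> = c * << h, k >>.
Proof. exact: linearZl_LR. Qed.

Lemma innerZr c h k : << h, c *: k >> = conjC c * << h, k >>.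
Proof. exact: linearZr_LR. Qed.

Lemma innerC h k : << h, k >> = conjC << k, h >>.
Proof. by rewrite hermC expr0 mul1r. Qed.

Lemma inner_cs h k : cabs << h, k >> <= rnorm h * rnorm k.
Proof.
have [k0|k0] := eqVneq (rnorm k) 0.
  by rewrite (rnorm0_eq0 k0) linear0r cabs0 mulr_ge0 ?rnorm_ge0.
have kp : 0 < rnorm k by rewrite lt_neqAle eq_sym k0 rnorm_ge0.
set c := << h, k >>; pose t : R[i] := c / (rnorm k ^+ 2)%:c.
have k2 : (rnorm k ^+ 2)%:c != 0 :> R[i].
  by apply/eqP => /(@complexI R); apply/eqP; rewrite expf_neq0.
have E : << h - t *: k, h - t *: k >> = (rnorm h ^+ 2 - cabs c ^+ 2 / rnorm k ^+ 2)%:c.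
  rewrite innerBl !innerBr !innerZl !innerZr !inner_rnorm (innerC k h) -/c.
  have ct : conjC t = conjC c / (rnorm k ^+ 2)%:c.
    by rewrite /t rmorphM/=; congr (_ * _); rewrite fmorphV/= conjC_real.
  rewrite [RHS](rmorphB (real_complex R)) (fmorph_div (real_complex R)).
  rewrite [X in _ - X / _](cabs_sqr c) ct /t.
  have aux (u v z z' : R[i]) : v != 0 ->
    u - z' / v * z - (z / v * z' - z / v * (z' / v * v)) = u - z * z' / v by move=> ?; field.
  exact: aux.
have := inner_rnorm (h - t *: k); rewrite E => /(@complexI R) E'.
have : 0 <= rnorm h ^+ 2 - cabs c ^+ 2 / rnorm k ^+ 2 by rewrite E' sqr_ge0.
rewrite subr_ge0 ler_pdivrMr ?exprn_gt0// -exprMn => h1.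
by apply: ler_of_sqr => //; rewrite mulr_ge0 ?rnorm_ge0.
Qed.

Definition inner_functional k (h : H) : R[i]^o := << h, k >>.

Fact inner_functional_linear k : linear (inner_functional k).
Proof. by move=> c a b; rewrite /inner_functional linearDl linearZl_LR. Qed.

HB.instance Definition _ k := GRing.isLinear.Build R[i] H R[i]^o _ (inner_functional k)
  (inner_functional_linear k).

Lemma inner_functional_continuous k : continuous (inner_functional k).
Proof.
move=> h; apply/cvgrPdist_le => e /pos_complex[-> e0].
have k0 : 0 < rnorm k + 1 by rewrite ltr_wpDl// rnorm_ge0.
have : nbhs h (ball h (complex.Re e / (rnorm k + 1))%:c).
  by apply: nbhsx_ballx; rewrite ltcR divr_gt0.
apply: filterS => y; rewrite -ball_normE/= lt_rnorm => hy.
rewrite -linearB/= -[X in X <= _]/((cabs _)%:c) lecR (le_trans (inner_cs _ _))//.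
rewrite (le_trans (ler_wpM2r (rnorm_ge0 _) (ltW hy)))// mulrAC ler_pdivrMr//.
by rewrite ler_wpM2l ?(ltW e0)// lerDl.
Qed.

(** For k above the norm of a, write a^* a / k^2 = 2y - y^2 with y self-adjoint. Then the squared
    norm of h - p(y) h is that of h minus that of p(a) h divided by k^2, and it is nonnegative. *)
Lemma adjoint_bound {A : cstarAlgType R} (p : A -> {linear H -> H}) a h :
  (forall (c : R[i]) a b h, p (c *: a + b) h = c *: p a h + p b h) ->
  (forall a b h, p (a ** b) h = p a (p b h)) ->
  (forall a, adjoint_operators (p a) (p (star a))) ->
  rnorm (p a h) <= rnorm a * rnorm h.
Proof.
move=> pl pM pS.
have bd (k : R) : rnorm a < k -> rnorm (p a h) <= k * rnorm h.
  move=> ak; have k0 : 0 < k by rewrite (le_lt_trans _ ak) ?rnorm_ge0.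
  have k2 : 0 < k ^+ 2 by rewrite exprn_gt0.
  pose x := ((k ^+ 2)^-1)%:c *: (star a ** a).
  have xs : star x = x by rewrite /x starZr starM starK.
  have q1 : (rnorm a / k) ^+ 2 < 1.
    by rewrite expr_lt1// ?divr_ge0 ?rnorm_ge0 ?(ltW k0)// ltr_pdivrMr// mul1r.
  have xN : @cstar_cnorm R A x <= (rnorm a / k) ^+ 2.
    rewrite -[cstar_cnorm _]/(rnorm _) /x rnorm_real rnorm_cstar ger0_norm ?invr_ge0 ?(ltW k2)//.
    by rewrite exprMn exprVn mulrC.
  have [y [yE ys _ _]] := cn_sqrt q1 xN xs.
  have p0 : p 0 h = 0 by have := pl (-1) 0 0 h; rewrite scaler0 add0r scaleN1r addNr.
  have pD b c : p (b + c) h = p b h + p c h by have := pl 1 b c h; rewrite !scale1r.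
  have pN b : p (- b) h = - p b h by have := pl (-1) b 0 h; rewrite !scaleN1r !addr0 p0 addr0.
  have xE : x = y + y - y ** y.
    by apply/eqP; rewrite eq_sym subr_eq -yE; apply/eqP; lmod A; rewrite ?rmorphD/=; ring.
  have pE : p x h = p y h + p y h - p y (p y h) by rewrite xE !pD pN pM.
  have h1 : << h - p y h, h - p y h >> = << h, h >> - << h, p x h >>.
    rewrite pE innerBl !innerBr innerDr.
    have e1 : << p y h, h >> = << h, p y h >> by rewrite pS ys.
    have e2 : << p y h, p y h >> = << h, p y (p y h) >> by rewrite pS ys.
    by rewrite e1 e2; ring.
  have h2 : << h, p x h >> = ((k ^+ 2)^-1 * rnorm (p a h) ^+ 2)%:c.
    have -> : p x h = ((k ^+ 2)^-1)%:c *: p (star a) (p a h).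
      by rewrite -pM; have := pl ((k ^+ 2)^-1)%:c (star a ** a) 0 h; rewrite p0 !addr0.
    by rewrite innerZr -pS inner_rnorm conjC_real -(rmorphM (real_complex R)).
  move: h1; rewrite h2 !inner_rnorm -rmorphB => /(@complexI R) h1.
  have h3 : 0 <= rnorm h ^+ 2 - (k ^+ 2)^-1 * rnorm (p a h) ^+ 2 by rewrite -h1 sqr_ge0.
  rewrite subr_ge0 mulrC ler_pdivrMr// mulrC -exprMn in h3.
  by apply: ler_of_sqr => //; rewrite mulr_ge0 ?rnorm_ge0// ltW.
apply: (@le_eps _ _ _ (rnorm h)) => e e0; rewrite [_ * e]mulrC -mulrDl.
by apply: bd; rewrite ltrDl.
Qed.

End hilbert.

(** * Convolution, integrated forms and the completion *)

Section crossed.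
Context {R : realType} {G : topGroupType} {A : cstarAlgType R}.
Variables (alpha : action G A) (mu : {measure set (borel G) -> \bar R}) (Delta : G -> R).
Hypothesis lcG : locally_compact_group G.
Hypothesis haar : left_haar mu.
Hypothesis DeltaP : modular_function mu Delta.
Implicit Types (f g : G -> A) (K : set G).
Local Notation NA := (@cstar_cnorm R A).
Local Notation Cn := (@complex_cnorm R).

Lemma action_rnorm s (a : A) : rnorm (alpha s a) = rnorm a.
Proof. by rewrite /rnorm action_norm. Qed.

Lemma action_joint : continuous (fun p : G * A => alpha p.1 p.2).
Proof.
move=> [s a]; apply/cvgrPdist_le => e /pos_complex[-> e0].
have e2 : 0 < complex.Re e / 2 by rewrite divr_gt0.
have h := (cn_continuousP (fun y => alpha y a)).1 (@action_continuous R G A alpha a) s _ e2.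
exists ([set y | NA (alpha y a - alpha s a) <= complex.Re e / 2], ball a (complex.Re e / 2)%:c).
  by split=> //; apply: nbhsx_ballx; rewrite ltcR.
move=> [t b] [/= ht]; rewrite -ball_normE/= lt_rnorm le_rnorm => hb.
have -> : alpha s a - alpha t b = (alpha s a - alpha t a) + alpha t (a - b).
  by rewrite linearB addrA subrK.
rewrite (le_trans (rnormD _ _))// action_rnorm rnormB.
by rewrite (splitr (complex.Re e)) lerD// ltW.
Qed.

Lemma Cc_linear c f g : Cc f -> Cc g -> Cc (c *: f + g).
Proof.
move=> [cf [K cK f0]] [cg [C cC g0]]; split.
  by move=> x; apply: cvgD; [apply: cvgZl_tmp; exact: cf|exact: cg].
exists (K `|` C); first exact: compactU.
move=> s nKC; have nK : ~ K s by move=> ?; apply: nKC; left.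
have nC : ~ C s by move=> ?; apply: nKC; right.
by rewrite -[LHS]/(c *: f s + g s) f0// g0// scaler0 addr0.
Qed.

Lemma Cc_star_in f : Cc f -> Cc (Cc_star alpha Delta f).
Proof.
move=> [cf [K cK f0]]; split.
  move=> s; apply: (@cvgZ _ _ _ (nbhs s)).
    apply/cvgrPdist_le => e /pos_complex[-> e0].
    have cD : continuous (Delta \o (fun s => s^-1%g)).
      by move=> x; apply: continuous_comp; [exact: invg_continuous|exact: (Delta_continuous lcG haar DeltaP)].
    have /cvgrPdist_le/(_ _ e0) := cD s; apply: filterS => t /= h.
    by rewrite -rmorphB -[X in X <= _]/((cabs _)%:c) lecR cabs_real.
  apply: (@continuous_comp _ _ _ (fun s => (s, star (f s^-1%g))) (fun p : G * A => alpha p.1 p.2)); last exact: action_joint.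
  apply: cvg_pair; first exact: cvg_id.
  apply: (@continuous_comp _ _ _ (fun s => f s^-1%g) (@star R A)); last exact: cstar_star_continuous.
  by apply: continuous_comp; [exact: invg_continuous|exact: cf].
exists [set (x^-1)%g | x in K]; first exact: compact_inv.
move=> s ns; rewrite /Cc_star f0 ?star0 ?raddf0 ?scaler0// => Ks.
by apply: ns; exists s^-1%g => //; rewrite invgK.
Qed.

Definition strong_integral (F : G -> A) (v : A) := exists K, [/\ compact K,
  forall r, ~ K r -> F r = 0 & has_integral mu NA (K : set (borel G)) F v].

Lemma strong_is_integral F v : continuous F -> strong_integral F v -> is_integral mu F v.
Proof. by move=> cF [K [cK F0 FK]]; exact: (has_integral_is_integral lcG haar cK). Qed.

Definition conv_integrand f g s r := f r ** alpha r (g (r^-1 * s)%g).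

Lemma conv_integrand_continuous f g : continuous f -> continuous g ->
  continuous (fun p : G * G => conv_integrand f g p.1 p.2).
Proof.
move=> cf cg p.
apply: (@continuous2_cvg _ _ _ _ (nbhs p) _ (fun p : G * G => f p.2)
  (fun p : G * G => alpha p.2 (g (p.2^-1 * p.1)%g)) (fun a b : A => a ** b) (f p.2) (alpha p.2 (g (p.2^-1 * p.1)%g))).
- exact: (@cstar_mul_continuous R A (f p.2, alpha p.2 (g (p.2^-1 * p.1)%g))).
- by apply: continuous_comp; [exact: cvg_snd|exact: cf].
- apply: (@continuous_comp _ _ _ (fun p : G * G => (p.2, g (p.2^-1 * p.1)%g)) (fun p : G * A => alpha p.1 p.2)); last exact: action_joint.
  apply: cvg_pair; first exact: cvg_snd.
  apply: continuous_comp; last exact: cg.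
  apply: (@mulg_continuous2 G _ (fun p => p.2^-1%g) fst) => q; last exact: cvg_fst.
  by apply: (@invg_continuous2 G _ snd) => z; exact: cvg_snd.
Qed.

Lemma convolution_ex f g : Cc f -> Cc g ->
  exists2 h, Cc h & forall s, strong_integral (conv_integrand f g s) (h s).
Proof.
move=> [cf [K cK f0]] [cg [C cC g0]].
have cF := conv_integrand_continuous cf cg; have [h1 h2] := joint_param cF.
have [h [ch hP]] := param_integral lcG haar cK h1 h2.
exists h; last first.
  move=> s; exists K; split; [exact: cK| |exact: hP].
  by move=> r nK; rewrite /conv_integrand f0// smul0x.
split; first exact/cn_continuousP.
exists [set (p.1 * p.2)%g | p in K `*` C]; first exact: compact_mul.
move=> s ns; apply: (has_integral_uniq (compact_finite_meas lcG haar cK) (hP s)).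
apply: (eq_has_integral _ (has_integral0 NA (compact_finite_meas lcG haar cK))) => r Kr.
rewrite /= /conv_integrand g0 ?raddf0 ?smulx0// => Cr; apply: ns.
by exists (r, r^-1 * s)%g => //=; rewrite mulgA mulgV mul1g.
Qed.

Section representation.
Variables (H : hilbertType R) (p : A -> {linear H -> H}) (U : G -> {linear H -> H}).
Hypothesis pU : covariant_rep alpha p U.

Lemma cov_contractive a h : rnorm (p a h) <= rnorm a * rnorm h.
Proof. by apply: adjoint_bound; [exact: cov_linear pU|exact: cov_smul pU|exact: cov_star pU]. Qed.

Lemma cov_isometric s h : rnorm (U s h) = rnorm h.
Proof.
have := cov_unitary pU s h h; rewrite !inner_rnorm => /(@complexI R) e.
by apply/eqP; rewrite -(@eqrXn2 _ 2) ?rnorm_ge0// e.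
Qed.

(** The weak integral is tested against T h itself: the squared norm of T h is then at most the
    integral of [w] times the norms of h and T h. *)
Lemma integrated_form_bound f (T : H -> H) K (w : G -> R) W : compact K -> continuous f ->
  (forall s, ~ K s -> f s = 0) -> (forall s, rnorm (f s) <= w s) ->
  has_integral mu Cn (K : set (borel G)) (fun s => (w s)%:c) W ->
  is_integrated_form mu p U f T -> forall h, rnorm (T h) <= complex.Re W * rnorm h.
Proof.
move=> cK cf f0 fw wW fT h; have fK := compact_finite_meas lcG haar cK.
pose F s : R[i]^o := inner_functional (T h) (p (f s) (U s h)).
have pB a b k : p a k - p b k = p (a - b) k.
  by have := cov_linear pU (-1) b a k; rewrite !scaleN1r addrC => ->; rewrite addrC.
have cF : cn_continuous Cn F.
  move=> s e e0; pose k := (rnorm h + rnorm (f s)) * rnorm (T h) + 1.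
  have k0 : 0 < k by rewrite ltr_wpDl// mulr_ge0 ?addr_ge0 ?rnorm_ge0.
  have h1 := (cn_continuousP f).1 cf s _ (divr_gt0 e0 k0).
  have /cvgrPdist_le/(_ (e / k)%:c) := @cov_strong R G A alpha H p U pU h s; rewrite ltcR => /(_ (divr_gt0 e0 k0)).
  apply: filterS2 h1 => t h1; rewrite le_rnorm rnormB => h2.
  rewrite -[Cn _]/(cabs _) /F -linearB/= (le_trans (inner_cs _ _))//.
  have -> : p (f t) (U t h) - p (f s) (U s h) = p (f t - f s) (U t h) + p (f s) (U t h - U s h).
    by rewrite -pB linearB addrA subrK.
  rewrite (le_trans (ler_wpM2r (rnorm_ge0 _) (rnormD _ _)))//.
  have h3 := cov_contractive (f t - f s) (U t h); rewrite cov_isometric in h3.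
  have h4 := cov_contractive (f s) (U t h - U s h).
  have h5 := le_trans h3 (ler_wpM2r (rnorm_ge0 h) h1).
  have h6 := le_trans h4 (ler_wpM2l (rnorm_ge0 (f s)) h2).
  rewrite (le_trans (ler_wpM2r (rnorm_ge0 _) (lerD h5 h6)))//.
  have -> : (e / k * rnorm h + rnorm (f s) * (e / k)) * rnorm (T h) = e / k * (k - 1).
    by rewrite /k; ring.
  by rewrite mulrAC ler_pdivrMr// ler_wpM2l ?(ltW e0)// gerBl.
have p0 k : p 0 k = 0 by have := pB 0 0 k; rewrite !subrr.
have F0 s : ~ K s -> F s = 0 by move=> /f0; rewrite /F => ->; rewrite p0 linear0.
have [v vF] := has_integral_ex lcG haar cK cF.
have := fT h (inner_functional (T h)) (@inner_functional_continuous _ _ _).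
rewrite (has_integral_complex lcG haar cK cF F0 vF) -[LHS]/(inner H (T h) (T h)) inner_rnorm => TE.
have vb : Cn v <= rnorm h * rnorm (T h) * complex.Re W.
  have -> : rnorm h * rnorm (T h) * complex.Re W =
      complex.Re ((rnorm h * rnorm (T h))%:c *: W : R[i]^o).
    by case: (W) => x y; rewrite -[_ *: _]/(_ * _) /= mul0r subr0.
  have zW : has_integral mu Cn (K : set (borel G)) (fun s => (rnorm h * rnorm (T h) * w s)%:c)
      ((rnorm h * rnorm (T h))%:c *: W : R[i]^o).
    by apply: (eq_has_integral _ (has_integralZ _ wW)) => s _; rewrite [RHS]rmorphM.
  apply: (has_integral_dominated fK vF zW) => s _; rewrite -[Cn _]/(cabs _) (le_trans (inner_cs _ _))//.
  rewrite [leRHS]mulrAC ler_wpM2r ?rnorm_ge0// (le_trans (cov_contractive _ _))//.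
  by rewrite cov_isometric mulrC ler_wpM2l ?rnorm_ge0.
rewrite -TE -[Cn _]/(cabs _) cabs_pos_real ?sqr_ge0// expr2 in vb.
have [T0|T0] := eqVneq (rnorm (T h)) 0.
  rewrite T0 mulr_ge0 ?rnorm_ge0//; apply: le_trans (has_integral_dominated fK (has_integral0 Cn fK) wW _).
    exact: cn_ge0.
  by move=> s _; rewrite cn0 (le_trans _ (fw s)) ?rnorm_ge0.
have Tp : 0 < rnorm (T h) by rewrite lt_neqAle eq_sym T0 rnorm_ge0.
by rewrite -(ler_pM2r Tp) (le_trans vb)// le_eqVlt; apply/orP; left; apply/eqP; ring.
Qed.

End representation.

Section completion.
Variables (B : cstarAlgType R) (iota : (G -> A) -> B).
Hypothesis BP : is_full_crossed_product alpha mu Delta iota.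
Local Notation M := (adj B).
Local Notation N := (@adj_ucnorm R B).

Lemma iota_bound_L1 f K (w : G -> R) W : compact K -> Cc f -> (forall s, ~ K s -> f s = 0) ->
  (forall s, rnorm (f s) <= w s) ->
  has_integral mu Cn (K : set (borel G)) (fun s => (w s)%:c) W -> rnorm (iota f) <= complex.Re W.
Proof.
move=> cK Ccf f0 fw wW; have fK := compact_finite_meas lcG haar cK.
have W0 : 0 <= complex.Re W.
  apply: le_trans (has_integral_dominated fK (has_integral0 Cn fK) wW _); first exact: cn_ge0.
  by move=> s _; rewrite cn0 (le_trans _ (fw s)) ?rnorm_ge0.
rewrite (crossed_norm BP)// /universal_norm.
(* The supremum of the empty set is 0, which is below the integral of [w]. *)
set S := [set r | _]; have [->|/set0P S0] := eqVneq S set0; first by rewrite sup0.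
apply: sup_le_ub => // _ [H [p [U [T [pU fT ->]]]]].
apply: sup_le_ub; first by exists (rnorm (T 0)), 0 => //=; rewrite normr0.
move=> _ [h /= h1 <-]; rewrite -[1]/(1%:c) le_rnorm in h1.
have [cf _] := Ccf; rewrite (le_trans (integrated_form_bound pU cK cf f0 fw wW fT h))//.
by rewrite ler_piMr.
Qed.

Lemma iota_bound f K c : compact K -> Cc f -> (forall s, ~ K s -> f s = 0) ->
  (forall s, rnorm (f s) <= c) -> rnorm (iota f) <= c * meas mu K.
Proof.
move=> cK Ccf f0 fc; have fK := compact_finite_meas lcG haar cK.
have := iota_bound_L1 cK Ccf f0 fc (has_integral_cst Cn (c%:c : R[i]^o) fK).
by rewrite -[_ *: _]/(_ * _) -rmorphM mulrC.
Qed.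

Lemma iota_linear c f g : Cc f -> Cc g -> iota (c *: f + g) = c *: iota f + iota g.
Proof. exact: crossed_linear BP c f g. Qed.

Lemma iotaB f g : Cc f -> Cc g -> iota (g - f) = iota g - iota f.
Proof.
move=> hf hg; have -> : g - f = (-1) *: f + g by rewrite scaleN1r addrC.
by rewrite iota_linear// scaleN1r addrC.
Qed.

Lemma iota_dense (x : B) e : 0 < e -> exists2 f, Cc f & rnorm (iota f - x) <= e.
Proof.
move=> e0; have : closure (iota @` Cc) x by rewrite (crossed_dense BP).
move=> /(_ (ball x e%:c))[|_ [[f Ccf <-]]].
  by apply: nbhsx_ballx; rewrite ltcR.
by rewrite -ball_normE/= lt_rnorm rnormB => /ltW h; exists f.
Qed.

Lemma iota_conv f g h : Cc f -> Cc g -> Cc h ->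
  (forall s, strong_integral (conv_integrand f g s) (h s)) -> iota h = iota f ** iota g.
Proof.
move=> hf hg hh fgh; apply: (crossed_smul BP) => // s.
apply: strong_is_integral; last exact: fgh.
move=> r; apply: (@continuous_comp _ _ _ (fun r : G => (s, r)) (fun p => conv_integrand f g p.1 p.2)).
  by apply: cvg_pair; [exact: cvg_cst|exact: cvg_id].
by apply: conv_integrand_continuous; [case: hf|case: hg].
Qed.

Lemma star_smul_iota f g : Cc f -> Cc g -> exists h, [/\ Cc h,
  forall s, strong_integral (conv_integrand (Cc_star alpha Delta f) g s) (h s) &
  iota h = star (iota f) ** iota g].
Proof.
move=> hf hg; have hs := Cc_star_in hf; have [h hh hP] := convolution_ex hs hg.
by exists h; split=> //; rewrite (iota_conv hs hg hh hP) (crossed_star BP).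
Qed.

(** Bounded in the norm of the images, [s] and [s'] extend to limits of images of compactly
    supported functions, and the adjoint relation passes to the limit. All multipliers of the
    crossed product are obtained this way. *)
Lemma adj_extend (s s' : (G -> A) -> (G -> A)) C : 0 <= C ->
  (forall f, Cc f -> Cc (s f) /\ Cc (s' f)) ->
  (forall c f g, s (c *: f + g) = c *: s f + s g /\ s' (c *: f + g) = c *: s' f + s' g) ->
  (forall f g, Cc f -> Cc g -> star (iota (s f)) ** iota g = star (iota f) ** iota (s' g)) ->
  (forall f, Cc f -> rnorm (iota (s f)) <= C * rnorm (iota f)) ->
  (forall f, Cc f -> rnorm (iota (s' f)) <= C * rnorm (iota f)) ->
  exists T : M, forall f, Cc f -> T (iota f) = iota (s f) /\ star T (iota f) = iota (s' f).
Proof.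
move=> C0 sCc slin sadj sb sb'.
have ext (t : (G -> A) -> (G -> A)) : (forall f, Cc f -> Cc (t f)) ->
    (forall c f g, t (c *: f + g) = c *: t f + t g) ->
    (forall f, Cc f -> rnorm (iota (t f)) <= C * rnorm (iota f)) ->
    exists T : B -> B, (forall x e, 0 < e -> exists f, [/\ Cc f, rnorm (iota f - x) <= e &
      rnorm (iota (t f) - T x) <= e]) /\ forall f, Cc f -> T (iota f) = iota (t f).
  move=> tCc tl tb.
  have tB f g : t f - t g = t (f - g).
    by have := tl (-1) g f; rewrite !scaleN1r addrC => ->; rewrite addrC.
  have bd f g : Cc f -> Cc g -> rnorm (iota (t f) - iota (t g)) <= C * rnorm (iota f - iota g).
    move=> hf hg; have CB : Cc (f - g) by rewrite -scaleN1r addrC; exact: Cc_linear.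
    by rewrite -(iotaB (tCc _ hg) (tCc _ hf)) -(iotaB hg hf) tB; exact: tb.
  suff /choice[T TP] : forall x, exists y, forall e, 0 < e -> exists f,
      [/\ Cc f, rnorm (iota f - x) <= e & rnorm (iota (t f) - y) <= e].
    exists T; split=> // f hf; apply/eqP; rewrite -subr_eq0; apply/eqP.
    apply: (cn_eqP (N := @cstar_cnorm R B)) => e e0; rewrite -[cstar_cnorm _]/(rnorm _).
    have C1 : 0 < C + 1 by rewrite ltr_wpDl.
    have [g [hg gf Tg]] := TP (iota f) _ (divr_gt0 e0 C1).
    have h1 := rnormD (T (iota f) - iota (t g)) (iota (t g) - iota (t f)).
    rewrite subrKA (rnormB (T (iota f)) (iota (t g))) in h1; rewrite (le_trans h1)//.
    rewrite (le_trans (lerD Tg (le_trans (bd g f hg hf) (ler_wpM2l C0 gf))))//.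
    by rewrite -{1}[e / _]mul1r -mulrDl addrC mulrCA divff ?mulr1// gt_eqF.
  move=> x; pose w n : R := 2^-1 ^+ n.
  have w0 n : 0 < w n by rewrite exprn_gt0// invr_gt0.
  have /choice[u uP] : forall n, exists f, Cc f /\ rnorm (iota f - x) <= w n.
    by move=> n; have [f hf fx] := iota_dense x (w0 n); exists f.
  have [y uy] : exists y, tends (@cstar_cnorm R B) (fun n => iota (t (u n))) y.
    apply: cauchy_tends => e e0; have k0 : 0 < 2 * (C + 1) by rewrite mulr_gt0// ltr_wpDl.
    have [n hn] := half_small (divr_gt0 e0 k0); exists n => m nm.
    have [um umx] := uP m; have [un unx] := uP n.
    rewrite -[cstar_cnorm _]/(rnorm _) (le_trans (bd _ _ um un))//.
    have h1 := rnormD (iota (u m) - x) (x - iota (u n)); rewrite subrKA (rnormB x) in h1.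
    have h2 := hn m nm; have h3 := hn n (leqnn n); rewrite -/(w m) in h2; rewrite -/(w n) in h3.
    have h4 : rnorm (iota (u m) - iota (u n)) <= 2 * (e / (2 * (C + 1))) by lra.
    rewrite (le_trans (ler_wpM2l C0 h4))//.
    have C1 : C + 1 != 0 by rewrite gt_eqF// ltr_wpDl.
    have -> : C * (2 * (e / (2 * (C + 1)))) = e * (C / (C + 1)) by field.
    by rewrite ler_piMr ?(ltW e0)// ler_pdivrMr ?ltr_wpDl// mul1r lerDl.
  exists y => e e0; have [n hn] := half_small e0; have [k hk] := uy e e0.
  have [umax umaxx] := uP (maxn n k); exists (u (maxn n k)); split=> //.
    exact: le_trans umaxx (hn _ (leq_maxl _ _)).
  exact: hk _ (leq_maxr _ _).
have [T [TP Ts]] := ext s (fun f hf => proj1 (sCc f hf)) (fun c f g => proj1 (slin c f g)) sb.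
have [T' [TP' Ts']] := ext s' (fun f hf => proj2 (sCc f hf)) (fun c f g => proj2 (slin c f g)) sb'.
have Tadj x y : star (T x) ** y = star x ** T' y.
  apply/eqP; rewrite -subr_eq0; apply/eqP; apply: (cn_eqP (N := @cstar_cnorm R B)) => e e0.
  rewrite -[cstar_cnorm _]/(rnorm _).
  pose k := rnorm x + rnorm y + rnorm (T x) + rnorm (T' y) + 2.
  have := rnorm_ge0 x; have := rnorm_ge0 y; have := rnorm_ge0 (T x); have := rnorm_ge0 (T' y).
  move=> p1 p2 p3 p4; have k0 : 0 < k by rewrite /k; lra.
  pose d := Num.min 1 (e / k); have d0 : 0 < d by rewrite lt_min ltr01 divr_gt0.
  have [f [hf fx Tf]] := TP x _ d0; have [g [hg gy Tg]] := TP' y _ d0.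
  have d1 : d <= 1 by rewrite ge_min lexx.
  have dk : d * k <= e by rewrite -ler_pdivlMr// ge_min lexx orbT.
  have E (a b a' b' : B) : rnorm (star a ** b - star a' ** b') <=
      rnorm (a - a') * (rnorm (b - b') + rnorm b') + rnorm a' * rnorm (b - b').
    have -> : star a ** b - star a' ** b' = star (a - a') ** b + star a' ** (b - b').
      by rewrite starB smulBl smulBr addrA subrK.
    rewrite (le_trans (rnormD _ _))// lerD// (le_trans (rnorm_smul_le _ _))// rnorm_star//.
    by rewrite ler_wpM2l ?rnorm_ge0// -{1}(subrK b' b) rnormD.
  have h1 := E (iota (s f)) (iota g) (T x) y; have h2 := E (iota f) (iota (s' g)) x (T' y).
  have h3 := rnormD (star (T x) ** y - star (iota (s f)) ** iota g)
     (star (iota f) ** iota (s' g) - star x ** T' y).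
  rewrite -(sadj f g hf hg) subrKA in h3.
  rewrite (rnormB (star (T x) ** y) (star (iota (s f)) ** iota g)) in h3; rewrite (sadj f g hf hg) in h1 h3.
  rewrite (le_trans h3)//.
  have aux (a b q t c : R) : 0 <= a -> 0 <= b -> a <= d -> b <= d -> 0 <= q -> 0 <= t ->
      c <= a * (b + q) + t * b -> c <= d * (1 + q + t).
    move=> a0 b0 ad bd q0 t0 /le_trans; apply.
    have -> : d * (1 + q + t) = d * (1 + q) + t * d by ring.
    by rewrite lerD ?ler_wpM2l// ler_pM ?addr_ge0// lerD2r (le_trans bd).
  have i1 := aux _ _ _ _ _ (rnorm_ge0 _) (rnorm_ge0 _) Tf gy p3 p2 h1.
  have i2 := aux _ _ _ _ _ (rnorm_ge0 _) (rnorm_ge0 _) fx Tg p1 p4 h2.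
  apply: le_trans dk; rewrite (le_trans (lerD i1 i2))// -mulrDr ler_wpM2l ?(ltW d0)//.
  by rewrite /k; lra.
have Tb : exists D, forall x, rnorm (T x) <= D * rnorm x.
  exists C => x; apply: (@le_eps _ _ _ (1 + C)) => e e0; have [f [hf fx Tf]] := TP x e e0.
  have h1 := rnormD (T x - iota (s f)) (iota (s f)); rewrite subrK rnormB in h1.
  have h2 := rnormD (iota f - x) x; rewrite subrK in h2.
  rewrite (le_trans h1)// (le_trans (lerD Tf (le_trans (sb f hf) (ler_wpM2l C0 h2))))//.
  rewrite mulrDr (le_trans (lerD (lexx e) (lerD (ler_wpM2l C0 fx) (lexx _))))//.
  by rewrite le_eqVlt; apply/orP; left; apply/eqP; ring.
exists (@Adj R B T T' Tadj Tb) => f hf; split; [exact: Ts|exact: Ts'].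
Qed.

End completion.

End crossed.

(** * Approximate units *)

Section approximate_unit.
Context {R : realType} {A : cstarAlgType R}.
Local Notation N := (@adj_ucnorm R A).
Local Notation NA := (@cstar_cnorm R A).
Local Notation "1e" := (uone N).

Lemma pos0 : pos N 0.
Proof. by rewrite -(scale0r 1e) -(rmorph0 (real_complex R)); exact: pos_scalar. Qed.

(** Take b = S / K with S the sum of the a a^*, c = (1 - b^2)^(1/2) and u = 1 - c^(2m). Then a - u a
    = c^(2m) a, and a a^* <= K b reduces its norm to that of b c^m, at most m^(-1/2). *)
Lemma approx_unit_finite (F : seq A) e : 0 < e -> exists u : A,
  [/\ star u = u, rnorm u <= 2 & forall a, a \in F -> rnorm (u ** a - a) <= e].
Proof.
move=> e0; pose S := \sum_(a <- F) a ** star a; pose K := rnorm S + 1.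
have K0 : 0 < K by rewrite ltr_wpDl// rnorm_ge0.
have Ss : star S = S by rewrite star_sum; apply: eq_bigr => a _; rewrite starM starK.
pose b : adj A := lmul (K^-1%:c *: S).
have bs : star b = b by rewrite /b -lmulS starZr Ss.
have b1 : N b < 1.
  rewrite -rnorm_lmul rnorm_real ger0_norm ?invr_ge0 ?(ltW K0)//.
  by rewrite mulrC ltr_pdivrMr// mul1r ltrDl.
have [c [cs cc c1 pc ccomm]] := sqrt_one_sub_sq bs b1.
have cb : c ** b = b ** c by apply: ccomm; rewrite smulA.
have cpow n : N (spow N c n) <= 1.
  by rewrite (le_trans (cn_spow _ _ _))// exprn_ile1// cn_ge0.
(* 1 - c^(2m) is left multiplication by an element of the algebra, since c^2 = 1 - b^2. *)
have uex m : exists u, spow N c (m + m) = 1e - lmul u.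
  elim: m => [|m [u uE]]; first by exists 0; rewrite lmul0 subr0.
  have -> : (m.+1 + m.+1 = 2 + (m + m))%N by rewrite addnS addSn.
  rewrite spowD uE !spowS /= (smulx1 N) cc.
  exists (u + (K^-1%:c *: S) ** (K^-1%:c *: S) - (K^-1%:c *: S) ** (K^-1%:c *: S) ** u).
  rewrite lmulB lmulD !lmulM -/b.
  by rewrite smulBl (smul1x N) smulBr (smulx1 N); lmod (adj A); ring.
have [m mP] : exists m : nat, (K / e ^+ 2) ^+ 2 <= m.+1%:R.
  exists (Num.bound ((K / e ^+ 2) ^+ 2)); rewrite ltW// (lt_trans (archi_boundP (sqr_ge0 _)))// ltr_nat//.
have [u uE] := uex m.+1; exists u.
have us : star u = u.
  apply: (@lmul_inj R A); rewrite lmulS.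
  have -> : lmul u = 1e - spow N c (m.+1 + m.+1) by rewrite uE; lmod (adj A); ring.
  by rewrite starB (star1 N) (star_spow _ _ cs).
split=> //.
  rewrite rnorm_lmul (_ : lmul u = 1e - spow N c (m.+1 + m.+1)).
    by rewrite (le_trans (cnBD _ _ _))// (_ : 2 = 1 + 1)// lerD// cn1.
  by rewrite uE; lmod (adj A); ring.
move=> a aF; set d := spow N c m.+1.
have ds : star d = d by exact: star_spow.
rewrite rnorm_lmul lmulB lmulM (_ : _ - _ = - (d ** (d ** lmul a))); last first.
  rewrite smulA -spowD uE smulBl (smul1x N); lmod (adj A); ring.
rewrite cnN (le_trans (cnM _ _ _))// (le_trans (ler_piMl (cn_ge0 _ _) (cpow _)))//.
have posS : pos N (lmul (S - a ** star a)).
  rewrite /S (big_rem a)//= addrC addrK; elim/big_ind: _ => [|x y px py|x _].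
  - by rewrite lmul0; exact: pos0.
  - by rewrite lmulD; exact: posD.
  - by rewrite lmulM lmulS -{1}[lmul x]starK; exact: pos_star_smul.
set z := star (lmul a) ** d; have -> : d ** lmul a = star z by rewrite starM starK ds.
rewrite cn_star; apply: ler_of_sqr; first exact: ltW.
rewrite -cn_cstar (_ : star z ** z = star d ** lmul (a ** star a) ** d); last first.
  by rewrite /z starM starK lmulM lmulS !smulA.
have h1 : N (star d ** lmul (a ** star a) ** d) <= N (star d ** lmul S ** d).
  apply: pos_norm_mono.
    by apply: pos_conj; rewrite lmulM lmulS -{1}[lmul a]starK; exact: pos_star_smul.
  by rewrite -smulBl -smulBr -lmulB; exact: pos_conj.
rewrite (le_trans h1)// (_ : lmul S = K%:c *: b); last first.
  by rewrite -lmulZ scalerA -rmorphM mulfV ?gt_eqF// scale1r.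
rewrite smulZr smulZl cn_real gtr0_norm// ds -smulA.
have h2 : N (d ** (b ** d)) <= N (b ** d).
  rewrite (le_trans (cnM N d (b ** d)))// ler_piMl ?cn_ge0//; exact: cpow.
rewrite mulrC -ler_pdivlMr// (le_trans h2)//.
have h3 := cn_mul_spow_sqrt m.+1 bs cs cb cc c1; rewrite -/d in h3.
have p0 : 0 < e ^+ 2 / K by rewrite divr_gt0// exprn_gt0.
apply: ler_of_sqr; first exact: ltW.
have q0 : 0 < (K / e ^+ 2) ^+ 2 by rewrite exprn_gt0// divr_gt0// exprn_gt0.
have -> : (e ^+ 2 / K) ^+ 2 = ((K / e ^+ 2) ^+ 2)^-1.
  by rewrite -exprVn invf_div.
by rewrite -[leRHS]mul1r ler_pdivlMr// (le_trans _ h3)// mulrC ler_wpM2r// sqr_ge0.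
Qed.

Lemma separable_enum (T : ptopologicalType) (D : set T) : countable D -> exists g : nat -> T,
  forall x, D x -> exists n, g n = x.
Proof.
move=> /countable_injP[f fi]; exists (fun n => xget point [set x | D x /\ f x = n]) => x Dx.
exists (f x); case: xgetP => [y _ [Dy fy]|/(_ x)[]//].
by apply: fi => //; rewrite inE.
Qed.

Lemma approx_unit : separable_set [set: A] -> exists u : nat -> A,
  (forall n, star (u n) = u n /\ rnorm (u n) <= 2) /\
  forall a, tends NA (fun n => u n ** a) a.
Proof.
move=> [S [cS _ dS]]; have [g gP] := @separable_enum A S cS.
have w0 n : 0 < (2^-1 : R) ^+ n by rewrite exprn_gt0// invr_gt0.
have [u uP] := choice (fun n => approx_unit_finite (mkseq g n.+1) (w0 n)).
exists u; split=> [n|a e e0]; first by have [] := uP n.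
have e8 : 0 < e / 8 by rewrite divr_gt0.
have : closure S a by exact: dS.
move=> /(_ (ball a (e / 8)%:c))[|d [Sd]]; first by apply: nbhsx_ballx; rewrite ltcR.
rewrite -ball_normE/= lt_rnorm => ad; have [k kd] := gP d Sd.
have [n hn] := half_small e8; exists (maxn n k) => m; rewrite geq_max => /andP[nm km].
have [_ u2 ua] := uP m.
have -> : u m ** a - a = u m ** (a - d) + (u m ** d - d) - (a - d).
  by rewrite smulBr; lmod A; ring.
have h1 := rnorm_smul_le (u m) (a - d).
have h2 : rnorm (u m ** d - d) <= e / 8.
  rewrite (le_trans (ua d _))// ?hn//; rewrite -kd; apply/mapP; exists k => //.
  by rewrite mem_iota add0n ltnS.
rewrite (le_trans (rnormD _ _))// rnormN.
have := rnormD (u m ** (a - d)) (u m ** d - d).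
have h3 : rnorm (u m) * rnorm (a - d) <= 2 * (e / 8).
  by rewrite ler_pM ?rnorm_ge0// ltW.
move: h1 h2 h3 ad; move: (rnorm _) (rnorm _) (rnorm _) (_ * rnorm _) (rnorm _) => x y z t v.
by lra.
Qed.

End approximate_unit.

(** * The canonical covariant pair in the multipliers *)

Section multipliers.
Context {R : realType} {G : topGroupType} {A : cstarAlgType R}.
Variables (alpha : action G A) (mu : {measure set (borel G) -> \bar R}) (Delta : G -> R).
Hypothesis lcG : locally_compact_group G.
Hypothesis haar : left_haar mu.
Hypothesis DeltaP : modular_function mu Delta.
Variables (B : cstarAlgType R) (iota : (G -> A) -> B).
Hypothesis BP : is_full_crossed_product alpha mu Delta iota.
Implicit Types (f g : G -> A) (K : set G).
Local Notation M := (adj B).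
Local Notation N := (@adj_ucnorm R B).
Local Notation NA := (@cstar_cnorm R A).
Local Notation NB := (@cstar_cnorm R B).
Local Notation Cn := (@complex_cnorm R).
Local Notation "1e" := (uone N).

Lemma adj_eq_dense (S T : M) : (forall f, Cc f -> S (iota f) = T (iota f)) -> S = T.
Proof.
move=> ST; apply: adj_ext => x; apply/eqP; rewrite -subr_eq0; apply/eqP.
apply: (cn_eqP (N := NB)) => e e0; rewrite -[NB _]/(rnorm _) -subE_adj.
have k0 : 0 < N (S - T) + 1 by rewrite ltr_wpDl// cn_ge0.
have [f hf fx] := iota_dense BP x (divr_gt0 e0 k0).
have -> : (S - T) x = - ((S - T) (iota f - x)).
  by rewrite adjB [(S - T) (iota f)]subE_adj ST// subrr sub0r opprK.
rewrite rnormN (le_trans (le_adj_norm _ _))// -[adj_norm _]/(N _).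
rewrite (le_trans (ler_wpM2l (cn_ge0 _ _) fx))// mulrCA ler_piMr ?(ltW e0)//.
by rewrite ler_pdivrMr// mul1r lerDl.
Qed.

Lemma left_mul_continuous (a : A) f : continuous f -> continuous (fun r => a ** f r).
Proof.
move=> cf r; apply: (@continuous2_cvg _ _ _ _ (nbhs r) _ (fun=> a) f (fun a b : A => a ** b) a (f r)).
- exact: (@cstar_mul_continuous R A (a, f r)).
- exact: cvg_cst.
- exact: cf.
Qed.

Lemma Cc_left_mul a f : Cc f -> Cc (fun r => a ** f r).
Proof.
move=> [cf [K cK f0]]; split; first exact: left_mul_continuous.
by exists K => // s /f0 ->; rewrite smulx0.
Qed.

Lemma iota_left_mul_adj a f g : Cc f -> Cc g ->
  star (iota (fun r => a ** f r)) ** iota g = star (iota f) ** iota (fun r => star a ** g r).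
Proof.
move=> hf hg; have ha := Cc_left_mul a hf; have hb := Cc_left_mul (star a) hg.
have [h [hh hP <-]] := star_smul_iota lcG haar DeltaP BP ha hg.
rewrite -(crossed_star BP)//; apply: (iota_conv lcG haar BP) => //.
  exact: (Cc_star_in alpha lcG haar DeltaP hf).
move=> s; have := hP s; congr strong_integral; apply/funext => r.
rewrite /conv_integrand /Cc_star starM !action_smul !smulZl; congr (_ *: _).
by rewrite smulA.
Qed.

(** The square is completed as in [adjoint_bound], now inside the crossed product: with q = f - y f,
    the image of q^* q is that of f^* f minus that of (a f)^* (a f) divided by k^2. *)
Lemma iota_left_mul_bound a f : Cc f -> rnorm (iota (fun r => a ** f r)) <= rnorm a * rnorm (iota f).
Proof.
move=> hf; apply: (@le_eps _ _ _ (rnorm (iota f))) => e e0.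
rewrite [_ * e]mulrC -mulrDl; set k := rnorm a + e.
have k0 : 0 < k by rewrite ltr_wpDl// rnorm_ge0.
have k2 : 0 < k ^+ 2 by rewrite exprn_gt0.
pose x := ((k ^+ 2)^-1)%:c *: (star a ** a).
have xs : star x = x by rewrite /x starZr starM starK.
have q1 : (rnorm a / k) ^+ 2 < 1.
  by rewrite expr_lt1// ?divr_ge0 ?rnorm_ge0 ?(ltW k0)// ltr_pdivrMr// mul1r ltrDl.
have xN : NA x <= (rnorm a / k) ^+ 2.
  rewrite -[NA _]/(rnorm _) /x rnorm_real rnorm_cstar ger0_norm ?invr_ge0 ?(ltW k2)//.
  by rewrite exprMn exprVn mulrC.
have [y [yE ys _ _]] := cn_sqrt q1 xN xs.
pose m b f : G -> A := fun r => b ** f r.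
have Ccm b g : Cc g -> Cc (m b g) by exact: Cc_left_mul.
have hl c u v : Cc u -> Cc v -> iota (c *: u + v) = c *: iota u + iota v by exact: (iota_linear BP).
pose q := f - m y f.
have hq : Cc q by rewrite /q -scaleN1r addrC; apply: Cc_linear => //; exact: Ccm.
have qq : star (iota q) ** iota q = star (iota f) ** iota f - ((k ^+ 2)^-1)%:c *: (star (iota (m a f)) ** iota (m a f)).
  have e1 : iota q = iota f - iota (m y f) by rewrite /q (iotaB BP)//; exact: Ccm.
  have e2 : star (iota (m y f)) ** iota f = star (iota f) ** iota (m y f).
    by rewrite (iota_left_mul_adj y hf hf) ys.
  have e3 : star (iota (m y f)) ** iota (m y f) = star (iota f) ** iota (m y (m y f)).
    by rewrite (iota_left_mul_adj y hf (Ccm y f hf)) ys.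
  have e4 : star (iota (m a f)) ** iota (m a f) = star (iota f) ** iota (m (star a) (m a f)).
    by rewrite (iota_left_mul_adj a hf (Ccm a f hf)).
  have e5 : iota (m y f) + iota (m y f) = ((k ^+ 2)^-1)%:c *: iota (m (star a) (m a f)) + iota (m y (m y f)).
    rewrite -(hl _ _ _ (Ccm _ _ (Ccm _ _ hf)) (Ccm _ _ (Ccm _ _ hf))).
    have -> : iota (m y f) + iota (m y f) = iota (1 *: m y f + m y f).
      by rewrite (hl _ _ _ (Ccm y f hf) (Ccm y f hf)) scale1r.
    congr iota; apply/funext => r.
    rewrite -[LHS]/(1 *: (y ** f r) + y ** f r) -[RHS]/(_ *: (star a ** (a ** f r)) + y ** (y ** f r)).
    have xr : x ** f r + (y ** y) ** f r = y ** f r + y ** f r.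
      by rewrite -smulDl -yE smulZl; lmod A; rewrite ?rmorphD/=; ring.
    by rewrite scale1r -xr /x smulZl -!smulA.
  rewrite e1 starB smulBl !smulBr e2 e3 e4 -smulZr.
  have -> : ((k ^+ 2)^-1)%:c *: iota (m (star a) (m a f)) =
     iota (m y f) + iota (m y f) - iota (m y (m y f)) by rewrite e5 addrK.
  by rewrite smulBr smulDr; lmod B; ring.
have h : N (lmul (((k ^+ 2)^-1)%:c *: (star (iota (m a f)) ** iota (m a f)))) <=
    N (lmul (star (iota f) ** iota f)).
  apply: pos_norm_mono.
    by rewrite lmulZ lmulM lmulS; apply: posZ; [rewrite invr_ge0 ltW|exact: pos_star_smul].
  by rewrite -lmulB -qq lmulM lmulS; exact: pos_star_smul.
rewrite -!rnorm_lmul rnorm_real !rnorm_cstar ger0_norm ?invr_ge0 ?(ltW k2)// in h.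
rewrite mulrC ler_pdivrMr// mulrC -exprMn in h.
by apply: ler_of_sqr => //; rewrite mulr_ge0 ?rnorm_ge0// ltW.
Qed.

(** The canonical homomorphism from [A] to the multipliers of the crossed product. *)
Lemma mulA_ex : exists m : A -> M, [/\
  forall a f, Cc f -> m a (iota f) = iota (fun r => a ** f r),
  forall a, star (m a) = m (star a), forall a b, m (a ** b) = m a ** m b,
  forall c a b, m (c *: a + b) = c *: m a + m b & forall a, N (m a) <= rnorm a].
Proof.
have ex a : exists T : M, forall f, Cc f -> T (iota f) = iota (fun r => a ** f r) /\
    star T (iota f) = iota (fun r => star a ** f r).
  apply: (adj_extend BP (rnorm_ge0 a)) => [f hf|c f g|f g hf hg|f hf|f hf].
  - by split; exact: Cc_left_mul.
  - by split; apply/funext => r; rewrite -[LHS]/(_ ** (c *: f r + g r)) smulDr smulZr.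
  - exact: iota_left_mul_adj.
  - exact: iota_left_mul_bound.
  - by have := iota_left_mul_bound (star a) hf; rewrite rnorm_star.
have [m mP] := choice ex; exists m; split.
- by move=> a f hf; have [] := mP a f hf.
- move=> a; apply: adj_eq_dense => f hf.
  by rewrite (mP a f hf).2 (mP (star a) f hf).1.
- move=> a b; apply: adj_eq_dense => f hf.
  rewrite (mP _ f hf).1 mulE_adj (mP b f hf).1 (mP a _ (Cc_left_mul b hf)).1.
  by congr iota; apply/funext => r; rewrite smulA.
- move=> c a b; apply: adj_eq_dense => f hf.
  rewrite (mP _ f hf).1 addE_adj scaleE_adj (mP b f hf).1 (mP a f hf).1.
  rewrite -(iota_linear BP); [|exact: Cc_left_mul|exact: Cc_left_mul].
  by congr iota; apply/funext => r; rewrite smulDl smulZl.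
- move=> a; apply: adj_norm_min => [|x]; first exact: rnorm_ge0.
  apply: (@le_eps _ _ _ (N (m a) + rnorm a)) => e e0; have [f hf fx] := iota_dense BP x e0.
  have -> : m a x = m a (iota f) - m a (iota f - x) by rewrite adjB opprB addrC subrK.
  have h1 := iota_left_mul_bound a hf; rewrite -(mP a f hf).1 in h1.
  have h2 := le_trans (le_adj_norm (m a) (iota f - x)) (ler_wpM2l (cn_ge0 N (m a)) fx).
  have h3 := rnormD (iota f - x) x; rewrite subrK in h3.
  have h4 := ler_wpM2l (rnorm_ge0 a) (le_trans h3 (lerD fx (lexx _))).
  rewrite (le_trans (rnormD _ _))// rnormN (le_trans (lerD (le_trans h1 h4) h2))//.
  by rewrite le_eqVlt; apply/orP; left; apply/eqP; ring.
Qed.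

(** Left multiplication by the canonical unitary of [g], in terms of functions. *)
Definition trans (g : G) f : G -> A := fun r => alpha g (f (g^-1 * r)%g).

Lemma trans_joint f : continuous f -> continuous (fun p : G * G => trans p.1 f p.2).
Proof.
move=> cf p.
apply: (@continuous_comp _ _ _ (fun p : G * G => (p.1, f (p.1^-1 * p.2)%g)) (fun p : G * A => alpha p.1 p.2)); last exact: action_joint.
apply: cvg_pair; first exact: cvg_fst.
apply: continuous_comp; last exact: cf.
apply: (@mulg_continuous2 G _ (fun p => p.1^-1%g) snd) => q; last exact: cvg_snd.
by apply: (@invg_continuous2 G _ fst) => z; exact: cvg_fst.
Qed.

Lemma Cc_trans s f : Cc f -> Cc (trans s f).
Proof.
move=> [cf [K cK f0]]; split.
  move=> r; apply: (@continuous_comp _ _ _ (fun r : G => (s, r)) (fun p => trans p.1 f p.2)); last exact: trans_joint.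
  by apply: cvg_pair; [exact: cvg_cst|exact: cvg_id].
exists [set (s * x)%g | x in K]; first exact: compact_lmul.
move=> r nr; rewrite /trans f0 ?raddf0// => Kr; apply: nr.
by exists (s^-1 * r)%g => //; rewrite mulgA mulgV mul1g.
Qed.

(** Replacing r by r s in the convolution integral produces the modular factor of a right
    translation, which cancels the one in [Cc_star]. *)
Lemma iota_trans_adj s f g : Cc f -> Cc g ->
  star (iota (trans s f)) ** iota g = star (iota f) ** iota (trans s^-1%g g).
Proof.
move=> hf hg; have hs := Cc_trans s hf; have hg' := Cc_trans s^-1%g hg.
have [h [hh hP <-]] := star_smul_iota lcG haar DeltaP BP hf hg'.
rewrite -(crossed_star BP)//; apply/esym; apply: (iota_conv lcG haar BP) => //.
  exact: (Cc_star_in alpha lcG haar DeltaP hs).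
move=> t; have [K [cK F0 FK]] := hP t.
have E (r : G) : conv_integrand alpha (Cc_star alpha Delta (trans s f)) g t r =
    (Delta s)%:c *: conv_integrand alpha (Cc_star alpha Delta f) (trans s^-1%g g) t (r * s)%g.
  rewrite /conv_integrand /Cc_star /trans invgK.
  rewrite -!action_star -!actionM !smulZl scalerA -rmorphM.
  have -> : Delta s * Delta (r * s)^-1%g = Delta r^-1%g.
    rewrite (DeltaV lcG haar DeltaP) (DeltaM lcG haar DeltaP) (DeltaV lcG haar DeltaP).
    by field; rewrite !gt_eqF// (Delta_gt0 DeltaP).
  by rewrite invgM !mulgA mulgV mul1g mulgK.
exists [set (x * s^-1)%g | x in K]; split; first exact: compact_rmul.
  move=> r nr; rewrite E F0 ?scaler0// => Kr; apply: nr.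
  by exists (r * s)%g => //; rewrite -mulgA mulgV mulg1.
have := has_integral_right_translate s^-1%g DeltaP FK; rewrite invgK => hr.
have -> : h t = (Delta s)%:c *: ((Delta s^-1%g)%:c *: h t).
  by rewrite scalerA -rmorphM (DeltaV lcG haar DeltaP) mulfV ?scale1r// gt_eqF// (Delta_gt0 DeltaP).
by apply: (eq_has_integral _ (has_integralZ (Delta s)%:c hr)) => r _; rewrite E.
Qed.

Lemma trans_mul s t f : trans (s * t)%g f = trans s (trans t f).
Proof. by apply/funext => r; rewrite /trans actionM invgM mulgA. Qed.

Lemma trans1 f : trans 1%g f = f.
Proof. by apply/funext => r; rewrite /trans action1 invg1 mul1g. Qed.

Lemma iota_trans_norm s f : Cc f -> rnorm (iota (trans s f)) = rnorm (iota f).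
Proof.
move=> hf; apply/eqP; rewrite -(@eqrXn2 _ 2) ?rnorm_ge0// -!rnorm_cstar.
by rewrite iota_trans_adj//; [rewrite -trans_mul mulVg trans1|exact: Cc_trans].
Qed.

(** One compact set contains the supports of all translates by s near 1, so uniform closeness
    controls the norm in the crossed product through [iota_bound]. *)
Lemma trans_near f : Cc f -> exists K, [/\ compact K, forall r, ~ K r -> f r = 0 &
  forall e : R, 0 < e -> \forall s \near (1 : G)%g, forall r,
    rnorm (trans s f r - f r) <= e /\ (~ K r -> trans s f r = 0)].
Proof.
move=> [cf [K cK f0]]; have [C cC nC] := compact_nbhs lcG 1%g.
pose K' := [set (p.1 * p.2)%g | p in C `*` K]; have cK' : compact K' by exact: compact_mul.
have KK' r : K r -> K' r.
  by move=> Kr; exists (1%g, r); rewrite ?mul1g//; split=> //; exact: nbhs_singleton.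
have nK' s r : C s -> ~ K' r -> trans s f r = 0.
  move=> Cs nr; rewrite /trans f0 ?raddf0// => Kr; apply: nr.
  by exists (s, s^-1 * r)%g => //=; rewrite mulgA mulgV mul1g.
exists K'; split=> // [r nr|e e0]; first by rewrite f0// => /KK'.
have [_ jF] := joint_param (trans_joint cf).
have h := @compact_near G G (nbhs (1 : G)%g) (fun s r => NA (trans s f r - trans 1%g f r) <= e) K'
  (nbhs_filter _) cK' (fun r _ => jF 1%g r e e0).
have : nbhs (1 : G)%g (C `&` [set s | forall r, K' r -> NA (trans s f r - trans 1%g f r) <= e]).
  exact: filterI nC h.
apply: filterS => s [Cs hs] r; split; last exact: nK'.
have [Kr|nKr] := pselect (K' r); first by have := hs r Kr; rewrite trans1.
by rewrite nK'// f0 ?subrr ?rnorm0 ?ltW// => /KK'.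
Qed.

Lemma unitG_ex : exists u : G -> M, [/\
  forall s f, Cc f -> u s (iota f) = iota (trans s f),
  forall s, star (u s) ** u s = 1e /\ u s ** star (u s) = 1e,
  forall s x, rnorm (u s x) = rnorm x &
  forall x e, 0 < e -> \forall s \near (1 : G)%g, rnorm (u s x - x) <= e].
Proof.
have ex s : exists T : M, forall f, Cc f -> T (iota f) = iota (trans s f) /\
    star T (iota f) = iota (trans s^-1%g f).
  apply: (adj_extend BP ler01) => [f hf|c f g|f g hf hg|f hf|f hf].
  - by split; exact: Cc_trans.
  - by split; apply/funext => r; rewrite /trans linearP.
  - exact: iota_trans_adj.
  - by rewrite iota_trans_norm// mul1r.
  - by rewrite iota_trans_norm// mul1r.
have [u uP] := choice ex.
have uu s : star (u s) ** u s = 1e /\ u s ** star (u s) = 1e.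
  split; apply: adj_eq_dense => f hf; rewrite mulE_adj.
    by rewrite (uP s f hf).1 (uP s _ (Cc_trans s hf)).2 -trans_mul mulVg trans1.
  by rewrite (uP s f hf).2 (uP s _ (Cc_trans _ hf)).1 -trans_mul mulgV trans1.
have ui s x : rnorm (u s x) = rnorm x.
  apply/eqP; rewrite -(@eqrXn2 _ 2) ?rnorm_ge0// -!rnorm_cstar.
  by have := adjP (u s) x (u s x); rewrite -[adj_adj (u s) _]/((star (u s) ** u s) x) (uu s).1 => ->.
exists u; split=> // [s f hf|x e e0]; first by have [] := uP s f hf.
have e3 : 0 < e / 3 by rewrite divr_gt0.
have [f hf fx] := iota_dense BP x e3.
have [K [cK f0 fP]] := trans_near hf.
have m1 : 0 < meas mu K + 1 by rewrite ltr_wpDl// meas_ge0.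
apply: filterS (fP _ (divr_gt0 e3 m1)) => s hs.
have hd : rnorm (iota (trans s f) - iota f) <= e / 3.
  rewrite -(iotaB BP hf (Cc_trans s hf)).
  have := iota_bound (c := e / 3 / (meas mu K + 1)) lcG haar BP cK _ _ _.
  move=> /(_ (trans s f - f)) h; apply: (le_trans (h _ _ _)).
  - by rewrite -scaleN1r addrC; apply: Cc_linear => //; exact: Cc_trans.
  - by move=> r nr; rewrite -[LHS]/(trans s f r - f r) (hs r).2// f0// subrr.
  - by move=> r; exact: (hs r).1.
  - by rewrite mulrAC ler_pdivrMr// ler_wpM2l ?(ltW e3)// lerDl.
have -> : u s x - x = - u s (iota f - x) + (iota (trans s f) - iota f) + (iota f - x).
  by rewrite adjB (uP s f hf).1; lmod B; ring.
rewrite (le_trans (rnormD _ _))//.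
have := rnormD (- u s (iota f - x)) (iota (trans s f) - iota f); rewrite rnormN ui.
move=> h; apply: (le_trans (lerD (le_trans h (lerD fx hd)) fx)); lra.
Qed.

End multipliers.

(** * Equicontinuous approximate units and a left unit of the crossed product *)

Section units.
Context {R : realType} {G : topGroupType} {A : cstarAlgType R}.
Variables (alpha : action G A) (mu : {measure set (borel G) -> \bar R}) (Delta : G -> R).
Hypothesis lcG : locally_compact_group G.
Hypothesis haar : left_haar mu.
Local Notation NA := (@cstar_cnorm R A).
Local Notation Cn := (@complex_cnorm R).
Variable v : nat -> A.
Hypothesis vb : forall n, star (v n) = v n /\ rnorm (v n) <= 2.
Hypothesis vP : forall a, tends NA (fun n => v n ** a) a.

Lemma unit_uniform (K : set G) (f : G -> A) e : compact K -> continuous f -> 0 < e ->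
  exists n, forall m, (n <= m)%N -> forall s, K s -> rnorm (v m ** f s - f s) <= e.
Proof.
move=> cK cf e0; have e4 : 0 < e / 4 by rewrite divr_gt0.
have := @compact_near G nat \oo (fun m s => rnorm (v m ** f s - f s) <= e) K _ cK.
have FF : Filter (\oo : set_system nat) by exact: _.
move=> /(_ FF) [|n _ hn]; last by exists n => m nm s Ks; exact: hn.
move=> s _; have [n hn] := vP (f s) e4.
exists ([set t | NA (f t - f s) <= e / 4], [set m | (n <= m)%N]).
  by split; [exact: (cn_continuousP f).1 cf s _ e4|exists n].
move=> [t m] [/= ht nm]; have h := hn m nm.
have -> : v m ** f t - f t = v m ** (f t - f s) + (v m ** f s - f s) - (f t - f s).
  by rewrite smulBr; lmod A; ring.
rewrite (le_trans (rnormD _ _))// rnormN.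
have h1 := le_trans (rnormD (v m ** (f t - f s)) _) (lerD (rnorm_smul_le _ _) h).
have h2 : rnorm (v m) * rnorm (f t - f s) <= 2 * (e / 4).
  by rewrite ler_pM ?rnorm_ge0//; exact: (vb m).2.
have h3 := le_trans (lerD h1 ht) (lerD (lerD h2 (lexx _)) (lexx _)).
by rewrite (le_trans h3)//; lra.
Qed.

Lemma weighted_integral_near K (w : G -> R) (F : G -> A) y z c : compact K ->
  (forall x, 0 <= w x) -> has_integral mu Cn (K : set (borel G)) (fun x => (w x)%:c) 1 ->
  has_integral mu NA (K : set (borel G)) (fun x => (w x)%:c *: F x) y ->
  (forall x, w x != 0 -> rnorm (F x - z) <= c) -> rnorm (y - z) <= c.
Proof.
move=> cK w0 iw iF Fc; have fK := compact_finite_meas lcG haar cK.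
have iz : has_integral mu NA (K : set (borel G)) (fun x => (w x)%:c *: z) z.
  have := @has_integral_map _ _ R mu R[i]^o A Cn NA (K : set (borel G)) (fun k => k *: z) (rnorm z)
    (fun x => (w x)%:c) 1 (rnorm_ge0 z).
  rewrite scale1r; apply=> // [r a b|a]; first by rewrite scalerDl scalerA.
  by rewrite cnZ mulrC.
have iFz : has_integral mu NA (K : set (borel G)) (fun x => (w x)%:c *: (F x - z)) (y - z).
  have -> : y - z = (-1) *: z + y by rewrite scaleN1r addrC.
  apply: (eq_has_integral _ (has_integral_linear (-1) fK iz iF)) => x _.
  by rewrite -[LHS]/(-1 *: ((w x)%:c *: z) + (w x)%:c *: F x) scaleN1r scalerBr addrC.
have icw : has_integral mu Cn (K : set (borel G)) (fun x => (c * w x)%:c) (c%:c : R[i]^o).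
  have := has_integralZ c%:c iw; rewrite -[_ *: 1]/(_ * 1) mulr1.
  by apply: eq_has_integral => x _; rewrite [RHS]rmorphM.
apply: (has_integral_dominated fK iFz icw) => x _.
rewrite cnZ cabs_real ger0_norm//; have [->|wx] := eqVneq (w x) 0; first by rewrite mul0r mulr0.
by rewrite mulrC ler_wpM2r//; exact: Fc.
Qed.

Lemma scale_real_continuous (w : G -> R) (F : G -> A) : continuous w -> continuous F ->
  continuous (fun x => (w x)%:c *: F x).
Proof.
move=> cw cF x; apply: (@cvgZ _ _ _ (nbhs x)); last exact: cF.
apply/cvgrPdist_le => e /pos_complex[-> e0].
have /cvgrPdist_le/(_ _ e0) := cw x; apply: filterS => t /= h.
by rewrite -rmorphB -[X in X <= _]/((cabs _)%:c) lecR cabs_real.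
Qed.

(** d_n averages alpha_x (v_n) against a bump w; acting by g only translates w, which makes the
    orbit maps equicontinuous. Such a sequence lies in A_oo^(alpha), where the unit condition on
    Rokhlin maps can be tested. *)
Lemma equicontinuous_unit : exists d : nat -> A, [/\
  forall n, rnorm (d n) <= 2,
  forall (g0 : G) (e : R), 0 < e -> \forall g \near g0, forall n, rnorm (alpha g (d n) - alpha g0 (d n)) <= e,
  forall a, tends NA (fun n => d n ** a) a & forall a, tends NA (fun n => a ** d n) a].
Proof.
have [w [K [[cw cK] w0 _ wK iw]]] := bump (R := R) lcG haar (filterT : nbhs (1 : G)%g setT).
have fK := compact_finite_meas lcG haar cK.
have cF (a : A) : continuous (fun x : G => (w x)%:c *: alpha x a).
  by apply: scale_real_continuous => //; exact: (@action_continuous R G A alpha a).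
have /choice[d dP] n := has_integral_ex lcG haar cK ((cn_continuousP _).1 (cF (v n))).
have ca (a : A) : continuous (fun r : G => alpha r^-1%g a).
  move=> r; apply: (@continuous_comp _ _ _ (fun r : G => r^-1%g) (fun s => alpha s a)).
    exact: invg_continuous.
  exact: (@action_continuous R G A alpha a).
have ds n : star (d n) = d n.
  apply: (has_integral_uniq fK _ (dP n)).
  have := @has_integral_map _ _ R mu A A NA NA (K : set (borel G)) (@star R A) 1 _ _ ler01 _ _ (dP n).
  move=> h; apply: (eq_has_integral _ (h _ _)).
  - by move=> x _; rewrite /= starZr -action_star (vb n).1.
  - by move=> r a b; rewrite starD starZr.
  - by move=> a; rewrite mul1r -[NA _]/(rnorm _) rnorm_star.
have dl a : tends NA (fun n => d n ** a) a.
  move=> e e0; have [n hn] := unit_uniform cK (ca a) e0; exists n => m /hn h.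
  have im : has_integral mu NA (K : set (borel G)) (fun x => (w x)%:c *: (alpha x (v m) ** a)) (d m ** a).
    have := @has_integral_map _ _ R mu A A NA NA (K : set (borel G)) (fun y => y ** a) (rnorm a) _ _ (rnorm_ge0 a) _ _ (dP m).
    move=> hm; apply: (eq_has_integral _ (hm _ _)).
    - by move=> x _; rewrite /= smulZl.
    - by move=> r p q; rewrite smulDl smulZl.
    - by move=> p; rewrite -![NA _]/(rnorm _) mulrC rnorm_smul_le.
  apply: (weighted_integral_near cK w0 iw im) => x wx.
  have Kx : K x by apply: contrapT => nK; move: wx; rewrite wK ?eqxx.
  have := h x Kx; rewrite -(action_rnorm alpha x) linearB action_smul -!actionM mulgV !action1.
  by [].
exists d; split=> // [n|g0 e e0|a].
- rewrite -[d n]subr0; apply: (weighted_integral_near cK w0 iw (dP n)) => x _.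
  by rewrite subr0 action_rnorm; exact: (vb n).2.
- have [C cC nC] := compact_nbhs lcG g0.
  pose K' := [set (p.1 * p.2)%g | p in C `*` K]; have cK' : compact K' by exact: compact_mul.
  have fK' := compact_finite_meas lcG haar cK'.
  have m1 : 0 < 2 * (meas mu K' + 1) by rewrite mulr_gt0// ltr_wpDl// meas_ge0.
  pose W (g x : G) : R := w (g^-1 * x)%g.
  have ig g n : C g -> has_integral mu NA (K' : set (borel G)) (fun x => (W g x)%:c *: alpha x (v n)) (alpha g (d n)).
    move=> Cg; have := @has_integral_map _ _ R mu A A NA NA (K : set (borel G)) (alpha g) 1 _ _ ler01 _ _ (dP n).
    move=> h; have {}h := h _ _.
    have := has_integral_left_translate (mu := mu) haar g (h _ _).
    move=> {}h; apply: (has_integral_extend (K := [set (g * x)%g | x in K] : set (borel G)) _ fK' _ _ _).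
    - exact: compact_finite_meas (compact_lmul cK).
    - by move=> _ [x Kx <-]; exists (g, x).
    - move=> x nx; rewrite /W wK ?scale0r// => Kx; apply: nx; exists (g^-1 * x)%g => //.
      by rewrite mulgA mulgV mul1g.
    - apply: (eq_has_integral _ (h _ _)) => [x _|r a b|a]; last 2 first.
      + by rewrite linearP.
      + by rewrite mul1r -![NA _]/(rnorm _) action_rnorm.
      by rewrite /= linearZ/= -actionM mulgA mulgV mul1g.
  have Wn : \forall g \near g0, forall x, K' x -> `|W g x - W g0 x| <= e / (2 * (meas mu K' + 1)).
    apply: (@compact_near G G (nbhs g0) (fun g x => `|W g x - W g0 x| <= e / (2 * (meas mu K' + 1)))) => // r _.
    have cW : continuous (fun p : G * G => W p.1 p.2).
      move=> p; apply: continuous_comp; last exact: cw.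
      apply: (@mulg_continuous2 G _ (fun p => p.1^-1%g) snd) => q; last exact: cvg_snd.
      by apply: (@invg_continuous2 G _ fst) => z; exact: cvg_fst.
    have e2 : 0 < e / (2 * (meas mu K' + 1)) / 2 by rewrite !divr_gt0.
    have /cvgrPdist_le/(_ _ e2) := cW (g0, r).
    move=> [[P Q] /= [Pg Qr] PQ]; exists (Q, P) => // -[x y] /= [Qx Py].
    have h1 := PQ (y, x) (conj Py Qx); have h2 := PQ (g0, x) (conj (nbhs_singleton Pg) Qx).
    rewrite /= in h1 h2; have := ler_distD (W g0 r) (W y x) (W g0 x).
    by move=> /le_trans; apply; rewrite (splitr (e / _)) lerD// distrC.
  have : nbhs g0 (C `&` [set g | forall x, K' x -> `|W g x - W g0 x| <= e / (2 * (meas mu K' + 1))]).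
    exact: filterI nC Wn.
  apply: filterS => g [Cg hg] n.
  have hd := has_integral_linear (-1) fK' (ig g0 n (nbhs_singleton nC)) (ig g n Cg).
  have -> : alpha g (d n) - alpha g0 (d n) = -1 *: alpha g0 (d n) + alpha g (d n).
    by rewrite scaleN1r addrC.
  apply: (le_trans (has_integral_bound (c := e / (2 * (meas mu K' + 1)) * 2) fK' hd _)).
    move=> x Kx; rewrite -[_ x]/(-1 *: ((W g0 x)%:c *: alpha x (v n)) + (W g x)%:c *: alpha x (v n)).
    rewrite scaleN1r addrC -scalerBl -rmorphB cnZ cabs_real -[NA _]/(rnorm _) action_rnorm.
    by rewrite ler_pM ?rnorm_ge0//; [exact: hg|exact: (vb n).2].
  have m2 : meas mu K' + 1 != 0 by rewrite gt_eqF// ltr_wpDl// meas_ge0.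
  have -> : e / (2 * (meas mu K' + 1)) * 2 * meas mu K' = e * (meas mu K' / (meas mu K' + 1)).
    by field.
  rewrite ler_piMr ?(ltW e0)// ler_pdivrMr ?mul1r ?lerDl// ltr_wpDl// meas_ge0//.
- move=> e e0; have [n hn] := dl (star a) e e0; exists n => m /hn.
  by rewrite -[NA _]/(rnorm _) -rnorm_star starB starM starK ds.
Qed.

Section left_unit.
Hypothesis DeltaP : modular_function mu Delta.
Variables (B : cstarAlgType R) (iota : (G -> A) -> B).
Hypothesis BP : is_full_crossed_product alpha mu Delta iota.
Hypothesis scG : @second_countable G.

Lemma nbhs_sequence : exists V : nat -> set G, (forall n, nbhs (1 : G)%g (V n)) /\
  forall W, nbhs (1 : G)%g W -> exists n, V n `<=` W.
Proof.
have [D cD [oD bD]] := scG; have /countable_injP[f fi] := cD.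
pose V n := xget setT [set W | [/\ D W, W (1 : G)%g & f W = n]].
exists V; split=> [n|W nW].
  rewrite /V; case: xgetP => [W _ [DW W1 _]|_]; last exact: filterT.
  by apply: open_nbhs_nbhs; split=> //; exact: oD.
have [U [DU U1] UW] := bD _ _ nW; exists (f U); rewrite /V.
case: xgetP => [Z _ [DZ Z1 fZ]|/(_ U)[]//].
by have -> : Z = U by apply: fi => //; rewrite inE.
Qed.

(** The elements are bumps times members of an approximate unit of [A]. Second countability leaves
    countably many bumps, and the pairs are enumerated in one sequence; the good index may depend on
    [x]. *)
Lemma left_unit : exists u : nat -> B, forall x e, 0 < e -> exists n, rnorm (u n ** x - x) <= e.
Proof.
have [V [nV VP]] := nbhs_sequence.
have /choice[w /choice[KW wP]] n := bump (R := R) lcG haar (nV n).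
pose p n m : G -> A := fun r => (w n r)%:c *: v m.
have Ccp n m : Cc (p n m).
  have [[cw cK] _ _ wK _] := wP n; split; last by exists (KW n) => // s /wK; rewrite /p => ->; rewrite scale0r.
  by apply: scale_real_continuous => // x; exact: cst_continuous.
have pN n m : rnorm (iota (p n m)) <= 2.
  have [[cw cK] w0 _ wK iw] := wP n.
  have i2 : has_integral mu Cn (KW n : set (borel G)) (fun x => (2 * w n x)%:c) (2%:c : R[i]^o).
    have := has_integralZ 2%:c iw; rewrite -[_ *: 1]/(_ * 1) mulr1.
    by apply: eq_has_integral => x _; rewrite [RHS]rmorphM.
  apply: (iota_bound_L1 lcG haar BP cK (Ccp n m) _ _ i2) => s.
    by move=> /wK; rewrite /p => ->; rewrite scale0r.
  by rewrite rnorm_real ger0_norm// mulrC ler_wpM2r//; exact: (vb m).2.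
pose u k := let: (n, m) := odflt (0, 0)%N (unpickle k) in iota (p n m).
exists u => x e e0; have e5 : 0 < e / 5 by rewrite divr_gt0.
have [f hf fx] := iota_dense BP x e5; have [cf _] := hf.
have [K [cK f0 fP]] := trans_near alpha lcG hf.
have m1 : 0 < 3 * (meas mu K + 1) by rewrite mulr_gt0// ltr_wpDl// meas_ge0.
have d0 := divr_gt0 e5 m1; set d := e / 5 / _ in d0.
have [n nP] := VP _ (fP d d0); have [m mP] := unit_uniform cK cf d0.
exists (pickle (n, m)); rewrite /u pickleK /=.
have [[cw cKW] w0 wV wK iw] := wP n.
have [h hh hP] := convolution_ex alpha lcG haar (Ccp n m) hf.
have hE := iota_conv lcG haar BP (Ccp n m) hf hh hP.
have near s c : (forall r, V n r -> rnorm (v m ** trans alpha r f s - f s) <= c) -> rnorm (h s - f s) <= c.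
  move=> hc; have [K1 [cK1 F0 FK1]] := hP s.
  pose K2 := K1 `|` KW n; have cK2 : compact K2 by exact: compactU.
  have fK2 := compact_finite_meas lcG haar cK2.
  have iw2 : has_integral mu Cn (K2 : set (borel G)) (fun x => (w n x)%:c) 1.
    apply: (has_integral_extend (compact_finite_meas lcG haar cKW) fK2 _ _ iw); first by move=> r; right.
    by move=> r /wK ->.
  have i2 : has_integral mu NA (K2 : set (borel G)) (fun x => (w n x)%:c *: (v m ** trans alpha x f s)) (h s).
    have h2 := has_integral_extend (compact_finite_meas lcG haar cK1) fK2 (@subsetUl _ K1 (KW n)) F0 FK1.
    by apply: (eq_has_integral _ h2) => r _; rewrite /conv_integrand /p smulZl.
  apply: (weighted_integral_near cK2 w0 iw2 i2) => r wr; apply: hc; apply: contrapT => nVr.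
  by move: wr; rewrite wV ?eqxx.
have hf0 s : ~ K s -> h s - f s = 0.
  move=> nK; apply: rnorm0_eq0; apply: le_anti; rewrite rnorm_ge0 andbT.
  by apply: near => r /nP/(_ s)[_ /(_ nK) ->]; rewrite f0// smulx0 subrr rnorm0.
have hfd s : rnorm (h s - f s) <= 3 * d.
  have [Ks|nK] := pselect (K s); last by rewrite hf0// rnorm0 mulr_ge0// ltW.
  apply: near => r /nP/(_ s)[h1 _]; have h2 := mP m (leqnn m) s Ks.
  have -> : v m ** trans alpha r f s - f s = v m ** (trans alpha r f s - f s) + (v m ** f s - f s).
    by rewrite smulBr addrA subrK.
  rewrite (le_trans (rnormD _ _))// (_ : 3 * d = 2 * d + d); last by ring.
  by rewrite lerD// (le_trans (rnorm_smul_le _ _))// ler_pM ?rnorm_ge0//; exact: (vb m).2.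
have hd : rnorm (iota h - iota f) <= e / 5.
  have Chf : Cc (h - f) by rewrite -scaleN1r addrC; exact: Cc_linear.
  rewrite -(iotaB BP hf hh) (le_trans (iota_bound lcG haar BP cK Chf hf0 hfd))//.
  have m2 : meas mu K + 1 != 0 by rewrite gt_eqF// ltr_wpDl// meas_ge0.
  have -> : 3 * d * meas mu K = e / 5 * (meas mu K / (meas mu K + 1)) by rewrite /d; field.
  by rewrite ler_piMr ?(ltW e5)// ler_pdivrMr ?mul1r ?lerDl// ltr_wpDl// meas_ge0.
rewrite (_ : _ - x = (iota h - iota f) + (iota f - x) - iota (p n m) ** (iota f - x)); last first.
  by rewrite smulBr -hE; lmod B; ring.
rewrite (le_trans (rnormD _ _))// rnormN.
have h1 := rnormD (iota h - iota f) (iota f - x).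
have h2 : rnorm (iota (p n m) ** (iota f - x)) <= 2 * (e / 5).
  by rewrite (le_trans (rnorm_smul_le _ _))// ler_pM ?rnorm_ge0.
apply: (le_trans (lerD (le_trans h1 (lerD hd fx)) h2)); lra.
Qed.

End left_unit.
End units.

(** * Oscillating functions on the coset space *)

Section cosets.
Context {G : topGroupType} (H : subgroup G).
Hypothesis lcG : locally_compact_group G.
Hypothesis Hclosed : closed (H : set G).
Hypothesis Hcoc : cocompact H.
Local Notation X := (coset_space H).
Local Notation pi := (@coset_proj G H).

Lemma coset_proj_continuous : continuous pi.
Proof. exact: pi_continuous. Qed.

Lemma coset_proj_surj (s : X) : exists g, s = pi g.
Proof. by exists (repr (s : {eq_quot coset_rel H}%qT)); rewrite /coset_proj reprK. Qed.

Lemma coset_rep_compact : exists2 K : set G, compact K & forall s : X, exists2 k, K k & s = pi k.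
Proof.
have [K cK KH] := Hcoc; exists K => // s; have [g ->] := coset_proj_surj s.
have [k [h [Kk Hh ->]]] := KH g; exists k => //.
by apply/esym/coset_proj_eq; rewrite mulgA mulVg mul1g.
Qed.

Lemma coset_compact : compact [set: X].
Proof.
have [K cK KX] := coset_rep_compact.
have -> : [set: X] = pi @` K.
  by apply/seteqP; split=> // s _; have [k Kk ->] := KX s; exists k.
apply: continuous_compact => //; apply: continuous_subspaceT; exact: coset_proj_continuous.
Qed.

Lemma coset_proj_open (U : set G) : open U -> open (pi @` U : set X).
Proof.
move=> oU; rewrite -[open _]/(open (pi @^-1` (pi @` U))).
have -> : pi @^-1` (pi @` U) = \bigcup_(h in (H : set G)) [set (x * h)%g | x in U].
  apply/seteqP; split=> [x [y Uy /coset_proj_eq Hyx]|_ [h Hh [x Ux <-]]].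
    by exists (y^-1 * x)%g => //; exists y => //; rewrite mulgA mulgV mul1g.
  by exists x => //; apply/coset_proj_eq; rewrite mulgA mulVg mul1g.
apply: bigcup_open => h _.
rewrite (image_preimage_inv (psi := fun x => (x * h^-1)%g)) => [|x|x].
- apply: open_comp => // x _; exact: mulg_continuousr.
- by rewrite -mulgA mulgV mulg1.
- by rewrite -mulgA mulVg mulg1.
Qed.

Lemma coset_hausdorff : hausdorff_space X.
Proof.
rewrite open_hausdorff => s t; have [x ->] := coset_proj_surj s; have [y ->] := coset_proj_surj t.
move=> xy; have nH : ~ (H : set G) (x^-1 * y)%g.
  by move=> /coset_proj_eq e; move: xy; rewrite e eqxx.
have cf : continuous (fun p : G * G => (p.1^-1 * p.2)%g).
  apply: (@mulg_continuous2 G _ (fun p => p.1^-1%g) snd) => q; last exact: cvg_snd.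
  by apply: (@invg_continuous2 G _ fst) => z; exact: cvg_fst.
have : nbhs (x, y) ((fun p : G * G => (p.1^-1 * p.2)%g) @^-1` (~` (H : set G))).
  by apply: cf; apply: open_nbhs_nbhs; split=> //; exact: closed_openC.
move=> [[P Q] /= [Px Qy] PQ]; move: Px Qy.
rewrite !nbhsE => -[U [oU Ux] UP] [W [oW Wy] WQ].
exists (pi @` U, pi @` W); rewrite /= ?inE; first by split; [exists x|exists y].
split; [exact: coset_proj_open|exact: coset_proj_open|].
apply/seteqP; split=> // _ [[u Uu <-] [w Ww /coset_proj_eq Hwu]].
apply: (PQ (u, w)); first by split; [exact: UP|exact: WQ].
by have := subgroupV Hwu; rewrite invgM invgK.
Qed.

(** The plateau value pi / 2 is a zero of the cosine, so cos f vanishes near [s]; outside [U] the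
    value 0 makes sin f vanish. *)
Lemma coset_bump {R : realType} (s : X) (U : set X) : open U -> U s ->
  exists f : X -> R, [/\ continuous f, forall t, ~ U t -> f t = 0 &
    \forall t \near s, f t = trigo.pi / 2].
Proof.
move=> oU Us.
have nX : normal_space X by apply: compact_normal; [exact: coset_hausdorff|exact: coset_compact].
have : uniform_separator [set s] (~` U).
  apply: (@normal_completely_regular R _ nX) => //; last exact: open_closedC.
  by apply: hausdorff_accessible; exact: coset_hausdorff.
move=> /(uniform_separatorP (R := R))[f [cf f01 f1 fU]].
have fs : f s = 0 by apply: f1; exists s.
have fU' t : ~ U t -> f t = 1 by move=> Ut; apply: fU; exists t.
pose g (r : R) : R := Num.min (trigo.pi / 2) (trigo.pi * (1 - r)).
exists (g \o f); split=> [t|t /fU'|].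
- apply: continuous_comp; first exact: cf.
  apply: (@continuous_min R R (cst (trigo.pi / 2)) (fun r => trigo.pi * (1 - r)) (f t)).
    exact: cst_continuous.
  apply: cvgM; [exact: cvg_cst|apply: cvgB; [exact: cvg_cst|exact: cvg_id]].
- by rewrite /g /= => ->; rewrite subrr mulr0 min_r// divr_ge0// pi_ge0.
- have : nbhs s (f @^-1` [set r | r < 1 / 2]).
    by apply: cf; rewrite fs; apply: open_nbhs_nbhs; split; [exact: open_lt|rewrite /=].
  have aux (r p : R) : 0 <= p -> r < 1 / 2 -> p / 2 <= p * (1 - r) by nra.
  by apply: filterS => t /= ht; rewrite /g min_l//; apply: aux => //; exact: pi_ge0.
Qed.

Hypothesis Hnopen : ~ open (H : set G).

(** Suppose finitely many cosets t_i H cover [D]. They are closed, so those that miss 1 stay away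
    from a neighbourhood of 1, which is then covered by H alone, and [H] would be open. *)
Lemma fresh_coset (D : set G) n (t : 'I_n -> G) : nbhs (1 : G)%g D ->
  exists2 d, D d & forall i, ~ (H : set G) ((t i)^-1 * d)%g.
Proof.
move=> nD; apply: contrapT => nex; apply: Hnopen.
have nH : nbhs (1 : G)%g (H : set G).
  have h (i : 'I_n) : \forall x \near (1 : G)%g, (H : set G) ((t i)^-1 * x)%g -> (H : set G) x.
    case: (pselect ((H : set G) (t i)^-1%g)) => [Ht|nHt].
      apply: nearW => x Hx; rewrite -(mulVKg (t i) x); apply: subgroupM => //.
      by rewrite -[t i]invgK; exact: subgroupV.
    have /(_ (~` (H : set G))) := @mulg_continuousl G (t i)^-1%g 1%g.
    rewrite mulg1 => hh; have : nbhs (1 : G)%g ((fun x => (t i)^-1 * x)%g @^-1` ~` (H : set G)).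
      by apply: hh; apply: open_nbhs_nbhs; split=> //; exact: closed_openC.
    by apply: filterS => x /= nHx /nHx.
  have hh := @filter_forall _ _ _ (nbhs (1 : G)%g) (nbhs_filter _) h.
  have : nbhs (1 : G)%g (D `&` [set x | forall i,
    (H : set G) ((t i)^-1 * x)%g -> (H : set G) x]) by exact: filterI.
  apply: filterS => x [Dx hx]; apply: contrapT => nHx; apply: nex; exists x => // i Hi.
  exact: nHx (hx i Hi).
rewrite openE => x Hx; rewrite /interior /=.
have : nbhs x ((fun y => x^-1 * y)%g @^-1` (H : set G)).
  by apply: mulg_continuousl; rewrite mulVg.
by apply: filterS => y /= Hy; rewrite -(mulVKg x y); exact: subgroupM.
Qed.

Lemma fresh_cosets (D : set G) n : nbhs (1 : G)%g D ->
  exists t : nat -> G, forall j, (j < n)%N -> D (t j) /\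
    forall i, (i < j)%N -> ~ (H : set G) ((t i)^-1 * t j)%g.
Proof.
move=> nD; elim: n => [|n [t tP]]; first by exists (fun=> 1%g).
have [d Dd dP] := fresh_coset (fun i : 'I_n => t i) nD.
exists (fun j => if (j < n)%N then t j else d) => j; rewrite ltnS => jn.
case: (ltnP j n) => jn'.
  have [Dj tj] := tP j jn'; split=> // i ij; rewrite (ltn_trans ij jn'); exact: tj.
have -> : j = n by lia.
by split=> // i ij; rewrite ij; exact: (dP (Ordinal ij)).
Qed.

Context {R : realType} (mu : {measure set (borel G) -> \bar R}).
Hypothesis haar : left_haar mu.

(** The inverse matches the coset shift, which evaluates at g^-1 s, and turns translations of cosets
    into left translations of subsets of [G]. *)
Definition slice (C : set G) (U : set X) : set (borel G) := C `&` [set g | U (pi g^-1%g)].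

Lemma slice_measurable C (U : set X) : compact C -> open U -> measurable (slice C U).
Proof.
move=> cC oU; apply: measurableI; first exact: (closed_measurable_borel (compact_is_closed lcG cC)).
apply: open_measurable_borel; apply: open_comp => // x _.
apply: continuous_comp; first exact: invg_continuous.
exact: coset_proj_continuous.
Qed.

(** The cosets of x^-1 t_i and x^-1 t_j are distinct, so at least one differs from [s] and is
    separated from it by disjoint open sets. Compactness of [K] makes the neighbourhood of [s]
    uniform in x. *)
Lemma separate_slices (K : set G) (t : nat -> G) n s : compact K ->
  (forall i j, (i < j < n)%N -> ~ (H : set G) ((t i)^-1 * t j)%g) ->
  exists U : set X, [/\ open U, U s & forall i j x, (i < j < n)%N -> K x ->
    U (pi (x^-1 * t i)%g) -> ~ U (pi (x^-1 * t j)%g)].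
Proof.
move=> cK tP.
have h (p : 'I_n * 'I_n) : filter_prod (nbhs s) (nbhs s) (fun yz => forall x, K x ->
    (p.1 < p.2)%N -> pi (x^-1 * t p.1)%g = yz.1 -> pi (x^-1 * t p.2)%g = yz.2 -> False).
  pose Q (yz : X * X) (x : G) := (p.1 < p.2)%N -> pi (x^-1 * t p.1)%g = yz.1 ->
    pi (x^-1 * t p.2)%g = yz.2 -> False.
  apply: (@compact_near G _ (filter_prod (nbhs s) (nbhs s)) Q K) => // x Kx.
  rewrite {}/Q; case: p => i j /=.
  case: (ltnP i j) => ij; last first.
    by exists (setT, setT) => //=; split; exact: filterT.
  have cp k : continuous (fun x => pi (x^-1 * t k)%g).
    move=> z; apply: continuous_comp; last exact: coset_proj_continuous.
    by apply: mulg_continuous2; [exact: invg_continuous|move=> ?; exact: cst_continuous].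
  have sep k : pi (x^-1 * t k)%g != s -> exists (W O : set X), [/\ nbhs x ((fun x => pi (x^-1 * t k)%g) @^-1` W),
      nbhs s O & W `&` O = set0].
    move=> ks; have := coset_hausdorff; rewrite open_hausdorff => /(_ _ _ ks)[[W O] /= [/set_mem Wk /set_mem Os]].
    move=> [oW oO WO]; exists W, O; split=> //.
    - by apply: cp; exact: (@open_nbhs_nbhs X _ W).
    - exact: (@open_nbhs_nbhs X s O).
    - exact/eqP.
  case: (eqVneq (pi (x^-1 * t i)%g) s) => [e1|ne]; last have [W [ O [nW nO WO]]] := sep i ne.
    have : pi (x^-1 * t j)%g != s.
      apply/eqP => e2; have := e1; rewrite -e2 => /coset_proj_eq.
      by rewrite invgM invgK -mulgA mulVKg; apply: tP; rewrite ij ltn_ord.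
    move=> /sep[W [ O [nW nO WO]]].
    exists ((fun x => pi (x^-1 * t j)%g) @^-1` W, setT `*` O).
      by split=> //=; exists (setT, O) => //; split=> //; exact: filterT.
    move=> [x' [y z]] /= [Wx [_ Oz]] _ _ e3.
    by have : (W `&` O) z by [split=> //; rewrite -e3]; rewrite WO.
  exists ((fun x => pi (x^-1 * t i)%g) @^-1` W, O `*` setT).
    by split=> //=; exists (O, setT) => //; split=> //; exact: filterT.
  move=> [x' [y z]] /= [Wx [Oy _]] _ e3 _.
  by have : (W `&` O) y by [split=> //; rewrite -e3]; rewrite WO.
have [[P Q] /= [nP nQ] PQ] := filter_forall _ h.
have nPQ : nbhs s (P `&` Q) by exact: filterI.
exists (interior (P `&` Q)); split; [exact: open_interior|exact: nPQ|].
move=> i j x /andP[ij jn] Kx /interior_subset[Pi _] /interior_subset[_ Qj].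
by apply: (PQ (_, _) (conj Pi Qj) (Ordinal (ltn_trans ij jn), Ordinal jn) x Kx ij).
Qed.

(** n + 1 left translates of the slice by elements of distinct cosets are disjoint, lie in the
    compact set D C and have equal Haar measure; n is chosen so that n e bounds the measure of D
    C. *)
Lemma thin_slice (C : set G) s (e : R) : compact C -> 0 < e ->
  exists U : set X, [/\ open U, U s & meas mu (slice C U) <= e].
Proof.
move=> cC e0; have [D cD nD] := compact_nbhs lcG (1 : G)%g.
set K := [set (p.1 * p.2)%g | p in D `*` C].
have cK : compact K by exact: compact_mul.
have fK := compact_finite_meas lcG haar cK.
have [n nP] : exists n : nat, meas mu K <= n%:R * e.
  exists (Num.truncn (meas mu K / e)).+1; rewrite -ler_pdivrMr//; apply: ltW.
  by apply: truncnS_gt.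
have [t tP] := fresh_cosets n.+1 nD.
have [|U [oU Us UP]] := @separate_slices K t n.+1 s cK.
  by move=> i j /andP[ij jn]; have [_] := tP j jn; exact.
exists U; split=> //; have mZ := slice_measurable cC oU.
set Z := slice C U in mZ *.
pose S m : set (borel G) := [set x | exists i : nat, (i < m)%N /\ Z ((t i)^-1 * x)%g].
have tE i : [set (t i * x)%g | x in Z] = (fun x => ((t i)^-1 * x)%g) @^-1` Z.
  apply: image_preimage_inv => x; [exact: mulKg|exact: mulVKg].
have mt i : measurable ((fun x => ((t i)^-1 * x)%g) @^-1` Z : set (borel G)).
  by apply: continuous_borel => //; exact: mulg_continuousl.
have SE m : S m.+1 = S m `|` ((fun x => ((t m)^-1 * x)%g) @^-1` Z).
  apply/seteqP; split=> x.
    move=> [i []]; rewrite ltnS leq_eqVlt => /orP[/eqP->|im] Zx; first by right.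
    by left; exists i.
  move=> [[i [im Zx]]|Zx]; first by exists i; split=> //; exact: (ltn_trans im).
  by exists m.
have SK i x : (i < n.+1)%N -> Z ((t i)^-1 * x)%g -> K x.
  move=> /tP[Di _] [Cx _]; exists (t i, (t i)^-1 * x)%g => //=; exact: mulVKg.
have hS m : (m <= n.+1)%N -> [/\ measurable (S m), S m `<=` K & meas mu (S m) = m%:R * meas mu Z].
  elim: m => [|m IH] mn.
    have -> : S 0%N = set0 by apply/seteqP; split=> // x [i []].
    by rewrite meas0 mul0r; split=> // x.
  have [mS SmK eS] := IH (ltnW mn); rewrite SE; split.
  - exact: measurableU.
  - by move=> x [/SmK//|]; exact: SK.
  - rewrite (measU fK mS (mt m)) ?eS//.
    + rewrite -tE -natr1 mulrDl mul1r; congr (_ + _).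
      by rewrite /meas; have [-> //] := haar.
    + by move=> x; exact: SK.
    + apply/seteqP; split=> // x [[i [im Zi]] Zm].
      have Kx := SK i x (ltn_trans im mn) Zi.
      apply: (UP i m x _ Kx); first by rewrite im.
        by case: Zi => _; rewrite /= invgM invgK.
      by case: Zm => _; rewrite /= invgM invgK.
have [mS SmK eS] := hS n.+1 (leqnn _).
have := measS fK mS fK.1 SmK (fun x h => h); rewrite eS => h.
have := le_trans h nP; rewrite -natr1 => h2.
have aux (a c m : R) : 0 <= c -> 0 <= a -> (a + 1) * m <= a * c -> m <= c.
  move=> c0 a0 h3; rewrite leNgt; apply/negP => cm.
  have : a * c <= a * m by rewrite ler_wpM2l// ltW.
  have := h3; rewrite mulrDl mul1r; lra.
by apply: (aux n%:R) => //; exact: ltW.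
Qed.

(** Compactness of the coset space leaves finitely many plateaus that still cover it. *)
Lemma thin_cover (C : set G) (e : R) : compact C -> 0 < e ->
  exists n (chi : 'I_n -> X -> R) (S : 'I_n -> set (borel G)), [/\ forall j, continuous (chi j),
    forall s, exists j, chi j s = trigo.pi / 2 &
    forall j, [/\ measurable (S j), S j `<=` C, meas mu (S j) <= e &
      forall g, C g -> ~ S j g -> chi j (pi g^-1%g) = 0]].
Proof.
move=> cC e0.
have h (s : X) : exists p : (X -> R) * set X * set (borel G), [/\ continuous p.1.1, nbhs s p.1.2,
    forall t, p.1.2 t -> p.1.1 t = trigo.pi / 2 &
    [/\ measurable p.2, p.2 `<=` C, meas mu p.2 <= e &
      forall g, C g -> ~ p.2 g -> p.1.1 (pi g^-1%g) = 0]].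
  have [U [oU Us Ue]] := thin_slice s cC e0.
  have [f [cf fU fs]] := coset_bump (R := R) oU Us.
  exists (f, [set t | f t = trigo.pi / 2], slice C U); split=> //=; split=> //.
  - exact: slice_measurable.
  - by move=> x [].
  - by move=> g Cg nS; apply: fU => Ug; apply: nS.
have [p pP] := choice h.
have cX := coset_compact; rewrite compact_cover in cX.
have [||D _ Dcov] := cX X setT (fun s => interior (p s).1.2).
- by move=> s _; exact: open_interior.
- by move=> s _; exists s => //; have [] := pP s.
pose e' := finmap.enum_fset D; exists (size e'), (fun j => (p (tnth (in_tuple e') j)).1.1),
  (fun j => (p (tnth (in_tuple e') j)).2); split.
- by move=> j; have [] := pP (tnth (in_tuple e') j).
- move=> s; have [t tD ts] := Dcov s I; have te : t \in e' by [].
  have /tnthP[j jt] : t \in in_tuple e' by [].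
  exists j; rewrite -jt; have [_ _ hh _] := pP t; apply: hh; exact: interior_subset ts.
- by move=> j; have [_ _ _] := pP (tnth (in_tuple e') j).
Qed.

End cosets.

(** * Choosing the signs of a phase *)

Section sign_choice.
Context {R : realType} {T X : topologicalType} (p : T -> X) (I : (T -> R) -> R).
Hypothesis cp : continuous p.
Hypothesis I_linear : forall (a : R) (f g : T -> R), continuous f -> continuous g ->
  I (fun x => a * f x + g x) = a * I f + I g.
Implicit Types (Y : T -> R) (theta : X -> R).

Lemma continuous_mulr (Y Y' : T -> R) : continuous Y -> continuous Y' -> continuous (fun x => Y x * Y' x).
Proof. by move=> cY cY' x; apply: cvgM; [exact: cY|exact: cY']. Qed.

Lemma continuous_cosp (theta : X -> R) : continuous theta -> continuous (fun x => cos (theta (p x)) : R).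
Proof.
move=> ct x; apply: (@continuous_comp _ _ _ (fun x => theta (p x)) cos); last exact: continuous_cos.
by apply: (@continuous_comp _ _ _ p theta); [exact: cp|exact: ct].
Qed.

Lemma continuous_sinp (theta : X -> R) : continuous theta -> continuous (fun x => sin (theta (p x)) : R).
Proof.
move=> ct x; apply: (@continuous_comp _ _ _ (fun x => theta (p x)) sin); last exact: continuous_sin.
by apply: (@continuous_comp _ _ _ p theta); [exact: cp|exact: ct].
Qed.

(* [phase_sq Y theta] is the square modulus of the integral of [Y e^(i theta)]. *)
Definition phase_sq Y theta : R :=
  I (fun x => Y x * cos (theta (p x))) ^+ 2 + I (fun x => Y x * sin (theta (p x))) ^+ 2.

(** The parallelogram law for the integrals of Y cos(chi) e^(i theta) and i Y sin(chi) e^(i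
    theta). *)
Lemma phase_sq_parallelogram (Y : T -> R) (theta chi : X -> R) : continuous Y -> continuous theta -> continuous chi ->
  phase_sq Y (fun x => theta x + chi x) + phase_sq Y (fun x => theta x - chi x) =
  2 * (phase_sq (fun x => Y x * cos (chi (p x))) theta + phase_sq (fun x => Y x * sin (chi (p x))) theta).
Proof.
move=> cY ct cx; rewrite /phase_sq.
pose a (f g : R -> R) x := Y x * f (chi (p x)) * g (theta (p x)).
have ca f g : continuous f -> continuous g -> continuous (a f g).
  move=> cf cg; apply: continuous_mulr; first apply: continuous_mulr => // x.
    apply: (@continuous_comp _ _ _ (fun x => chi (p x)) f); last exact: cf.
    by apply: (@continuous_comp _ _ _ p chi); [exact: cp|exact: cx].
  move=> x; apply: (@continuous_comp _ _ _ (fun x => theta (p x)) g); last exact: cg.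
  by apply: (@continuous_comp _ _ _ p theta); [exact: cp|exact: ct].
have cc := @continuous_cos R; have cs := @continuous_sin R.
have E k f g f' g' h : continuous f -> continuous g -> continuous f' -> continuous g' ->
    (forall x, h x = k * a f g x + a f' g' x) -> I h = k * I (a f g) + I (a f' g').
  move=> *; rewrite -I_linear; [congr I; exact/funext|exact: ca|exact: ca].
have -> : I (fun x => Y x * cos (theta (p x) + chi (p x))) = -1 * I (a sin sin) + I (a cos cos).
  by apply: E => // x; rewrite cosD /a; ring.
have -> : I (fun x => Y x * sin (theta (p x) + chi (p x))) = 1 * I (a sin cos) + I (a cos sin).
  by apply: E => // x; rewrite sinD /a; ring.
have -> : I (fun x => Y x * cos (theta (p x) - chi (p x))) = 1 * I (a sin sin) + I (a cos cos).
  by apply: E => // x; rewrite cosB /a; ring.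
have -> : I (fun x => Y x * sin (theta (p x) - chi (p x))) = -1 * I (a sin cos) + I (a cos sin).
  by apply: E => // x; rewrite sinB /a; ring.
rewrite -/(a cos cos) -/(a cos sin) -/(a sin cos) -/(a sin sin); ring.
Qed.

Variable chi : nat -> X -> R.
Hypothesis chi_continuous : forall i, continuous (chi i).

(* The mean of [phase_sq Y theta] over [theta = +- chi 0 +- ... +- chi (n - 1)]. *)
Fixpoint averaged n Y : R := if n is n'.+1
  then averaged n' (fun x => Y x * cos (chi n' (p x))) + averaged n' (fun x => Y x * sin (chi n' (p x)))
  else I Y ^+ 2.

(** For the sum over the whole family, one of theta + chi_n and theta - chi_n does not exceed their
    mean. Summing over [j] lets a single theta serve all the [Y j]. *)
Lemma sign_choice n : forall (J : finType) (Y : J -> T -> R), (forall j, continuous (Y j)) ->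
  exists2 theta : X -> R, continuous theta & \sum_j phase_sq (Y j) theta <= \sum_j averaged n (Y j).
Proof.
elim: n => [|n IH] J Y cY.
  exists (fun=> 0); first by move=> x; exact: cst_continuous.
  apply: ler_sum => j _; rewrite /phase_sq /= le_eqVlt; apply/orP; left; apply/eqP.
  have i0 : I (fun=> 0) = 0.
    have := @I_linear (-1) (Y j) (Y j) (cY j) (cY j).
    have -> : (fun x => -1 * Y j x + Y j x) = (fun=> 0) by apply/funext => x; rewrite mulN1r addNr.
    by move=> ->; rewrite mulN1r addNr.
  have -> : (fun x => Y j x * sin 0) = (fun=> 0) by apply/funext => x; rewrite sin0 mulr0.
  have -> : (fun x => Y j x * cos 0) = Y j by apply/funext => x; rewrite cos0 mulr1.
  by rewrite i0 expr0n addr0.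
(* The family doubles at each step, because the mean over the sign of chi_n splits each Y_j into a
   cosine part and a sine part. *)
pose Z (k : J + J) := match k with
  inl j => fun x => Y j x * cos (chi n (p x)) | inr j => fun x => Y j x * sin (chi n (p x)) end.
have [|theta ct] := IH _ Z.
  by case=> j; apply: continuous_mulr => //; [exact: continuous_cosp|exact: continuous_sinp].
rewrite !big_sumType/= -!big_split/= => h.
have h2 : \sum_j phase_sq (Y j) (fun x => theta x + chi n x) +
    \sum_j phase_sq (Y j) (fun x => theta x - chi n x) <=
    2 * \sum_j (averaged n (fun x => Y j x * cos (chi n (p x))) +
                averaged n (fun x => Y j x * sin (chi n (p x)))).
  rewrite -big_split/= (le_trans _ (ler_wpM2l _ h))// mulr_sumr le_eqVlt.
  by apply/orP; left; apply/eqP/eq_bigr => j _; exact: phase_sq_parallelogram.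
have aux (a b c : R) : a + b <= 2 * c -> a <= c \/ b <= c.
  by move=> abc; have [ac|ac] := lerP a c; [left|right; lra].
case: (aux _ _ _ h2) => h3; [exists (fun x => theta x + chi n x)|exists (fun x => theta x - chi n x)] => //.
  by move=> x; apply: cvgD; [exact: ct|exact: chi_continuous].
by move=> x; apply: cvgB; [exact: ct|exact: chi_continuous].
Qed.

Fixpoint cos_prod n (x : T) : R := if n is n'.+1 then cos (chi n' (p x)) * cos_prod n' x else 1.

Lemma cos_prod_continuous n : continuous (cos_prod n).
Proof.
elim: n => [|n IH]; first by move=> x; exact: cst_continuous.
by apply: continuous_mulr => //; exact: continuous_cosp.
Qed.

Variable delta : R.
Hypothesis I_thin : forall i (Y : T -> R), continuous Y ->
  I (fun x => Y x * sin (chi i (p x))) ^+ 2 <= delta * I (fun x => (Y x * sin (chi i (p x))) ^+ 2).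

(** Each term that ends in a sine factor is bounded by [I_thin]. The resulting integrals of squares
    telescope by cos^2 + sin^2 = 1, and only the product of all cosines escapes the bound. *)
Lemma averaged_bound n : forall Y : T -> R, continuous Y -> averaged n Y <=
  delta * (I (fun x => Y x ^+ 2) - I (fun x => (Y x * cos_prod n x) ^+ 2)) + I (fun x => Y x * cos_prod n x) ^+ 2.
Proof.
elim: n => [|n IH] Y cY /=.
  have -> : (fun x => Y x * 1) = Y by apply/funext => x; rewrite mulr1.
  have -> : (fun x => (Y x * 1) ^+ 2) = (fun x => Y x ^+ 2) by apply/funext => x; rewrite mulr1.
  by rewrite subrr mulr0 add0r.
have cc := continuous_cosp (@chi_continuous n); have cs := continuous_sinp (@chi_continuous n).
have h1 := IH _ (continuous_mulr cY cc); have h2 := IH _ (continuous_mulr cY cs).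
have h3 := @I_thin n (fun x => Y x * cos_prod n x) (continuous_mulr cY (@cos_prod_continuous n)).
have e1 : (fun x => Y x * (cos (chi n (p x)) * cos_prod n x)) = (fun x => Y x * cos (chi n (p x)) * cos_prod n x).
  by apply/funext => x; rewrite mulrA.
have e2 : (fun x => (Y x * (cos (chi n (p x)) * cos_prod n x)) ^+ 2) =
    (fun x => (Y x * cos (chi n (p x)) * cos_prod n x) ^+ 2).
  by apply/funext => x; rewrite mulrA.
have e3 : (fun x => Y x * cos_prod n x * sin (chi n (p x))) = (fun x => Y x * sin (chi n (p x)) * cos_prod n x).
  by apply/funext => x; rewrite mulrAC.
have e4 : (fun x => (Y x * cos_prod n x * sin (chi n (p x))) ^+ 2) =
    (fun x => (Y x * sin (chi n (p x)) * cos_prod n x) ^+ 2).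
  by apply/funext => x; rewrite mulrAC.
have csq (f : T -> R) : continuous f -> continuous (fun x => f x ^+ 2).
  by move=> cf; apply: continuous_mulr.
have e5 : I (fun x => Y x ^+ 2) = I (fun x => (Y x * cos (chi n (p x))) ^+ 2) +
    I (fun x => (Y x * sin (chi n (p x))) ^+ 2).
  rewrite -[X in X + _]mul1r -I_linear; try by apply: csq; exact: continuous_mulr.
  by congr I; apply/funext => x; rewrite !exprMn mul1r -mulrDr cos2Dsin2 mulr1.
rewrite e1 e2 e5; rewrite e3 e4 in h3.
set a := I _ in h1 *; set b := I _ in h1 *; set c := I _ in h1 *; set d := I _ in h2 *.
set f := I _ in h2 h3 *; set g := I _ in h2 h3.
move: (averaged _ _) (averaged _ _) (c ^+ 2) (g ^+ 2) h1 h2 h3 => u v c' g' h1 h2 h3.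
have -> : delta * (a + d - b) + c' = (delta * (a - b) + c') + (delta * (d - f) + delta * f) by ring.
by rewrite lerD// (le_trans h2)// lerD2l.
Qed.

End sign_choice.

(** * Oscillating phases *)

Section oscillation.
Context {R : realType} {G : topGroupType} (mu : {measure set (borel G) -> \bar R}) (H : subgroup G).
Hypothesis lcG : locally_compact_group G.
Hypothesis haar : left_haar mu.
Hypothesis Hclosed : closed (H : set G).
Hypothesis Hcoc : cocompact H.
Hypothesis Hnopen : ~ open (H : set G).
Local Notation Cn := (@complex_cnorm R).
Local Notation X := (coset_space H).
Implicit Types (C K : set G) (f w : G -> R).

Definition real_integral C f : R :=
  xget 0 [set r : R | has_integral mu Cn (C : set (borel G)) (fun x => (f x)%:c) (r%:c : R[i]^o)].

Section compact_domain.
Variable C : set G.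
Hypothesis cC : compact C.
Let fC := compact_finite_meas lcG haar cC.
Local Notation I := (real_integral C).

Lemma real_integralP f : continuous f ->
  has_integral mu Cn (C : set (borel G)) (fun x => (f x)%:c) ((I f)%:c : R[i]^o).
Proof.
move=> cf; have [v hv] := has_integral_ex lcG haar cC (cn_continuous_real cf).
have ex : exists r : R, [set r : R | has_integral mu Cn (C : set (borel G)) (fun x => (f x)%:c)
    (r%:c : R[i]^o)] r by exists (complex.Re v) => /=; rewrite -(real_has_integral fC hv).
exact: (xgetPex 0 ex).
Qed.

Lemma real_integral_eq f r : continuous f ->
  has_integral mu Cn (C : set (borel G)) (fun x => (f x)%:c) (r%:c : R[i]^o) -> I f = r.
Proof. by move=> cf h; apply: (@complexI R); exact: has_integral_uniq fC (real_integralP cf) h. Qed.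

Lemma real_complexL (a r s : R) : (a * r + s)%:c = a%:c *: (r%:c : R[i]^o) + s%:c :> R[i]^o.
Proof. by rewrite [LHS]rmorphD (rmorphM (real_complex R)). Qed.

Lemma real_integral_linear (a : R) f g : continuous f -> continuous g ->
  I (fun x => a * f x + g x) = a * I f + I g.
Proof.
move=> cf cg; apply: real_integral_eq.
  by move=> x; apply: cvgD; [apply: cvgM; [exact: cvg_cst|exact: cf]|exact: cg].
have e1 := real_complexL a.
have := has_integral_linear a%:c fC (real_integralP cf) (real_integralP cg).
by rewrite e1; apply: eq_has_integral => x _; rewrite e1.
Qed.

Lemma real_integral_bound f c : continuous f -> (forall x, C x -> `|f x| <= c) -> `|I f| <= c * meas mu C.
Proof.
move=> cf fc; rewrite -cabs_real; apply: (has_integral_bound fC (real_integralP cf)) => x Cx.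
by rewrite -[Cn _]/(cabs _) cabs_real fc.
Qed.

(** The Cauchy-Schwarz inequality for f supported in S, obtained by integrating 2 l f <= l^2 1_S +
    f^2 with l the integral of f divided by delta. *)
Lemma real_integral_thin f (S : set (borel G)) (delta : R) : continuous f -> 0 < delta ->
  measurable S -> S `<=` C -> meas mu S <= delta -> (forall x, C x -> ~ S x -> f x = 0) ->
  I f ^+ 2 <= delta * I (fun x => f x ^+ 2).
Proof.
move=> cf d0 mS SC Sd f0; have fS := finite_measS fC mS SC.
pose ind (x : G) : R := if pselect (S x) then 1 else 0.
have iS : has_integral mu Cn (C : set (borel G)) (fun x => (ind x)%:c) ((meas mu S)%:c : R[i]^o).
  have iS1 : has_integral mu Cn S (fun x => (ind x)%:c) ((meas mu S)%:c : R[i]^o).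
    have := has_integral_cst Cn (1 : R[i]^o) fS; rewrite -[_ *: _]/(_ * _) mulr1.
    by apply: eq_has_integral => x Sx; rewrite /ind; case: pselect.
  by apply: (has_integral_extend fS fC SC _ iS1) => x nS; rewrite /ind; case: pselect.
have cf2 : continuous (fun x => f x ^+ 2) by exact: continuous_mulr.
set m := I f; pose l := m / delta.
have h1 := has_integral_linear (l ^+ 2)%:c fC iS (real_integralP cf2).
have h2 := has_integralZ (2 * l)%:c (real_integralP cf).
have := @has_integral_dominated _ _ R mu _ Cn (C : set (borel G)) _ _
  (fun x => l ^+ 2 * ind x + f x ^+ 2) _ fC h2.
move=> /(_ ((l ^+ 2)%:c *: ((meas mu S)%:c : R[i]^o) + (I (fun x => f x ^+ 2))%:c)) h3.
have h4 : has_integral mu Cn (C : set (borel G)) (fun x => (l ^+ 2 * ind x + f x ^+ 2)%:c)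
    ((l ^+ 2)%:c *: ((meas mu S)%:c : R[i]^o) + (I (fun x => f x ^+ 2))%:c).
  apply: eq_has_integral h1 => x _.
  by rewrite real_complexL.
have h5 x : C x -> Cn ((2 * l)%:c *: ((f x)%:c : R[i]^o)) <= l ^+ 2 * ind x + f x ^+ 2.
  move=> Cx; rewrite -[_ *: _]/((2 * l)%:c * (f x)%:c) -(rmorphM (real_complex R)).
  rewrite -[Cn _]/(cabs _) cabs_real /ind; case: pselect => Sx.
    rewrite mulr1 ler_norml; apply/andP; split.
      by have := sqr_ge0 (l + f x); rewrite sqrrD => h; lra.
    by have := sqr_ge0 (l - f x); rewrite sqrrB => h; lra.
  by rewrite (f0 _ Cx Sx) !mulr0 normr0 expr0n addr0.
have := h3 h4 h5; rewrite -![_ *: _]/(_ * _) -!(rmorphM (real_complex R)) -rmorphD -[Cn _]/(cabs _) cabs_real /= => h.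
have h6 := le_trans (ler_norm _) h.
have h7 : l ^+ 2 * meas mu S <= l ^+ 2 * delta by rewrite ler_wpM2l// sqr_ge0.
have e1 : l * delta = m by rewrite /l divfK// gt_eqF.
have e2 : m ^+ 2 = delta * (2 * l * m - l ^+ 2 * delta) by rewrite -e1; ring.
by rewrite e2 ler_wpM2l ?(ltW d0)// lerBlDr (le_trans h6)// addrC lerD2l.
Qed.

Lemma riemann_sum f (J : finType) (E : J -> set (borel G)) (t : J -> G) (c : R) : continuous f ->
  0 <= c ->
  finite_partition (C : set (borel G)) E -> (forall j x, E j x -> `|f x - f (t j)| <= c) ->
  `|I f - \sum_j meas mu (E j) * f (t j)| <= c * meas mu C.
Proof.
move=> cf c0 pE Ec; apply: (@le_eps R _ _ (1 + meas mu C)) => e e0.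
have [J' [E' [F' [pE' EF' h]]]] := real_integralP cf e0.
have EF j x : E j x -> Cn ((f x)%:c - (f (t j))%:c) <= c.
  by move=> Ejx; rewrite -rmorphB -[Cn _]/(cabs _) cabs_real; exact: Ec.
have h2 := simple_integral_close fC pE' pE EF' EF.
have sE : simple_integral mu E (fun j => (f (t j))%:c : R[i]^o) = (\sum_j meas mu (E j) * f (t j))%:c.
  rewrite [RHS](rmorph_sum (real_complex R)); apply: eq_bigr => j _.
  by rewrite [RHS](rmorphM (real_complex R)).
rewrite sE in h2; rewrite -cabs_real rmorphB -[cabs _]/(Cn _).
rewrite -(subrKA (simple_integral mu E' F')) (le_trans (cnD _ _ _))//.
rewrite (le_trans (lerD h h2))//; lra.
Qed.

End compact_domain.

Lemma tube (F : G -> G -> R) C (k : G) (e : R) : compact C -> continuous (fun q : G * G => F q.1 q.2) ->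
  0 < e -> \forall k' \near k, forall x, C x -> `|F k' x - F k x| <= e.
Proof.
move=> cC cF e0; have e2 : 0 < e / 2 by rewrite divr_gt0.
apply: (@compact_near G G (nbhs k) (fun k' x => `|F k' x - F k x| <= e) C _ cC) => x _.
have /cvgrPdist_le/(_ _ e2)[[P Q] /= [Pk Qx] PQ] := cF (k, x).
exists (Q, P) => // -[x' k'] /= [Qx' Pk'].
have h1 := PQ (k', x') (conj Pk' Qx'); have h2 := PQ (k, x') (conj (nbhs_singleton Pk) Qx').
rewrite /= in h1 h2.
have -> : F k' x' - F k x' = (F k x - F k x') - (F k x - F k' x') by ring.
by rewrite (le_trans (ler_normB _ _))//; lra.
Qed.

Local Notation p := (fun x : G => coset_proj H x^-1%g).

Lemma inv_proj_continuous : continuous p.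
Proof.
move=> x; apply: (@continuous_comp _ _ _ (fun x : G => x^-1%g) (coset_proj H)).
  exact: invg_continuous.
exact: coset_proj_continuous.
Qed.

(** Every coset lies on a plateau, so the product of all cosines vanishes and the mean over all
    signs is at most e / (B + 1) times the integrals of the Y_j^2, whose sum is B. *)
Lemma phases_ex C (J : finType) (Y : J -> G -> R) (e : R) : compact C ->
  (forall j, continuous (Y j)) -> 0 < e -> exists2 theta : X -> R, continuous theta &
    forall j, phase_sq p (real_integral C) (Y j) theta <= e.
Proof.
move=> cC cY e0; set I := real_integral C.
have csq j : continuous (fun x => Y j x ^+ 2) by exact: continuous_mulr.
have I0 : I (fun=> 0) = 0.
  have c0 : continuous (fun _ : G => 0 : R) by move=> x; exact: cst_continuous.
  have := real_integral_linear cC (-1) c0 c0.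
  have -> : (fun x : G => -1 * 0 + 0 : R) = (fun=> 0) by apply/funext => x; rewrite mulr0 addr0.
  by rewrite -/I => ->; rewrite mulN1r addNr.
have Isq j : 0 <= I (fun x => Y j x ^+ 2).
  have := @real_integral_thin C cC (Y j) (C : set (borel G)) (meas mu C + 1) (cY j).
  have m1 : 0 < meas mu C + 1 by rewrite ltr_wpDl// meas_ge0.
  have [mC _] := compact_finite_meas lcG haar cC.
  move=> /(_ m1 mC (fun _ h => h) _ (fun _ a b => False_ind _ (b a))); rewrite lerDl ler01 => /(_ isT) h.
  by have := le_trans (sqr_ge0 _) h; rewrite pmulr_rge0.
set B := \sum_j I (fun x => Y j x ^+ 2); have B0 : 0 <= B by exact: sumr_ge0.
have B1 : 0 < B + 1 by rewrite ltr_wpDl.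
have d0 : 0 < e / (B + 1) by rewrite divr_gt0.
have [n [chi [S [cchi chis SP]]]] := thin_cover lcG Hclosed Hcoc Hnopen haar cC d0.
pose chi' i : X -> R := if insub i is Some j then chi j else fun=> 0.
have cchi' i : continuous (chi' i).
  by rewrite /chi'; case: insubP => [j _ _|_]; [exact: cchi|move=> x; exact: cst_continuous].
have lin := real_integral_linear cC; have cp := inv_proj_continuous.
have thin i (Z : G -> R) : continuous Z ->
    I (fun x => Z x * sin (chi' i (p x))) ^+ 2 <= e / (B + 1) * I (fun x => (Z x * sin (chi' i (p x))) ^+ 2).
  move=> cZ; have cs := continuous_mulr cZ (continuous_sinp cp (cchi' i)).
  have : exists S' : set (borel G), [/\ measurable S', S' `<=` C, meas mu S' <= e / (B + 1) &
      forall x, C x -> ~ S' x -> Z x * sin (chi' i (p x)) = 0].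
    rewrite /chi'; case: insubP => [j _ _|_].
      have [mS SC Se S0] := SP j; exists (S j); split=> // x Cx nS.
      by rewrite S0// sin0 mulr0.
    exists set0; split=> // [|x _ _]; first by rewrite meas0 ltW.
    by rewrite sin0 mulr0.
  by move=> [S' [mS SC Se S0]]; exact: (real_integral_thin cC cs d0 mS SC Se S0).
have [theta ct h] := sign_choice cp lin cchi' n cY; exists theta => // j.
have cos0 x : cos_prod p chi' n x = 0.
  have [i hi] := chis (p x); have ci : cos (chi' i (p x)) = 0.
    by rewrite /chi' valK hi cos_pihalf.
  have aux m : (i < m)%N -> cos_prod p chi' m x = 0.
    elim: m => // m IH; rewrite ltnS leq_eqVlt /= => /orP[/eqP<-|/IH->]; last by rewrite mulr0.
    by rewrite ci mul0r.
  by apply: aux; exact: ltn_ord.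
have avg k : averaged p I chi' n (Y k) <= e / (B + 1) * I (fun x => Y k x ^+ 2).
  have := averaged_bound cp lin cchi' thin n (cY k).
  have -> : (fun x => (Y k x * cos_prod p chi' n x) ^+ 2) = (fun=> 0).
    by apply/funext => x; rewrite cos0 mulr0 expr0n.
  have -> : (fun x => Y k x * cos_prod p chi' n x) = (fun=> 0).
    by apply/funext => x; rewrite cos0 mulr0.
  by rewrite -/I I0 subr0 expr0n addr0.
have h2 := le_trans h (ler_sum _ (fun k _ => avg k)).
have : phase_sq p I (Y j) theta <= \sum_k phase_sq p I (Y k) theta.
  rewrite (bigD1 j)//= lerDl; apply: sumr_ge0 => k _.
  by rewrite /phase_sq addr_ge0// sqr_ge0.
move=> /le_trans/(_ h2)/le_trans; apply; rewrite -mulr_sumr -/B mulrAC ler_pdivrMr//.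
by rewrite ler_wpM2l ?(ltW e0)// lerDl.
Qed.

(** With s = k H and k in a compact set of representatives, the average over x of e^(i theta) at
    x^-1 k H becomes, with k x for x, an integral of the fixed phase against the weight w(k x).
    Phases are thus needed for a family of weights, and a Riemann sum turns the average into a
    convex combination. *)
Lemma oscillation (V : set G) (e : R) : nbhs (1 : G)%g V -> 0 < e ->
  exists (theta : X -> R) (n : nat) (c : 'I_n -> R) (g : 'I_n -> G),
    [/\ continuous theta, forall b, 0 <= c b /\ V (g b), \sum_b c b = 1 &
      forall s, `|\sum_b c b * cos (theta (coset_translate (g b)^-1%g s))| <= e /\
                `|\sum_b c b * sin (theta (coset_translate (g b)^-1%g s))| <= e].
Proof.
(* e <= 1 keeps the Riemann sum [S] of the weights above 1/2, so that dividing by it is harmless. *)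
move=> nV; wlog e1 : e / e <= 1.
  move=> hw e0; have [||theta [n [c [g [ct cg c1 h]]]]] := hw (Num.min e 1).
  - by rewrite ge_min lexx orbT.
  - by rewrite lt_min e0 ltr01.
  exists theta, n, c, g; split=> // s; have [h1 h2] := h s.
  by split; [apply: le_trans h1 _|apply: le_trans h2 _]; rewrite ge_min lexx.
move=> e0; have [w [K [[cw cK] w0 wV wK iw]]] := bump (R := R) lcG haar nV.
have [K0 cK0 K0X] := coset_rep_compact Hcoc.
set C := [set (q.1 * q.2)%g | q in [set (x^-1)%g | x in K0] `*` K].
have cC : compact C by apply: compact_mul => //; exact: compact_inv.
set I := real_integral C; set mC := meas mu C + 1; set mK := meas mu K + 1.
have mC0 : 0 < mC by rewrite ltr_wpDl// meas_ge0.
have mK0 : 0 < mK by rewrite ltr_wpDl// meas_ge0.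
have e8 : 0 < e / 8 by rewrite divr_gt0.
have cwm : continuous (fun q : G * G => w (q.1 * q.2)%g).
  by move=> q; apply: continuous_comp; [exact: mulg_continuous|exact: cw].
(* Up to small errors on [C], compactness leaves finitely many of the weights w(k x). *)
pose U k := interior [set k' | forall x, C x -> `|w (k' * x)%g - w (k * x)%g| <= e / 8 / mC].
have [k _|n1 [t1 [E1 [pE1 t1P]]]] := @fine_partition G lcG K0 U cK0.
  split; first exact: open_interior.
  by apply: (tube (F := fun k x => w (k * x)%g)) => //; rewrite divr_gt0.
have cY (k : G) : continuous (fun x => w (k * x)%g).
  by move=> x; apply: continuous_comp; [exact: mulg_continuousl|exact: cw].
have e82 : 0 < (e / 8) ^+ 2 by rewrite exprn_gt0.
have [theta ct tP] := phases_ex cC (fun a => cY (t1 a)) e82.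
have cp := inv_proj_continuous.
have osc (tr : R -> R) k : continuous tr -> (forall x, `|tr x| <= 1) ->
    (forall a, `|I (fun x => w (t1 a * x)%g * tr (theta (p x)))| <= e / 8) -> K0 k ->
    `|I (fun x => w (k * x)%g * tr (theta (p x)))| <= e / 4.
  move=> ctr tr1 trP K0k; have [_ _ /(_ k)[/(_ K0k)[a Ea] _]] := pE1.
  have [_ /(_ _ Ea)/interior_subset h] := t1P a.
  have ctt : continuous (fun x => tr (theta (p x))).
    move=> x; apply: (@continuous_comp _ _ _ (fun x => theta (p x)) tr); last exact: ctr.
    by apply: (@continuous_comp _ _ _ p theta); [exact: cp|exact: ct].
  have ck := continuous_mulr (cY k) ctt; have ca := continuous_mulr (cY (t1 a)) ctt.
  have := real_integral_linear cC (-1) ca ck; rewrite -/I mulN1r.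
  set J := (I _ in LHS); move=> JE; have {}JE : I (fun x => w (k * x)%g * tr (theta (p x))) =
    J + I (fun x => w (t1 a * x)%g * tr (theta (p x))) by rewrite JE; ring.
  have hJ : `|J| <= e / 8 / mC * meas mu C.
    apply: real_integral_bound => // [|x Cx].
      move=> x; apply: cvgD; last exact: ck.
      by apply: cvgM; [exact: cvg_cst|exact: ca].
    rewrite mulN1r -mulNr -mulrDl normrM -[leRHS]mulr1 ler_pM// addrC.
    exact: h.
  have hJ2 : `|J| <= e / 8.
    by rewrite (le_trans hJ)// mulrAC ler_pdivrMr// ler_wpM2l ?(ltW e8)// lerDl.
  rewrite JE (le_trans (ler_normD _ _))// (le_trans (lerD hJ2 (trP a)))//; lra.
have sq_le (a b c : R) : 0 <= c -> a ^+ 2 + b ^+ 2 <= c ^+ 2 -> `|a| <= c /\ `|b| <= c.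
  have one x : 0 <= c -> x ^+ 2 <= c ^+ 2 -> `|x| <= c.
    by move=> c0 h; rewrite -sqrtr_sqr -[leRHS](ger0_norm c0) -[leRHS]sqrtr_sqr ler_wsqrtr.
  move=> c0 h; split; apply: one => //; apply: le_trans h; first by rewrite lerDl sqr_ge0.
  by rewrite lerDr sqr_ge0.
have cs1 x : `|cos x : R| <= 1 by rewrite ler_norml cos_geN1 cos_le1.
have sn1 x : `|sin x : R| <= 1 by rewrite ler_norml sin_geN1 sin_le1.
have oscc k (Kk : K0 k) := osc cos k (@continuous_cos R) cs1 (fun a => (sq_le _ _ _ (ltW e8) (tP a)).1) Kk.
have oscs k (Kk : K0 k) := osc sin k (@continuous_sin R) sn1 (fun a => (sq_le _ _ _ (ltW e8) (tP a)).2) Kk.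
pose F (tr : R -> R) x k := w x * tr (theta (coset_proj H (x^-1 * k)%g)).
have cF (tr : R -> R) : continuous tr -> continuous (fun q : G * G => F tr q.1 q.2).
  move=> ctr; apply: continuous_mulr.
    by move=> q; apply: (@continuous_comp _ _ _ fst w); [exact: cvg_fst|exact: cw].
  move=> q; apply: (@continuous_comp _ _ _ (fun q : G * G => coset_proj H (q.1^-1 * q.2)%g)
    (fun s => tr (theta s))).
    apply: (@continuous_comp _ _ _ (fun q : G * G => (q.1^-1 * q.2)%g) (coset_proj H)).
      apply: (@mulg_continuous2 G _ (fun p => p.1^-1%g) snd) => r; last exact: cvg_snd.
      by apply: (@invg_continuous2 G _ fst) => z; exact: cvg_fst.
    exact: coset_proj_continuous.
  by apply: (@continuous_comp _ _ _ theta tr); [exact: ct|exact: ctr].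
have cFk (tr : R -> R) k : continuous tr -> continuous (fun x => F tr x k).
  move=> ctr x; apply: (@continuous_comp _ _ _ (fun x : G => (x, k)) (fun q : G * G => F tr q.1 q.2)).
    by apply: cvg_pair; [exact: cvg_id|exact: cvg_cst].
  exact: cF.
have e8K : 0 < e / 8 / mK by rewrite divr_gt0.
pose U2 x0 := interior [set x | [/\ forall k, K0 k -> `|F cos x k - F cos x0 k| <= e / 8 / mK,
  forall k, K0 k -> `|F sin x k - F sin x0 k| <= e / 8 / mK & `|w x - w x0| <= e / 8 / mK]].
have [x _|n [t [E [pE tE]]]] := @fine_partition G lcG K U2 cK.
  split; first exact: open_interior.
  have h1 := tube x cK0 (cF _ (@continuous_cos R)) e8K.
  have h2 := tube x cK0 (cF _ (@continuous_sin R)) e8K.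
  have h3 : \forall x' \near x, `|w x' - w x| <= e / 8 / mK.
    by have /cvgrPdist_le/(_ _ e8K) := cw x; apply: filterS => z; rewrite distrC.
  by apply: filterS3 h1 h2 h3 => z ? ? ?; split.
have EP j x : E j x -> [/\ forall k, K0 k -> `|F cos x k - F cos (t j) k| <= e / 8 / mK,
  forall k, K0 k -> `|F sin x k - F sin (t j) k| <= e / 8 / mK & `|w x - w (t j)| <= e / 8 / mK].
  by move=> /(tE j).2/interior_subset.
have K1 : e / 8 / mK * meas mu K <= e / 8.
  by rewrite mulrAC ler_pdivrMr// ler_wpM2l ?(ltW e8)// lerDl.
set S := \sum_j meas mu (E j) * w (t j).
have S1 : `|1 - S| <= e / 8.
  have := riemann_sum cK cw (ltW e8K) pE (fun j x Ex => let: And3 _ _ h := EP j x Ex in h).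
  rewrite (real_integral_eq cK cw iw) => h; exact: le_trans h K1.
have S2 : 1 / 2 <= S by move: S1; rewrite ler_norml => /andP[_]; lra.
have S0 : 0 < S by lra.
have hK (tr : R -> R) k : continuous tr -> K0 k ->
    `|I (fun x => w (k * x)%g * tr (theta (p x)))| <= e / 4 ->
    (forall j x, E j x -> `|F tr x k - F tr (t j) k| <= e / 8 / mK) ->
    `|\sum_j meas mu (E j) / S * F tr (t j) k| <= e.
  move=> ctr K0k Ie Ek; have ck := cFk tr k ctr.
  have IE : I (fun x => w (k * x)%g * tr (theta (p x))) = real_integral K (fun x => F tr x k).
    have cG : continuous (fun x => F tr (k * x)%g k).
      move=> x; apply: (@continuous_comp _ _ _ (fun x => (k * x)%g) (fun x => F tr x k)); last exact: ck.
      exact: mulg_continuousl.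
    have -> : (fun x => w (k * x)%g * tr (theta (p x))) = (fun x => F tr (k * x)%g k).
      by apply/funext => x; rewrite /F invgM -mulgA mulVg mulg1.
    apply: real_integral_eq => //.
    have h := has_integral_left_translate (mu := mu) haar k^-1%g (real_integralP cK ck).
    have cK' := @compact_lmul G k^-1%g K cK.
    have fK' := compact_finite_meas lcG haar cK'; have fC := compact_finite_meas lcG haar cC.
    have KC : [set (k^-1 * x)%g | x in K] `<=` C.
      by move=> _ [x Kx <-]; exists (k^-1%g, x) => //=; split=> //; exists k.
    have := has_integral_extend (N := Cn) fK' fC KC _ h; rewrite invgK; apply=> x nK.
    rewrite /F wK ?mul0r// => Kx; apply: nK; exists (k * x)%g => //; exact: mulKg.
  rewrite IE in Ie; have h := le_trans (riemann_sum cK ck (ltW e8K) pE Ek) K1.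
  have -> : \sum_j meas mu (E j) / S * F tr (t j) k = (\sum_j meas mu (E j) * F tr (t j) k) / S.
    by rewrite mulr_suml; apply: eq_bigr => j _; rewrite mulrAC.
  rewrite normrM normfV (gtr0_norm S0) ler_pdivrMr//.
  set a := \sum_j _ in h *; set b := real_integral _ _ in Ie h.
  have -> : a = b - (b - a) by ring.
  rewrite (le_trans (ler_normB _ _))// (le_trans (lerD Ie h))//.
  have : e * (1 / 2) <= e * S by rewrite ler_wpM2l ?(ltW e0).
  lra.
(* Sample points of weight 0 may lie outside [V] and are replaced by 1. *)
exists theta, n, (fun j => meas mu (E j) * w (t j) / S), (fun j => if w (t j) == 0 then 1%g else t j).
split=> //.
- move=> j; split; first by rewrite divr_ge0 ?(ltW S0)// mulr_ge0 ?meas_ge0.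
  have [_|wt] := eqVneq (w (t j)) 0; first exact: nbhs_singleton nV.
  by apply: contrapT => /wV h; rewrite h eqxx in wt.
- by rewrite -mulr_suml divff// gt_eqF.
- move=> s; have [k K0k ->] := K0X s.
  have E2 (tr : R -> R) : \sum_b meas mu (E b) * w (t b) / S *
      tr (theta (coset_translate (if w (t b) == 0 then 1%g else t b)^-1%g (coset_proj H k))) =
      \sum_b meas mu (E b) / S * F tr (t b) k.
    apply: eq_bigr => b _; rewrite /F; have [->|_] := eqVneq (w (t b)) 0.
      by rewrite !(mulr0, mul0r).
    by rewrite coset_translateE; ring.
  rewrite (E2 cos) (E2 sin); split; apply: hK => //.
  + exact: continuous_cos.
  + exact: oscc.
  + by move=> j x /EP[h _ _]; exact: h.
  + exact: continuous_sin.
  + exact: oscs.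
  + by move=> j x /EP[_ h _]; exact: h.
Qed.

End oscillation.

(** * Sequences representing Rokhlin maps *)

Section near_commuting_family.
Context {R : realType} {E : starAlgType R}.
Variables (n : nat) (P : 'I_n -> E) (om : R[i]).
Hypothesis om1 : conjC om * om = 1.
Hypothesis P_sa : forall i, star (P i) = P i.
Hypothesis P_far : forall i j : 'I_n, (i.+1 < j)%N || (j.+1 < i)%N -> P i ** P j = 0.

Definition mod_coef (c i : nat) : R[i] := (i %% 3 == c %% 3)%N%:R.
Definition mod_part c := \sum_(i < n) mod_coef c i *: P i.

(* Distinct P_i and P_j with nonzero product have adjacent indices, which the
   residues mod 3 tell apart. *)
Lemma twisted_sum_sq : let S := \sum_(i < n) om ^+ i *: P i in let h := \sum_(i < n) P i in
  star S ** S - h ** h =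
  (om - 1) *: (\sum_(c < 3) mod_part c ** mod_part c.+1) +
  (conjC om - 1) *: (\sum_(c < 3) mod_part c.+1 ** mod_part c).
Proof.
have dbl (a b : nat -> R[i]) : (\sum_(i < n) a i *: P i) ** (\sum_(i < n) b i *: P i) =
    \sum_(i < n) \sum_(j < n) (a i * b j) *: (P i ** P j).
  rewrite smul_suml; apply: eq_bigr => i _; rewrite smul_sumr; apply: eq_bigr => j _.
  by rewrite smulZl smulZr scalerA.
move=> S h; have -> : star S = \sum_(i < n) (conjC om) ^+ i *: P i.
  by rewrite star_sum; apply: eq_bigr => i _; rewrite starZ P_sa rmorphXn.
have -> : h = \sum_(i < n) 1 *: P i by apply: eq_bigr => i _; rewrite scale1r.
rewrite (dbl (fun i => conjC om ^+ i) (fun i => om ^+ i)) (dbl (fun=> 1) (fun=> 1)) -sumrB.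
rewrite (eq_bigr _ (fun (c : 'I_3) _ => dbl (mod_coef c) (mod_coef c.+1))).
rewrite [X in _ = _ + _ *: X](eq_bigr (fun c : 'I_3 => \sum_(i < n) \sum_(j < n) (mod_coef c.+1 i * mod_coef c j) *: (P i ** P j)));
  last by move=> c _; exact: (dbl (mod_coef c.+1) (mod_coef c)).
rewrite [X in _ *: X + _]exchange_big [X in _ + _ *: X]exchange_big !scaler_sumr -big_split/=.
apply: eq_bigr => i _; rewrite -sumrB.
rewrite [X in _ *: X + _]exchange_big [X in _ + _ *: X]exchange_big !scaler_sumr -big_split/=.
apply: eq_bigr => j _; rewrite -!scaler_suml !scalerA -scalerDl -scalerBl.
case: (boolP ((i.+1 < j)%N || (j.+1 < i)%N)) => [/P_far->|]; first by rewrite !scaler0.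
move=> ij; congr (_ *: _).
have m3 c k l : mod_coef c k * mod_coef c.+1 l = ((k %% 3 == c %% 3) && (l %% 3 == c.+1 %% 3))%N%:R.
  by rewrite /mod_coef -natrM mulnb.
rewrite (eq_bigr _ (fun (c : 'I_3) _ => m3 c i j)).
rewrite [X in _ = _ + _ * X](eq_bigr (fun c : 'I_3 => ((j %% 3 == c %% 3) && (i %% 3 == c.+1 %% 3))%N%:R)); last first.
  by move=> c _; rewrite mulrC m3.
have omX k : conjC om ^+ k * om ^+ k = 1 by rewrite -exprMn om1 expr1n.
(* For adjacent indices the three residue classes count the pair once in the sum belonging to the
   sign of j - i and not at all in the other; equal indices are not counted. *)
have : [\/ j = i :> nat, j = i.+1 :> nat | i = j.+1 :> nat].
  by move: ij; rewrite negb_or -!leqNgt => /andP[h1 h2]; have : (j <= i.+1)%N by []; case: (ltngtP i j) => h3 _;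
    [constructor 2|constructor 3|constructor 1]; lia.
have sum3 (b : nat -> bool) : \sum_(c < 3) (b c)%:R = (b 0 + b 1 + b 2)%:R :> R[i].
  by rewrite !big_ord_recr big_ord0 /= add0r -!natrD.
rewrite (sum3 (fun c => (i %% 3 == c %% 3) && (j %% 3 == c.+1 %% 3))%N).
rewrite (sum3 (fun c => (j %% 3 == c %% 3) && (i %% 3 == c.+1 %% 3))%N).
have same k l : k = l -> ((k %% 3 == 0 %% 3) && (l %% 3 == 1 %% 3) + (k %% 3 == 1 %% 3) && (l %% 3 == 2 %% 3) +
    (k %% 3 == 2 %% 3) && (l %% 3 == 3 %% 3))%N = 0%N by move=> <-; lia.
have next k l : l = k.+1 -> ((k %% 3 == 0 %% 3) && (l %% 3 == 1 %% 3) + (k %% 3 == 1 %% 3) && (l %% 3 == 2 %% 3) +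
    (k %% 3 == 2 %% 3) && (l %% 3 == 3 %% 3))%N = 1%N by move=> ->; lia.
have prev k l : k = l.+1 -> ((k %% 3 == 0 %% 3) && (l %% 3 == 1 %% 3) + (k %% 3 == 1 %% 3) && (l %% 3 == 2 %% 3) +
    (k %% 3 == 2 %% 3) && (l %% 3 == 3 %% 3))%N = 0%N by move=> ->; lia.
case=> ji.
- by rewrite same// (same j)// ji omX mul1r subrr !mulr0 addr0.
- by rewrite next// (prev j)// ji exprSr mulrA omX !mul1r !mulr1 mulr0 addr0.
- by rewrite prev// (next j)// ji exprS -mulrA omX !mulr1 mulr0 add0r.
Qed.

End near_commuting_family.

Lemma quot_norm_ge0 {R : realType} {E : starAlgType R} (J : starIdeal E) (p : E -> R) x :
  (forall a, 0 <= p a) -> 0 <= quot_norm (J := J) p x.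
Proof.
move=> p0; apply: lb_le_inf; last by move=> _ [a _ <-].
by have [a ->] := quot_projP x; exists (p a), a.
Qed.

Lemma quot_norm_approx {R : realType} {E : starAlgType R} (J : starIdeal E) (p : E -> R) x e :
  (forall a, 0 <= p a) -> 0 < e -> exists a, x = quot_proj J a /\ p a <= quot_norm p x + e.
Proof.
move=> p0 e0; have hi : has_inf (p @` [set a | quot_proj J a = x]).
  split; first by have [a ->] := quot_projP x; exists (p a), a.
  by exists 0 => _ [a _ <-].
by have [_ [a ax <-] /ltW h] := inf_adherent e0 hi; exists a.
Qed.

(** * Representing sequences of central sequences *)

Section representatives.
Context {R : realType} {G : topGroupType} {A : cstarAlgType R} (alpha : action G A).
Variable D : starSub A.
Hypothesis DT : forall a, (D : set A) a.
Hypothesis Dinv : action_invariant alpha D.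
Local Notation NA := (@cstar_cnorm R A).
Implicit Types (q : central_quot D) (a b : nat -> A).

(** A lift through both quotients, modulo the annihilator and modulo null sequences, so that later
    estimates concern plain sequences in [A]. *)
Definition represents q a := exists (s : subalg (commutant D)) (z : linf A),
  [/\ q = quot_proj (annihilator D) s, val s = quot_proj (null_seqs A) z & val z = a].

Lemma linf_norm_le (z : linf A) n : rnorm (val z n) <= linf_norm z.
Proof.
apply: ub_le_sup; last by exists n.
have [M zM] := linf_bounded z; exists (complex.Re M) => _ [m _ <-].
by move: (zM m); rewrite rnormE lecE => /andP[].
Qed.

Lemma null_seqsP (z : linf A) : (null_seqs A : set _) z <-> tends NA (val z) 0.
Proof.
split=> [|h].
  move=> /cvgr0Pnorm_le h e e0; have [|n _ hn] := h e%:c; first by rewrite ltcR.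
  by exists n => m nm; rewrite subr0 -[NA _]/(rnorm _) -le_rnorm; exact: hn.
apply/cvgr0Pnorm_le => e /pos_complex[-> e0]; have [n hn] := h _ e0; exists n => // m /= nm.
by have := hn m nm; rewrite subr0 -[NA _]/(rnorm _) -le_rnorm.
Qed.

Lemma represents_bounded q a : represents q a -> exists M : R, forall n, rnorm (a n) <= M.
Proof. by move=> [s [z [_ _ <-]]]; exists (linf_norm z); exact: linf_norm_le. Qed.

(** Equality modulo the annihilator becomes convergence to 0 after multiplication by any [d], as [D]
    is all of [A]. *)
Lemma represents_uniq q a b d : represents q a -> represents q b ->
  tends NA (fun n => (a n - b n) ** d) 0.
Proof.
move=> [s [z [-> sz <-]]] [s' [z' [/quot_proj_eq h sz' <-]]].
have [h1 _] := h d (DT d); move: h1.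
have -> : val (s - s') = val s - val s' by [].
rewrite smulBl sz sz' -!quot_projM => /eqP; rewrite subr_eq0 => /eqP/quot_proj_eq/null_seqsP.
by apply: tends_ext => n; rewrite [RHS]smulBl.
Qed.

Lemma representsL (c : R[i]) q q' a b : represents q a -> represents q' b ->
  represents (c *: q + q') (fun n => c *: a n + b n).
Proof.
move=> [s [z [-> sz <-]]] [s' [z' [-> sz' <-]]]; exists (c *: s + s'), (c *: z + z'); split=> //.
  by rewrite quot_projL.
have -> : val (c *: s + s') = c *: val s + val s' by [].
by rewrite sz sz' quot_projL.
Qed.

Lemma representsM q q' a b : represents q a -> represents q' b ->
  represents (q ** q') (fun n => a n ** b n).
Proof.
move=> [s [z [-> sz <-]]] [s' [z' [-> sz' <-]]]; exists (s ** s'), (z ** z'); split=> //.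
  by rewrite quot_projM.
have -> : val (s ** s') = val s ** val s' by [].
by rewrite sz sz' quot_projM.
Qed.

Lemma representsS q a : represents q a -> represents (star q) (fun n => star (a n)).
Proof.
move=> [s [z [-> sz <-]]]; exists (star s), (star z); split=> //.
  by rewrite quot_projS.
have -> : val (star s) = star (val s) by [].
by rewrite sz quot_projS.
Qed.

Lemma represents0 : represents 0 (fun=> 0).
Proof. by exists 0, 0. Qed.

Lemma represents_sum n (c : 'I_n -> R[i]) (q : 'I_n -> central_quot D) (a : 'I_n -> nat -> A) :
  (forall i, represents (q i) (a i)) ->
  represents (\sum_i c i *: q i) (fun m => \sum_i c i *: a i m).
Proof.
elim: n c q a => [|n IH] c q a h.
  have -> : (fun m => \sum_(i < 0) c i *: a i m) = (fun=> 0) by apply/funext => m; rewrite big_ord0.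
  by rewrite big_ord0; exact: represents0.
have -> : (fun m => \sum_i c i *: a i m) = (fun m => c ord0 *: a ord0 m + \sum_i c (lift ord0 i) *: a (lift ord0 i) m).
  by apply/funext => m; rewrite big_ord_recl.
by rewrite big_ord_recl; apply: representsL => //; apply: (IH (fun i => c (lift ord0 i))).
Qed.

Lemma linf_norm_ge0 (z : linf A) : 0 <= linf_norm z.
Proof. exact: le_trans (rnorm_ge0 _) (linf_norm_le z 0). Qed.

Lemma represents_ex q e : 0 < e -> exists a, represents q a /\ forall n, rnorm (a n) <= central_quot_norm q + e.
Proof.
move=> e0; have e2 : 0 < e / 2 by rewrite divr_gt0.
have [|s [qs hs]] := quot_norm_approx (J := annihilator D) (p := fun x => Ainf_norm (val x)) q _ e2.
  by move=> x; apply: quot_norm_ge0; exact: linf_norm_ge0.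
have [z [sz hz]] := quot_norm_approx (val s) linf_norm_ge0 e2.
exists (val z); split; first by exists s, z.
move=> n; rewrite (le_trans (linf_norm_le z n))// (le_trans hz)//.
by move: hs; rewrite /central_quot_norm /Ainf_norm; lra.
Qed.

Lemma represents_act g q a b d : represents q a -> represents (central_quot_act Dinv g q) b ->
  tends NA (fun n => (alpha g (a n) - b n) ** d) 0.
Proof.
move=> qa qb; pose s := repr q; have [z sz] := quot_projP (val s).
have qz : represents q (val z) by exists s, z; split=> //; rewrite /quot_proj reprK.
have gz : represents (central_quot_act Dinv g q) (fun n => alpha g (val z n)).
  by exists (commutant_act Dinv g s), (linf_act alpha g z); split=> //; rewrite /= sz Ainf_actE.
have h1 := represents_uniq d gz qb; have h2 := represents_uniq (alpha g^-1%g d) qa qz.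
have h3 : tends NA (fun n => alpha g ((a n - val z n) ** alpha g^-1%g d)) 0.
  apply: (tends0_le (N := NA) (C := 1) _ _ h2) => // n; rewrite mul1r.
  by rewrite -[NA (alpha g _)]/(rnorm _) -[leRHS]/(rnorm _) action_rnorm.
have := tendsD h3 h1; rewrite addr0; apply: tends_ext => n.
rewrite action_smul -actionM mulgV action1 -smulDl raddfB.
by congr (_ ** _); rewrite subrKA.
Qed.

(** Provides the element of F^(alpha) against which [rokhlin_unit] tests the unit condition. *)
Lemma represents_unit (u : nat -> A) : (forall n, rnorm (u n) <= 2) ->
  (forall (g0 : G) (e : R), 0 < e -> \forall g \near g0, forall n, rnorm (alpha g (u n) - alpha g0 (u n)) <= e) ->
  (forall d, tends NA (fun n => u n ** d) d) -> (forall d, tends NA (fun n => d ** u n) d) ->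
  exists x : central_alg alpha D, represents (val x) u.
Proof.
move=> u2 uc ul ur.
have ub : (bounded_seqs A : set _) u by exists 2%:c => n; rewrite le_rnorm.
pose z := mksub ub.
have zc : (commutant D : set _) (quot_proj (null_seqs A) z).
  move=> d _; rewrite -!quot_projM; apply/quot_proj_eq/null_seqsP.
  have := tendsD (ul d) (tendsZ (-1) (ur d)).
  have -> : d + -1 *: d = 0 by rewrite scaleN1r subrr.
  by apply: tends_ext => n; rewrite scaleN1r.
pose s : subalg (commutant D) := mksub zc.
have xc : (central_quot_cont alpha D : set _) (quot_proj (annihilator D) s).
  exists s => //; exists z => // g0 e /pos_complex[-> e0].
  by have := uc g0 _ e0; apply: filterS => g h n; rewrite le_rnorm; exact: h.
by exists (mksub xc); exists s, z.
Qed.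

End representatives.

(** * Partitions of unity and exponentials on the line *)

Section tent_functions.
Context {R : realType}.

(** The hat function max(0, 1 - |t|), written with absolute values so that continuity is
    immediate. *)
Definition tent (t : R) : R := (`|t + 1| + `|t - 1|) / 2 - `|t|.

Lemma tent_ge0 t : 0 <= tent t.
Proof.
have := ler_normD (t + 1) (t - 1); have -> : t + 1 + (t - 1) = 2 * t by ring.
by rewrite normrM ger0_norm// /tent; lra.
Qed.

Lemma tent_far t : 1 <= `|t| -> tent t = 0.
Proof.
rewrite /tent; have [t0|t0] := lerP 0 t.
  rewrite (ger0_norm t0) => h.
  have h1 : 0 <= t - 1 by lra.
  have h2 : 0 <= t + 1 by lra.
  by rewrite (ger0_norm h1) (ger0_norm h2); field.
rewrite (ltr0_norm t0) => h.
have h1 : t - 1 <= 0 by lra.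
have h2 : t + 1 <= 0 by lra.
by rewrite (ler0_norm h1) (ler0_norm h2); field.
Qed.

Lemma tent_sum m t : 0 <= t <= m%:R -> \sum_(i < m.+1) tent (t - i%:R) = 1.
Proof.
(* [q] is the ramp from 0 to 1 on the unit interval; tents are differences of its translates, so
   their sum telescopes. *)
pose q (t : R) : R := (`|t| - `|t - 1| + 1) / 2.
have tq s : tent s = q (s + 1) - q s by rewrite /q /tent addrK; field.
have -> : \sum_(i < m.+1) tent (t - i%:R) = q (t + 1) - q (t - m%:R).
  elim: m => [|m IH]; first by rewrite big_ord1 tq subr0.
  rewrite big_ord_recr /= IH tq.
  have -> : t - m.+1%:R + 1 = t - m%:R by rewrite -natr1; ring.
  by ring.
move=> /andP[t0 tm]; rewrite /q addrK (ger0_norm (_ : 0 <= t + 1)) ?(ger0_norm t0).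
  rewrite (ler0_norm (_ : t - m%:R <= 0)) ?(ler0_norm (_ : t - m%:R - 1 <= 0)); try lra.
lra.
Qed.

Lemma tent_continuous : continuous tent.
Proof.
move=> t; have h (a : R) : continuous (fun t : R => `|t + a|).
  by move=> s; apply: (@cvg_norm _ R); apply: cvgD; [exact: cvg_id|exact: cvg_cst].
apply: cvgB; last exact: norm_continuous.
by apply: cvgM; [apply: cvgD; exact: h|exact: cvg_cst].
Qed.

Lemma tent_affine_continuous {X : topologicalType} (f : X -> R) (a b c : R) : continuous f ->
  continuous (fun s => tent (f s * a + b - c)).
Proof.
move=> cf s; apply: (@continuous_comp _ _ _ (fun s => f s * a + b - c) tent); last exact: tent_continuous.
apply: cvgB; last exact: cvg_cst.
by apply: cvgD; [apply: cvgM; [exact: cf|exact: cvg_cst]|exact: cvg_cst].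
Qed.

Definition cexp (t : R) : R[i] := Complex (cos t) (sin t).

Lemma cexpD s t : cexp (s + t) = cexp s * cexp t.
Proof. by rewrite /cexp cosD sinD; simpc; congr Complex; ring. Qed.

Lemma cexp0 : cexp 0 = 1.
Proof. by rewrite /cexp cos0 sin0. Qed.

Lemma cexp_conj t : conjC (cexp t) * cexp t = 1.
Proof.
have -> : conjC (cexp t) = Complex (cos t) (- sin t) by [].
rewrite /cexp; simpc; apply/eqP; rewrite eq_complex/=; apply/andP; split; apply/eqP.
  by rewrite -!expr2 cos2Dsin2.
by ring.
Qed.

Lemma cabs_cexp t : cabs (cexp t) = 1.
Proof.
have := cabs_sqr (cexp t); rewrite mulrC cexp_conj => /(@complexI R)/eqP.
by rewrite -[X in _ == X](expr1n _ 2) eqrXn2 ?cabs_ge0// => /eqP.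
Qed.

Lemma cexpX t n : cexp t ^+ n = cexp (t * n%:R).
Proof.
elim: n => [|n IH]; first by rewrite mulr0 cexp0 expr0.
by rewrite exprS IH -cexpD -natr1; congr cexp; ring.
Qed.

Lemma cexp_near e : 0 < e -> exists2 d : R, 0 < d & forall t, `|t| <= d -> cabs (cexp t - 1) <= e.
Proof.
move=> e0; have e2 : 0 < e / 2 by rewrite divr_gt0.
have /cvgrPdist_le/(_ _ e2) h1 := @continuous_cos R 0.
have /cvgrPdist_le/(_ _ e2) h2 := @continuous_sin R 0.
have : nbhs (0 : R) [set t : R | `|cos 0 - cos t| <= e / 2 /\ `|sin 0 - sin t| <= e / 2].
  by apply: filterS2 h1 h2.
move=> /nbhs_ballP[d /= d0 hd]; exists (d / 2); first by rewrite divr_gt0.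
move=> t td; have [|] := hd t.
  by rewrite /ball /= sub0r normrN (le_lt_trans td)// ltr_pdivrMr// ltr_pMr// ltr1n.
rewrite cos0 sin0 sub0r normrN distrC => k1 k2.
by rewrite (le_trans (cabs_ReIm _))//= subr0; lra.
Qed.

End tent_functions.

Section contfun_theory.
Context {R : realType} {X : topologicalType}.
Implicit Types (f : contfun (R := R) X).

Lemma contfun_ext f f' : (forall s, val f s = val f' s) -> f = f'.
Proof. by move=> h; apply/val_inj/funext. Qed.

Lemma contfun_sumE n (c : 'I_n -> R[i]) (f : 'I_n -> contfun (R := R) X) s :
  val (\sum_i c i *: f i) s = \sum_i c i * val (f i) s.
Proof.
elim: n c f => [|n IH] c f; first by rewrite !big_ord0.
by rewrite !big_ord_recl /= -IH.
Qed.

Lemma real_contfun_subproof (f : X -> R) : continuous f ->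
  (continuous_sub X : set _) (fun s => (f s)%:c : R[i]^o).
Proof.
move=> cf s; apply/cvgrPdist_le => e /pos_complex[-> e0].
have /cvgrPdist_le/(_ _ e0) := cf s; apply: filterS => t /= h.
by rewrite -rmorphB -[X in X <= _]/((cabs _)%:c) lecR cabs_real.
Qed.

Definition real_contfun (f : X -> R) (cf : continuous f) : contfun X := mksub (real_contfun_subproof cf).

Lemma real_contfun_positive (f : X -> R) (cf : continuous f) : (forall s, 0 <= f s) ->
  positive (real_contfun cf).
Proof.
move=> f0; have cs : continuous (fun s => Num.sqrt (f s)).
  move=> s; apply: (@continuous_comp _ _ _ f (@Num.sqrt R)); first exact: cf.
  exact: sqrt_continuous.
exists (real_contfun cs); apply: contfun_ext => s /=.
rewrite -[RHS]/(conjC (Num.sqrt (f s))%:c * (Num.sqrt (f s))%:c) conjC_real -(rmorphM (real_complex R)).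
by rewrite -expr2 sqr_sqrtr.
Qed.

Lemma contfun_norm_le f (c : R) (s0 : X) : (forall s, cabs (val f s) <= c) -> contfun_norm f <= c.
Proof.
move=> h; apply: ge_sup; first by exists (rnorm (val f s0)), s0.
by move=> _ [s _ <-]; exact: h.
Qed.

End contfun_theory.

(** * Discretized phases on the coset space *)

Section phase_functions.
Context {R : realType} {G : topGroupType} (mu : {measure set (borel G) -> \bar R}) (H : subgroup G).
Hypothesis lcG : locally_compact_group G.
Hypothesis haar : left_haar mu.
Hypothesis Hclosed : closed (H : set G).
Hypothesis Hcoc : cocompact H.
Hypothesis Hnopen : ~ open (H : set G).
Local Notation X := (coset_space H).
Local Notation C := (contfun (R := R) X).
Let s0 : X := coset_proj H 1%g.

(* A discretized unimodular function: xi runs through powers of om, interpolated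
   by a partition of unity in which only neighbours overlap. *)
Definition discrete_phase (e : R) (xi : C) := exists m (p : 'I_m -> C) (om : R[i]),
  [/\ conjC om * om = 1 /\ cabs (om - 1) <= e,
      forall i, positive (p i),
      \sum_i p i = contfun_one /\ xi = \sum_(i < m) om ^+ i *: p i,
      forall i j : 'I_m, (i.+1 < j)%N || (j.+1 < i)%N -> p i ** p j = 0 &
      forall c, contfun_norm (\sum_(i < m) mod_coef c i *: p i) <= 1].

(** Pointwise closeness is uniform because every coset has a representative in one compact set. *)
Lemma shift_near (xi : C) e : 0 < e ->
  \forall g \near (1 : G)%g, contfun_norm (coset_shift g xi - xi) <= e.
Proof.
move=> e0; have [K0 cK0 K0X] := coset_rep_compact Hcoc.
pose F (g k : G) : R := cabs (val xi (coset_proj H (g^-1 * k)%g) - val xi (coset_proj H k)).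
have cx : continuous (val xi : X -> R[i]^o) := set_mem (valP xi).
have cF : continuous (fun q : G * G => F q.1 q.2).
  pose f (q : G * G) : R[i]^o := val xi (coset_proj H (q.1^-1 * q.2)%g) - val xi (coset_proj H q.2).
  suff cf : continuous f.
    move=> q; apply/cvgrPdist_le => d d0.
    have /cvgrPdist_le/(_ d%:c) := cf q; rewrite ltcR => /(_ d0); apply: filterS => y.
    rewrite -[X in X <= _]/(`|(f q - f y : R[i])|) cabsE lecR => zy.
    rewrite -[F q.1 q.2]/(cabs (f q)) -[F y.1 y.2]/(cabs (f y)).
    have h1 := cabsD (f q - f y) (f y); rewrite subrK in h1.
    have h2 := cabsD (f y - f q) (f q); rewrite subrK -[cabs (f y - f q)]cabsN opprB in h2.
    by rewrite ler_norml; apply/andP; split; lra.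
  move=> q.
  apply: (@cvgB _ R[i]^o).
    apply: (@continuous_comp _ _ _ (fun q : G * G => coset_proj H (q.1^-1 * q.2)%g)); last exact: cx.
    apply: (@continuous_comp _ _ _ (fun q : G * G => (q.1^-1 * q.2)%g) (coset_proj H)).
      apply: (@mulg_continuous2 G _ (fun p => p.1^-1%g) snd) => r; last exact: cvg_snd.
      by apply: (@invg_continuous2 G _ fst) => z; exact: cvg_fst.
    exact: coset_proj_continuous.
  apply: (@continuous_comp _ _ _ (fun q : G * G => coset_proj H q.2)); last exact: cx.
  by apply: (@continuous_comp _ _ _ snd (coset_proj H)); [exact: cvg_snd|exact: coset_proj_continuous].
have := tube (F := F) 1%g cK0 cF e0; apply: filterS => g hg.
apply: (contfun_norm_le s0) => s; have [k K0k ->] := K0X s.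
have := hg k K0k; rewrite {2}/F invg1 mul1g subrr cabs0 subr0 => /(le_trans (ler_norm _)).
by rewrite /F -coset_translateE.
Qed.

Lemma phase_ex (V : set G) (e : R) : nbhs (1 : G)%g V -> 0 < e -> exists xi : C,
  discrete_phase e xi /\ contfun_norm xi <= 1 /\ exists n (c : 'I_n -> R) (g : 'I_n -> G),
    [/\ forall b, 0 <= c b /\ V (g b), \sum_b c b = 1 &
        contfun_norm (\sum_b (c b)%:c *: coset_shift (g b) xi) <= e].
Proof.
move=> nV e0; have e2 : 0 < e / 2 by rewrite divr_gt0.
have e4 : 0 < e / 4 by rewrite divr_gt0.
have [eta eta0 etaP] := cexp_near e2.
have [theta [n [c [g [ct cg c1 osc]]]]] := oscillation lcG haar Hclosed Hcoc Hnopen nV e4.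
have [M M0 thM] : exists2 M : R, 0 < M & forall s, `|theta s| <= M.
  have cK : compact (range theta).
    apply: continuous_compact; last exact: coset_compact.
    exact: continuous_subspaceT.
  have [M [_ hM]] := compact_bounded cK.
  exists (`|M| + 1); first by rewrite ltr_wpDl.
  by move=> s; apply: (hM (`|M| + 1)); [rewrite (le_lt_trans (ler_norm _))// ltrDl|exists s].
(* The shift by [k] moves theta / eta into the interval [0, 2k], where only powers with natural
   exponents occur. *)
pose k := (Num.truncn (M / eta)).+1.
have kM : M / eta <= k%:R by apply/ltW/truncnS_gt.
pose t s : R := theta s / eta + k%:R.
have t_bd s : 0 <= t s <= (2 * k)%N%:R.
  have := thM s; rewrite ler_norml => /andP[h1 h2].
  have h3 : - (M / eta) <= theta s / eta by rewrite -mulNr ler_pM2r ?invr_gt0.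
  have h4 : theta s / eta <= M / eta by rewrite ler_pM2r ?invr_gt0.
  by rewrite /t natrM; apply/andP; split; lra.
have ctt (i : nat) : continuous ((fun s => tent (t s - i%:R)) : X -> R).
  exact: (@tent_affine_continuous R X theta eta^-1 k%:R i%:R ct).
pose p (i : 'I_(2 * k).+1) : C := real_contfun (ctt i).
pose om := cexp eta; pose xi : C := \sum_(i < (2 * k).+1) om ^+ i *: p i.
have xiE s : val xi s = \sum_(i < (2 * k).+1) cexp (eta * i%:R) * (tent (t s - i%:R))%:c.
  by rewrite /xi contfun_sumE; apply: eq_bigr => i _; rewrite cexpX.
have tsum s := tent_sum (t_bd s).
have csumE s (f : 'I_(2 * k).+1 -> R[i]) : cabs (\sum_i f i * (tent (t s - i%:R))%:c) <=
    \sum_i cabs (f i) * tent (t s - i%:R).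
  rewrite (le_trans (cn_sum (@complex_cnorm R) _ _ _))//; apply: ler_sum => i _.
  by rewrite -[leLHS]/(cabs _) cabsM cabs_real ger0_norm// tent_ge0.
have weight s (f : 'I_(2 * k).+1 -> R[i]) (b : R) : 0 <= b ->
    (forall i : 'I_(2 * k).+1, `|t s - i%:R| < 1 -> cabs (f i) <= b) ->
    cabs (\sum_i f i * (tent (t s - i%:R))%:c) <= b.
  move=> b0 fb; rewrite (le_trans (csumE s f))//.
  have -> : b = \sum_(i < (2 * k).+1) b * tent (t s - i%:R) by rewrite -mulr_sumr tsum mulr1.
  apply: ler_sum => i _.
  have [h|h] := lerP 1 `|t s - i%:R|; first by rewrite tent_far// !mulr0.
  by rewrite ler_wpM2r ?tent_ge0// fb.
have xi_near s : cabs (val xi s - cexp (eta * t s)) <= e / 2.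
  have -> : val xi s - cexp (eta * t s) =
      \sum_(i < (2 * k).+1) (cexp (eta * i%:R) - cexp (eta * t s)) * (tent (t s - i%:R))%:c.
    under [RHS]eq_bigr do rewrite mulrBl.
    rewrite sumrB -xiE -mulr_sumr -(rmorph_sum (real_complex R)) tsum rmorph1 mulr1 //.
  apply: weight => // [|i hi]; first exact: ltW.
  have -> : cexp (eta * i%:R) = cexp (eta * t s) * cexp (eta * (i%:R - t s)).
    by rewrite -cexpD; congr cexp; ring.
  rewrite -{2}[cexp (eta * t s)]mulr1 -mulrBr cabsM cabs_cexp mul1r; apply: etaP.
  by rewrite normrM (gtr0_norm eta0) distrC -[leRHS]mulr1 ler_pM2l// ltW.
exists xi; split; last split.
- exists (2 * k).+1, p, om; split.
  + split; first exact: cexp_conj.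
    rewrite (le_trans (etaP eta _)) ?(gtr0_norm eta0)//; lra.
  + by move=> i; apply: real_contfun_positive => s; exact: tent_ge0.
  + split=> //; apply: contfun_ext => s.
    have -> : \sum_i p i = \sum_i 1 *: p i by apply: eq_bigr => i _; rewrite scale1r.
    rewrite contfun_sumE -[RHS]/((1 : R)%:c) -[in RHS](tsum s) [RHS](rmorph_sum (real_complex R)).
    by apply: eq_bigr => i _; rewrite mul1r.
  + move=> i j ij; apply: contfun_ext => s.
    rewrite -[LHS]/((tent (t s - i%:R))%:c * (tent (t s - j%:R))%:c) -(rmorphM (real_complex R)).
    have [hi|hi] := lerP 1 `|t s - i%:R|; first by rewrite tent_far// mul0r.
    have [hj|hj] := lerP 1 `|t s - j%:R|; first by rewrite (tent_far hj) mulr0.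
    move: hi hj; rewrite !ltr_norml => /andP[a1 a2] /andP[b1 b2].
    move: ij => /orP[]; rewrite -(ltr_nat R) -natr1 => h; exfalso.
      have : (i.+2 <= j)%N by rewrite -(ltr_nat R) -natr1 in h *; move: h; rewrite natr1 ltr_nat.
      by rewrite -(ler_nat R) -!natr1 => h3; lra.
    have : (j.+2 <= i)%N by move: h; rewrite natr1 ltr_nat.
    by rewrite -(ler_nat R) -!natr1 => h3; lra.
  + move=> c'; apply: (contfun_norm_le s0) => s; rewrite contfun_sumE; apply: weight => // i _.
    by rewrite /mod_coef; case: (_ == _); rewrite ?cabs1 ?cabs0.
- apply: (contfun_norm_le s0) => s; rewrite xiE; apply: weight => // i _.
  by rewrite cabs_cexp.
- exists n, c, g; split=> //; apply: (contfun_norm_le s0) => s; rewrite contfun_sumE.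
  set sb := fun b => coset_translate (H := H) (g b)^-1%g s.
  rewrite -[cabs _]/(cabs (\sum_b (c b)%:c * val xi (sb b))).
  have -> : \sum_b (c b)%:c * val xi (sb b) =
      (\sum_b (c b)%:c * (val xi (sb b) - cexp (eta * t (sb b)))) +
      (\sum_b (c b)%:c * cexp (theta (sb b))) * cexp (eta * k%:R).
    rewrite mulr_suml -big_split/=; apply: eq_bigr => b _.
    have -> : eta * t (sb b) = theta (sb b) + eta * k%:R.
      by rewrite /t mulrDr mulrC divfK// gt_eqF.
    by rewrite cexpD; ring.
  have h1 : cabs (\sum_b (c b)%:c * (val xi (sb b) - cexp (eta * t (sb b)))) <= e / 2.
    rewrite (le_trans (cn_sum (@complex_cnorm R) _ _ _))//.
    have -> : e / 2 = \sum_b c b * (e / 2) by rewrite -mulr_suml c1 mul1r.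
    apply: ler_sum => b _; rewrite -[leLHS]/(cabs _) cabsM cabs_real ger0_norm ?(cg b).1//.
    by rewrite ler_wpM2l ?(cg b).1.
  have h2 : cabs (\sum_b (c b)%:c * cexp (theta (sb b))) <= e / 2.
    have -> : \sum_b (c b)%:c * cexp (theta (sb b)) =
        Complex (\sum_b c b * cos (theta (sb b))) (\sum_b c b * sin (theta (sb b))).
      apply/eqP; rewrite eq_complex/= !raddf_sum/=; apply/andP; split; apply/eqP; apply: eq_bigr => b _.
        by rewrite mul0r subr0.
      by rewrite mul0r addr0.
    rewrite (le_trans (cabs_ReIm _))//=; have [] := osc s; rewrite -/sb => k1 k2.
    by lra.
  rewrite (le_trans (cabsD _ _))// cabsM cabs_cexp mulr1; lra.
Qed.

End phase_functions.

Lemma near_all_seq {T I : Type} {F : set_system T} (FF : Filter F) (Q : I -> T -> Prop) (s : seq I) :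
  (forall i, \forall x \near F, Q i x) -> \forall x \near F, forall k i0, (k < size s)%N -> Q (nth i0 s k) x.
Proof.
move=> h; elim: s => [|i s IH]; first by apply: nearW.
by have := h i; apply: filterS2 IH => x IHx Qx [|k] i0 ks //=; exact: IHx.
Qed.

(** * Asymptotic estimates for Rokhlin maps *)

Section rokhlin_estimates.
Context {R : realType} {G : topGroupType} {A : cstarAlgType R} (alpha : action G A).
Context {B : cstarAlgType R} (m : A -> adj B).
Local Notation N := (@adj_ucnorm R B).
Local Notation NA := (@cstar_cnorm R A).
Hypothesis mS : forall a, star (m a) = m (star a).
Hypothesis mM : forall a b, m (a ** b) = m a ** m b.
Hypothesis mL : forall c a b, m (c *: a + b) = c *: m a + m b.
Hypothesis mN : forall a, N (m a) <= rnorm a.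
Hypothesis m_unit : forall x e, 0 < e -> exists a, rnorm (m a x - x) <= e.

Lemma m_le a x : rnorm (m a x) <= rnorm a * rnorm x.
Proof. by apply: (le_trans (le_adj_norm _ _)); rewrite ler_wpM2r ?rnorm_ge0//; exact: mN. Qed.

Lemma mB a b x : m (a - b) x = m a x - m b x.
Proof. by rewrite addrC -scaleN1r mL scaleN1r addrC subE_adj. Qed.

Lemma mME a b x : m (a ** b) x = m a (m b x).
Proof. by rewrite mM. Qed.

Lemma m0 : m 0 = 0.
Proof. by have := mL (-1) 0 0; rewrite scaleN1r addNr scaleN1r addNr. Qed.

Lemma m_sum n (c : 'I_n -> R[i]) (a : 'I_n -> A) x :
  m (\sum_i c i *: a i) x = \sum_i c i *: m (a i) x.
Proof.
elim: n c a => [|n IH] c a; first by rewrite !big_ord0 m0.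
by rewrite !big_ord_recl mL -IH.
Qed.

Lemma star_m a x y : star (m a x) ** y = star x ** m (star a) y.
Proof. by rewrite -mS; have := adjP' (star (m a)) x y. Qed.

Lemma tends_near (v : nat -> A) a e : tends NA v a -> 0 < e -> \forall n \near \oo, rnorm (v n - a) <= e.
Proof. by move=> h e0; have [n hn] := h e e0; exists n. Qed.

(** Convergence of a_n d to 0 passes to vectors of [B] because x is close to m(d) x for some d. *)
Lemma null_apply (a : nat -> A) (M : R) x e : (forall n, rnorm (a n) <= M) ->
  (forall d, tends NA (fun n => a n ** d) 0) -> 0 < e -> \forall n \near \oo, rnorm (m (a n) x) <= e.
Proof.
move=> aM a0 e0; have M0 : 0 <= M := le_trans (rnorm_ge0 _) (aM 0).
have e1 : 0 < e / 2 / (M + 1) by rewrite !divr_gt0// ltr_wpDl.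
have e2 : 0 < e / 2 / (rnorm x + 1) by rewrite !divr_gt0// ltr_wpDl// rnorm_ge0.
have [d hd] := m_unit x e1; have := tends_near (a0 d) e2; apply: filterS => n; rewrite subr0 => hn.
have -> : m (a n) x = m (a n ** d) x - m (a n) (m d x - x).
  by rewrite mME adjB; lmod B; ring.
rewrite (le_trans (rnormD _ _))// rnormN (splitr e) lerD//.
  rewrite (le_trans (m_le _ _))// (le_trans (ler_wpM2r (rnorm_ge0 _) hn))//.
  by rewrite mulrAC ler_pdivrMr ?ltr_wpDl ?rnorm_ge0// ler_wpM2l ?lerDl// ltW// divr_gt0.
rewrite (le_trans (m_le _ _))// (le_trans (ler_pM (rnorm_ge0 _) (rnorm_ge0 _) (aM n) hd))//.
by rewrite mulrA ler_pdivrMr ?ltr_wpDl// mulrC ler_wpM2l ?lerDl// ltW// divr_gt0.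
Qed.

Lemma unit_apply (v : nat -> A) x e : (forall n, rnorm (v n) <= 2) ->
  (forall d, tends NA (fun n => v n ** d) d) -> 0 < e -> \forall n \near \oo, rnorm (m (v n) x - x) <= e.
Proof.
move=> v2 vP e0; have e6 : 0 < e / 6 by rewrite divr_gt0.
have e2 : 0 < e / 2 / (rnorm x + 1) by rewrite !divr_gt0// ltr_wpDl// rnorm_ge0.
have [d hd] := m_unit x e6; have := tends_near (vP d) e2; apply: filterS => n hn.
have -> : m (v n) x - x = m (v n ** d - d) x - m (v n) (m d x - x) + (m d x - x).
  by rewrite mB mME adjB; lmod B; ring.
have h1 : rnorm (m (v n ** d - d) x) <= e / 2.
  rewrite (le_trans (m_le _ _))// (le_trans (ler_wpM2r (rnorm_ge0 _) hn))//.
  by rewrite mulrAC ler_pdivrMr ?ltr_wpDl ?rnorm_ge0// ler_wpM2l ?lerDl// ltW// divr_gt0.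
have h2 := le_trans (m_le (v n) (m d x - x)) (ler_pM (rnorm_ge0 _) (rnorm_ge0 _) (v2 n) hd).
have h3 := rnormD (m (v n ** d - d) x) (- m (v n) (m d x - x)); rewrite rnormN in h3.
by rewrite (le_trans (rnormD _ _))//; lra.
Qed.

Variable D : starSub A.
Hypothesis DT : forall a, (D : set A) a.
Hypothesis Dinv : action_invariant alpha D.
Implicit Types (q : central_quot D) (a : nat -> A).

Lemma represents_close q a (b : nat -> A) x e : represents q a -> represents q b -> 0 < e ->
  \forall n \near \oo, rnorm (m (a n) x - m (b n) x) <= e.
Proof.
move=> qa qb e0; have [M aM] := represents_bounded qa; have [M' bM] := represents_bounded qb.
have hM n : rnorm (a n - b n) <= M + M'.
  by rewrite (le_trans (rnormD _ _))// rnormN lerD.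
have := null_apply (a := fun n => a n - b n) x hM (fun d => represents_uniq DT d qa qb) e0.
by apply: filterS => n; rewrite mB.
Qed.

Lemma represents_near_norm q a (c : R) x e : represents q a -> central_quot_norm q <= c -> 0 < e ->
  \forall n \near \oo, rnorm (m (a n) x) <= c * rnorm x + e.
Proof.
move=> qa qc e0; have e2 : 0 < e / 2 by rewrite divr_gt0.
have x1 : 0 < rnorm x + 1 by rewrite ltr_wpDl// rnorm_ge0.
have [b [qb bc]] := represents_ex q (divr_gt0 e2 x1).
have := represents_close x qa qb e2; apply: filterS => n h.
have -> : m (a n) x = (m (a n) x - m (b n) x) + m (b n) x by rewrite subrK.
rewrite (le_trans (rnormD _ _))//.
have h2 : rnorm (m (b n) x) <= (c + e / 2 / (rnorm x + 1)) * rnorm x.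
  by rewrite (le_trans (m_le _ _))// ler_wpM2r ?rnorm_ge0// (le_trans (bc n))// lerD2r.
have h3 : e / 2 / (rnorm x + 1) * rnorm x <= e / 2.
  by rewrite mulrAC ler_pdivrMr// ler_wpM2l ?lerDl// ltW.
by move: h2; rewrite mulrDl; lra.
Qed.

Variable H : subgroup G.
Local Notation C := (contfun (R := R) (coset_space H)).
Variable phi : {linear C -> central_alg alpha D}.
Hypothesis phi_cp : completely_positive phi.
Hypothesis phi_contr : contractive (@contfun_norm R (coset_space H)) (@central_alg_norm R A G alpha D) phi.
Hypothesis phi_oz : order_zero phi.
Hypothesis phi_eq : forall g f, val (phi (coset_shift g f)) = central_quot_act Dinv g (val (phi f)).

(** Complete positivity on 1 by 1 matrices exhibits phi(f) in the form z^* z. *)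
Lemma cp_star (f : C) : positive f -> star (phi f) = phi f.
Proof.
move=> [y fy]; have [|z hz] := phi_cp (n := 1) (x := const_mx f).
  by exists (const_mx y) => i j; rewrite big_ord1 !mxE.
have := hz ord0 ord0; rewrite big_ord1 !mxE => ->.
by rewrite starM starK.
Qed.

(** Order zero makes phi(p_i) phi(p_j) vanish for distant indices, so [twisted_sum_sq] applies to
    the phi(p_i) and leaves only terms with the small factor om - 1 or its conjugate. *)
Lemma phase_modulus (xi : C) (e : R) a h x eta : 0 <= e -> discrete_phase e xi ->
  represents (val (phi xi)) a -> represents (val (phi contfun_one)) h -> 0 < eta ->
  \forall n \near \oo, rnorm (m (star (a n) ** a n - star (h n) ** h n) x) <= 24 * e * rnorm x + eta.
Proof.
move=> e0 [k [p [om [[om1 ome] p0 [p1 xiE] pfar pn]]]] ra rh eta0.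
pose P i := phi (p i); have P_sa i : star (P i) = P i by exact: cp_star.
have P_far (i j : 'I_k) : (i.+1 < j)%N || (j.+1 < i)%N -> P i ** P j = 0.
  by move=> ij; apply: phi_oz => //; exact: pfar.
have := twisted_sum_sq om1 P_sa P_far.
have phi_sum (c : nat -> R[i]) : \sum_(i < k) c i *: P i = phi (\sum_(i < k) c i *: p i).
  by rewrite linear_sum; apply: eq_bigr => i _; rewrite linearZ.
rewrite (phi_sum (fun i => om ^+ i)) -xiE.
have -> : \sum_(i < k) P i = phi contfun_one by rewrite -p1 linear_sum.
have h_sa : star (phi contfun_one) = phi contfun_one.
  by rewrite -p1 linear_sum star_sum; apply: eq_bigr => i _; exact: P_sa.
pose T c := mod_part P c; rewrite -/(T _).
have /choice[b bP] (c : nat) : exists b, represents (val (T c)) b /\ forall n, rnorm (b n) <= 2.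
  have [b [rb hb]] := represents_ex (val (T c)) (@ltr01 R); exists b; split=> // n.
  apply: (le_trans (hb n)); have -> : 2 = 1 + 1 :> R by [].
  rewrite lerD2r; apply: le_trans (pn c).
  by rewrite /T /mod_part (phi_sum (mod_coef c)); exact: phi_contr.
move=> /(congr1 val) E.
pose z n := (om - 1) *: (\sum_(c < 3) 1 *: (b c n ** b c.+1 n)) +
  (conjC om - 1) *: (\sum_(c < 3) 1 *: (b c.+1 n ** b c n)) : A.
have vsum (F : 'I_3 -> central_alg alpha D) : val (\sum_(c < 3) F c) = \sum_(c < 3) 1 *: val (F c).
  rewrite (big_morph val (fun _ _ => erefl) erefl); apply: eq_bigr => c _; by rewrite scale1r.
have rz1 : represents (val ((om - 1) *: (\sum_(c < 3) T c ** T c.+1) +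
    (conjC om - 1) *: (\sum_(c < 3) T c.+1 ** T c))) z.
  have r1 := represents_sum (fun=> 1) (fun c : 'I_3 => representsM (bP c).1 (bP c.+1).1).
  have r2 := represents_sum (fun=> 1) (fun c : 'I_3 => representsM (bP c.+1).1 (bP c).1).
  rewrite -[val _]/((om - 1) *: val (\sum_(c < 3) T c ** T c.+1) + (conjC om - 1) *: val (\sum_(c < 3) T c.+1 ** T c)).
  rewrite !vsum; apply: (representsL _ r1).
  rewrite -[_ *: (\sum_(c < 3) _)]addr0.
  have -> : (fun n => (conjC om - 1) *: (\sum_(c < 3) 1 *: (b c.+1 n ** b c n))) =
    (fun n => (conjC om - 1) *: (\sum_(c < 3) 1 *: (b c.+1 n ** b c n)) + (fun=> 0) n).
    by apply/funext => n; rewrite addr0.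
  by apply: (representsL _ r2); exact: represents0.
have ry : represents (val ((om - 1) *: (\sum_(c < 3) T c ** T c.+1) +
    (conjC om - 1) *: (\sum_(c < 3) T c.+1 ** T c)))
    (fun n => star (a n) ** a n - star (h n) ** h n).
  rewrite -E -[val _]/(star (val (phi xi)) ** val (phi xi) - val (phi contfun_one) ** val (phi contfun_one)).
  have hv : val (phi contfun_one) = star (val (phi contfun_one)) by rewrite -[in LHS]h_sa.
  rewrite {1}hv.
  have := representsL (-1) (representsM (representsS rh) rh) (representsM (representsS ra) ra).
  rewrite scaleN1r addrC; congr represents; apply/funext => n; by rewrite scaleN1r addrC.
have := represents_close x ry rz1 eta0; apply: filterS => n hn.
(* Lifts of norm at most 2 give products of norm at most 4 and sums of three of norm at most 12; two
   such sums carry coefficients of modulus at most e. *)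
have zn : rnorm (z n) <= 24 * e.
  have bb i j : rnorm (b i n ** b j n) <= 4.
    rewrite (le_trans (rnorm_smul_le _ _))// (le_trans (ler_pM (rnorm_ge0 _) (rnorm_ge0 _) ((bP i).2 n) ((bP j).2 n)))//.
    lra.
  have s3 (F : 'I_3 -> A) : (forall c, rnorm (F c) <= 4) -> rnorm (\sum_(c < 3) 1 *: F c) <= 12.
    move=> F4; rewrite (le_trans (cn_sum NA _ _ _))// (_ : 12 = \sum_(c < 3) 4); last first.
      by rewrite sumr_const card_ord -mulr_natl; ring.
    by apply: ler_sum => c _; rewrite scale1r; exact: F4.
  rewrite (le_trans (rnormD _ _))// !rnormZ.
  have -> : cabs (conjC om - 1) = cabs (om - 1) by rewrite -[RHS]cabs_conj rmorphB rmorph1.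
  have h1 := ler_pM (cabs_ge0 _) (rnorm_ge0 _) ome (s3 (fun c => b c n ** b c.+1 n) (fun c => bb _ _)).
  have h2 := ler_pM (cabs_ge0 _) (rnorm_ge0 _) ome (s3 (fun c => b c.+1 n ** b c n) (fun c => bb _ _)).
  by rewrite (_ : 24 * e = e * 12 + e * 12) ?lerD//; ring.
have h2 : rnorm (m (z n) x) <= 24 * e * rnorm x.
  by rewrite (le_trans (m_le _ _))// ler_wpM2r ?rnorm_ge0.
by rewrite -[m _ x](subrK (m (z n) x)) (le_trans (rnormD _ _))// addrC lerD.
Qed.

(** By equivariance the average represents the image under phi of the averaged shifts of xi, and phi
    is contractive. *)
Lemma phase_decorrelation (xi : C) (e : R) a k (c : 'I_k -> R) (g : 'I_k -> G) x eta :
  represents (val (phi xi)) a -> (forall b, 0 <= c b) -> \sum_b c b = 1 ->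
  contfun_norm (\sum_b (c b)%:c *: coset_shift (g b) xi) <= e -> 0 < eta ->
  \forall n \near \oo, rnorm (\sum_b (c b)%:c *: m (alpha (g b) (a n)) x) <= e * rnorm x + eta.
Proof.
move=> ra c0 c1 ce eta0; have eta2 : 0 < eta / 2 by rewrite divr_gt0.
have /choice[f fP] (b : 'I_k) : exists f, represents (val (phi (coset_shift (g b) xi))) f.
  by have [f [rf _]] := represents_ex (val (phi (coset_shift (g b) xi))) (@ltr01 R); exists f.
have rs := represents_sum (fun b => (c b)%:c) fP.
have nq : central_quot_norm (\sum_b (c b)%:c *: val (phi (coset_shift (g b) xi))) <= e.
  apply: le_trans ce; have := phi_contr (\sum_b (c b)%:c *: coset_shift (g b) xi).
  rewrite linear_sum /central_alg_norm (big_morph val (fun _ _ => erefl) erefl).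
  by under eq_bigr do rewrite linearZ.
have h1 := represents_near_norm x rs nq eta2.
have h2 (b : 'I_k) : \forall n \near \oo, rnorm (m (alpha (g b) (a n)) x - m (f b n) x) <= eta / 2.
  have rb := fP b; rewrite phi_eq in rb.
  have [M aM] := represents_bounded ra; have [M' bM] := represents_bounded rb.
  have hM n : rnorm (alpha (g b) (a n) - f b n) <= M + M'.
    by rewrite (le_trans (rnormD _ _))// rnormN action_rnorm lerD.
  have := null_apply (a := fun n => alpha (g b) (a n) - f b n) x hM
    (fun d => represents_act DT d ra rb) eta2.
  by apply: filterS => n; rewrite mB.
have FF : Filter (\oo : set_system nat) by exact: _.
have := @filter_forall _ _ _ (\oo : set_system nat) FF h2.
apply: filterS2 h1 => n h1 h3; rewrite m_sum in h1.
have -> : \sum_b (c b)%:c *: m (alpha (g b) (a n)) x =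
    \sum_b (c b)%:c *: m (f b n) x + \sum_b (c b)%:c *: (m (alpha (g b) (a n)) x - m (f b n) x).
  by rewrite -big_split/=; apply: eq_bigr => b _; rewrite -scalerDr addrC subrK.
have h4 : rnorm (\sum_b (c b)%:c *: (m (alpha (g b) (a n)) x - m (f b n) x)) <= eta / 2.
  rewrite (le_trans (cn_sum (@cstar_cnorm R B) _ _ _))//.
  have -> : eta / 2 = \sum_b c b * (eta / 2) by rewrite -mulr_suml c1 mul1r.
  apply: ler_sum => b _; rewrite -[leLHS]/(rnorm _) rnorm_real ger0_norm ?ler_wpM2l//.
by rewrite (le_trans (rnormD _ _))//; lra.
Qed.

Lemma phase_shift (xi : C) (e : R) a g x eta : represents (val (phi xi)) a ->
  contfun_norm (coset_shift g xi - xi) <= e -> 0 < eta ->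
  \forall n \near \oo, rnorm (m (alpha g (a n)) x - m (a n) x) <= e * rnorm x + eta.
Proof.
move=> ra ce eta0; have eta2 : 0 < eta / 2 by rewrite divr_gt0.
have [f [rf _]] := represents_ex (val (phi (coset_shift g xi))) (@ltr01 R).
have nq : central_quot_norm (-1 *: val (phi xi) + val (phi (coset_shift g xi))) <= e.
  apply: le_trans ce; have := phi_contr (coset_shift g xi - xi).
  by rewrite -scaleN1r addrC linearP.
have h1 := represents_near_norm x (representsL (-1) ra rf) nq eta2.
have [M aM] := represents_bounded ra; have [M' bM] := represents_bounded rf.
have hM n : rnorm (alpha g (a n) - f n) <= M + M'.
  by rewrite (le_trans (rnormD _ _))// rnormN action_rnorm lerD.
rewrite phi_eq in rf.
have h2 := null_apply (a := fun n => alpha g (a n) - f n) x hM (fun d => represents_act DT d ra rf) eta2.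
apply: filterS2 h1 h2 => n; rewrite scaleN1r addrC !mB => h1 h2.
rewrite -(subrKA (m (f n) x)) (le_trans (rnormD _ _))//; lra.
Qed.

End rokhlin_estimates.

(** The difference is half the sum of (W_i - W_j)^* (W_i - W_j) over all pairs. *)
Lemma pos_sum_sq {R : realType} {M : starAlgType R} (N : ucnorm M) n (W : 'I_n -> M) :
  pos N ((n%:R)%:c *: (\sum_i star (W i) ** W i) - star (\sum_i W i) ** (\sum_i W i)).
Proof.
have p0 : pos N 0 by have := pos_scalar N (lexx 0); rewrite scale0r.
have -> : (n%:R)%:c *: (\sum_i star (W i) ** W i) - star (\sum_i W i) ** (\sum_i W i) =
    (2^-1)%:c *: (\sum_i \sum_j star (W i - W j) ** (W i - W j)).
  have E i : \sum_j star (W i - W j) ** (W i - W j) = (n%:R)%:c *: (star (W i) ** W i) +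
      \sum_j star (W j) ** W j - star (W i) ** (\sum_j W j) - star (\sum_j W j) ** W i.
    have -> : (n%:R)%:c *: (star (W i) ** W i) = \sum_(j < n) star (W i) ** W i.
      by rewrite sumr_const card_ord rmorph_nat scaler_nat.
    rewrite smul_sumr star_sum smul_suml -big_split -!sumrB/=; apply: eq_bigr => j _.
    move: (W i) (W j) => a b; rewrite starB !expand_smul.
    move: (star a ** a) (star a ** b) (star b ** a) (star b ** b) => *; lmod M; ring.
  rewrite (eq_bigr _ (fun i _ => E i)) !sumrB big_split/= -scaler_sumr.
  rewrite -smul_suml -star_sum -smul_sumr sumr_const card_ord.
  have -> : (\sum_j star (W j) ** W j) *+ n = (n%:R)%:c *: (\sum_j star (W j) ** W j).
    by rewrite rmorph_nat scaler_nat.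
  move: (_ *: _) (_ ** _) => x y.
  have -> : x + x - y - y = 2%:c *: (x - y) by rewrite rmorph_nat scaler_nat mulr2n; lmod M; ring.
  by rewrite scalerA -rmorphM mulVf ?pnatr_eq0// scale1r.
apply: posZ; first by rewrite invr_ge0.
do 2![apply: (big_ind (pos N)) => // [*|? _]; first exact: posD].
exact: pos_star_smul.
Qed.

(** * Shifts from Rokhlin maps *)

Section shifts_from_rokhlin.
Context {R : realType} {G : topGroupType} {A : cstarAlgType R} (alpha : action G A).
Context (mu : {measure set (borel G) -> \bar R}) (H : subgroup G).
Context {B : cstarAlgType R} (m : A -> adj B) (u : G -> adj B).
Local Notation N := (@adj_ucnorm R B).
Local Notation NA := (@cstar_cnorm R A).
Local Notation "1e" := (uone N).
Local Notation C := (contfun (R := R) (coset_space H)).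
Hypothesis lcG : locally_compact_group G.
Hypothesis haar : left_haar mu.
Hypothesis Hclosed : closed (H : set G).
Hypothesis Hcoc : cocompact H.
Hypothesis Hnopen : ~ open (H : set G).
Hypothesis mS : forall a, star (m a) = m (star a).
Hypothesis mM : forall a b, m (a ** b) = m a ** m b.
Hypothesis mL : forall c a b, m (c *: a + b) = c *: m a + m b.
Hypothesis mN : forall a, N (m a) <= rnorm a.
Hypothesis m_unit : forall x e, 0 < e -> exists a, rnorm (m a x - x) <= e.
Hypothesis u_unitary : forall g, star (u g) ** u g = 1e /\ u g ** star (u g) = 1e.
Hypothesis u_norm : forall g x, rnorm (u g x) = rnorm x.
Hypothesis u_near : forall x e, 0 < e -> \forall g \near (1 : G)%g, rnorm (u g x - x) <= e.
Hypothesis covariance : forall g a, u g ** m a = m (alpha g a) ** u g.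

Lemma unitary_fix g x : rnorm (star (u g) x - x) = rnorm (u g x - x).
Proof.
rewrite -(u_norm g) adjB -[u g (star (u g) x)]/((u g ** star (u g)) x).
by rewrite (u_unitary g).2 rnormB.
Qed.

Lemma covariance_conj g a x : m (alpha g a) x = u g (m a (star (u g) x)).
Proof.
rewrite -[RHS]/((u g ** m a) (star (u g) x)) covariance.
rewrite -[RHS]/(m (alpha g a) ((u g ** star (u g)) x)) (u_unitary g).2 //.
Qed.

(* Replacing a by an average of its translates costs little, as u g almost fixes x
   and y for the g that occur, and the average almost annihilates x. *)
Lemma cross_bound a k (c : 'I_k -> R) (g : 'I_k -> G) x y rx ry ka : rnorm a <= 2 ->
  (forall b, 0 <= c b) -> \sum_b c b = 1 -> (forall b, rnorm (u (g b) x - x) <= rx) ->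
  (forall b, rnorm (u (g b) y - y) <= ry) ->
  rnorm (\sum_b (c b)%:c *: m (alpha (g b) a) x) <= ka ->
  rnorm (star y ** m a x) <= 2 * ry * rnorm x + 2 * rnorm y * rx + rnorm y * ka.
Proof.
move=> a2 c0 c1 hx hy hk.
have -> : star y ** m a x = \sum_b (c b)%:c *: (star y ** m a x - star y ** m (alpha (g b) a) x) +
    star y ** (\sum_b (c b)%:c *: m (alpha (g b) a) x).
  rewrite smul_sumr -big_split/= -[LHS]scale1r -(rmorph1 (real_complex R)) -c1 rmorph_sum scaler_suml.
  by apply: eq_bigr => b _; rewrite smulZr -scalerDr subrK.
have h2 : rnorm (star y ** (\sum_b (c b)%:c *: m (alpha (g b) a) x)) <= rnorm y * ka.
  by rewrite (le_trans (rnorm_smul_le _ _))// rnorm_star ler_wpM2l ?rnorm_ge0.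
rewrite (le_trans (rnormD _ _))// lerD// (le_trans (cn_sum (@cstar_cnorm R B) _ _ _))//.
have -> : 2 * ry * rnorm x + 2 * rnorm y * rx = \sum_b c b * (2 * ry * rnorm x + 2 * rnorm y * rx).
  by rewrite -mulr_suml c1 mul1r.
apply: ler_sum => b _; rewrite -[leLHS]/(rnorm _) rnorm_real ger0_norm// ler_wpM2l//.
rewrite covariance_conj; set xs := star (u (g b)) x; set z := m a xs.
have -> : star y ** u (g b) z = star (star (u (g b)) y) ** z by exact/esym/adjP'.
set ys := star (u (g b)) y.
have -> : star y ** m a x - star ys ** z = star (y - ys) ** m a x + star ys ** m a (x - xs).
  by rewrite adjB starB smulBl smulBr addrA subrK.
have nys : rnorm ys = rnorm y.
  by rewrite -(u_norm (g b)) -[u (g b) ys]/((u (g b) ** star (u (g b))) y) (u_unitary _).2.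
have hxs : rnorm (x - xs) <= rx by rewrite rnormB unitary_fix.
have hys : rnorm (y - ys) <= ry by rewrite rnormB unitary_fix.
have n2 w : rnorm (m a w) <= 2 * rnorm w.
  by rewrite (le_trans (m_le mN _ _))// ler_wpM2r ?rnorm_ge0.
rewrite (le_trans (rnormD _ _))// lerD// (le_trans (rnorm_smul_le _ _))// rnorm_star.
  rewrite [2 * ry]mulrC -mulrA ler_pM ?rnorm_ge0//.
rewrite nys [2 * rnorm y]mulrC -mulrA ler_wpM2l ?rnorm_ge0// (le_trans (n2 _))// ler_wpM2l//.
Qed.

Definition full_sub : starSub A.
Proof. by exists [set: A]. Defined.

Let D := full_sub.
Let DT (a : A) : (D : set A) a := I.
Hypothesis A_separable : separable_set [set: A].

Section phases.
Variable Dinv : action_invariant alpha D.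
Variables (d : nat) (phi : 'I_d.+1 -> {linear C -> central_alg alpha D}).
Hypothesis phiP : forall l, [/\ completely_positive (phi l),
  contractive (@contfun_norm R (coset_space H)) (@central_alg_norm R A G alpha D) (phi l),
  order_zero (phi l) &
  forall g f, val (phi l (coset_shift g f)) = central_quot_act Dinv g (val (phi l f))].
Hypothesis phi_one : is_one (\sum_l phi l contfun_one).

(** The unit condition speaks about F^(alpha), so it is applied to the class of the equicontinuous
    approximate unit v; afterwards m(v_n) x is replaced by x. *)
Lemma rokhlin_unit (h : 'I_d.+1 -> nat -> A) x e :
  (forall l, represents (val (phi l contfun_one)) (h l)) -> (forall l n, rnorm (h l n) <= 2) -> 0 < e ->
  \forall n \near \oo, rnorm (\sum_l m (h l n) x - x) <= e.
Proof.
move=> hP h2 e0; have [v0 [v0b v0P]] := approx_unit A_separable.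
have [v [v2 vc vl vr]] := equicontinuous_unit alpha lcG haar v0b v0P.
have [w wv] := represents_unit D v2 vc vl vr.
pose q : R := 2 * d.+1%:R + 1.
have q0 : 0 < q by rewrite /q ltr_wpDl// mulr_ge0.
have e2 : 0 < e / 2 by rewrite divr_gt0.
have hs : represents (val w) (fun n => (\sum_l 1 *: h l n) ** v n).
  have := representsM (represents_sum (fun=> 1) hP) wv.
  have -> : \sum_l 1 *: val (phi l contfun_one) = val (\sum_l phi l contfun_one).
    by rewrite (big_morph val (fun _ _ => erefl) erefl); apply: eq_bigr => l _; rewrite scale1r.
  by rewrite -[_ ** val w]/(val ((\sum_l phi l contfun_one) ** w)) (phi_one w).1.
have h1 := represents_close mM mL mN m_unit DT x hs wv e2.
have h3 := unit_apply mM mL mN m_unit x v2 vl (divr_gt0 e2 q0).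
apply: filterS2 h1 h3 => n h1 h3.
have bd y : rnorm (\sum_l m (h l n) y) <= 2 * d.+1%:R * rnorm y.
  rewrite (le_trans (cn_sum (@cstar_cnorm R B) _ _ _))//.
  have -> : 2 * d.+1%:R * rnorm y = \sum_(l < d.+1) 2 * rnorm y.
    by rewrite sumr_const card_ord -[_ *+ _]mulr_natl; ring.
  apply: ler_sum => l _; rewrite -[leLHS]/(rnorm _) (le_trans (m_le mN _ _))//.
  by rewrite ler_wpM2r ?rnorm_ge0.
have sE y : \sum_l m (h l n) y = m (\sum_l 1 *: h l n) y.
  by rewrite (m_sum mL); apply: eq_bigr => l _; rewrite scale1r.
have -> : \sum_l m (h l n) x - x = - (\sum_l m (h l n) (m (v n) x - x)) +
    (m ((\sum_l 1 *: h l n) ** v n) x - m (v n) x) + (m (v n) x - x).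
  by rewrite (mME mM) !sE adjB; lmod B; ring.
have h4 := le_trans (bd (m (v n) x - x)) (ler_wpM2l _ h3).
have h5 := rnormD (- (\sum_l m (h l n) (m (v n) x - x))) (m ((\sum_l 1 *: h l n) ** v n) x - m (v n) x).
rewrite rnormN in h5; rewrite (le_trans (rnormD _ _))//.
have {}h4 := h4 (mulr_ge0 (ler0n _ 2) (ler0n _ _)).
have e3 : 2 * d.+1%:R * (e / 2 / q) + e / 2 / q = e / 2 by rewrite /q; field; rewrite gt_eqF.
by rewrite (le_trans (lerD h5 h3))//; lra.
Qed.

(** The translations that average the n-th phase have to almost fix the given vectors and all
    earlier phases. Both hold near 1, and [phase_ex] finds a phase that oscillates within any
    neighbourhood of 1. *)
Lemma phases_choice (F : seq B) (de : R) : 0 < de -> exists f : nat -> C, forall n,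
  [/\ discrete_phase de (f n), contfun_norm (f n) <= 1 &
    exists k (c : 'I_k -> R) (g : 'I_k -> G), [/\ forall b, 0 <= c b, \sum_b c b = 1,
      forall b x, x \in F -> rnorm (u (g b) x - x) <= de,
      forall b i, (i < n)%N -> contfun_norm (coset_shift (g b) (f i) - f i) <= de &
      contfun_norm (\sum_b (c b)%:c *: coset_shift (g b) (f n)) <= de]].
Proof.
move=> de0; pose P (s : seq C) (xi : C) := [/\ discrete_phase de xi, contfun_norm xi <= 1 &
    exists k (c : 'I_k -> R) (g : 'I_k -> G), [/\ forall b, 0 <= c b, \sum_b c b = 1,
      forall b x, x \in F -> rnorm (u (g b) x - x) <= de,
      forall b i, (i < size s)%N -> contfun_norm (coset_shift (g b) (nth 0 s i) - nth 0 s i) <= de &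
      contfun_norm (\sum_b (c b)%:c *: coset_shift (g b) xi) <= de]].
have [s|f fP] := @history_choice C P; last first.
  exists f => n; have [f1 f2 [k [c [g [c0 c1 gF gs fs]]]]] := fP n; split=> //.
  exists k, c, g; split=> // b i ni; have := gs b i; rewrite size_mkseq nth_mkseq//; exact.
have n1 := near_all_seq (nbhs_filter (1 : G)%g) F (fun x => u_near x de0).
have n2 := near_all_seq (nbhs_filter (1 : G)%g) s (fun xi => shift_near Hcoc xi de0).
have nV := @filterI _ (nbhs (1 : G)%g) (nbhs_filter _) _ _ n1 n2.
have [xi [xi1 [xi2 [k [c [g [cg c1 cs]]]]]]] := phase_ex lcG haar Hclosed Hcoc Hnopen nV de0.
exists xi; split=> //; exists k, c, g; split=> //.
- by move=> b; have [] := cg b.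
- move=> b x xF; have [_ [h _]] := cg b.
  by have := h (index x F) 0; rewrite index_mem nth_index//; exact.
- by move=> b i si; have [_ [_ h]] := cg b; exact: h.
Qed.

(** All requirements on the finite set [F] hold for large indices, so one index n serves them
    together, and the multiplier is the sum of the a_l at n. Representatives of norm at most 2 give
    the bound 2 (d + 1). *)
Lemma rokhlin_has_shifts : @has_shifts R B.
Proof.
set Dn : R := d.+1%:R; have Dn1 : 1 <= Dn by rewrite ler1n.
have Dn0 : 0 < Dn by rewrite (lt_le_trans ltr01).
exists Dn^-1, (2 * Dn); split; [by rewrite invr_gt0|by rewrite mulr_ge0 ?(ltW Dn0)|move=> F e e0].
pose K := \sum_(x <- F) rnorm x + 1.
have K1 : 1 <= K by rewrite lerDr; apply: sumr_ge0 => x _; exact: rnorm_ge0.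
have K0 : 0 < K by rewrite (lt_le_trans ltr01).
have FK x : x \in F -> rnorm x <= K.
  move=> xF; rewrite /K (big_rem x xF)/= -addrA lerDl addr_ge0//.
  by apply: sumr_ge0 => y _; exact: rnorm_ge0.
(* 44 = 25 + 16 + 3: the errors of the moduli, of the cross terms and of replacing the sum of the
   h_l by 1. *)
pose Q := 44 * Dn ^+ 2 * K ^+ 2; have Q1 : 1 <= Q.
  have h : 1 <= Dn ^+ 2 * K ^+ 2 by rewrite mulr_ege1// expr_ge1// ltW.
  by rewrite /Q -mulrA; lra.
have Q0 : 0 < Q by rewrite (lt_le_trans ltr01).
have e1 : 0 < 1 + e by rewrite addr_gt0.
(* The factor 1 / (1 + e) also ensures de <= 1. *)
pose de := e / (1 + e) / Q; have de0 : 0 < de by rewrite !divr_gt0.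
have Qde : Q * de <= e by rewrite /de mulrC divfK ?gt_eqF// ler_pdivrMr// ler_peMr ?(ltW e0)// lerDl ltW.
have de1 : de <= 1.
  by rewrite /de ler_pdivrMr// mul1r (le_trans _ Q1)// ler_pdivrMr// mul1r lerDr.
have sum_cst (r : R) : \sum_(l < d.+1) r = Dn * r by rewrite sumr_const card_ord mulr_natl.
have three_terms (r s : R) : 1 <= r -> r <= s -> 25 * r + 16 * s + 3 <= 44 * s by lra.
have one_term (r s : R) : 0 < r -> r <= s -> r * 6 <= 44 * s by lra.
have [f fP] := phases_choice F de0.
have qn l : central_quot_norm (val (phi l (f l))) <= 1.
  by have [_ h _ _] := phiP l; apply: le_trans (h _) _; have [] := fP l.
have /choice[a aP] (l : 'I_d.+1) : exists a, represents (val (phi l (f l))) a /\ forall n, rnorm (a n) <= 2.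
  have [a [ra ha]] := represents_ex (val (phi l (f l))) (@ltr01 R); exists a; split=> // n.
  by rewrite (le_trans (ha n))// (_ : 2 = 1 + 1)// lerD2r.
have /choice[h hP] (l : 'I_d.+1) : exists h, represents (val (phi l contfun_one)) h /\ forall n, rnorm (h n) <= 2.
  have [h [rh hh]] := represents_ex (val (phi l contfun_one)) (@ltr01 R); exists h; split=> // n.
  rewrite (le_trans (hh n))// (_ : 2 = 1 + 1)// lerD2r.
  have [_ hc _ _] := phiP l; apply: le_trans (hc _) _.
  apply: (contfun_norm_le (coset_proj H 1%g)) => s.
  by rewrite -[val contfun_one s]/(1 : R[i]) cabs1.
pose good (l : 'I_d.+1) x n := rnorm (m (star (a l n) ** a l n - star (h l n) ** h l n) x) <= 24 * de * rnorm x + de /\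
  exists k (c : 'I_k -> R) (g : 'I_k -> G), [/\ forall b, 0 <= c b, \sum_b c b = 1,
    forall b z, z \in F -> rnorm (u (g b) z - z) <= de,
    rnorm (\sum_b (c b)%:c *: m (alpha (g b) (a l n)) x) <= de * rnorm x + de &
    forall b (l' : 'I_d.+1), (l' < l)%N -> rnorm (m (alpha (g b) (a l' n)) x - m (a l' n) x) <= de * rnorm x + de].
have FF : Filter (\oo : set_system nat) by exact: _.
have near_good l x : \forall n \near \oo, good l x n.
  have [phi_cp phi_contr phi_oz phi_eq] := phiP l.
  have [f1 f2 [k [c [g [c0 c1 gF gs fs]]]]] := fP l.
  have n1 := phase_modulus mM mL mN m_unit DT phi_cp phi_contr phi_oz x (ltW de0) f1 (aP l).1 (hP l).1 de0.
  have n2 := phase_decorrelation mM mL mN m_unit DT phi_contr phi_eq x (aP l).1 c0 c1 fs de0.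
  have n3 (b : 'I_k) (l' : 'I_d.+1) : \forall n \near \oo, (l' < l)%N ->
      rnorm (m (alpha (g b) (a l' n)) x - m (a l' n) x) <= de * rnorm x + de.
    have [ll|ll] := ltnP l' l; last by apply: nearW.
    have [_ pc _ pe] := phiP l'.
    have := phase_shift mM mL mN m_unit DT pc pe x (aP l').1 (gs b l' ll) de0.
    by apply: filterS.
  have n4 := @filter_forall _ _ _ (\oo : set_system nat) FF (fun b => @filter_forall _ _ _ (\oo : set_system nat) FF (n3 b)).
  by apply: filterS3 n1 n2 n4 => n h1 h2 h3; split=> //; exists k, c, g.
have near_one x : \forall n \near \oo, rnorm (\sum_l m (h l n) x - x) <= de.
  by apply: rokhlin_unit => // [l|l n]; [exact: (hP l).1|exact: (hP l).2].
have near_all := @filterI _ (\oo : set_system nat) FF _ _ (@filter_forall _ _ _ (\oo : set_system nat) FF (fun l => near_all_seq FF F (near_good l)))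
  (near_all_seq FF F near_one).
have [n [goodn onen]] := filter_ex near_all.
have {}goodn l x : x \in F -> good l x n.
  by move=> xF; have := goodn l (index x F) 0; rewrite index_mem nth_index//; exact.
have {}onen x : x \in F -> rnorm (\sum_l m (h l n) x - x) <= de.
  by move=> xF; have := onen (index x F) 0; rewrite index_mem nth_index//; exact.
pose q := K * de; have q0 : 0 < q by rewrite mulr_gt0.
have deq : de <= q by rewrite ler_peMl ?(ltW de0).
have qKq : q <= K * q by rewrite ler_peMl ?(ltW q0).
have Kq0 : 0 <= K * q := mulr_ge0 (ltW K0) (ltW q0).
have QE : Q * de = 44 * Dn ^+ 2 * (K * q) by rewrite /Q /q; ring.
have deK x : x \in F -> de * rnorm x + de <= 2 * q.
  move=> xF; have : de * rnorm x <= de * K by rewrite ler_wpM2l ?(ltW de0) ?FK.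
  by rewrite [de * K]mulrC -/q (_ : 2 * q = q + q); [move=> ?; exact: lerD|ring].
have deK0 (x : B) : 0 <= de * rnorm x + de.
  by apply: addr_ge0; [apply: mulr_ge0; [exact: ltW|exact: rnorm_ge0]|exact: ltW].
have mK l x : x \in F -> rnorm (m (a l n) x) <= 2 * K.
  by move=> xF; rewrite (le_trans (m_le mN _ _))// ler_pM ?rnorm_ge0 ?FK//; exact: (aP l).2.
have cross z l x : x \in F -> z \in F -> rnorm (star z ** m (a l n) x) <= 6 * (K * q).
  move=> xF zF; have [_ [k [c [g [c0 c1 gF dec _]]]]] := goodn l x xF.
  apply: (le_trans (cross_bound ((aP l).2 n) c0 c1 (fun b => gF b x xF) (fun b => gF b z zF) dec)).
  have h1 : 2 * de * rnorm x <= 2 * (K * q).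
    rewrite -mulrA ler_wpM2l// (le_trans _ qKq)// mulrC ler_wpM2r ?FK//; exact: ltW.
  have h2 : 2 * rnorm z * de <= 2 * (K * q).
    rewrite -mulrA ler_wpM2l// (le_trans _ qKq)// ler_wpM2r ?FK//; exact: ltW.
  have h3 : rnorm z * (de * rnorm x + de) <= 2 * (K * q).
    rewrite (_ : 2 * (K * q) = K * (2 * q)); last by ring.
    by apply: ler_pM; [exact: rnorm_ge0|exact: deK0|exact: FK|exact: deK].
  rewrite (le_trans (lerD (lerD h1 h2) h3))// -!mulrDl (ler_wpM2r Kq0)//.
  by rewrite -!natrD ler_nat.
(* The translations that average phase l almost fix x and phase l', hence the vector a_l' x, so
   [cross_bound] applies with y = a_l' x. *)
have cross2 (l' l : 'I_d.+1) x : x \in F -> (l' < l)%N -> rnorm (star (m (a l' n) x) ** m (a l n) x) <= 16 * (K * q).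
  move=> xF ll; have [_ [k [c [g [c0 c1 gF dec sh]]]]] := goodn l x xF.
  have hy b : rnorm (u (g b) (m (a l' n) x) - m (a l' n) x) <= 4 * q.
    have -> : u (g b) (m (a l' n) x) = m (alpha (g b) (a l' n)) (u (g b) x).
      by rewrite -[LHS]/((u (g b) ** m (a l' n)) x) covariance.
    have -> : m (alpha (g b) (a l' n)) (u (g b) x) - m (a l' n) x =
      m (alpha (g b) (a l' n)) (u (g b) x - x) + (m (alpha (g b) (a l' n)) x - m (a l' n) x).
      by rewrite adjB addrA subrK.
    have h1 : rnorm (m (alpha (g b) (a l' n)) (u (g b) x - x)) <= 2 * de.
      rewrite (le_trans (m_le mN _ _))// ler_pM ?rnorm_ge0// ?gF//.
      by rewrite action_rnorm; exact: (aP l').2.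
    have h2 := le_trans (sh b l' ll) (deK x xF).
    apply: (le_trans (rnormD _ _)); apply: (le_trans (lerD h1 h2)).
    by rewrite (_ : 4 * q = 2 * q + 2 * q); [rewrite lerD2r ler_wpM2l|ring].
  apply: (le_trans (cross_bound ((aP l).2 n) c0 c1 (fun b => gF b x xF) hy dec)).
  have h1 : 2 * (4 * q) * rnorm x <= 8 * (K * q).
    rewrite (_ : 2 * (4 * q) = 8 * q); last by ring.
    by rewrite -mulrA ler_wpM2l// mulrC ler_wpM2r ?FK// ltW.
  have h2 : 2 * rnorm (m (a l' n) x) * de <= 4 * (K * q).
    rewrite (_ : 4 * (K * q) = 2 * (2 * K) * q); last by ring.
    apply: ler_pM; [by rewrite mulr_ge0 ?rnorm_ge0|exact: ltW|by rewrite ler_wpM2l// mK|exact: deq].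
  have h3 : rnorm (m (a l' n) x) * (de * rnorm x + de) <= 4 * (K * q).
    rewrite (_ : 4 * (K * q) = 2 * K * (2 * q)); last by ring.
    by apply: ler_pM; [exact: rnorm_ge0|exact: deK0|exact: mK|exact: deK].
  rewrite (le_trans (lerD (lerD h1 h2) h3))// -!mulrDl (ler_wpM2r Kq0)//.
  by rewrite -!natrD ler_nat.
exists (\sum_l m (a l n)); split.
- rewrite (le_trans (cn_sum N _ _ _))// (_ : 2 * Dn = \sum_(l < d.+1) 2); last first.
    by rewrite sum_cst mulrC.
  by apply: ler_sum => l _; apply: (le_trans (mN _)); exact: (aP l).2.
- move=> x xF; rewrite sumE_adj.
  set v := fun l => m (a l n) x; set w := fun l => m (h l n) x.
  rewrite -[X in lmul X]/(\sum_l v l); set V := \sum_l v l; set W := \sum_l w l.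
  have -> : star (lmul V) ** lmul V - Dn^-1%:c *: (star (lmul x) ** lmul x) =
      lmul (star V ** V - Dn^-1%:c *: (star x ** x)).
    by rewrite lmulB lmulZ !lmulM !lmulS.
  (* [tB] is exactly positive. What remains consists of the errors in the moduli, the cross terms
     and the replacement of W by x. *)
  pose tB := \sum_l star (w l) ** w l - Dn^-1%:c *: (star W ** W).
  have pt : pos N (lmul tB).
    have -> : lmul tB = Dn^-1%:c *: (Dn%:c *: (\sum_l star (lmul (w l)) ** lmul (w l)) -
        star (\sum_l lmul (w l)) ** (\sum_l lmul (w l))).
      rewrite scalerBr scalerA -rmorphM mulVf ?gt_eqF// scale1r /tB lmulB lmulZ lmulM lmulS.
      have ls (F' : 'I_d.+1 -> B) : lmul (\sum_l F' l) = \sum_l lmul (F' l).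
        by rewrite (big_morph (@lmul R B) lmulD (id1 := 0))// -[0 in LHS](scale0r (0 : B)) lmulZ scale0r.
      rewrite !ls; congr (_ - _); apply: eq_bigr => l _; by rewrite lmulM lmulS.
    by apply: posZ; [rewrite invr_ge0 ltW|exact: pos_sum_sq].
  apply: (pos_near pt).
    by rewrite -lmulS !expand_star.
  rewrite -lmulB -rnorm_lmul.
  pose S1 := \sum_l (star (v l) ** v l - star (w l) ** w l).
  pose S2 := \sum_l \sum_(l' | l' != l) star (v l) ** v l'.
  have -> : star V ** V - Dn^-1%:c *: (star x ** x) - tB =
      S1 + S2 + Dn^-1%:c *: (star W ** W - star x ** x).
    have -> : star V ** V = \sum_l star (v l) ** v l + S2.
      rewrite star_sum smul_suml -big_split/=; apply: eq_bigr => l _.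
      by rewrite smul_sumr (bigD1 l).
    rewrite /S1 sumrB /tB.
    move: (\sum_l star (v l) ** v l) (\sum_l star (w l) ** w l) (star W ** W) (star x ** x) => p1 p2 p3 p4.
    rewrite scalerBr; move: (_ *: p3) (_ *: p4) => p5 p6; lmod B; ring.
  have hS1 : rnorm S1 <= 25 * Dn * (K * q).
    rewrite (le_trans (cn_sum (@cstar_cnorm R B) _ _ _))// (_ : 25 * Dn * (K * q) = \sum_(l < d.+1) 25 * (K * q)); last first.
      by rewrite sum_cst [RHS]mulrCA [RHS]mulrA.
    apply: ler_sum => l _; rewrite -[leLHS]/(rnorm _) /v /w !(star_m mS).
    have -> : star x ** m (star (a l n)) (m (a l n) x) - star x ** m (star (h l n)) (m (h l n) x) =
        star x ** m (star (a l n) ** a l n - star (h l n) ** h l n) x.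
      by rewrite -smulBr (mB mL) !(mME mM).
    have [h1 _] := goodn l x xF.
    rewrite (le_trans (rnorm_smul_le _ _))// rnorm_star (_ : 25 * (K * q) = K * (25 * q)); last by ring.
    rewrite ler_pM ?rnorm_ge0 ?FK// (le_trans h1)//.
    have h2 : de * rnorm x <= q by rewrite mulrC ler_wpM2r ?(ltW de0) ?FK.
    rewrite -mulrA (le_trans (lerD (ler_wpM2l _ h2) deq))//.
    by rewrite (_ : 25 * q = 24 * q + q)//; ring.
  have hS2 : rnorm S2 <= 16 * Dn ^+ 2 * (K * q).
    have Kq16 : 0 <= 16 * (K * q) by rewrite mulr_ge0.
    rewrite (le_trans (cn_sum (@cstar_cnorm R B) _ _ _))//.
    rewrite (_ : 16 * Dn ^+ 2 * (K * q) = \sum_(l < d.+1) \sum_(l' < d.+1) 16 * (K * q)); last first.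
      by rewrite !sum_cst [RHS]mulrA -expr2 [RHS]mulrCA [RHS]mulrA.
    apply: ler_sum => l _; rewrite (le_trans (cn_sum (@cstar_cnorm R B) _ _ _))//.
    rewrite [leRHS](bigID (fun l' => l' != l))/= -[leLHS]addr0 lerD ?sumr_ge0//.
    apply: ler_sum => l' ll; rewrite -[leLHS]/(rnorm _).
    have [|ll'] := ltnP l l'; first exact: cross2.
    rewrite -rnorm_star starM starK; apply: cross2 => //.
    by rewrite ltn_neqAle ll' andbT.
  have hW : rnorm (W - x) <= de by exact: onen.
  have nW : rnorm W <= 2 * K.
    rewrite -(subrK x W) (le_trans (rnormD _ _))// (le_trans (lerD hW (FK x xF)))//.
    by rewrite (_ : 2 * K = K + K); [rewrite lerD2r (le_trans de1)|ring].
  have h3 : rnorm (star W ** W - star x ** x) <= 3 * (K * q).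
    have -> : star W ** W - star x ** x = star (W - x) ** W + star x ** (W - x).
      by rewrite starB smulBl smulBr addrA subrK.
    have b1 : rnorm (star (W - x) ** W) <= 2 * q.
      rewrite (le_trans (rnorm_smul_le _ _))// rnorm_star (_ : 2 * q = de * (2 * K)); last by rewrite /q; ring.
      by rewrite ler_pM ?rnorm_ge0.
    have b2 : rnorm (star x ** (W - x)) <= q.
      by rewrite (le_trans (rnorm_smul_le _ _))// rnorm_star ler_pM ?rnorm_ge0 ?FK.
    apply: (le_trans (rnormD _ _)); apply: (le_trans (lerD b1 b2)).
    by rewrite (_ : 2 * q + q = 3 * q); [rewrite ler_wpM2l|ring].
  have h4 : rnorm (Dn^-1%:c *: (star W ** W - star x ** x)) <= 3 * (K * q).
    rewrite rnorm_real ger0_norm ?invr_ge0 ?(ltW Dn0)// (le_trans _ h3)// ler_piMl ?rnorm_ge0//.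
    by rewrite invf_le1.
  apply: le_trans Qde; rewrite QE.
  apply: (le_trans (rnormD _ _)); apply: (le_trans (lerD (le_trans (rnormD _ _) (lerD hS1 hS2)) h4)).
  rewrite -!mulrDl (ler_wpM2r Kq0)//.
  have : Dn <= Dn ^+ 2 by rewrite expr2 ler_peMl ?(ltW Dn0).
  exact: three_terms Dn1.
- move=> x z xF zF; rewrite sumE_adj smul_sumr (le_trans (cn_sum (@cstar_cnorm R B) _ _ _))//.
  apply: le_trans Qde; rewrite QE.
  have : \sum_l rnorm (star z ** m (a l n) x) <= \sum_(l < d.+1) 6 * (K * q).
    by apply: ler_sum => l _; exact: cross.
  move=> /le_trans; apply; rewrite sum_cst [leLHS]mulrA.
  rewrite (ler_wpM2r Kq0)//.
  have : Dn <= Dn ^+ 2 by rewrite expr2 ler_peMl ?(ltW Dn0).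
  exact: one_term Dn0.
Qed.

End phases.

End shifts_from_rokhlin.

Section covariant_multipliers.
Context {R : realType} {G : topGroupType} {A : cstarAlgType R} (alpha : action G A).
Context (mu : {measure set (borel G) -> \bar R}) (Delta : G -> R).
Context {B : cstarAlgType R} (iota : (G -> A) -> B).
Hypothesis lcG : locally_compact_group G.
Hypothesis haar : left_haar mu.
Hypothesis BP : is_full_crossed_product alpha mu Delta iota.
Variables (m : A -> adj B) (u : G -> adj B).
Hypothesis mE : forall a f, Cc f -> m a (iota f) = iota (fun r => a ** f r).
Hypothesis uE : forall s f, Cc f -> u s (iota f) = iota (trans alpha s f).

Lemma covariance_eq g a : u g ** m a = m (alpha g a) ** u g.
Proof.
apply: (adj_eq_dense BP) => f Cf.
rewrite -[LHS]/(u g (m a (iota f))) -[RHS]/(m (alpha g a) (u g (iota f))) mE// !uE ?mE//.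
- by congr iota; apply/funext => r; rewrite /trans action_smul.
- exact: Cc_trans.
- exact: Cc_left_mul.
Qed.

(** On a compactly supported function an approximate unit of [A] acts almost trivially, uniformly
    over the support; boundedness of [m] extends this to all of [B]. *)
Lemma left_mul_nondegenerate : separable_set [set: A] -> (forall a, adj_ucnorm (m a) <= rnorm a) ->
  forall x e, 0 < e -> exists a, rnorm (m a x - x) <= e.
Proof.
move=> sepA mN x e e0; have [v [vb vP]] := approx_unit sepA.
have e4 : 0 < e / 4 by rewrite divr_gt0.
have [f Cf fx] := iota_dense BP x e4; have [cf [K cK f0]] := Cf.
have m1 : 0 < meas mu K + 1 by rewrite ltr_wpDl// meas_ge0.
have [n nP] := unit_uniform vb vP cK cf (divr_gt0 e4 m1).
exists (v n); have h1 : rnorm (m (v n) (iota f) - iota f) <= e / 4.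
  have Cv := Cc_left_mul (v n) Cf; rewrite mE// -(iotaB BP Cf Cv).
  have Cd : Cc ((fun r => v n ** f r) - f) by rewrite -scaleN1r addrC; exact: Cc_linear.
  rewrite (le_trans (iota_bound lcG haar BP cK Cd _ _ (c := e / 4 / (meas mu K + 1))))//.
  - by move=> s nK; rewrite -[LHS]/(v n ** f s - f s) f0// smulx0 subrr.
  - move=> s; rewrite -[X in rnorm X]/(v n ** f s - f s).
    have [Ks|nK] := pselect (K s); first exact: nP (leqnn n) s Ks.
    by rewrite f0// smulx0 subrr rnorm0 divr_ge0// ltW.
  - by rewrite mulrAC ler_pdivrMr// ler_wpM2l ?(ltW e4)// lerDl.
have h2 : rnorm (m (v n) (iota f - x)) <= 2 * (e / 4).
  by rewrite (le_trans (m_le mN _ _))// ler_pM ?rnorm_ge0//; exact: (vb n).2.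
have -> : m (v n) x - x = (m (v n) (iota f) - iota f) + (iota f - x) - m (v n) (iota f - x).
  by rewrite adjB; lmod B; ring.
rewrite (le_trans (rnormD _ _))// rnormN.
apply: (le_trans (lerD (le_trans (rnormD _ _) (lerD h1 fx)) h2)); lra.
Qed.

End covariant_multipliers.

Theorem theorem8p4 (R : realType) (G : topGroupType) (H : subgroup G)
    (A : cstarAlgType R) (alpha : action G A)
    (mu : {measure set (borel G) -> \bar R}) (Delta : G -> R)
    (B : cstarAlgType R) (iota : (G -> A) -> B)
    (G_second_countable : @second_countable G)
    (G_residually_compact : residually_compact G)
    (H_closed : closed (H : set G))
    (H_cocompact : cocompact H)
    (H_not_open : ~ open (H : set G))
    (A_separable : separable_set [set: A])
    (mu_haar : left_haar mu)
    (Delta_modular : modular_function mu Delta)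
    (B_crossed : is_full_crossed_product alpha mu Delta iota)
    (dim_finite : (rokhlin_dim alpha H < +oo)%E) :
  stable B.
Proof.
have [lcG _] := G_residually_compact.
have [_ [d hd _] _] := ereal_inf_lt dim_finite.
(* The Rokhlin maps are taken for D = A, which is admissible because [A] is separable. *)
have [phi [phiP phi1]] := hd (full_sub (A := A)) closedT A_separable (fun _ _ _ => I).
have [m [mE mS mM mL mN]] := mulA_ex lcG mu_haar Delta_modular B_crossed.
have [u [uE u_unitary u_norm u_near]] := unitG_ex lcG mu_haar Delta_modular B_crossed.
have covariance := covariance_eq B_crossed mE uE.
have m_unit := left_mul_nondegenerate lcG mu_haar B_crossed mE A_separable mN.
have shifts := rokhlin_has_shifts lcG mu_haar H_closed H_cocompact H_not_open mS mM mL mN m_unit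
  u_unitary u_norm u_near covariance A_separable phiP phi1.
have [v [vb vP]] := approx_unit A_separable.
have [w wP] := left_unit lcG mu_haar vb vP B_crossed G_second_countable.
have [h [c hc]] := strictly_positive_exists wP.
have [S [K [k [k0 SK Sk SS hS]]]] := shift_sequence hc shifts.
have [s [so sP]] := isometry_decomposition hc k0 SK Sk SS hS.
exact: stable_of_isometries so sP.
Qed.
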